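(* Let $F$ be a function field of characteristic $p>0$, let $E/F$ be a non-isotrivial elliptic curve having good or split multiplicative reduction at every place of $F$, let $l\neq p$ be a prime, and let $\mathcal{F}/F$ be a $\mathbb{Z}_l^d$-extension. Let $F\subset F_1\subset\dots\subset F_n\subset\dots\subset\bigcup_n F_n=\mathcal{F}$ be a sequence of finite extensions of $F$ and put $\Gamma_n=\mathrm{Gal}(\mathcal{F}/F_n)$. Let $r$ be a prime with $r\neq l$ and $r\neq p$. Then the natural maps $$Sel_E(F_n)_r\longrightarrow Sel_E(\mathcal{F})_r^{\Gamma_n}$$ are isomorphisms.
   Context: A function field $F$ of characteristic $p$ is a finitely generated field of transcendence degree 1 over its constant field $\mathbb{F}$ (algebraically closed in $F$), where $\mathbb{F}_p\subseteq\mathbb{F}\subseteq\overline{\mathbb{F}}_p$. Non-isotrivial means $j(E)\notin\mathbb{F}$. A $\mathbb{Z}_l^d$-extension is a Galois extension with Galois group isomorphic to $\mathbb{Z}_l^d$. Selmer groups: for an algebraic extension $L/F$ and a prime $r$, let $\mathcal{M}_L$ be the set of places of $L$ and $L_v$ the completion of $L$ at $v$. Put $H^1_{fl}(\mathrm{Spec}\,L,E[r^\infty]):=\varinjlim_n H^1_{fl}(\mathrm{Spec}\,L,E[r^n])$ (flat cohomology; for $r\neq p$ this coincides with Galois cohomology $H^1(\mathrm{Gal}(L^{sep}/L),E[r^\infty])$), and likewise for $L_v$. Let $\kappa_v:E(L_v)\otimes\mathbb{Q}_r/\mathbb{Z}_r\hookrightarrow H^1_{fl}(\mathrm{Spec}\,L_v,E[r^\infty])$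 be the local Kummer map. Then $$Sel_E(L)_r:=\mathrm{Ker}\Big\{H^1_{fl}(\mathrm{Spec}\,L,E[r^\infty])\to\prod_{v\in\mathcal{M}_L}H^1_{fl}(\mathrm{Spec}\,L_v,E[r^\infty])/\mathrm{Im}\,\kappa_v\Big\}.$$ The natural maps between Selmer groups are induced by restriction in cohomology. *)

(* Defs.v *)
From HB Require Import structures.
From mathcomp Require Import all_boot all_order all_algebra all_field.
From mathcomp Require Import boolp classical_sets functions.

Set Implicit Arguments.
Unset Strict Implicit.
Unset Printing Implicit Defensive.

Import GRing.Theory.
Local Open Scope ring_scope.
Local Open Scope classical_set_scope.

(** * Subfields and field extensions

    Subfields and subrings are sets of elements of an ambient field. *)

Section Fields.
Variable T : fieldType.
Implicit Types (A L M : set T) (x : T) (s : seq T).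

Definition subring A : Prop := subring_closed (mem A).
Definition subfield A : Prop := divring_closed (mem A).

Definition algebraic_over A x : Prop :=
  exists q : {poly T}, [/\ q \is a polyOver (mem A), q != 0 & root q x].

Definition separable_over A x : Prop :=
  exists q : {poly T}, [/\ q \is a polyOver (mem A), separable_poly q & root q x].

Definition adjoin A (B : set T) : set T :=
  [set x | forall L, subfield L -> A `<=` L -> B `<=` L -> L x].

Definition separably_closed : Prop :=
  forall q : {poly T}, separable_poly q -> (1 < size q)%N -> exists x, root q x.

(** The ambient field is a separable closure of its subfield [A]. *)
Definition separable_closure A : Prop :=
  [/\ subfield A, separably_closed & forall x, separable_over A x].

Definition finite_extension A L : Prop :=
  [/\ subfield L, A `<=` L &
      exists2 s, {in s, forall y, L y} &
        forall x, L x -> exists2 a : T -> T,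
          {in s, forall y, A (a y)} & x = \sum_(y <- s) a y * y].

(** Prime subfield (in positive characteristic). *)
Definition prime_subfield : set T := range (fun n : nat => n%:R : T).

(** [T] is a function field of characteristic [p] with constant field [k]. *)
Definition function_field (p : nat) (k : set T) : Prop :=
  [/\ p \in [pchar T], subfield k,
      forall x, k x -> algebraic_over prime_subfield x,
      forall x, algebraic_over k x -> k x &
      (exists s, adjoin k [set x | x \in s] = setT) /\
      (exists2 t, ~ algebraic_over k t &
         forall x, algebraic_over (adjoin k [set t]) x)].

(** ** Places

    A place of [L] is given by its valuation ring [O].  The fields [L] used
    below are algebraic over a function field, itself algebraic over F_p(t), so
    that all their nontrivial valuations have rank one and are trivial on the
    constants. *)

Definition place L (O : set T) : Prop :=
  [/\ O `<=` L, subring O, (forall x, L x -> O x \/ O x^-1) &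
      exists2 x, L x & ~ O x].

Definition vunit (O : set T) : set T := [set x | x != 0 /\ O x /\ O x^-1].

Definition vmax (O : set T) : set T := [set x | O x /\ ~ vunit O x].

(** Completeness of [L] for the topology of the valuation ring [O].  As
    valuations have rank one, sequences suffice. *)
Definition vcauchy L (O : set T) (u : nat -> T) : Prop :=
  forall a, L a -> a != 0 ->
    exists N, forall m n, (N <= m)%N -> (N <= n)%N -> O ((u m - u n) / a).

Definition vcvg L (O : set T) (u : nat -> T) x : Prop :=
  forall a, L a -> a != 0 ->
    exists N, forall n, (N <= n)%N -> O ((u n - x) / a).

Definition vcomplete L (O : set T) : Prop :=
  forall u, (forall n, L (u n)) -> vcauchy L O u -> exists2 x, L x & vcvg L O u x.

End Fields.

(** The subfield [K] of [S], with valuation ring [OK], is the completion of [L]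
    at the place [O], [S] is a separable closure of [K], and [i] is an embedding
    into [S] of the field in which [L] lives (a separable closure of [L] in all
    uses) that extends [L -> K]. *)
Definition completion (Fs S : fieldType) (L O : set Fs)
    (i : {rmorphism Fs -> S}) (K OK : set S) : Prop :=
  [/\ separable_closure K,
      place K OK /\ vcomplete K OK,
      (forall x, L x -> K (i x)),
      (forall x, L x -> (O x <-> OK (i x))) &
      forall x a, K x -> K a -> a != 0 -> exists2 y, L y & OK ((x - i y) / a)].

(** * Field automorphisms and Galois groups *)

Record aut (K : fieldType) := Aut {
  aut_fun :> K -> K;
  autP : [/\ zmod_morphism aut_fun, monoid_morphism aut_fun & bijective aut_fun]
}.

Section AutGroup.
Variable K : fieldType.
Implicit Types s t : aut K.

Lemma aut_ext s t : s =1 t -> s = t.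
Proof.
case: s t => [s sP] [t tP] /= /funext est; case: _ / est tP => tP.
by congr Aut; exact: Prop_irrelevance.
Qed.

HB.instance Definition _ := gen_eqMixin (aut K).
HB.instance Definition _ := gen_choiceMixin (aut K).

Fact aut_id_proof :
  [/\ zmod_morphism (@id K), monoid_morphism (@id K) & bijective (@id K)].
Proof. by split=> //; exists id. Qed.

Definition aut_id : aut K := Aut aut_id_proof.

Fact aut_comp_proof s t :
  [/\ zmod_morphism (s \o t), monoid_morphism (s \o t) & bijective (s \o t)].
Proof.
case: (autP s) (autP t) => sB [s1 sM] sb [tB [t1 tM] tb].
split; last exact: bij_comp.
- by move=> x y /=; rewrite tB sB.
- by split=> [|x y] /=; [rewrite t1 s1 | rewrite tM sM].
Qed.

Definition aut_comp s t : aut K := Aut (aut_comp_proof s t).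

Definition aut_inv_fun s (x : K) : K := xget 0 [set y | s y = x].

Fact aut_inv_funK s : cancel (aut_inv_fun s) s.
Proof.
move=> x; rewrite /aut_inv_fun; case: xgetP => [y _ //|noy].
by case: (autP s) => _ _ [g _ gK]; case: (noy (g x)); exact: gK.
Qed.

Fact aut_funK s : cancel s (aut_inv_fun s).
Proof.
by move=> x; case: (autP s) => _ _ /bij_inj; apply; rewrite aut_inv_funK.
Qed.

Fact aut_inv_proof s :
  [/\ zmod_morphism (aut_inv_fun s), monoid_morphism (aut_inv_fun s)
    & bijective (aut_inv_fun s)].
Proof.
have [sB [s1 sM] /bij_inj s_inj] := autP s.
split; last by exists s; [exact: aut_inv_funK | exact: aut_funK].
- by move=> x y; apply: s_inj; rewrite sB !aut_inv_funK.
- by split=> [|x y]; apply: s_inj; rewrite ?sM !aut_inv_funK ?s1.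
Qed.

Definition aut_inv s : aut K := Aut (aut_inv_proof s).

Fact aut_mulA : associative aut_comp.
Proof. by move=> s t u; apply: aut_ext. Qed.
Fact aut_mul1 : left_id aut_id aut_comp.
Proof. by move=> s; apply: aut_ext. Qed.
Fact aut_mulr1 : right_id aut_id aut_comp.
Proof. by move=> s; apply: aut_ext. Qed.
Fact aut_mulV : left_inverse aut_id aut_inv aut_comp.
Proof. by move=> s; apply: aut_ext => x /=; exact: aut_funK. Qed.
Fact aut_mulrV : right_inverse aut_id aut_inv aut_comp.
Proof. by move=> s; apply: aut_ext => x /=; exact: aut_inv_funK. Qed.

HB.instance Definition _ :=
  isGroup.Build (aut K) aut_mulA aut_mul1 aut_mulr1 aut_mulV aut_mulrV.

End AutGroup.

(** The absolute Galois group of [L] when the ambient field is a separable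
    closure of [L].  For a Galois subextension [M / L], the group Gal(M/L) is
    [Gal L] with automorphisms identified when they agree on [M]. *)
Definition Gal (K : fieldType) (L : set K) : set (aut K) :=
  [set s : aut K | forall x, L x -> s x = x].

(** Galois subextensions of a separable closure: those stable under the
    absolute Galois group. *)
Definition galois_extension (K : fieldType) (L M : set K) : Prop :=
  [/\ subfield M, L `<=` M & forall s, Gal L s -> s @` M `<=` M].

(** Z_l as the inverse limit of the Z/l^n: [a n] in [0, l^n) is the residue of
    the l-adic integer [a] modulo l^n. *)
Definition padic (l : nat) : set (nat -> nat) :=
  [set a | forall n, a n = (a n.+1 %% l ^ n)%N].

(** [phi] induces an isomorphism of topological groups between Gal(M/L) and
    Z_l^d; the last two clauses are the continuity at 1 of the induced map and of
    its inverse, for the Krull and l-adic topologies. *)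
Definition Zld_extension (l d : nat) (K : fieldType) (L M : set K) : Prop :=
  galois_extension L M /\
  exists phi : aut K -> 'I_d -> nat -> nat,
    [/\ forall s, Gal L s -> forall i, padic l (phi s i),
        forall s t, Gal L s -> Gal L t -> forall i n,
          phi (s * t)%g i n = ((phi s i n + phi t i n) %% l ^ n)%N,
        forall s t, Gal L s -> Gal L t ->
          (phi s = phi t <-> forall x, M x -> s x = t x),
        forall a : 'I_d -> nat -> nat, (forall i, padic l (a i)) ->
          exists2 s, Gal L s & phi s = a &
        (forall n, exists2 e : seq K, {in e, forall x, M x} &
           forall s, Gal L s -> {in e, forall x, s x = x} ->
             forall i, phi s i n = 0%N) /\
        (forall e : seq K, {in e, forall x, M x} ->
           exists n, forall s, Gal L s -> (forall i, phi s i n = 0%N) ->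
             {in e, forall x, s x = x})].

(** * Elliptic curves *)

(** y^2 + a1 xy + a3 y = x^3 + a2 x^2 + a4 x + a6 *)
Record weierstrass (K : Type) := Weierstrass { a1 : K; a2 : K; a3 : K; a4 : K; a6 : K }.

Definition wmap (K K' : Type) (f : K -> K') (W : weierstrass K) : weierstrass K' :=
  Weierstrass (f (a1 W)) (f (a2 W)) (f (a3 W)) (f (a4 W)) (f (a6 W)).

(** Points of the projective plane on a Weierstrass curve: [None] is the point
    at infinity. *)
Definition point (K : Type) : Type := option (K * K).

Definition point_map (K K' : Type) (f : K -> K') (P : point K) : point K' :=
  if P is Some (x, y) then Some (f x, f y) else None.

Section Weierstrass.
Variables (K : fieldType) (W : weierstrass K).
Local Notation a1 := (a1 W).
Local Notation a2 := (a2 W).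
Local Notation a3 := (a3 W).
Local Notation a4 := (a4 W).
Local Notation a6 := (a6 W).

Definition b2 : K := a1 ^+ 2 + 4 * a2.
Definition b4 : K := 2 * a4 + a1 * a3.
Definition b6 : K := a3 ^+ 2 + 4 * a6.
Definition b8 : K :=
  a1 ^+ 2 * a6 + 4 * a2 * a6 - a1 * a3 * a4 + a2 * a3 ^+ 2 - a4 ^+ 2.
Definition c4 : K := b2 ^+ 2 - 24 * b4.
Definition disc : K :=
  - (b2 ^+ 2 * b8) - 8 * b4 ^+ 3 - 27 * b6 ^+ 2 + 9 * b2 * b4 * b6.
Definition j_inv : K := c4 ^+ 3 / disc.

Definition elliptic : Prop := disc != 0.

(** The equation obtained by x = u^2 x' + r, y = u^3 y' + u^2 s x' + t. *)
Definition change_of_variables (u r s t : K) : weierstrass K :=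
  Weierstrass
    ((a1 + 2 * s) / u)
    ((a2 - s * a1 + 3 * r - s ^+ 2) / u ^+ 2)
    ((a3 + r * a1 + 2 * t) / u ^+ 3)
    ((a4 - s * a3 + 2 * r * a2 - (t + r * s) * a1 + 3 * r ^+ 2 - 2 * s * t) / u ^+ 4)
    ((a6 + r * a4 + r ^+ 2 * a2 + r ^+ 3 - t * a3 - t ^+ 2 - r * t * a1) / u ^+ 6).

(** The chord-and-tangent group law. *)
Definition on_curve (P : point K) : Prop :=
  if P is Some (x, y)
  then y ^+ 2 + a1 * x * y + a3 * y = x ^+ 3 + a2 * x ^+ 2 + a4 * x + a6
  else True.

Definition ec_opp (P : point K) : point K :=
  if P is Some (x, y) then Some (x, - y - a1 * x - a3) else None.

Definition ec_add (P Q : point K) : point K :=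
  match P, Q with
  | None, _ => Q
  | _, None => P
  | Some (x1, y1), Some (x2, y2) =>
    if (x1 == x2) && (y1 + y2 + a1 * x2 + a3 == 0) then None else
    let m := if x1 == x2
             then (3 * x1 ^+ 2 + 2 * a2 * x1 + a4 - a1 * y1) / (2 * y1 + a1 * x1 + a3)
             else (y2 - y1) / (x2 - x1) in
    let x3 := m ^+ 2 + a1 * m - a2 - x1 - x2 in
    Some (x3, - (m + a1) * x3 - (y1 - m * x1) - a3)
  end.

Definition ec_sub (P Q : point K) : point K := ec_add P (ec_opp Q).

Definition ec_muln (n : nat) (P : point K) : point K := iter n (ec_add P) None.

(** E(L), for a subfield [L] of [K]. *)
Definition rational_points (L : set K) : set (point K) :=
  [set P | on_curve P /\ if P is Some (x, y) then L x /\ L y else True].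

(** E[r^oo](K) *)
Definition primary_torsion (r : nat) : set (point K) :=
  [set P | on_curve P /\ exists n, ec_muln (r ^ n) P = None].

End Weierstrass.

(** ** Reduction types at the place of valuation ring [O] *)

Section Reduction.
Variables (K : fieldType) (O : set K).
Implicit Types E W : weierstrass K.

Definition integral W : Prop :=
  [/\ O (a1 W), O (a2 W), O (a3 W), O (a4 W) & O (a6 W)].

Definition integral_model E W : Prop :=
  integral W /\ exists u r s t, u != 0 /\ W = change_of_variables E u r s t.

(** The valuation of the discriminant is minimal among integral models. *)
Definition minimal_model E W : Prop :=
  integral_model E W /\
  forall W', integral_model E W' -> O (disc W' / disc W).

Definition good_reduction E : Prop :=
  exists2 W, minimal_model E W & vunit O (disc W).

(** [(x, y)] reduces to a singular point of the reduction of [W], i.e., both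
    partial derivatives and the equation itself vanish there.  The residue
    fields in use being perfect, a singular point is rational. *)
Definition singular_reduction W (x y : K) : Prop :=
  [/\ O x /\ O y,
      vmax O (y ^+ 2 + a1 W * x * y + a3 W * y
              - (x ^+ 3 + a2 W * x ^+ 2 + a4 W * x + a6 W)),
      vmax O (a1 W * y - (3 * x ^+ 2 + 2 * a2 W * x + a4 W)) &
      vmax O (2 * y + a1 W * x + a3 W)].

(** The tangent cone Y^2 + a1 XY - (3x + a2) X^2 at the singular point
    [(x, y)] reduces to (Y - m X)(Y - m' X), with slopes [m], [m'] in the
    residue field, distinct. *)
Definition split_multiplicative_reduction E : Prop :=
  exists2 W, minimal_model E W &
    exists x y m m',
      [/\ singular_reduction W x y, O m /\ O m',
          vmax O (m + m' + a1 W), vmax O (m * m' + (3 * x + a2 W))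
        & vunit O (m - m')].

End Reduction.

(** * Galois cohomology of E[r^oo]

    [S] is a separable closure of its subfield [L] and [W] has coefficients in
    [L].  For a prime [r] different from the characteristic, all of E[r^oo] is
    rational over [S], and the flat cohomology group H^1(Spec L, E[r^oo]) is
    the Galois cohomology group H^1(L, E[r^oo]) of continuous 1-cocycles modulo
    coboundaries.  Cochains are maps on all of [aut S], of which only the values
    on [Gal L] matter: cohomology classes are sets of cocycles. *)

Section Cohomology.
Variables (S : fieldType) (W : weierstrass S) (r : nat).
Local Notation M := (primary_torsion W r).
Local Notation "P +e Q" := (ec_add W P Q) (at level 50, left associativity).
Local Notation "P -e Q" := (ec_sub W P Q) (at level 50, left associativity).

Definition cochain : Type := aut S -> point S.
Implicit Types (L : set S) (c : cochain) (X Y : set cochain).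

(** The third clause is continuity, for the Krull topology on [Gal L] and the
    discrete topology on E[r^oo]. *)
Definition cocycle L c : Prop :=
  [/\ forall s, Gal L s -> M (c s),
      forall s t, Gal L s -> Gal L t -> c (s * t)%g = c s +e point_map s (c t) &
      forall s, Gal L s -> exists e : seq S, forall t, Gal L t ->
        {in e, forall x, t x = s x} -> c t = c s].

Definition cobound (P : point S) : cochain := fun s => point_map s P -e P.

Definition cohomologous L c c' : Prop :=
  exists2 P, M P & forall s, Gal L s -> c' s = c s +e cobound P s.

Definition cclass L c : set cochain :=
  [set c' | cocycle L c' /\ cohomologous L c c'].

Definition H1 L : set (set cochain) := cclass L @` cocycle L.

Definition class_add L X Y : set cochain :=
  \bigcup_(c in X) \bigcup_(c' in Y) cclass L (fun s => c s +e c' s).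

(** Restriction of classes to an extension [L'] of [L]. *)
Definition res L' X : set cochain := \bigcup_(c in X) cclass L' c.

(** Action of [g] on H^1(L), for [g] an automorphism stabilising [L]. *)
Definition class_act L (g : aut S) X : set cochain :=
  \bigcup_(c in X) cclass L (fun s => point_map g (c (s ^ g)%g)).

(** H^1(L)^Gal(L/K), where [L / K] is Galois: g in Gal(L/K) acts through any of
    its lifts to [Gal K]. *)
Definition H1_invariants K L : set (set cochain) :=
  [set X | H1 L X /\ forall g, Gal K g -> class_act L g X = X].

(** Image of the Kummer map E(L) (x) Q_r/Z_r -> H^1(L, E[r^oo]).  Any element
    of the left-hand side is some P (x) r^-n; it is sent to the class of the
    cocycle s |-> sQ - Q, where Q in E(S) is such that r^n Q = P. *)
Definition kummer_image L : set (set cochain) :=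
  [set X | exists n P Q, [/\ rational_points W L P, on_curve W Q,
     ec_muln W (r ^ n) Q = P & X = cclass L (cobound Q)]].

End Cohomology.

(** * Selmer groups *)

(** The restriction of [s] to [Fs], seen as a subfield of [S] through [i]; the
    default value 1 is not used if [Fs / L] is normal and [s] fixes [i @` L]. *)
Definition aut_restrict (Fs S : fieldType) (i : Fs -> S) (s : aut S) : aut Fs :=
  xget 1%g [set t : aut Fs | forall x, i (t x) = s (i x)].

(** The localisation map H^1(L, E[r^oo]) -> H^1(K, E[r^oo]). *)
Definition localisation (Fs S : fieldType) (W : weierstrass Fs) (r : nat)
    (i : {rmorphism Fs -> S}) (K : set S) (X : set (cochain Fs)) : set (cochain S) :=
  \bigcup_(c in X)
    cclass (wmap i W) r K (fun s => point_map i (c (aut_restrict i s))).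

(** The local condition at a place does not depend on the choice of the
    completion, of its separable closure and of the embedding [i]. *)
Definition Selmer (Fs : fieldType) (W : weierstrass Fs) (r : nat) (L : set Fs) :
    set (set (cochain Fs)) :=
  [set X | H1 W r L X /\
     forall O : set Fs, place L O ->
     forall (S : fieldType) (i : {rmorphism Fs -> S}) (K OK : set S),
       completion L O i K OK ->
       kummer_image (wmap i W) r K (localisation W r i K X)].

(** Sel(L)^Gal(L/K) *)
Definition Selmer_invariants (Fs : fieldType) (W : weierstrass Fs) (r : nat)
    (K L : set Fs) : set (set (cochain Fs)) :=
  Selmer W r L `&` H1_invariants W r K L.

Definition group_isomorphism (T U : Type) (A : set T) (addA : T -> T -> T)
    (B : set U) (addB : U -> U -> U) (f : T -> U) : Prop :=
  set_bij A B f /\ {in A &, {morph f : x y / addA x y >-> addB x y}}.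

(* Main.v *)
From HB Require Import structures.
From mathcomp Require Import all_boot all_order all_algebra all_fingroup all_field.
From mathcomp Require Import boolp classical_sets functions.
From mathcomp Require Import ring zify.
Require Import Defs.

Set Implicit Arguments.
Unset Strict Implicit.
Unset Printing Implicit Defensive.

Import GRing.Theory.
Local Open Scope ring_scope.
Local Open Scope classical_set_scope.

(** Write L for a layer of the extension, M for the whole extension [cF], and G for Gal(M/L), a
    closed subgroup of Z_l^d and hence a pro-l group. Since r differs from l, r-primary coefficients
    can be averaged over finite l-groups. So the higher cohomology of G in the points of E[r^oo]
    over M vanishes, and restriction identifies H^1(L) with the G-invariants of H^1(M). This is
    carried out on cocycles. [tower_inflation] kills a cocycle of G by the order of a finite
    quotient, which gives injectivity ([res_injective]). [tower_corestriction] extends an invariant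
    class to an open subgroup and corestricts it, which gives surjectivity ([res_surjective]). The
    record [tower] retains only the finite l-quotients of G, so that the same lemmas serve over L
    and over its completions.

    It remains to compare the local conditions. Going up is easy: a completion of M contains a
    completion of L at the place below ([sub_completion]), and a Kummer class stays a Kummer class
    ([kummer_local_sub]).

    Going down is the heart of the proof ([local_descent]). Let K be a completion of L, with
    separable closure S, and let KM be the compositum, again a tower of l-groups over K
    ([local_tower]). The closure of KM in the completion C of S is a completion of M
    ([completion_sepcl]). Hence over it the cocycle is s |-> sQ' - Q', with r^N Q' rational over the
    closure of KM, and this has to be brought back to KM itself. As r differs from p, small points
    near the origin of E are divisible by r and have no r-torsion ([nbh_divisible],
    [nbh_torsion_free]). So Q' can be changed by a point over the closure of KM until r^N Q' is a
    point with one coordinate in KM that determines the other one locally ([approx_isolated]). Such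
    a point is fixed by a level of the tower, and the points dividing it are fixed by an open
    subgroup of Gal(K). An averaging argument in the style of Ax, possible since l differs from p,
    shows that elements of C of this kind lie in S ([fixed_algebraic]). Thus the cocycle is, over
    KM, the coboundary of a point of E(S), and one more average over the l-tower takes it down to K
    ([descent_finish]).

    The supporting theory: the group law of E is obtained from the ideal classes of its coordinate
    ring ([pideal_add], [pideal_inj]); automorphisms are extended to the separable closure
    ([pgraph_total]); valuations are extended by Chevalley's theorem ([chevalley]), uniquely over a
    complete field ([vring_unique]); and a Krasner-type argument finds a separable closure of the
    closure of KM inside C ([sepcl_closed]). *)

Section IdealSpan.

(** * The group law of E from ideal classes of its coordinate ring *)

Variable R : comNzRingType.
Implicit Types (s t : seq R) (x y : R).

(** Ideals are handled through finite lists of generators. Splitting off one coefficient at a time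
    keeps explicit membership proofs down to giving witnesses followed by [ring]. *)
Fixpoint span s x : Prop :=
  if s is a :: s' then exists c, span s' (x - c * a) else x = 0.

Lemma span0 s : span s 0.
Proof. by elim: s => //= a s IH; exists 0; rewrite mul0r subr0. Qed.

Lemma spanD s x y : span s x -> span s y -> span s (x + y).
Proof.
elim: s x y => [|a s IH] x y /= => [-> ->|[c cx] [d dy]]; first by rewrite addr0.
by exists (c + d); rewrite mulrDl opprD addrACA; exact: IH.
Qed.

Lemma spanM s x y : span s y -> span s (x * y).
Proof.
elim: s y => [|a s IH] y /= => [->|[c cy]]; first by rewrite mulr0.
by exists (x * c); rewrite -mulrA -mulrBr; exact: IH.
Qed.

Lemma span_mem s x : x \in s -> span s x.
Proof.
elim: s => //= a s IH; rewrite inE => /orP[/eqP ->|/IH xs].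
  by exists 1; rewrite mul1r subrr; exact: span0.
by exists 0; rewrite mul0r subr0.
Qed.

Lemma span_cons s a x : span s x -> span (a :: s) x.
Proof. by move=> sx; exists 0; rewrite mul0r subr0. Qed.

Lemma span_sub s t x : (forall a, a \in s -> span t a) -> span s x -> span t x.
Proof.
elim: s x => [|a s IH] x st /= => [->|[c cx]]; first exact: span0.
rewrite -(subrK (c * a) x); apply: spanD.
  by apply: IH => // b bs; apply: st; rewrite inE bs orbT.
by apply: spanM; apply: st; rewrite mem_head.
Qed.

Definition prods s t : seq R := [seq a * b | a <- s, b <- t].

Lemma spanMr s y z : span s y -> span [seq z * a | a <- s] (z * y).
Proof.
elim: s y => [|a s IH] y /= => [->|[c cy]]; first by rewrite mulr0.
by exists c; rewrite mulrCA -mulrBr; exact: IH.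
Qed.

Lemma span_prods s t x y : span s x -> span t y -> span (prods s t) (x * y).
Proof.
move=> sx ty; rewrite mulrC; apply: (span_sub _ (spanMr y sx)) => _ /mapP[a a_s ->].
rewrite mulrC; apply: (span_sub _ (spanMr a ty)) => _ /mapP[b b_t ->].
by apply: span_mem; apply/allpairsP; exists (a, b).
Qed.

Definition ideq s t : Prop :=
  (forall a, a \in s -> span t a) /\ (forall a, a \in t -> span s a).

Definition scal x s := [seq x * a | a <- s].

(** Equality of ideal classes. *)
Definition iclass s t : Prop :=
  exists x y, [/\ GRing.lreg x, GRing.lreg y & ideq (scal x s) (scal y t)].

Lemma ideq_span s t x : ideq s t -> span s x <-> span t x.
Proof. by case=> st ts; split; apply: span_sub. Qed.

Lemma ideq_prods s s' t t' :
  ideq s t -> ideq s' t' -> ideq (prods s s') (prods t t').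
Proof.
move=> [st ts] [st' ts']; split=> _ /allpairsP[[a b] /= [a_s b_s ->]];
  by apply: span_prods; auto.
Qed.

Lemma ideq_trans t s u : ideq s t -> ideq t u -> ideq s u.
Proof.
move=> [st ts] [tu ut]; split=> a ?.
  by apply: (span_sub tu); apply: st.
by apply: (span_sub ts); apply: ut.
Qed.

Lemma ideq_sym s t : ideq s t -> ideq t s. Proof. by case. Qed.

Lemma ideq_refl s : ideq s s. Proof. by split=> a; apply: span_mem. Qed.

Lemma ideq_scal x s t : ideq s t -> ideq (scal x s) (scal x t).
Proof. by move=> [st ts]; split=> _ /mapP[a a_s ->]; apply: spanMr; auto. Qed.

Lemma ideq_mem s t : s =i t -> ideq s t.
Proof. by move=> st; split=> a a_s; apply: span_mem; rewrite ?st // -st. Qed.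

Lemma scalM x y s : scal x (scal y s) = scal (x * y) s.
Proof. by rewrite /scal -map_comp; apply: eq_map => a /=; rewrite mulrA. Qed.

Lemma iclass_refl s : iclass s s.
Proof. by exists 1, 1; split; [exact: lreg1 | exact: lreg1 | exact: ideq_refl]. Qed.

Lemma iclass_sym s t : iclass s t -> iclass t s.
Proof. by move=> [x [y [? ? /ideq_sym st]]]; exists y, x. Qed.

Lemma iclass_trans t s u : iclass s t -> iclass t u -> iclass s u.
Proof.
move=> [x [y [rx ry st]]] [x' [y' [rx' ry' tu]]].
exists (x' * x), (y * y'); split; [exact: lregM | exact: lregM |].
rewrite -!scalM; apply: ideq_trans (ideq_scal x' st) _.
by rewrite !scalM [x' * y]mulrC -!scalM; apply: ideq_scal.
Qed.

Lemma iclass_prods s s' t t' :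
  iclass s t -> iclass s' t' -> iclass (prods s s') (prods t t').
Proof.
move=> [x [y [rx ry st]]] [x' [y' [rx' ry' st']]].
exists (x * x'), (y * y'); split; [exact: lregM | exact: lregM |].
have scalP z z' u u' : scal (z * z') (prods u u') =i prods (scal z u) (scal z' u').
  move=> a; apply/mapP/allpairsP => [[_ /allpairsP[[b c] /= [bu cu ->]] ->]|].
    by exists (z * b, z' * c); rewrite /= !map_f // mulrACA.
  move=> [[_ _] /= [/mapP[b bu ->] /mapP[c cu ->] ->]].
  by exists (b * c); rewrite 1?mulrACA //; apply/allpairsP; exists (b, c).
apply: ideq_trans (ideq_mem (scalP _ _ _ _)) _; apply: ideq_sym.
apply: ideq_trans (ideq_mem (scalP _ _ _ _)) _; apply: ideq_sym.
exact: ideq_prods.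
Qed.

Lemma prodsC s t : iclass (prods s t) (prods t s).
Proof.
exists 1, 1; split; [exact: lreg1 | exact: lreg1 |]; apply: ideq_scal; apply: ideq_mem => a.
by apply/allpairsP/allpairsP => [] [[b c] /= [? ? ->]]; exists (c, b); rewrite /= mulrC.
Qed.

Lemma prodsA s t u : iclass (prods s (prods t u)) (prods (prods s t) u).
Proof.
exists 1, 1; split; [exact: lreg1 | exact: lreg1 |]; apply: ideq_scal; apply: ideq_mem => a.
apply/allpairsP/allpairsP.
  move=> [[b _] /= [? /allpairsP[[c d] /= [? ? ->]] ->]].
  by exists (b * c, d); rewrite /= mulrA; split=> //; apply/allpairsP; exists (b, c).
move=> [[_ d] /= [/allpairsP[[b c] /= [? ? ->]] ? ->]].
by exists (b, c * d); rewrite /= mulrA; split=> //; apply/allpairsP; exists (c, d).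
Qed.

End IdealSpan.

(** The pair [(p, q)] stands for p + qY, where Y^2 = F - GY. *)
Definition coordring (K : fieldType) (W : weierstrass K) : Type := ({poly K} * {poly K})%type.

Section CoordinateRing.
Variables (K : fieldType) (W : weierstrass K).
Local Notation a1 := (a1 W).
Local Notation a2 := (a2 W).
Local Notation a3 := (a3 W).
Local Notation a4 := (a4 W).
Local Notation a6 := (a6 W).

Definition curve_lin : {poly K} := a1 *: 'X + a3%:P.
Definition curve_cub : {poly K} := 'X^3 + a2 *: 'X^2 + a4 *: 'X + a6%:P.
Local Notation G := curve_lin.
Local Notation F := curve_cub.

Local Notation coordring := (coordring W).
HB.instance Definition _ := GRing.Zmodule.on coordring.

Definition coord1 : coordring := (1, 0).
Definition coordM (f g : coordring) : coordring :=
  (f.1 * g.1 + f.2 * g.2 * F, f.1 * g.2 + f.2 * g.1 - f.2 * g.2 * G).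

Fact coordMA : associative coordM.
Proof. by move=> [a b] [c d] [e f]; congr pair; rewrite /=; ring. Qed.
Fact coordMC : commutative coordM.
Proof. by move=> [a b] [c d]; congr pair; rewrite /=; ring. Qed.
Fact coord1M : left_id coord1 coordM.
Proof. by move=> [a b]; congr pair; rewrite /=; ring. Qed.
Fact coordMDl : left_distributive coordM +%R.
Proof. by move=> [a b] [c d] [e f]; congr pair; rewrite /=; ring. Qed.
Fact coord1_neq0 : coord1 != 0.
Proof. by apply/eqP => -[] /eqP; rewrite oner_eq0. Qed.

HB.instance Definition _ := GRing.Zmodule_isComNzRing.Build coordring
  coordMA coordMC coord1M coordMDl coord1_neq0.

Lemma coord_mulE (f g : coordring) :
  f * g = (f.1 * g.1 + f.2 * g.2 * F, f.1 * g.2 + f.2 * g.1 - f.2 * g.2 * G) :> coordring.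
Proof. by []. Qed.

Lemma coord_addE (f g : coordring) : f + g = (f.1 + g.1, f.2 + g.2) :> coordring.
Proof. by []. Qed.

Lemma coord_oppE (f : coordring) : - f = (- f.1, - f.2) :> coordring.
Proof. by []. Qed.

(** The product of p + qY with its conjugate under Y |-> -Y - G, that is, the norm to K[X]. *)
Definition cnorm (f : coordring) : {poly K} :=
  f.1 ^+ 2 - f.1 * f.2 * G - f.2 ^+ 2 * F.

Lemma cnormM (f g : coordring) : cnorm (f * g) = cnorm f * cnorm g.
Proof. by case: f g => [a b] [c d]; rewrite coord_mulE /cnorm /=; ring. Qed.

Lemma size_cub : size F = 4%N.
Proof.
rewrite /curve_cub -!addrA size_polyDl ?size_polyXn //.
rewrite (leq_ltn_trans (size_polyD _ _)) // gtn_max.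
rewrite (leq_ltn_trans (size_scale_leq _ _)) ?size_polyXn //=.
rewrite (leq_ltn_trans (size_polyD _ _)) // gtn_max.
by rewrite (leq_ltn_trans (size_scale_leq _ _)) ?size_polyX //= (leq_ltn_trans (size_polyC_leq1 _)).
Qed.

Lemma size_lin : (size G <= 2)%N.
Proof.
rewrite (leq_trans (size_polyD _ _)) // geq_max.
by rewrite (leq_trans (size_scale_leq _ _)) ?size_polyX //= (leq_trans (size_polyC_leq1 _)).
Qed.

(** The degree of p^2 is even and that of q^2 F is odd, so these two terms cannot cancel, and pqG
    has smaller degree than the larger of them. A function that involves Y therefore has norm of
    degree at least 3. *)
Lemma size_cnorm (f : coordring) : f.2 != 0 -> (3 < size (cnorm f))%N.
Proof.
case: f => p q /= q0; rewrite /cnorm /=.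
have F0 : F != 0 by rewrite -size_poly_eq0 size_cub.
have sq : size (q ^+ 2 * F) = ((size q).*2 + 2)%N.
  rewrite size_mul ?expf_neq0 // size_cub expr2 size_mul // -addnn.
  move: q0; rewrite -size_poly_gt0. move: (size q) => s. lia.
have b0 : (0 < size q)%N by rewrite size_poly_gt0.
have [->|p0] := eqVneq p 0.
  rewrite expr0n /= !mul0r subr0 sub0r size_polyN sq.
  by lia.
have a0 : (0 < size p)%N by rewrite size_poly_gt0.
have sp : size (p ^+ 2) = (size p).*2.-1 by rewrite expr2 size_mul // -addnn.
have spq : (size (p * q * G)%R <= size p + size q)%N.
  apply: leq_trans (size_polyMleq _ _) _; rewrite size_mul //.
  by have := size_lin; move: (size G) (size p) (size q) a0 => ? ? ?; lia.
rewrite -addrA -opprD.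
move: sp sq spq a0 b0; set A := _ ^+ 2; set B := _ * F; set C := _ * G.
move: (size p) (size q) => a b sp sq spq a0 b0.
have [lt|ge] := ltnP b.+1 a.
  rewrite size_polyDl; first by rewrite sp; lia.
  rewrite size_polyN sp (leq_ltn_trans (size_polyD _ _)) // gtn_max sq.
  by move: (size C) spq => ?; lia.
rewrite opprD addrA addrC size_polyDl size_polyN sq; first lia.
rewrite (leq_ltn_trans (size_polyD _ _)) // gtn_max size_polyN sp.
by move: (size C) spq => ?; lia.
Qed.

Lemma cnorm_eq0 (f : coordring) : cnorm f = 0 -> f = 0.
Proof.
case: f => p q N0; have [q0|q0] := eqVneq q 0; last first.
  by have /= := @size_cnorm (p, q) q0; rewrite N0 size_poly0.
move: N0; rewrite /cnorm q0 /= !(expr0n, mul0r, mulr0, subr0) /= => /eqP.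
by rewrite expf_eq0 /= => /eqP ->.
Qed.

(** The norm is multiplicative and vanishes only at 0, so the coordinate ring is a domain. *)
Lemma coord_lreg (f : coordring) : f != 0 -> GRing.lreg f.
Proof.
move=> f0 g h /eqP; rewrite -subr_eq0 -mulrBr => /eqP fg; apply/eqP; rewrite -subr_eq0.
apply/eqP; apply: cnorm_eq0; have /eqP := congr1 cnorm fg.
have -> : cnorm 0 = 0 by rewrite /cnorm /=; ring.
rewrite cnormM mulf_eq0 => /orP[|/eqP //].
by move=> /eqP /cnorm_eq0 /eqP; rewrite (negPf f0).
Qed.

Definition cX (x : K) : coordring := ('X - x%:P, 0).
Definition cY (y : K) : coordring := (- y%:P, 1).

(** The maximal ideal of an affine point; the point at infinity gets the unit ideal, since it is to
    become the neutral element of the class group. *)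
Definition pideal (P : point K) : seq coordring :=
  if P is Some (x, y) then [:: cX x; cY y] else [:: 1].

Definition ceval (x y : K) (f : coordring) : K := f.1.[x] + f.2.[x] * y.

Lemma cevalM x y f g : on_curve W (Some (x, y)) ->
  ceval x y (f * g) = ceval x y f * ceval x y g.
Proof.
case: f g => [a b] [c d] /= E; rewrite /ceval coord_mulE /= /curve_cub /curve_lin.
rewrite !(hornerD, hornerN, hornerM, hornerZ, hornerC, hornerXn, hornerX).
by rewrite -E; ring.
Qed.

Lemma span_pideal_eval x y f : on_curve W (Some (x, y)) ->
  span (pideal (Some (x, y))) f -> ceval x y f = 0.
Proof.
move=> E [c [d /=]] /eqP; rewrite subr_eq0 subr_eq => /eqP ->.
have evD f' g : ceval x y (f' + g) = ceval x y f' + ceval x y g.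
  by rewrite /ceval coord_addE /= !hornerD; ring.
by rewrite evD !cevalM // /ceval /= !(hornerD, hornerN, hornerC, hornerX); ring.
Qed.

(** A generator h of the ideal of an affine point would divide X - x, of norm (X - x)^2. By
    [size_cnorm] neither h nor its cofactor involves Y. Since h also divides Y - y, the coefficient
    of Y shows that h is a unit of K[X], whereas h vanishes at the point. *)
Lemma pideal_nontrivial P : on_curve W P -> iclass (pideal P) [:: 1] -> P = None.
Proof.
case: P => // -[x y] E [f [g [rf rg [fg gf]]]].
have memf (s : seq coordring) u z : span (scal u s) z -> exists2 h, span s h & z = u * h.
  elim: s z => [|a s IH] z /= => [->|[c /IH[h sh zh]]]; first by exists 0; rewrite ?mulr0.
  exists (h + c * a); last by rewrite mulrDr -zh mulrCA subrK.
  by exists c; rewrite addrK.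
have [h Ph gE] : exists2 h, span (pideal (Some (x, y))) h & g = f * h.
  by apply: memf; have := gf g; rewrite /scal /= inE mulr1 eqxx => /(_ isT).
have fac a : a \in pideal (Some (x, y)) -> exists c, a = h * c.
  move=> aP; have /fg/memf[c _] : f * a \in scal f (pideal (Some (x, y))) by exact: map_f.
  by rewrite gE -mulrA => /rf ->; exists c.
have [|c Xc] := fac (cX x); first by rewrite inE eqxx.
have [|d Yd] := fac (cY y); first by rewrite !inE eqxx orbT.
have Xn : cnorm (cX x) = ('X - x%:P) ^+ 2 by rewrite /cnorm /=; ring.
have NN : cnorm h * cnorm c = ('X - x%:P) ^+ 2 by rewrite -cnormM -Xc.
have N0 : cnorm h * cnorm c != 0 by rewrite NN expf_neq0 // polyXsubC_eq0.
have /norP[Nh0 Nc0] : ~~ ((cnorm h == 0) || (cnorm c == 0)) by rewrite -mulf_eq0.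
have sN : (size (cnorm h) + size (cnorm c)).-1 = 3%N.
  by rewrite -size_mul // NN size_exp_XsubC.
have small (u : coordring) : (size (cnorm u) <= 3)%N -> u.2 = 0.
  by move=> su; apply/eqP; apply: contraTT su => /size_cnorm; rewrite -ltnNge.
have h2 : h.2 = 0.
  apply: small; move: sN Nc0; rewrite -size_poly_gt0.
  by case: (size (cnorm c)) => // n; rewrite addnS /= => <- _; exact: leq_addr.
have c2 : c.2 = 0.
  apply: small; move: sN Nh0; rewrite -size_poly_gt0.
  by case: (size (cnorm h)) => // n; rewrite addSn /= => <- _; exact: leq_addl.
have /(congr1 fst)/= := Xc; have /(congr1 snd)/= := Yd.
rewrite h2 c2 !mul0r addr0 addr0 subr0 => hd hc.
have /(span_pideal_eval E) := Ph; rewrite /ceval h2 horner0 mul0r addr0 => hx.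
have := congr1 (fun u => u.[x]) hd; rewrite hornerM hx hornerC.
by rewrite mul0r => /eqP; rewrite oner_eq0.
Qed.

End CoordinateRing.

Section ChordIdeals.
Variable R : comNzRingType.

(** The ideal form of the chord construction: L is the line of slope m through the first two points,
    and X3, Y3 generate the ideal of their sum. The third hypothesis is the equation of the curve:
    the line meets it over the roots of X1 X2 X3, and Y3 + k X3 is the conjugate of L. *)
Lemma chord_ideal (X1 X2 X3 Y1 Y2 Y3 L m k u : R) :
  Y1 = L + m * X1 -> Y2 = L + m * X2 -> X1 * X2 * X3 = L * (Y3 + k * X3) ->
  span (prods [:: X1; Y1] [:: X2; Y2]) L ->
  ideq (scal X3 (prods [:: X1; Y1] [:: X2; Y2])) (scal L [:: X3; Y3]).
Proof.
move=> -> -> E memL; split=> a.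
  rewrite !inE => /or4P[] /eqP ->.
  - by exists k, 1; rewrite /=; ring: E.
  - by exists (X1 + m * k), m; rewrite /=; ring: E.
  - by exists (X2 + m * k), m; rewrite /=; ring: E.
  - by exists (L + m * (X1 + X2) + m ^+ 2 * k), (m ^+ 2); rewrite /=; ring: E.
rewrite !inE => /orP[] /eqP ->; first by rewrite (mulrC L); exact: (spanMr X3 memL).
have -> : L * Y3 = X3 * (X1 * X2) - k * (X3 * L) by ring: E.
apply: spanD; first by apply: span_mem; rewrite inE eqxx.
by rewrite -mulNr; apply: spanM; exact: (spanMr X3 memL).
Qed.

End ChordIdeals.

Section GroupLaw.
Variables (K : fieldType) (W : weierstrass K).
Local Notation a1 := (a1 W).
Local Notation a2 := (a2 W).
Local Notation a3 := (a3 W).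
Local Notation a4 := (a4 W).
Local Notation a6 := (a6 W).
Local Notation cX := (@cX K W).
Local Notation cY := (@cY K W).
Local Notation cC c := ((c%:P, 0) : coordring W).

Definition slope x1 y1 x2 y2 : K :=
  if x1 == x2 then (3 * x1 ^+ 2 + 2 * a2 * x1 + a4 - a1 * y1) / (2 * y1 + a1 * x1 + a3)
  else (y2 - y1) / (x2 - x1).

Lemma ec_addE x1 y1 x2 y2 : ec_add W (Some (x1, y1)) (Some (x2, y2)) =
  if (x1 == x2) && (y1 + y2 + a1 * x2 + a3 == 0) then None else
  let m := slope x1 y1 x2 y2 in
  let x3 := m ^+ 2 + a1 * m - a2 - x1 - x2 in
  Some (x3, - (m + a1) * x3 - (y1 - m * x1) - a3).
Proof. by []. Qed.

(** Vieta's formulas for the three points of the line y = mx + c on the curve. *)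
Definition collinear m c x1 x2 x3 : Prop :=
  [/\ m ^+ 2 + a1 * m - a2 = x1 + x2 + x3,
      2 * m * c + a1 * c + a3 * m - a4 = - (x1 * x2 + x1 * x3 + x2 * x3) &
      c ^+ 2 + a3 * c - a6 = x1 * x2 * x3].

Lemma same_x x y1 y2 : on_curve W (Some (x, y1)) -> on_curve W (Some (x, y2)) ->
  y1 + y2 + a1 * x + a3 != 0 -> y1 = y2.
Proof.
move=> /= E1 E2 n0; apply/eqP; rewrite -subr_eq0.
have : (y1 - y2) * (y1 + y2 + a1 * x + a3) == 0.
  apply/eqP; rewrite (_ : _ * _ = y1 ^+ 2 + a1 * x * y1 + a3 * y1 - (y2 ^+ 2 + a1 * x * y2 + a3 * y2)).
    by rewrite E1 E2 subrr.
  by ring.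
by rewrite mulf_eq0 (negPf n0) orbF.
Qed.

(** Restricted to the line, the equation of the curve is a cubic with root x1; the slope is chosen
    so that x2 is the other prescribed root, a double root in the tangent case, and x3 is then read
    off from the sum of the roots. *)
Lemma slopeP x1 y1 x2 y2 :
  on_curve W (Some (x1, y1)) -> on_curve W (Some (x2, y2)) ->
  ~~ ((x1 == x2) && (y1 + y2 + a1 * x2 + a3 == 0)) ->
  let m := slope x1 y1 x2 y2 in
  y2 = m * x2 + (y1 - m * x1) /\
  collinear m (y1 - m * x1) x1 x2 (m ^+ 2 + a1 * m - a2 - x1 - x2).
Proof.
move=> E1 E2 ne m; set c := y1 - m * x1; set x3 := _ - x2.
have y1E : y1 = m * x1 + c by rewrite /c; ring.
(* [A] is the defect of the second Vieta formula, and [e] is the equation of the curve along the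
   line. *)
pose A := 2 * m * c + a1 * c + a3 * m - a4 + (x1 * x2 + x1 * x3 + x2 * x3).
pose e x := (m * x + c) ^+ 2 + a1 * x * (m * x + c) + a3 * (m * x + c)
    - (x ^+ 3 + a2 * x ^+ 2 + a4 * x + a6).
have e1 : e x1 = 0 by apply/eqP; rewrite subr_eq0; apply/eqP; rewrite -y1E.
have main : y2 = m * x2 + c /\ A = 0.
  move: ne; have [x12|x12] := eqVneq x1 x2 => /= ne; last first.
    have y2E : y2 = m * x2 + c.
      by rewrite /c /m /slope (negPf x12); field; rewrite subr_eq0 eq_sym.
    split=> //; have e2 : e x2 = 0 by apply/eqP; rewrite subr_eq0; apply/eqP; rewrite -y2E.
    have /eqP : A * (x1 - x2) = 0.
      by have -> : A * (x1 - x2) = e x1 - e x2; [rewrite /A /x3 /e; ring | rewrite e1 e2 subrr].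
    by rewrite mulf_eq0 subr_eq0 (negPf x12) orbF => /eqP.
  move: ne E1 E2; rewrite -x12 => ne E1 E2.
  have y12 := same_x E1 E2 ne; split; first by rewrite -y12.
  move: ne; rewrite -y12 -mulr2n -mulr_natl => t0.
  have mt : m * (2 * y1 + a1 * x1 + a3) = 3 * x1 ^+ 2 + 2 * a2 * x1 + a4 - a1 * y1.
    by rewrite /m /slope -x12 eqxx; field.
  move/eqP: mt; rewrite -subr_eq0 => /eqP <-; rewrite /A /x3 -x12 y1E; ring.
have [-> A0] := main; split=> //; split; first by rewrite /x3; ring.
  by apply/eqP; rewrite -subr_eq0 opprK; apply/eqP.
have -> : a6 = e x1 - A * x1 + a6 by rewrite e1 A0; ring.
by rewrite /e /A /x3; ring.
Qed.

Lemma on_curve_add P Q : on_curve W P -> on_curve W Q -> on_curve W (ec_add W P Q).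
Proof.
case: P Q => [[x1 y1]|] [[x2 y2]|] // E1 E2; rewrite ec_addE; case: ifPn => // ne.
have [_ [h2 h1 h0]] := slopeP E1 E2 ne; move: h2 h1 h0; rewrite /=.
set m := slope _ _ _ _; set c := y1 - m * x1; set x3 := _ - x2 => h2 h1 h0.
have -> : a2 = m ^+ 2 + a1 * m - (x1 + x2 + x3) by rewrite -h2; ring.
have -> : a4 = 2 * m * c + a1 * c + a3 * m + (x1 * x2 + x1 * x3 + x2 * x3).
  by apply/eqP; rewrite -subr_eq0; apply/eqP; rewrite -[RHS](subrr (x1 * x2 * x3)) ;
     move/eqP: h1; rewrite -subr_eq0 opprK => /eqP h1; rewrite subrr -[RHS]oppr0 -h1; ring.
have -> : a6 = c ^+ 2 + a3 * c - x1 * x2 * x3 by rewrite -h0; ring.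
by ring.
Qed.

Lemma on_curve_opp P : on_curve W P -> on_curve W (ec_opp W P).
Proof. by case: P => [[x y]|] //= <-; ring. Qed.

Hypothesis EW : elliptic W.

(** If both partial derivatives vanish, then a3, a4 and a6 can be eliminated, after which the
    discriminant is identically 0. *)
Lemma nonsingular x y : on_curve W (Some (x, y)) ->
  (2 * y + a1 * x + a3 != 0) || (3 * x ^+ 2 + 2 * a2 * x + a4 - a1 * y != 0).
Proof.
move=> /= E; apply/norP => -[/negbNE/eqP t0 /negbNE/eqP s0]; move: EW; rewrite /elliptic => /eqP; apply.
have a3E : a3 = - (2 * y) - a1 * x by rewrite -[LHS]subr0 -t0; ring.
have a4E : a4 = a1 * y - 3 * x ^+ 2 - 2 * a2 * x by rewrite -[LHS]subr0 -s0; ring.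
have a6E : a6 = y ^+ 2 + a1 * x * y + a3 * y - (x ^+ 3 + a2 * x ^+ 2 + a4 * x) by rewrite E; ring.
by rewrite /disc /b2 /b4 /b6 /b8 a6E a4E a3E; ring.
Qed.

Lemma coord_cst (c : K) : c != 0 -> exists u : coordring W, u * cC c = 1.
Proof.
move=> c0; exists ((c^-1)%:P, 0); congr pair; rewrite /= ?mul0r ?mulr0 ?addr0 ?subr0 //.
by rewrite -polyCM mulVf.
Qed.

(** P and -P are the two points above x, so the product of their ideals is generated by X - x.
    Smoothness puts X - x itself into the product: the value c of a nonvanishing partial derivative
    at P is a unit, and c(X - x) is a combination of the products of generators. *)
Lemma pideal_opp P : on_curve W P ->
  iclass (prods (pideal W P) (pideal W (ec_opp W P))) [:: 1].
Proof.
case: P => [[x y]|] E /=; last first.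
  by exists 1, 1; split; [exact: lreg1 | exact: lreg1 | apply: ideq_mem => a; rewrite !inE !mul1r].
exists 1, (cX x); split; first exact: lreg1.
  by apply: coord_lreg; apply/eqP => -[/eqP]; rewrite polyXsubC_eq0.
(* [g] is the divided difference of the cubic at x, so that (Y - y)(Y - y') = (X - x)(g - a1 Y). *)
set y' := - y - _ - _; pose g := ('X^2 + x *: 'X + (x ^+ 2)%:P + a2 *: ('X + x%:P) + a4%:P : {poly K}).
have YY : cY y * cY y' = cX x * (g, - a1%:P).
  have c0 : (- a6 + (y ^+ 2 + a1 * x * y + a3 * y - (x ^+ 3 + a2 * x ^+ 2 + a4 * x)))%:P = 0 :> {poly K}.
    by rewrite E -polyC0; congr (_%:P); ring.
  congr pair; rewrite /= /y' /g /curve_cub /curve_lin; last first.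
    by rewrite -!mul_polyC !(polyCD, polyCN, polyCM); ring.
  rewrite -[LHS]addr0 -[in LHS]c0 -!mul_polyC !(polyCD, polyCN, polyCM, polyC_exp); ring.
have memX : span (prods [:: cX x; cY y] [:: cX x; cY y']) (cX x).
  pose t := 2 * y + a1 * x + a3; pose s := 3 * x ^+ 2 + 2 * a2 * x + a4 - a1 * y.
  suff main (c : K) : c != 0 -> span (prods [:: cX x; cY y] [:: cX x; cY y']) (cC c * cX x) ->
      span (prods [:: cX x; cY y] [:: cX x; cY y']) (cX x).
    have /orP[n0|n0] := nonsingular E; apply: main n0 _.
      exists 0, 1, (- 1); rewrite /= -/t; exists 0; congr pair; rewrite /= /y' /t.
        by rewrite !(polyCD, polyCN, polyCM); ring.
      by ring.
    exists (- ('X + (2 * x + a2)%:P, 0)), 0, (a1%:P, 0), 1; rewrite /= YY -/s.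
    by congr pair; rewrite /= /y' /s /g -!mul_polyC !(polyCD, polyCN, polyCM, polyCMn); ring.
  move=> c0 cX_in; have [v vc] := coord_cst c0.
  by have := spanM v cX_in; rewrite mulrA vc mul1r.
split=> a; last first.
  rewrite /scal /= !inE mulr1 => /eqP ->.
  by have := spanMr 1 memX; rewrite mul1r.
rewrite /scal /= !inE !mul1r => a_in; suff [c ->] : exists c, a = c * cX x.
  by exists c; rewrite /= mulr1 subrr.
by case/or4P: a_in => /eqP ->; [exists (cX x) | exists (cY y') | exists (cY y) | exists (g, - a1%:P); rewrite YY];
  rewrite // mulrC.
Qed.

(** Sending a point to the class of its ideal is additive. For opposite points this is [pideal_opp].
    Otherwise [chord_ideal] applies once the line L is known to lie in the product of the two
    ideals, which is checked separately for secants and tangents. *)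
Lemma pideal_add P Q : on_curve W P -> on_curve W Q ->
  iclass (prods (pideal W P) (pideal W Q)) (pideal W (ec_add W P Q)).
Proof.
have unitl s : iclass (prods [:: 1] s) (s : seq (coordring W)).
  by exists 1, 1; split; [exact: lreg1 | exact: lreg1 | apply: ideq_scal; apply: ideq_mem => a;
    rewrite /prods /= cats0; under eq_map => b do rewrite mul1r; rewrite map_id].
case: P Q => [[x1 y1]|] [[x2 y2]|] E1 E2; last 2 [exact: unitl].
  rewrite ec_addE; case: ifPn => [/andP[/eqP x12 /eqP t0]|ne]; cbv zeta.
    suff -> : Some (x2, y2) = ec_opp W (Some (x1, y1)) by exact: pideal_opp.
    by rewrite /= x12; congr (Some (_, _)); rewrite -[LHS]subr0 -t0; ring.
set m := slope _ _ _ _; set x3 := _ - x2.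
  have [y2E [h2 h1 h0]] := slopeP E1 E2 ne.
  move: y2E h2 h1 h0; rewrite -/m -/x3; set c := y1 - m * x1 => y2E h2 h1 h0.
  have y1E : y1 = m * x1 + c by rewrite /c; ring.
  clearbody x3 c m.
  have a2E : a2 = m ^+ 2 + a1 * m - (x1 + x2 + x3) by rewrite -h2; ring.
  have a4E : a4 = 2 * m * c + a1 * c + a3 * m + (x1 * x2 + x1 * x3 + x2 * x3).
    by move/eqP: h1; rewrite -subr_eq0 => /eqP h1; rewrite -[LHS]addr0 -h1; ring.
  have a6E : a6 = c ^+ 2 + a3 * c - x1 * x2 * x3 by rewrite -h0; ring.
  pose L : coordring W := (- (m *: 'X + c%:P), 1).
  pose k := cC (m + a1).
  exists (cX x3), L; split.
  - by apply: coord_lreg; apply/eqP => -[/eqP]; rewrite polyXsubC_eq0.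
  - by apply: coord_lreg; apply/eqP => -[_ /eqP]; rewrite oner_eq0.
  have YE x y : y = m * x + c -> cY y = L + cC m * cX x.
    by move=> ->; congr pair; rewrite /= -?mul_polyC; ring.
  apply: (@chord_ideal _ _ _ _ _ _ _ L (cC m) k 0) => //; try exact: YE.
    congr pair; rewrite /= /curve_cub /curve_lin -!mul_polyC a2E a4E a6E; ring.
  have XY x y : y = m * x + c -> cX x * cY y - cC m * (cX x * cX x) = cX x * L.
    by move=> /YE ->; ring.
  set I := prods _ _.
  have XX : span I (cX x1 * cX x2) by apply: span_mem; rewrite !inE eqxx.
  have XL1 : span I (cX x2 * L).
    have -> : cX x2 * L = cY y1 * cX x2 + - cC m * (cX x1 * cX x2) by rewrite (YE _ _ y1E); ring.
    by apply: spanD; [apply: span_mem; rewrite !inE eqxx !orbT | exact: spanM].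
  have XL2 : span I (cX x1 * L).
    have -> : cX x1 * L = cX x1 * cY y2 + - cC m * (cX x1 * cX x2) by rewrite (YE _ _ y2E); ring.
    by apply: spanD; [apply: span_mem; rewrite !inE eqxx !orbT | exact: spanM].
  have unit (a : K) : a != 0 -> span I (cC a * L) -> span I L.
    move=> a0 aL; have [v va] := coord_cst a0.
    by have := spanM v aL; rewrite mulrA va mul1r.
  move: ne; have [x12|x12] := eqVneq x1 x2 => /= ne; last first.
    (* Secant case: X1 - X2 is the nonzero constant x2 - x1. *)
    apply: (unit (x2 - x1)); first by rewrite subr_eq0 eq_sym.
    have -> : cC (x2 - x1) * L = cX x1 * L - cX x2 * L.
      by congr pair; rewrite /= ?polyCB -?mul_polyC; ring.
    by rewrite -mulN1r; apply: spanD => //; exact: spanM.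
  (* Tangent case: the constant is the derivative of the equation with respect to Y at the point,
     nonzero because the sum is not the point at infinity. *)
  apply: (unit _ ne); rewrite -x12.
  have y12 : y1 = y2 by rewrite y1E y2E x12.
  have -> : cC (y1 + y2 + a1 * x1 + a3) * L =
      - (cY y1 * cY y2) + cC m * (cX x2 * L + cX x1 * L)
      + cC m * cC m * (cX x1 * cX x2)
      + (cX x3 * (cX x1 * cX x2) - cC (2 * m + a1) * (cX x1 * L)).
    congr pair; rewrite /= /curve_cub /curve_lin -!mul_polyC a2E a4E a6E y1E y2E -x12; ring.
  apply: spanD; last apply: spanD; last by rewrite -mulNr; exact: spanM.
    apply: spanD; last exact: spanM.
    apply: spanD; last by apply: spanM; exact: spanD.
    by rewrite -mulN1r; apply: spanM; apply: span_mem; rewrite !inE eqxx !orbT.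
  exact: spanM.
  by apply: iclass_trans (prodsC _ _) _; exact: unitl.
exact: unitl.
Qed.

Lemma pideal_inj P Q : on_curve W P -> on_curve W Q ->
  iclass (pideal W P) (pideal W Q) -> P = Q.
Proof.
move=> oP oQ PQ; have oQ' := on_curve_opp oQ.
have : ec_add W P (ec_opp W Q) = None.
  apply: pideal_nontrivial (on_curve_add oP oQ') _.
  apply: iclass_trans (iclass_sym (pideal_add oP oQ')) _.
  apply: iclass_trans (pideal_opp oQ).
  exact: iclass_prods PQ (iclass_refl _).
case: P Q {PQ oP oQ oQ'} => [[x1 y1]|] [[x2 y2]|] //.
rewrite /ec_opp ec_addE; case: ifPn => // /andP[/eqP -> /eqP y0] _.
by congr (Some (_, _)); rewrite -[RHS]addr0 -y0; ring.
Qed.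

(** Associativity is inherited from the multiplication of ideals, because a point is determined by
    its ideal class ([pideal_inj]). *)
Lemma ec_addA P Q R : on_curve W P -> on_curve W Q -> on_curve W R ->
  ec_add W P (ec_add W Q R) = ec_add W (ec_add W P Q) R.
Proof.
move=> oP oQ oR; have oPQ := on_curve_add oP oQ; have oQR := on_curve_add oQ oR.
apply: pideal_inj; try exact: on_curve_add.
apply: iclass_trans (iclass_sym (pideal_add oP oQR)) _.
apply: iclass_trans (pideal_add oPQ oR).
apply: iclass_trans (iclass_prods (iclass_refl _) (iclass_sym (pideal_add oQ oR))) _.
apply: iclass_trans (prodsA _ _ _) _.
exact: iclass_prods (pideal_add oP oQ) (iclass_refl _).
Qed.

Lemma ec_addC P Q : on_curve W P -> on_curve W Q -> ec_add W P Q = ec_add W Q P.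
Proof.
move=> oP oQ; apply: pideal_inj; try exact: on_curve_add.
apply: iclass_trans (iclass_sym (pideal_add oP oQ)) _.
exact: iclass_trans (prodsC _ _) (pideal_add oQ oP).
Qed.

Lemma ec_addNP P : on_curve W P -> ec_add W (ec_opp W P) P = None.
Proof.
case: P => [[x y]|] // _; rewrite /ec_opp ec_addE eqxx /=.
by rewrite (_ : _ + _ + _ + _ = 0) ?eqxx //; ring.
Qed.

End GroupLaw.

(** The group E(K) of points of an elliptic curve, as a Z-module. *)
Record ecpt (K : fieldType) (W : weierstrass K) (EW : elliptic W) :=
  Ecpt { ptval : point K; ptvalP : on_curve W ptval }.

Section PointGroup.
Variables (K : fieldType) (W : weierstrass K) (EW : elliptic W).
Local Notation E := (ecpt EW).

Lemma ptval_inj : injective (@ptval K W EW).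
Proof. by move=> [P oP] [Q oQ] /= PQ; case: _ / PQ oQ => oQ; congr Ecpt; exact: Prop_irrelevance. Qed.

HB.instance Definition _ := gen_eqMixin E.
HB.instance Definition _ := gen_choiceMixin E.

Definition pt0 : E := @Ecpt K W EW None I.
Definition ptD (P Q : E) : E := Ecpt EW (on_curve_add (ptvalP P) (ptvalP Q)).
Definition ptN (P : E) : E := Ecpt EW (on_curve_opp (ptvalP P)).

Fact ptDA : associative ptD.
Proof. by move=> P Q R; apply: ptval_inj; apply: (ec_addA EW); exact: ptvalP. Qed.
Fact ptDC : commutative ptD.
Proof. by move=> P Q; apply: ptval_inj; apply: (ec_addC EW); exact: ptvalP. Qed.
Fact pt0D : left_id pt0 ptD. Proof. by move=> P; exact: ptval_inj. Qed.
Fact ptND : left_inverse pt0 ptN ptD.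
Proof. by move=> P; apply: ptval_inj; apply: ec_addNP; exact: ptvalP. Qed.

HB.instance Definition _ := GRing.isZmodule.Build E ptDA ptDC pt0D ptND.

Lemma ptval0 : ptval (0 : E) = None. Proof. by []. Qed.
Lemma ptvalD (P Q : E) : ptval (P + Q) = ec_add W (ptval P) (ptval Q). Proof. by []. Qed.
Lemma ptvalN (P : E) : ptval (- P) = ec_opp W (ptval P). Proof. by []. Qed.
Lemma ptvalB (P Q : E) : ptval (P - Q) = ec_sub W (ptval P) (ptval Q). Proof. by []. Qed.
Lemma ptvalMn (P : E) n : ptval (P *+ n) = ec_muln W n (ptval P).
Proof. by elim: n => [//|n IH]; rewrite mulrS ptvalD IH. Qed.

Lemma ptvalK (P : point K) : on_curve W P -> exists P' : E, ptval P' = P.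
Proof. by move=> oP; exists (Ecpt EW oP). Qed.

End PointGroup.

(** * Points of the curve under field embeddings *)

Section PointMap.
Variables (K K' : fieldType) (f : {rmorphism K -> K'}) (W : weierstrass K).

Lemma point_map_curve P : on_curve W P <-> on_curve (wmap f W) (point_map f P).
Proof.
case: P => [[x y]|] //=; rewrite -!rmorphXn -!rmorphM -!rmorphD.
by split=> [->//|/fmorph_inj].
Qed.

Lemma point_mapD P Q :
  point_map f (ec_add W P Q) = ec_add (wmap f W) (point_map f P) (point_map f Q).
Proof.
case: P Q => [[x1 y1]|] [[x2 y2]|] //=.
rewrite (inj_eq (fmorph_inj f)) -(fmorph_eq0 f) !rmorphD !rmorphM /=; case: ifP => // _.
have mE : f (if x1 == x2 then (3 * x1 ^+ 2 + 2 * a2 W * x1 + a4 W - a1 W * y1) / (2 * y1 + a1 W * x1 + a3 W)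
    else (y2 - y1) / (x2 - x1)) =
  if x1 == x2 then (3 * f x1 ^+ 2 + 2 * f (a2 W) * f x1 + f (a4 W) - f (a1 W) * f y1) / (2 * f y1 + f (a1 W) * f x1 + f (a3 W))
    else (f y2 - f y1) / (f x2 - f x1).
  by case: ifP => _; rewrite fmorph_div; congr (_ / _); ring.
by congr (Some (_, _)); rewrite -mE; ring.
Qed.

Lemma point_mapN P :
  point_map f (ec_opp W P) = ec_opp (wmap f W) (point_map f P).
Proof. by case: P => [[x y]|] //=; rewrite !rmorphB rmorphN rmorphM. Qed.

Lemma disc_map : disc (wmap f W) = f (disc W).
Proof. by rewrite /disc /b2 /b4 /b6 /b8 /=; ring. Qed.

Lemma elliptic_map : elliptic W -> elliptic (wmap f W).
Proof. by rewrite /elliptic disc_map fmorph_eq0. Qed.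

End PointMap.

(** * Zorn's lemma, subfields as types, minimal polynomials *)

Lemma ex_min_nat (P : nat -> Prop) : (exists n, P n) ->
  exists2 n, P n & forall m, P m -> (n <= m)%N.
Proof.
move=> [n Pn]; have /ex_minnP[m /asboolP Pm minm] : exists n, `[< P n >].
  by exists n; apply/asboolP.
by exists m => // k Pk; apply: minm; apply/asboolP.
Qed.

(** [Zorn_bigcup] also demands the union of the empty chain. Adding the empty set to the family
    takes care of it, and the rest consists in discarding that extra member again. *)
Lemma Zorn_above (T : Type) (P : set (set T)) (A0 : set T) : P A0 ->
  (forall C : set (set T), C `<=` P -> C !=set0 -> total_on C subset ->
     P (\bigcup_(X in C) X)) ->
  exists A, [/\ P A, A0 `<=` A & forall B, P B -> A `<=` B -> B = A].
Proof.
move=> PA0 Pchain.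
have [C CP Ctot|A [PA maxA]] := @Zorn_bigcup T [set X | X = set0 \/ P X /\ A0 `<=` X].
  have [[X0 [CX0 X0n]]|noX] := pselect (exists X, C X /\ X <> set0); last first.
    left; rewrite -subset0 => x [X CX Xx]; apply: noX; exists X; split=> // X0.
    by rewrite X0 in Xx.
  right; pose D := C `&` [set X | X <> set0].
  have -> : \bigcup_(X in C) X = \bigcup_(X in D) X.
    apply/seteqP; split=> x [X].
      by move=> CX Xx; exists X => //; split=> // X0'; rewrite X0' in Xx.
    by move=> [CX _] Xx; exists X.
  have DP X : D X -> P X /\ A0 `<=` X by move=> [/CP[->|//]].
  split; last by move=> x A0x; exists X0; [split | apply: (DP X0 _).2; first split].
  apply: Pchain; first by move=> X /DP[].
    by exists X0.
  by move=> X Y [CX _] [CY _]; exact: Ctot.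
case: PA => [A_0|[PA A0A]].
  have [[x A0x]|A00] := pselect (A0 !=set0).
    exfalso; apply: (maxA A0); last by right; split.
    by rewrite A_0; split=> [z []|/(_ _ A0x)[]].
  have A0_0 : A0 = set0 by rewrite -subset0 => x A0x; apply: A00; exists x.
  exists A0; split=> // B PB _; apply: contrapT => BA; apply: (maxA B).
    rewrite A_0; split=> [z []|B0]; apply: BA; rewrite A0_0; apply/seteqP; split=> //.
  by rewrite /=; right; split=> //; rewrite A0_0.
exists A; split=> // B PB AB; apply: contrapT => BA; apply: (maxA B).
  by split=> // BA'; apply: BA; apply/seteqP.
by rewrite /=; right; split=> //; apply: subset_trans AB.
Qed.

Lemma mk_rmorph (R S : nzRingType) (f : R -> S) :
  zmod_morphism f -> monoid_morphism f -> exists g : {rmorphism R -> S}, g =1 f.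
Proof.
move=> fB fM.
pose fA := GRing.isZmodMorphism.Build R S f fB.
pose fMM := GRing.isMonoidMorphism.Build R S f fM.
pose g : {rmorphism R -> S} := HB.pack f fA fMM.
by exists g.
Qed.

Section SubfieldTheory.
Variables (T : fieldType) (A : set T).
Hypothesis hA : subfield A.

Let AP x : (x \in A) <-> A x. Proof. by rewrite in_setE. Qed.

Lemma sf1 : A 1. Proof. by case: hA => /AP. Qed.
Lemma sfB x y : A x -> A y -> A (x - y).
Proof. by case: hA => _ h _ /AP ? /AP ?; apply/AP; exact: h. Qed.
Lemma sf_div x y : A x -> A y -> A (x / y).
Proof. by case: hA => _ _ h /AP ? /AP ?; apply/AP; exact: h. Qed.
Lemma sf0 : A 0. Proof. by rewrite -(subrr 1); apply: sfB; exact: sf1. Qed.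
Lemma sfN x : A x -> A (- x). Proof. by move=> Ax; rewrite -sub0r; apply: sfB => //; exact: sf0. Qed.
Lemma sfD x y : A x -> A y -> A (x + y).
Proof. by move=> Ax Ay; rewrite -[y]opprK; apply: sfB => //; exact: sfN. Qed.
Lemma sfV x : A x -> A x^-1. Proof. by move=> Ax; rewrite -div1r; apply: sf_div => //; exact: sf1. Qed.
Lemma sfM x y : A x -> A y -> A (x * y).
Proof. by move=> Ax Ay; rewrite -[y]invrK; apply: sf_div => //; exact: sfV. Qed.
Lemma sfX x n : A x -> A (x ^+ n).
Proof. by move=> Ax; elim: n => [|n IH]; rewrite ?expr0 ?exprS; [exact: sf1 | exact: sfM]. Qed.
Lemma sf_sum (I : Type) (r : seq I) (P : pred I) (F : I -> T) :
  (forall i, P i -> A (F i)) -> A (\sum_(i <- r | P i) F i).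
Proof. by move=> AF; elim/big_ind: _ => //; [exact: sf0 | exact: sfD]. Qed.
Lemma sf_nat n : A n%:R.
Proof. by elim: n => [|n IH]; [exact: sf0 | rewrite -natr1; apply: sfD => //; exact: sf1]. Qed.

Definition sfpred : {pred T} := mem A.
HB.instance Definition _ := GRing.isDivringClosed.Build T sfpred hA.
Record sfT := SfT { sfval : T; sfP : sfval \in sfpred }.
HB.instance Definition _ := [isSub for sfval].
HB.instance Definition _ := [Choice of sfT by <:].
HB.instance Definition _ := [SubChoice_isSubIntegralDomain of sfT by <:].
HB.instance Definition _ := [SubIntegralDomain_isSubField of sfT by <:].

(** Passes from a subfield given as a set to a field type with an embedding, where the library's
    polynomials and field extensions are available. *)
Lemma subfield_type : exists (U : fieldType) (v : {rmorphism U -> T}), range v = A.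
Proof.
exists sfT, (val : {rmorphism sfT -> T}); apply/seteqP; split=> x /=.
  by move=> [u _ <-]; apply/AP; exact: (sfP u).
by move=> /AP Ax; exists (SfT Ax).
Qed.

End SubfieldTheory.

Lemma polyOver_set (T : fieldType) (A : set T) (q : {poly T}) : A 0 ->
  (q \is a polyOver (mem A)) <-> (forall i, A q`_i).
Proof.
move=> A0; split=> [/allP h i|h]; last by apply/(all_nthP 0) => i _; rewrite in_setE.
have [lt|ge] := ltnP i (size q); last by rewrite nth_default.
by have := h _ (mem_nth 0 lt); rewrite in_setE.
Qed.

Lemma range_subfield (U T : fieldType) (v : {rmorphism U -> T}) : subfield (range v).
Proof.
split; first by rewrite in_setE; exists 1 => //; rewrite rmorph1.
  move=> _ _ /set_mem[x _ <-] /set_mem[y _ <-]; rewrite in_setE; exists (x - y) => //.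
  by rewrite rmorphB.
move=> _ _ /set_mem[x _ <-] /set_mem[y _ <-]; rewrite in_setE; exists (x / y) => //.
by rewrite fmorph_div.
Qed.

Lemma lift_poly (U T : fieldType) (v : {rmorphism U -> T}) (q : {poly T}) :
  q \is a polyOver (mem (range v)) -> exists q', q = map_poly v q'.
Proof.
move/(polyOver_set _ (sf0 (range_subfield v))) => h.
have [|g gP] := @choice nat U (fun i u => v u = q`_i).
  by move=> i; have [u _ <-] := h i; exists u.
exists (\poly_(i < size q) g i); apply/polyP => i; rewrite coef_map coef_poly.
case: ltnP => [_|le]; first exact: (esym (gP i)).
by rewrite nth_default //; exact/esym/rmorph0.
Qed.

Lemma map_polyOver (U T : fieldType) (v : {rmorphism U -> T}) q :
  map_poly v q \is a polyOver (mem (range v)).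
Proof.
by apply/(polyOver_set _ (sf0 (range_subfield v))) => i; rewrite coef_map; exists q`_i.
Qed.

(** Minimal polynomials. *)
Lemma minpoly_exists (U T : fieldType) (v : {rmorphism U -> T}) y :
  (exists2 q, q != 0 & root (map_poly v q) y) ->
  exists2 m, irreducible_poly m & forall g, root (map_poly v g) y <-> m %| g.
Proof.
move=> [q q0 qy].
have [_ [m [m0 my <-]] minm] := @ex_min_nat
   (fun n => exists m, [/\ m != 0, root (map_poly v m) y & size m = n])
   (ex_intro _ _ (ex_intro _ q (And3 q0 qy erefl))).
have dvd g : root (map_poly v g) y <-> m %| g.
  split=> [gy|/dvdpP[h ->]]; last by rewrite rmorphM rootM my orbT.
  rewrite /dvdp; apply: contraT => r0; have := ltn_modp g m; rewrite m0 ltnNge.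
  rewrite minm //; exists (g %% m); split=> //.
  move: gy; rewrite {1}(divp_eq g m) /root rmorphD rmorphM hornerD hornerM.
  by rewrite (eqP my) mulr0 add0r.
exists m => //; split.
  rewrite ltnNge; apply: contraL my => /size1_polyC E; move: m0; rewrite E polyC_eq0.
  by rewrite map_polyC rootC /= fmorph_eq0.
move=> g g1 /dvdpP[h mE]; have := my; rewrite mE rmorphM rootM => /orP[/dvd mh|/dvd mg].
  have h0 : h != 0 by apply: contraNneq m0 => h0; rewrite mE h0 mul0r.
  have g0 : g != 0 by apply: contraNneq m0 => g0; rewrite mE g0 mulr0.
  have := dvdp_leq h0 mh; rewrite mE size_mul //.
  have : (0 < size g)%N by rewrite size_poly_gt0.
  have : (0 < size h)%N by rewrite size_poly_gt0.
  by move: (size g) (size h) g1 => a b /eqP *; lia.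
by rewrite /eqp -mE mg mE dvdp_mull.
Qed.

Lemma all_roots (T : fieldType) (q : {poly T}) : q != 0 ->
  exists2 rs : seq T, uniq rs & forall z, root q z = (z \in rs).
Proof.
elim: {q}_.+1 {-2}q (ltnSn (size q)) => // n IH q; rewrite ltnS => qn q0.
have [[z qz]|noz] := pselect (exists z, root q z); last first.
  by exists [::] => // z; rewrite in_nil; apply/negP => qz; apply: noz; exists z.
have /factor_theorem[h qE] := qz.
have h0 : h != 0 by apply: contraNneq q0 => h0; rewrite qE h0 mul0r.
have [|rs urs rsP] := IH h _ h0.
  by move: qn; rewrite qE size_Mmonic ?monicXsubC // size_XsubC addn2.
have [zr|zr] := boolP (z \in rs).
  exists rs => // u; rewrite qE rootM root_XsubC rsP.
  by have [->|] := eqVneq u z; rewrite ?zr ?orbF.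
exists (z :: rs); first by rewrite /= zr.
by move=> u; rewrite qE rootM root_XsubC rsP inE orbC.
Qed.

Lemma polyOver_sub (T : fieldType) (A B : set T) (q : {poly T}) : A `<=` B ->
  q \is a polyOver (mem A) -> q \is a polyOver (mem B).
Proof. by move=> AB /allP h; apply/allP => x /h; rewrite !in_setE; exact: AB. Qed.

Lemma separable_over_sub (T : fieldType) (A B : set T) x : A `<=` B ->
  separable_over A x -> separable_over B x.
Proof. by move=> AB [q [qA qs qx]]; exists q; split=> //; exact: polyOver_sub qA. Qed.

Lemma algebraic_over_sub (T : fieldType) (A B : set T) x : A `<=` B ->
  algebraic_over A x -> algebraic_over B x.
Proof. by move=> AB [q [qA qs qx]]; exists q; split=> //; exact: polyOver_sub qA. Qed.

Lemma separable_algebraic (T : fieldType) (A : set T) x :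
  separable_over A x -> algebraic_over A x.
Proof. by move=> [q [? /separable_poly_neq0 ? ?]]; exists q. Qed.

Lemma separable_closure_sub (T : fieldType) (A B : set T) : A `<=` B -> subfield B ->
  separable_closure A -> separable_closure B.
Proof. by move=> AB sB [_ sc sA]; split=> // x; exact: separable_over_sub (sA x). Qed.

(** * Extension of isomorphisms and the Galois correspondence for the base field *)

(** Isomorphisms between subfields of [S] over [L], as graphs in the ring S x S. *)
Section AutExtension.
Variables (S : fieldType) (L : set S).
Hypothesis hS : separable_closure L.
Let hL : subfield L. Proof. by case: hS. Qed.

(** A subring of S x S containing the diagonal of L and single-valued above 0. Closure under
    inverses is not demanded, so unions of chains and adjunction of an element need only ring
    operations; [pgV] recovers it. *)
Definition pgraph (G : set (S * S)) : Prop :=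
  [/\ (forall u v, G u -> G v -> G (u.1 - v.1, u.2 - v.2)),
      (forall u v, G u -> G v -> G (u.1 * v.1, u.2 * v.2)),
      (forall a, L a -> G (a, a)) &
      (forall b, G (0, b) -> b = 0)].

Section Graph.
Variable G : set (S * S).
Hypothesis hG : pgraph G.

Lemma pg_diag a : L a -> G (a, a). Proof. by case: hG => _ _ h _ /h. Qed.
Lemma pg0 : G (0, 0). Proof. exact/pg_diag/(sf0 hL). Qed.
Lemma pg1 : G (1, 1). Proof. exact/pg_diag/(sf1 hL). Qed.
Lemma pgB a b c d : G (a, b) -> G (c, d) -> G (a - c, b - d).
Proof. by case: hG => h _ _ _ /h{}h /h. Qed.
Lemma pgM a b c d : G (a, b) -> G (c, d) -> G (a * c, b * d).
Proof. by case: hG => _ h _ _ /h{}h /h. Qed.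
Lemma pgD a b c d : G (a, b) -> G (c, d) -> G (a + c, b + d).
Proof.
move=> ab cd; rewrite -[c]opprK -[d]opprK; apply: pgB => //.
by rewrite -sub0r -[- d]sub0r; apply: pgB => //; exact: pg0.
Qed.
Lemma pg_fun a b b' : G (a, b) -> G (a, b') -> b = b'.
Proof.
move=> ab ab'; apply/eqP; rewrite -subr_eq0; apply/eqP; case: hG => _ _ _; apply.
by rewrite -(subrr a); exact: pgB.
Qed.

Lemma pg_horner (q : {poly S}) a b : q \is a polyOver (mem L) -> G (a, b) -> G (q.[a], q.[b]).
Proof.
move=> /(polyOver_set _ (sf0 hL)) qL ab; rewrite !horner_coef.
elim/big_rec2: _ => [|i x y _ xy]; first exact: pg0.
apply: pgD => //; apply: pgM; first exact: pg_diag.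
elim: (nat_of_ord i) => [|n IH]; first exact: pg1.
by rewrite !exprS; exact: pgM.
Qed.

(** An algebraic element has its inverse among its polynomials over L, and the same polynomial
    inverts the image b, because b is a root of the same equation as a. *)
Lemma pgV a b : G (a, b) -> G (a^-1, b^-1).
Proof.
move=> ab; have [a0|a0] := eqVneq a 0.
  have -> : b = 0 by apply: pg_fun ab _; rewrite a0; exact: pg0.
  by rewrite a0 invr0; exact: pg0.
have [U [v vL]] := subfield_type hL.
have [q [qL qs qa]] := let: And3 _ _ h := hS in h a.
move: qL; rewrite -vL => /lift_poly[q' qE].
have [|m [sm _] mP] := @minpoly_exists _ _ v a.
  exists q'; last by rewrite -qE.
  by move/separable_poly_neq0: qs; rewrite qE map_poly_eq0.
have ma : root (map_poly v m) a by apply/mP.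
have m0 : (map_poly v m)`_0 != 0.
  apply: contraTneq sm => m0; rewrite -leqNgt.
  have /factor_theorem[h mE] : root m 0 by rewrite /root horner_coef0 -(fmorph_eq0 v) -coef_map m0.
  have : root (map_poly v h) a.
    move: ma; rewrite mE rmorphM rootM => /orP[//|].
    by rewrite subr0 /= map_polyX /root hornerX (negPf a0).
  move/mP; have [h0 _|h0 dv] := eqVneq h 0; first by rewrite mE h0 mul0r size_poly0.
  by move: (dvdp_leq h0 dv); rewrite mE size_Mmonic ?monicXsubC // size_XsubC addn2 ltnn.
have hL' : map_poly v m \is a polyOver (mem L) by rewrite -vL; exact: map_polyOver.
move: (map_poly v m) ma m0 hL' => h ma m0 hL' {mP sm}.
(* From h = h1 X + h(0), a root x of h satisfies 1/x = - h1(x) / h(0). *)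
pose h1 := \poly_(i < size h) h`_i.+1.
have hE : h = h1 * 'X + (h`_0)%:P.
  apply/polyP => i; rewrite coefD coefMX coefC coef_poly; case: i => [|i]; first by rewrite !eqxx add0r.
  rewrite [_.+1 == 0%N]/= [_.+1.-1]/=.
  by rewrite addr0; case: ltnP => // le; rewrite nth_default // (leq_trans le) ?leqnSn.
have h1L : h1 \is a polyOver (mem L).
  apply/(polyOver_set _ (sf0 hL)) => i; rewrite coef_poly; case: ifP => _; last exact: sf0.
  by move/(polyOver_set _ (sf0 hL)): hL'; apply.
have inv x : h.[x] = 0 -> x^-1 = - (h`_0)^-1 * h1.[x].
  move=> hx; have : (h1 * 'X + (h`_0)%:P).[x] = 0 by rewrite -hE.
  rewrite hornerD hornerMX hornerC => /eqP; rewrite addr_eq0 => /eqP E.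
  have x0 : x != 0 by apply: contraNneq m0 => x0; move/eqP: E; rewrite x0 mulr0 eq_sym oppr_eq0.
  have -> : h1.[x] = - h`_0 / x by rewrite -E mulfK.
  by field; rewrite x0 m0.
have ha : h.[a] = 0 by apply/eqP.
have hb : h.[b] = 0.
  apply: pg_fun (pg_diag (sf0 hL)); rewrite -ha; exact: pg_horner.
rewrite (inv _ ha) (inv _ hb); apply: pgM; last exact: pg_horner.
apply: pg_diag; apply: (sfN hL); apply: (sfV hL).
by have /(polyOver_set _ (sf0 hL)) := hL'; apply.
Qed.

(** The extension step: [m] is the minimal polynomial of [y] over the domain of
    the graph and any root of its image can be taken as the image of [y]. *)
Lemma pgraph_step y : exists m : {poly S}, exists m' : {poly S},
  [/\ size m = size m' /\ (1 < size m)%N, separable_poly m', root m y,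
      (forall i, G (m`_i, m'`_i)) &
      forall y', root m' y' -> exists G', [/\ pgraph G', G `<=` G' & G' (y, y')]].
Proof.
pose D : set S := [set a | exists b, G (a, b)].
have hD : subfield D.
  split; first by rewrite in_setE; exists 1; exact: pg1.
    by move=> a c /set_mem[b ab] /set_mem[d cd]; rewrite in_setE; exists (b - d); exact: pgB.
  move=> a c /set_mem[b ab] /set_mem[d cd]; rewrite in_setE; exists (b / d).
  by apply: pgM => //; exact: pgV.
have [U [v vD]] := subfield_type hD.
have [u uP] : exists u : U -> S, forall a, G (v a, u a).
  have [|u uP] := @choice U S (fun a b => G (v a, b)).
    by move=> a; have : range v (v a); [exists a | rewrite vD].
  by exists u.
have [t tE] : exists t : {rmorphism U -> S}, t =1 u.
  apply: mk_rmorph; first by move=> a b; apply: pg_fun (uP _) _; rewrite rmorphB; exact: pgB.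
  split; first by apply: pg_fun (uP _) _; rewrite rmorph1; exact: pg1.
  by move=> a b; apply: pg_fun (uP _) _; rewrite rmorphM; exact: pgM.
have tG a : G (v a, t a) by rewrite tE.
have LD : L `<=` D by move=> a La; exists a; exact: pg_diag.
have [q [qL qs qy]] := let: And3 _ _ h := hS in h y.
have : q \is a polyOver (mem (range v)) by rewrite vD; exact: polyOver_sub qL.
move=> /lift_poly[q' qE].
have q's : separable_poly q' by move: qs; rewrite qE separable_map.
have [|m mi mP] := @minpoly_exists _ _ v y.
  by exists q'; rewrite -?qE //; exact: separable_poly_neq0.
have my : root (map_poly v m) y by apply/mP.
exists (map_poly v m), (map_poly t m); split=> //.
- by split; rewrite !size_map_poly //; case: mi.
- rewrite separable_map; apply: dvdp_separable q's; apply/mP; by rewrite -qE.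
- by move=> i; rewrite !coef_map; exact: tG.
move=> y' my'.
exists [set w | exists g : {poly U}, w = ((map_poly v g).[y], (map_poly t g).[y'])].
split; first split.
- move=> _ _ [g ->] [h ->] /=; exists (g - h); by rewrite !rmorphB !hornerD !hornerN.
- move=> _ _ [g ->] [h ->] /=; exists (g * h); by rewrite !rmorphM !hornerM.
- move=> a La; have [c _ ca] : range v a by rewrite vD; exact: LD.
  exists c%:P; rewrite !map_polyC !hornerC /= ca.
  by congr pair; apply: pg_fun (pg_diag La) _; rewrite -{1}ca.
- move=> b [g [/esym/eqP gy ->]]; move: gy; rewrite -/(root _ _) => /mP/dvdpP[h ->].
  by rewrite rmorphM hornerM (eqP my') mulr0.
- move=> [a b] ab; have [c _ ca] : range v a by rewrite vD; exists b.
  exists c%:P; rewrite !map_polyC !hornerC /= ca; congr pair.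
  by apply: pg_fun ab _; rewrite -ca.
- by exists 'X; rewrite !map_polyX !hornerX.
Qed.

End Graph.

(** A maximal graph is defined everywhere: the image of the minimal polynomial of a new element is
    separable, hence has a root in S, and [pgraph_step] would extend the graph. *)
Lemma pgraph_total G : pgraph G ->
  exists2 s, Gal L s & forall a b, G (a, b) -> s a = b.
Proof.
move=> hG; have [|M [hM GM maxM]] := @Zorn_above _ pgraph G hG.
  move=> C CP [X0 CX0] Ctot.
  have two u v : (\bigcup_(X in C) X) u -> (\bigcup_(X in C) X) v ->
      exists X, [/\ C X, X u & X v].
    move=> [X CX Xu] [Y CY Yv]; have [XY|YX] := Ctot _ _ CX CY.
      by exists Y; split=> //; exact: XY.
    by exists X; split=> //; exact: YX.
  split.
  - move=> u v /two h /h[X [CX Xu Xv]]; exists X => //.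
    by case: (CP _ CX) => + _ _ _; apply.
  - move=> u v /two h /h[X [CX Xu Xv]]; exists X => //.
    by case: (CP _ CX) => _ + _ _; apply.
  - by move=> a La; exists X0 => //; case: (CP _ CX0) => _ _ + _; apply.
  - by move=> b [X CX]; case: (CP _ CX) => _ _ _ h /h.
have sc : separably_closed S by case: hS.
have tot y : exists y', M (y, y').
  have [m [m' [[sm m1] m's _ _ step]]] := pgraph_step hM y.
  have [|y' my'] := sc m' m's; first by rewrite -sm.
  have [G' [hG' MG' Gy]] := step y' my'; exists y'.
  by rewrite -(maxM G' hG' MG').
have [t tM] := @choice S S (fun a b => M (a, b)) tot.
have tB : zmod_morphism t by move=> a b; apply: (pg_fun hM (tM _)); exact: (pgB hM).
have tMm : monoid_morphism t.
  split; first by apply: (pg_fun hM (tM _)); exact: (pg1 hM).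
  by move=> a b; apply: (pg_fun hM (tM _)); exact: (pgM hM).
have tL a : L a -> t a = a by move=> La; apply: (pg_fun hM (tM _)); exact: (pg_diag hM).
have [t' tE] := mk_rmorph tB tMm.
have ti : injective t by move=> a b; rewrite -!tE => /fmorph_inj.
(* An injective map fixing L permutes the finite set of roots of a polynomial over L. *)
have tsurj z : exists y, t y = z.
  have [q [qL qs qz]] := let: And3 _ _ h := hS in h z.
  have [rs urs rsP] := all_roots (separable_poly_neq0 qs).
  have sub : {subset map t rs <= rs}.
    move=> _ /mapP[x xr ->]; rewrite -rsP; apply/eqP; apply: (pg_fun hM (a := q.[x])).
      by exact: (pg_horner hM).
    by move: xr; rewrite -rsP => /eqP ->; exact: (pg0 hM).
  have [_ eqm] := uniq_min_size (etrans (map_inj_uniq ti rs) urs) sub (eq_leq (esym (size_map t rs))).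
  by move: qz; rewrite rsP -eqm => /mapP[y _ ->]; exists y.
have tb : bijective t.
  have [g gP] := @choice S S (fun z y => t y = z) tsurj.
  by exists g => // x; apply: ti.
exists (Aut (And3 tB tMm tb)) => // a b ab; exact: (pg_fun hM (tM a) (GM _ ab)).
Qed.

(** The fixed field of the absolute Galois group of [L] is [L]. *)
Lemma galois_moves x : ~ L x -> exists2 s, Gal L s & s x <> x.
Proof.
move=> nLx; pose G : set (S * S) := [set u | L u.1 /\ u.2 = u.1].
have hG : pgraph G.
  split.
  - by move=> [a b] [c d] [/= La ->] [/= Lc ->]; split=> //=; exact: (sfB hL).
  - by move=> [a b] [c d] [/= La ->] [/= Lc ->]; split=> //=; exact: (sfM hL).
  - by [].
  - by move=> b [].
have [m [m' [[sm m1] m's mx mG step]]] := pgraph_step hG x.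
have mm' : m' = m by apply/polyP => i; have [] := mG i.
have mL i : L m`_i by have [] := mG i.
rewrite mm' in m's step; have /factor_theorem[h mE] := mx.
have h0 : h != 0 by apply: contraNneq (separable_poly_neq0 m's) => h0; rewrite mE h0 mul0r.
(* [h] is the minimal polynomial of x divided by X - x. If it is constant, then x lies in L;
   otherwise any root of it is a conjugate of x, distinct from x by separability. *)
have [h1|h1] := leqP (size h) 1.
  exfalso; apply: nLx; have [c hc] : exists c, h = c%:P by exists h`_0; exact: size1_polyC.
  have c0 : c != 0 by move: h0; rewrite hc polyC_eq0.
  have := mL 0%N; have := mL 1%N; rewrite mE hc !coefCM !coefB !coefX !coefC /= subr0 mulr1 sub0r.
  move=> Lc Lcx; have -> : x = - (c * - x / c) by field.
  by apply: (sfN hL); exact: (sf_div hL).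
have hs : separable_poly h by apply: dvdp_separable m's; rewrite mE dvdp_mulr.
have sc : separably_closed S by case: hS.
have [x' hx'] := sc h hs h1.
have [|G' [hG' _ Gx]] := step x'; first by rewrite mE rootM hx'.
have [s sL sG] := pgraph_total hG'; exists s => //; rewrite (sG _ _ Gx) => xx.
move: m's; rewrite mE -xx separable_mul => /and3P[_ _].
by rewrite coprimep_XsubC hx'.
Qed.

End AutExtension.

(** * Finite and separable extensions inside an ambient field *)

Section Embed.
Variable T : fieldType.

Lemma ext_embed_step (F0 : fieldType) (i : {rmorphism F0 -> T}) (L : fieldExtType F0)
    (j : {rmorphism L -> T}) x : (forall a, j a%:A = i a) ->
  (exists2 q, q != 0 & root (map_poly j q) x) ->
  exists (L' : fieldExtType F0) (j' : {rmorphism L' -> T}),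
    [/\ forall a, j' a%:A = i a, range j `<=` range j' & range j' x].
Proof.
move=> jA ax; have [m mi mP] := minpoly_exists ax.
have m0 : m != 0 by case: mi => + _; apply: contraTneq => ->; rewrite size_poly0.
have mx : root (map_poly j m) x by apply/mP.
pose L2 : fieldExtType L := SubFieldExtType mx mi.
pose j2 : {rmorphism L2 -> T} := (@subfx_inj _ _ j x m : {rmorphism subFExtend j x m -> T}).
have j2A a : j2 a%:A = j a by exact: subfx_inj_base.
exists (baseFieldType L2 : fieldExtType F0), (j2 : {rmorphism baseFieldType L2 -> T}); split.
- by move=> a; rewrite -jA -j2A.
- by move=> _ [a _ <-]; exists (a%:A : L2) => //; exact: j2A.
- by exists (subfx_root j x m) => //; exact: subfx_inj_root.
Qed.

(** Places finitely many algebraic elements in the image of one abstract finite extension, to which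
    the library's theory of [fieldExtType] applies. *)
Lemma finite_ext_embed (F0 : fieldType) (i : {rmorphism F0 -> T}) (s : seq T) :
  (forall x, x \in s -> exists2 q, q != 0 & root (map_poly i q) x) ->
  exists (L : fieldExtType F0) (j : {rmorphism L -> T}),
    (forall a, j a%:A = i a) /\ forall x, x \in s -> range j x.
Proof.
elim: s => [|x s IH] sP.
  exists (F0^o : fieldExtType F0), (i : {rmorphism F0^o -> T}); split=> // a.
  by congr (i _); rewrite /GRing.scale /= mulr1.
have [|L [j [jA js]]] := IH; first by move=> y ys; apply: sP; rewrite inE ys orbT.
have [|L' [j' [jA' jj' j'x]]] := @ext_embed_step _ i L j x jA.
  have [q q0 qx] := sP x (mem_head _ _); exists (map_poly (in_alg L) q).
    by rewrite map_poly_eq0.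
  by rewrite -map_poly_comp (eq_map_poly jA).
by exists L', j'; split=> // y; rewrite inE => /orP[/eqP -> //|/js/jj'].
Qed.

Lemma separable_embed (F0 : fieldType) (i : {rmorphism F0 -> T}) (L : fieldExtType F0)
    (j : {rmorphism L -> T}) z : (forall a, j a%:A = i a) ->
  separable_over (range i) (j z) <-> separable_element 1%AS z.
Proof.
move=> jA; have jE q : map_poly j (map_poly (in_alg L) q) = map_poly i q.
  by rewrite -map_poly_comp; exact: eq_map_poly.
split.
  move=> [_ [/lift_poly[q ->] qs qz]]; apply/separable_elementP.
  exists (map_poly (in_alg L) q); split; first exact: alg_polyOver.
    by move: qz; rewrite -jE; rewrite !/(root _ _) horner_map fmorph_eq0.
  by move: qs; rewrite !separable_map.
move=> /separable_elementP[f [/polyOver1P[q ->] fz fs]]; exists (map_poly i q); split.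
- exact: map_polyOver.
- by move: fs; rewrite !separable_map.
- by rewrite -jE /root horner_map (eqP fz) rmorph0.
Qed.

Lemma sep_alg (F0 : fieldType) (i : {rmorphism F0 -> T}) x :
  separable_over (range i) x -> exists2 q, q != 0 & root (map_poly i q) x.
Proof.
move=> [_ [/lift_poly[q ->] qs qz]]; exists q => //.
by move/separable_poly_neq0: qs; rewrite map_poly_eq0.
Qed.

Variable A : set T.
Hypothesis hA : subfield A.

Lemma separable_base x : A x -> separable_over A x.
Proof.
move=> Ax; exists ('X - x%:P); split; last by rewrite root_XsubC.
  apply/(polyOver_set _ (sf0 hA)) => i; rewrite coefB coefX coefC.
  by apply: (sfB hA); case: eqP => // _; [exact: (sf1 hA) | exact: (sf0 hA) | exact: (sf0 hA)].
by have := separable_prod_XsubC [:: x]; rewrite big_seq1.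
Qed.

Lemma separable_subfield : subfield [set x | separable_over A x].
Proof.
have [U [v vA]] := subfield_type hA.
have pair x y : separable_over A x -> separable_over A y ->
    exists (L : fieldExtType U) (j : {rmorphism L -> T}) x' y' (E : {subfield L}),
      [/\ x = j x', y = j y', x' \in E, y' \in E & forall z, z \in E -> separable_over A (j z)].
  rewrite -vA => sx sy; have [|L [j [jA js]]] := @finite_ext_embed _ v [:: x; y].
    by move=> z; rewrite !inE => /orP[] /eqP ->; exact: sep_alg.
  have [x' _ xE] : range j x by apply: js; rewrite inE eqxx.
  have [y' _ yE] : range j y by apply: js; rewrite !inE eqxx orbT.
  exists L, j, x', y', <<1%AS & [:: x'; y']>>%AS; split=> //.
  - by apply: seqv_sub_adjoin; rewrite inE eqxx.
  - by apply: seqv_sub_adjoin; rewrite !inE eqxx orbT.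
  move=> z zE; apply/(separable_embed _ jA).
  have /separableP : separable 1%AS <<1%AS & [:: x'; y']>>%AS; last by apply.
  apply: separable_Fadjoin_seq; rewrite /= andbT; apply/andP.
  by split; apply/(separable_embed _ jA); rewrite ?xE ?yE.
split.
- by rewrite in_setE; exact/separable_base/(sf1 hA).
- move=> x y /set_mem sx /set_mem sy; rewrite in_setE /=.
  have [L [j [x' [y' [E [-> -> xE yE EP]]]]]] := pair _ _ sx sy.
  by rewrite -rmorphB; apply: EP; exact: rpredB.
- move=> x y /set_mem sx /set_mem sy; rewrite in_setE /=.
  have [L [j [x' [y' [E [-> -> xE yE EP]]]]]] := pair _ _ sx sy.
  by rewrite -fmorph_div; apply: EP; exact: rpred_div.
Qed.

(** The coefficients of a separable equation of y generate a finite separable extension of A, and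
    separability is transitive for finite extensions. *)
Lemma separable_over_trans y :
  separable_over [set x | separable_over A x] y -> separable_over A y.
Proof.
have [U [v vA]] := subfield_type hA => -[q [qA qs qy]].
have cq x : x \in (q : seq T) -> separable_over (range v) x.
  by move=> xq; move/allP/(_ _ xq): qA; rewrite in_setE vA.
have [|L1 [j1 [j1A j1s]]] := @finite_ext_embed _ v q.
  by move=> z /cq; exact: sep_alg.
have [|L [j [jA j1j jy]]] := @ext_embed_step _ v L1 j1 y j1A.
  have [|q1 qE] := @lift_poly _ _ j1 q; last first.
    exists q1; last by rewrite -qE.
    by move/separable_poly_neq0: qs; rewrite qE map_poly_eq0.
  by apply/allP => x /j1s xq; rewrite in_setE.
have js x : x \in (q : seq T) -> range j x by move=> /j1s/j1j.
have [y' _ yE] := jy.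
have [cs csE] : exists cs : seq L, map j cs = q.
  have : {subset (q : seq T) <= [pred x | `[< range j x >]]}.
    by move=> x xq; apply/asboolP; exact: js.
  elim: (q : seq T) => [|x s IH] sub; first by exists [::].
  have [|cs <-] := IH; first by move=> z zs; apply: (sub z); rewrite in_cons zs orbT.
  have /asboolP[c _ <-] := sub x (mem_head _ _); by exists (c :: cs).
pose E := <<1%AS & cs>>%AS.
have sE : separable 1%AS E.
  apply: separable_Fadjoin_seq; apply/allP => c cin; apply/(separable_embed _ jA).
  by apply: cq; rewrite -csE map_f.
have yE' : separable_element E y'.
  apply/separable_elementP; exists (Poly cs).
  have qE : map_poly j (Poly cs) = q.
    apply/polyP => i; rewrite coef_map coef_Poly -[in RHS]csE.
    have [lt|ge] := ltnP i (size cs); first by rewrite (nth_map 0).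
    by rewrite !nth_default ?size_map //; exact: rmorph0.
  split.
  - apply/polyOverP => i; rewrite coef_Poly; have [lt|ge] := ltnP i (size cs).
      by apply: seqv_sub_adjoin; exact: mem_nth.
    by rewrite nth_default ?rpred0.
  - by move: qy; rewrite -qE -yE /root horner_map fmorph_eq0.
  - by move: qs; rewrite -qE separable_map.
rewrite -yE -vA; apply/(separable_embed _ jA).
have : separable 1%AS <<E; y'>>%AS.
  by apply: separable_trans sE _; rewrite -adjoin_separable_eq.
by move/separableP; apply; exact: memv_adjoin.
Qed.

Lemma adjoin_finite (s : seq T) : (forall x, x \in s -> algebraic_over A x) ->
  exists n (e : 'I_n -> T), forall x, adjoin A [set` s] x ->
    exists2 a : 'I_n -> T, (forall i, A (a i)) & x = \sum_i a i * e i.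
Proof.
move=> sA; have [U [v vA]] := subfield_type hA.
have [|L [j [jA js]]] := @finite_ext_embed _ v s.
  move=> x /sA[]; rewrite -vA => _ [/lift_poly[q ->] q0 qx]; exists q => //.
  by move: q0; rewrite map_poly_eq0.
exists (\dim {:L}), (fun i => j (vbasis {:L})`_i) => x.
case/(_ (range j)).
- exact: range_subfield.
- by rewrite -vA => _ [a _ <-]; exists a%:A.
- by move=> y /= /js.
move=> z _ <-; exists (fun i => v (coord (vbasis {:L}) i z)).
  by move=> i; rewrite -vA; eexists.
rewrite {1}(coord_vbasis (memvf z)) rmorph_sum; apply: eq_bigr => i _.
by rewrite -jA -rmorphM mulr_algl.
Qed.

End Embed.

(** * Adjunction, automorphisms, finiteness of orbits *)

Section Adjoin.
Variable T : fieldType.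
Implicit Types A B L : set T.

Lemma adjoin_subfield A B : subfield (adjoin A B).
Proof.
split; first by rewrite in_setE => L hL _ _; exact: sf1.
  move=> x y /set_mem hx /set_mem hy; rewrite in_setE => L hL AL BL.
  by apply: sfB => //; [exact: hx | exact: hy].
move=> x y /set_mem hx /set_mem hy; rewrite in_setE => L hL AL BL.
by apply: sf_div => //; [exact: hx | exact: hy].
Qed.

Lemma sub_adjoin_l A B : A `<=` adjoin A B.
Proof. by move=> x Ax L _ AL _; exact: AL. Qed.

Lemma sub_adjoin_r A B : B `<=` adjoin A B.
Proof. by move=> x Bx L _ _ BL; exact: BL. Qed.

Lemma adjoin_min A B L : subfield L -> A `<=` L -> B `<=` L -> adjoin A B `<=` L.
Proof. by move=> hL AL BL x; apply. Qed.

Lemma adjoin_mono A B A' B' : A `<=` A' -> B `<=` B' -> adjoin A B `<=` adjoin A' B'.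
Proof.
move=> AA BB; apply: adjoin_min; first exact: adjoin_subfield.
  exact: subset_trans AA (@sub_adjoin_l _ _).
exact: subset_trans BB (@sub_adjoin_r _ _).
Qed.

End Adjoin.

Section AutRing.
Variable K : fieldType.

HB.instance Definition _ (s : aut K) := GRing.isZmodMorphism.Build K K (aut_fun s)
  (let: And3 h _ _ := autP s in h).
HB.instance Definition _ (s : aut K) := GRing.isMonoidMorphism.Build K K (aut_fun s)
  (let: And3 _ h _ := autP s in h).

Implicit Types s t : aut K.

Lemma autM s t x : (s * t)%g x = s (t x). Proof. by []. Qed.
Lemma aut1 x : (1%g : aut K) x = x. Proof. by []. Qed.
Lemma autVK s x : (s^-1)%g (s x) = x. Proof. exact: aut_funK. Qed.
Lemma autKV s x : s ((s^-1)%g x) = x. Proof. exact: aut_inv_funK. Qed.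

Variable L : set K.

Lemma Gal1 : Gal L 1%g. Proof. by []. Qed.
Lemma GalM s t : Gal L s -> Gal L t -> Gal L (s * t)%g.
Proof. by move=> sL tL x Lx; rewrite autM tL // sL. Qed.
Lemma GalV s : Gal L s -> Gal L (s^-1)%g.
Proof. by move=> sL x Lx; rewrite -{1}(sL x Lx) autVK. Qed.

End AutRing.

Lemma Gal_sub (K : fieldType) (L L' : set K) s : L `<=` L' -> Gal L' s -> Gal L s.
Proof. by move=> LL sL x /LL; exact: sL. Qed.

Section FiniteOrbits.
Variables (S : fieldType) (K : set S).
Hypothesis hS : separable_closure K.

Lemma Gal_root q x s : q \is a polyOver (mem K) -> Gal K s -> root q x -> root q (s x).
Proof.
move=> qK sK qx; have <- : map_poly s q = q.
  apply/polyP => i; rewrite coef_map /= sK //.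
  by have /(polyOver_set _ (sf0 (let: And3 h _ _ := hS in h))) := qK; apply.
by rewrite /root horner_map (eqP qx) rmorph0.
Qed.

Lemma conj_list x : exists rs : seq S, forall s, Gal K s -> s x \in rs.
Proof.
have [q [qK qs qx]] := let: And3 _ _ h := hS in h x.
have [rs _ rsP] := all_roots (separable_poly_neq0 qs).
by exists rs => s sK; rewrite -rsP; exact: Gal_root.
Qed.

Lemma conj_seq (e : seq S) : exists rs : seq S,
  forall s x, Gal K s -> x \in e -> s x \in rs.
Proof.
elim: e => [|y e [rs rsP]]; first by exists [::].
have [rs' rsP'] := conj_list y; exists (rs' ++ rs) => s x sK.
by rewrite inE mem_cat => /orP[/eqP ->|/(rsP s x sK) ->]; rewrite ?rsP' ?orbT.
Qed.

(** Every element has finitely many conjugates, so a finite list has finitely many images, and h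
    factors through the image of e. *)
Lemma finite_values (V : eqType) (h : aut S -> V) (G : set (aut S)) (e : seq S) :
  G `<=` Gal K ->
  (forall s t, G s -> G t -> {in e, s =1 t} -> h s = h t) ->
  exists vs : seq V, forall s, G s -> h s \in vs.
Proof.
move=> GK hh; have [ls lsP] : exists ls : seq (seq S), forall s, G s -> map s e \in ls.
  elim: (e) => [|x e' [ls lsP]]; first by exists [:: [::]] => s _; rewrite inE.
  have [rs rsP] := conj_list x.
  exists [seq y :: w | y <- rs, w <- ls] => s Gs.
  by apply/allpairsP; exists (s x, map s e'); split; rewrite ?lsP ?rsP //; exact: GK.
pose rep w : aut S := xget 1%g [set s | G s /\ map s e = w].
exists [seq h (rep w) | w <- ls] => s Gs.
apply/mapP; exists (map s e); first exact: lsP.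
rewrite /rep; case: xgetP => [t _ [Gt te]|/(_ s) /=]; last by case.
apply: hh => // x xe; move/eqP: te; rewrite eq_sym => /eqP/eq_in_map; exact.
Qed.

End FiniteOrbits.

(** * Towers of finite l-quotients *)

(** A Galois extension [M / K] whose group is the closure of a tower of finite
    [l]-quotients, given by their quotient maps. *)
Record tower (l : nat) (S : fieldType) (K M : set S) := Tower {
  twX : nat -> finZmodType;
  tw : forall m, aut S -> twX m;
  tw_closure : separable_closure K;
  tw_subfield : subfield M;
  tw_sub : K `<=` M;
  tw_norm : forall s x, Gal K s -> M x -> M (s x);
  tw_pnat : forall m, l.-nat #|{: twX m}|;
  twM : forall m s t, Gal K s -> Gal K t -> tw m (s * t)%g = tw m s + tw m t;
  tw_le : forall m n s, (m <= n)%N -> Gal K s -> tw n s = 0 -> tw m s = 0;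
  twG : forall m s, Gal M s -> tw m s = 0;
  tw_fix : forall x, M x -> exists m, forall s, Gal K s -> tw m s = 0 -> s x = x;
  tw_open : forall m, exists2 e : seq S, {in e, forall x, M x} &
    forall s, Gal K s -> {in e, forall x, s x = x} -> tw m s = 0 }.

Section Tower.
Variables (l : nat) (S : fieldType) (K M : set S) (T : tower l K M).
Local Notation tw := (tw T).
Let hS := tw_closure T.
Let hM := tw_subfield T.

Lemma GalMK s : Gal M s -> Gal K s. Proof. exact: (Gal_sub (tw_sub T)). Qed.

Lemma tw1 m : tw m 1%g = 0.
Proof. exact: twG. Qed.

Lemma twV m s : Gal K s -> tw m (s^-1)%g = - tw m s.
Proof.
move=> sK; apply/eqP; rewrite -subr_eq0 opprK -twM ?mulVg ?tw1 //; exact: GalV.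
Qed.

(** Representatives of G modulo the kernel of level m. Their number is the order of a subgroup of
    the level, hence a power of l, and summing over them a function that is invariant on the right
    under the kernel gives a translation-invariant result. This is the source of every average taken
    below. *)
Lemma tower_transversal m (G : set (aut S)) : G `<=` Gal K -> G 1%g ->
  (forall s t, G s -> G t -> G (s * t)%g) -> (forall s, G s -> G (s^-1)%g) ->
  exists ts : seq (aut S), [/\ l.-nat (size ts), (forall t, t \in ts -> G t) &
    forall (V : zmodType) (h : aut S -> V),
      (forall s u, G s -> G u -> tw m u = 0 -> h (s * u)%g = h s) ->
      forall s, G s -> \sum_(t <- ts) h (s * t)%g = \sum_(t <- ts) h t].
Proof.
move=> GK G1 GM GV; pose D := [set x : twX T m | `[< exists2 s, G s & tw m s = x >]]%SET.
have DP x : reflect (exists2 s, G s & tw m s = x) (x \in D).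
  by rewrite inE; exact: asboolP.
pose rep x : aut S := xget 1%g [set s | G s /\ tw m s = x].
have repP x : x \in D -> G (rep x) /\ tw m (rep x) = x.
  by move=> /DP[s Gs sx]; rewrite /rep; case: xgetP => [t _ //|/(_ s)[]].
have Dgrp : group_set D.
  apply/group_setP; split; first by apply/DP; exists 1%g => //; rewrite tw1.
  move=> x y /DP[s Gs <-] /DP[t Gt <-]; apply/DP; exists (s * t)%g; first exact: GM.
  by rewrite twM //; exact: GK.
exists [seq rep x | x <- enum D]; split.
- rewrite size_map -cardE; apply: pnat_dvd (tw_pnat T m).
  by rewrite -cardsT; exact: (cardSg (finset.subsetT (Group Dgrp))).
- by move=> t /mapP[x]; rewrite mem_enum => /repP[Gt _] ->.
move=> V h hinv s Gs; rewrite !big_map !big_enum /=.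
have sD x : (tw m s + x \in D) = (x \in D).
  apply/DP/DP => -[t Gt tx].
    exists (s^-1 * t)%g; first by apply: GM => //; exact: GV.
    by rewrite twM ?twV ?tx ?addKr //; [exact: GK | exact/GalV/GK | exact: GK].
  by exists (s * t)%g; [exact: GM | rewrite twM ?tx //; exact: GK].
rewrite [RHS](reindex_inj (addrI (tw m s))) /= (eq_bigl _ _ sD).
apply: eq_bigr => x xD; have [Gx twx] := repP x xD.
have [Gsx twsx] : G (rep (tw m s + x)) /\ tw m (rep (tw m s + x)) = tw m s + x.
  by apply: repP; rewrite sD.
rewrite -(mulKVg (rep (tw m s + x)) (s * rep x)%g) hinv //.
  by apply: (GM _ _ (GV _ _)) => //; exact: (GM _ _).
have [? ? ?] := And3 (GK _ Gs) (GK _ Gx) (GK _ Gsx).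
by rewrite !twM ?twV ?twx ?twsx ?addNr //; [exact: GalV | exact: GalM].
Qed.

Lemma adjoin_fix (e : seq S) z : adjoin M [set` e] z ->
  exists m, forall s, Gal K s -> tw m s = 0 -> {in e, forall x, s x = x} -> s z = z.
Proof.
have up m n s : Gal K s -> tw (maxn m n) s = 0 -> tw m s = 0 /\ tw n s = 0.
  by move=> sK tw0; split; apply: tw_le tw0; rewrite ?leq_maxl ?leq_maxr.
case/(_ [set z | exists m, forall s, Gal K s -> tw m s = 0 -> {in e, forall x, s x = x} -> s z = z]).
- split; first by rewrite in_setE; exists 0%N => s *; rewrite rmorph1.
    move=> x y /set_mem[m hm] /set_mem[n hn]; rewrite in_setE; exists (maxn m n) => s sK tw0 se.
    by have [? ?] := up _ _ _ sK tw0; rewrite rmorphB /= hm ?hn.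
  move=> x y /set_mem[m hm] /set_mem[n hn]; rewrite in_setE; exists (maxn m n) => s sK tw0 se.
  by have [? ?] := up _ _ _ sK tw0; rewrite fmorph_div /= hm ?hn.
- by move=> x /(tw_fix T)[m hm]; exists m => s sK tw0 _; exact: hm.
- by move=> x xe; exists 0%N => s _ _; exact.
by move=> m hm; exists m.
Qed.

(** [Gal M] is the intersection of the kernels of the levels; by compactness, a sufficiently deep
    kernel moves a given finite list only in ways in which [Gal M] does. The induction on the list
    replaces compactness by the finite orbit of each new element. *)
Lemma tower_lift (e : seq S) : exists m, forall s, Gal K s -> tw m s = 0 ->
  exists2 g, Gal M g & {in e, g =1 s}.
Proof.
elim: e => [|x e [m1 IH]]; first by exists 0%N => s _ _; exists 1%g.
pose N := adjoin M [set` e].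
have hN : subfield N by exact: adjoin_subfield.
have KN : K `<=` N by apply: subset_trans (tw_sub T) _; exact: sub_adjoin_l.
have hSN := separable_closure_sub KN hN hS.
have [rs0 rs0P] := conj_list hSN x.
(* The orbit of x over N = M(e). Its polynomial [f] below has coefficients in N, which a deep level
   fixes as soon as e is fixed. *)
pose rs := [seq y <- undup rs0 | `[< exists2 g, Gal N g & g x = y >]].
have urs : uniq rs by rewrite filter_uniq ?undup_uniq.
have rsP y : reflect (exists2 g, Gal N g & g x = y) (y \in rs).
  apply: (iffP idP); first by rewrite mem_filter => /andP[/asboolP].
  by move=> [g gN gx]; rewrite mem_filter mem_undup -gx rs0P // andbT; apply/asboolP; exists g.
pose f := \prod_(y <- rs) ('X - y%:P).
have fN i : N f`_i.
  apply: contrapT => /(galois_moves hSN)[g gN]; apply.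
  rewrite -coef_map; congr ((polyseq _)`_i); rewrite /f rmorph_prod /=.
  under eq_bigr do rewrite rmorphB /= map_polyX map_polyC /=.
  have sub : {subset map g rs <= rs}.
    move=> _ /mapP[_ /rsP[h hN' <-] ->]; apply/rsP; exists (g * h)%g => //; exact: GalM.
  have ug : uniq (map g rs) by rewrite map_inj_uniq //; exact: fmorph_inj.
  have [_ eqm] := uniq_min_size ug sub (eq_leq (esym (size_map g rs))).
  have pe : perm_eq (map g rs) rs by exact: uniq_perm.
  by rewrite -[RHS](perm_big _ pe) big_map.
have [m2 m2P] : exists m, forall s, Gal K s -> tw m s = 0 -> {in e, forall x, s x = x} ->
    forall i, s f`_i = f`_i.
  have : forall n, exists m, forall s, Gal K s -> tw m s = 0 -> {in e, forall x, s x = x} ->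
      forall i, (i < n)%N -> s f`_i = f`_i.
    elim=> [|n [m hm]]; first by exists 0%N.
    have [m' hm'] := adjoin_fix (fN n); exists (maxn m m') => s sK tw0 se i.
    rewrite ltnS leq_eqVlt => /orP[/eqP ->|lt].
      by apply: hm' => //; apply: tw_le tw0; rewrite ?leq_maxr.
    by apply: hm => //; apply: tw_le tw0; rewrite ?leq_maxl.
  move=> /(_ (size f))[m hm]; exists m => s sK tw0 se i.
  by have [lt|ge] := ltnP i (size f); [exact: hm | rewrite nth_default ?rmorph0].
exists (maxn m1 m2) => s sK tw0.
have [|g1 g1M g1e] := IH s sK; first by apply: tw_le tw0; rewrite ?leq_maxl.
have g1K := GalMK g1M.
(* After correction by g1 the automorphism fixes e and the coefficients of f, so it sends x to a
   conjugate over N, which some g2 fixing N also reaches. *)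
pose s1 := (g1^-1 * s)%g; have s1K : Gal K s1 by apply: GalM => //; exact: GalV.
have s1e : {in e, forall x, s1 x = x} by move=> y ye; rewrite /s1 autM -g1e ?autVK.
have tw1 : tw m2 s1 = 0.
  rewrite /s1 twM ?twV ?(twG T m2 g1M) ?oppr0 ?add0r //; last exact: GalV.
  by apply: tw_le tw0; rewrite ?leq_maxr.
have /rsP[g2 g2N g2x] : s1 x \in rs.
  rewrite -root_prod_XsubC -/f; have <- : map_poly s1 f = f.
    by apply/polyP => i; rewrite coef_map; exact: m2P.
  rewrite /root horner_map fmorph_eq0 -/(root _ _) root_prod_XsubC.
  by apply/rsP; exists 1%g.
have g2M : Gal M g2 by apply: Gal_sub g2N; exact: sub_adjoin_l.
exists (g1 * g2)%g; first exact: GalM.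
move=> y; rewrite inE autM => /orP[/eqP ->|ye].
  by rewrite g2x /s1 autM autKV.
by rewrite g2N ?g1e //; exact: sub_adjoin_r.
Qed.

End Tower.

(** * Inflation and corestriction along a tower *)

Section TowerCohomology.
Variables (l : nat) (S : fieldType) (K M : set S) (T : tower l K M).
Local Notation tw := (tw T).
Let hS := tw_closure T.
Variables (V : zmodType) (act : aut S -> V -> V).
Hypothesis actB : forall s u v, Gal K s -> act s (u - v) = act s u - act s v.
Hypothesis actM : forall s t v, Gal K s -> Gal K t -> act (s * t)%g v = act s (act t v).
Hypothesis act1 : forall v, act 1%g v = v.

Lemma act0 s : Gal K s -> act s 0 = 0.
Proof. by move=> sK; rewrite -(subrr 0) actB // !subrr. Qed.
Lemma actN s v : Gal K s -> act s (- v) = - act s v.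
Proof. by move=> sK; rewrite -sub0r actB // act0 // sub0r. Qed.
Lemma actD s u v : Gal K s -> act s (u + v) = act s u + act s v.
Proof. by move=> sK; rewrite -{1}[v]opprK actB // actN // opprK. Qed.
Lemma act_sum s (I : Type) (r : seq I) (F : I -> V) : Gal K s ->
  act s (\sum_(i <- r) F i) = \sum_(i <- r) act s (F i).
Proof.
by move=> sK; elim: r => [|i r IH]; rewrite ?big_nil ?big_cons ?act0 // actD // IH.
Qed.
Lemma actMn s v n : Gal K s -> act s (v *+ n) = act s v *+ n.
Proof. by move=> sK; elim: n => [|n IH]; rewrite ?mulr0n ?act0 // !mulrS actD // IH. Qed.

Lemma cocycle_right (b : aut S -> V) s u :
  (forall s t, Gal K s -> Gal K t -> b (s * t)%g = b s + act s (b t)) ->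
  Gal K s -> Gal K u -> b u = 0 -> b (s * u)%g = b s.
Proof. by move=> bM sK uK bu; rewrite bM // bu act0 // addr0. Qed.

(** A cocycle of the tower is killed by a power of [l], by averaging. *)
Lemma tower_inflation (b : aut S -> V) :
  (forall s t, Gal K s -> Gal K t -> b (s * t)%g = b s + act s (b t)) ->
  (forall g, Gal M g -> b g = 0) ->
  (exists e : seq S, forall s, Gal K s -> {in e, forall x, s x = x} -> b s = 0) ->
  exists (k : nat) (ts : seq (aut S)), [/\ l.-nat k, forall t, t \in ts -> Gal K t &
    forall s, Gal K s -> b s *+ k = act s (- \sum_(t <- ts) b t) - (- \sum_(t <- ts) b t)].
Proof.
move=> bM bG [e be]; have [m hm] := tower_lift T e.
(* An element of the kernel of level m differs from an element of [Gal M] by one that fixes e; the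
   cocycle vanishes on both. *)
have bm s : Gal K s -> tw m s = 0 -> b s = 0.
  move=> sK /(hm _ sK)[g gM ge]; have gK := GalMK T gM.
  have uK : Gal K (g^-1 * s)%g by apply: GalM => //; exact: GalV.
  rewrite -(mulKVg g s) (cocycle_right bM gK uK); first exact: bG.
  apply: be => // x xe.
  by rewrite autM -ge ?autVK.
have [ts [tsl tsK tsP]] :=
  @tower_transversal _ _ _ _ T m (Gal K) (fun _ => id) (@Gal1 _ _) (@GalM _ _) (@GalV _ _).
exists (size ts), ts; split=> // s sK.
have := tsP V b (fun s u sK uK tu => cocycle_right bM sK uK (bm _ uK tu)) s sK.
(* By translation invariance the left-hand side is the sum of the b(t), so the order of the quotient
   times b(s) is a coboundary. *)
have -> : \sum_(t <- ts) b (s * t)%g = b s *+ size ts + act s (\sum_(t <- ts) b t).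
  rewrite act_sum // -[b s *+ _]iter_addr_0 -count_predT -big_const_seq -big_split /=.
  by apply: eq_big_seq => t /tsK tK; rewrite bM.
by move=> E; rewrite actN // opprK -[X in _ + X]E addrC addrK.
Qed.

(** Surjectivity of restriction on [H^1]: a stable class of [Gal M] extends to an
    open subgroup, and the corestriction of this extension is its multiple by a
    power of [l]. *)
Variables (r : nat) (Tor : set V).
Hypothesis lr : coprime l r.
Hypothesis TorB : forall u v, Tor u -> Tor v -> Tor (u - v).
Hypothesis Tor_act : forall s v, Gal K s -> Tor v -> Tor (act s v).
Hypothesis Tor_pow : forall v, Tor v -> exists n, v *+ (r ^ n) = 0.
Hypothesis smooth : forall v, exists e : seq S,
  forall s, Gal K s -> {in e, forall x, s x = x} -> act s v = v.

Lemma Tor0_of v : Tor v -> Tor 0. Proof. by move=> Tv; rewrite -(subrr v); exact: TorB. Qed.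
Lemma TorN v : Tor v -> Tor (- v).
Proof. by move=> Tv; rewrite -sub0r; apply: TorB => //; exact: Tor0_of Tv. Qed.
Lemma TorD u v : Tor u -> Tor v -> Tor (u + v).
Proof. by move=> Tu Tv; rewrite -[v]opprK; apply: TorB => //; exact: TorN. Qed.
Lemma Tor_sum (I : eqType) (s : seq I) (F : I -> V) : Tor 0 ->
  (forall i, i \in s -> Tor (F i)) -> Tor (\sum_(i <- s) F i).
Proof. by move=> T0 TF; rewrite big_seq; elim/big_ind: _ => //; exact: TorD. Qed.
Lemma TorMn v n : Tor v -> Tor (v *+ n).
Proof.
move=> Tv; elim: n => [|n IH]; first by rewrite mulr0n; exact: Tor0_of Tv.
by rewrite mulrS; exact: TorD.
Qed.

Lemma smooth_seq (vs : seq V) : exists e : seq S,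
  forall s v, Gal K s -> {in e, forall x, s x = x} -> v \in vs -> act s v = v.
Proof.
elim: vs => [|v vs [e he]]; first by exists [::].
have [e' he'] := smooth v; exists (e' ++ e) => s u sK se.
rewrite inE => /orP[/eqP ->|uvs]; first by apply: he' => // x xe; apply: se; rewrite mem_cat xe.
by apply: he => // x xe; apply: se; rewrite mem_cat xe orbT.
Qed.

Lemma pow_seq (vs : seq V) : {in vs, forall v, Tor v} ->
  exists n, {in vs, forall v, v *+ (r ^ n) = 0}.
Proof.
elim: vs => [|v vs IH] vsT; first by exists 0%N.
have [|n hn] := IH; first by move=> u uv; apply: vsT; rewrite inE uv orbT.
have [m hm] := Tor_pow (vsT v (mem_head _ _)).
exists (m + n)%N => u; rewrite inE expnD => /orP[/eqP ->|/hn h].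
  by rewrite mulrnA hm mul0rn.
by rewrite mulnC mulrnA h mul0rn.
Qed.

(** The cocycle c is extended to the kernel H of a deep level, then transferred from H to [Gal K].
    Stability of the class makes the transfer restrict on [Gal M] to k c up to a coboundary, with k
    a power of l, and k is invertible modulo the exponent of the values of c. *)
Lemma tower_corestriction (c : aut S -> V) :
  (forall s t, Gal M s -> Gal M t -> c (s * t)%g = c s + act s (c t)) ->
  (forall s, Gal M s -> Tor (c s)) ->
  (exists e : seq S, forall s, Gal M s -> {in e, forall x, s x = x} -> c s = 0) ->
  (forall t, Gal K t -> exists2 P, Tor P &
     forall g, Gal M g -> act t (c (g ^ t)%g) = c g + (act g P - P)) ->
  exists C : aut S -> V, [/\
    forall s t, Gal K s -> Gal K t -> C (s * t)%g = C s + act s (C t),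
    forall s, Gal K s -> Tor (C s),
    (exists e : seq S, forall s, Gal K s -> {in e, forall x, s x = x} -> C s = 0) &
    exists2 P, Tor P & forall g, Gal M g -> C g = c g + (act g P - P)].
Proof.
move=> cM cT [e0 ce0] cinv; have MK := GalMK T.
have T0 : Tor 0 by apply: Tor0_of; exact: (cT _ (@Gal1 _ _)).
have c1 : c 1%g = 0 by apply: ce0.
have cR g u : Gal M g -> Gal M u -> c u = 0 -> c (g * u)%g = c g.
  by move=> gM uM cu; rewrite cM // cu act0 ?addr0 //; exact: MK.
have [vs vsP] : exists vs : seq V, forall g, Gal M g -> c g \in vs.
  apply: (finite_values hS (e := e0)); first by move=> s /MK.
  move=> s t sM tM st; have stM : Gal M (s^-1 * t)%g by apply: GalM => //; exact: GalV.
  rewrite -(mulKVg s t) cR //; apply: ce0 => // x xe.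
  by rewrite autM -st ?autVK.
have [e1 e1P] := smooth_seq vs.
have [E3 E3P] := conj_seq hS (e0 ++ e1).
(* An open normal subgroup of [Gal K] which acts trivially on the finitely many values of c and on
   which c vanishes wherever it is defined. *)
pose U : set (aut S) := [set u | Gal K u /\ forall s x, Gal K s -> x \in e0 ++ e1 -> u (s x) = s x].
have UK u : U u -> Gal K u by case.
have U1 : U 1%g by split.
have UM u u' : U u -> U u' -> U (u * u')%g.
  move=> [uK hu] [u'K hu']; split; first exact: GalM.
  by move=> s x sK xe; rewrite autM hu' ?hu.
have UV u : U u -> U (u^-1)%g.
  move=> [uK hu]; split; first exact: GalV.
  by move=> s x sK xe; rewrite -{1}(hu s x) ?autVK.
have UJ u s : U u -> Gal K s -> U (u ^ s)%g.
  move=> [uK hu] sK; split; first by apply: GalM; [exact: GalV | exact: GalM].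
  by move=> t x tK xe; rewrite /conjg !autM -[s (t x)]autM hu ?autM ?autVK //; exact: GalM.
have UE3 u : Gal K u -> {in E3, forall x, u x = x} -> U u.
  by move=> uK hu; split=> // s x sK xe; apply: hu; exact: E3P.
have Uc u : U u -> Gal M u -> c u = 0.
  move=> [uK hu] uM; apply: ce0 => // x xe.
  by have := hu 1%g x (@Gal1 _ _); rewrite aut1 mem_cat xe; apply.
have Uv u g : U u -> Gal M g -> act u (c g) = c g.
  move=> [uK hu] gM; apply: e1P => //; last exact: vsP.
  by move=> x xe; have := hu 1%g x (@Gal1 _ _); rewrite aut1 mem_cat xe orbT; apply.
have MJ g s : Gal M g -> Gal K s -> Gal M (g ^ s)%g.
  move=> gM sK x Mx; rewrite /conjg !autM gM ?autVK //.
  exact: (tw_norm T).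
(* For this m, the kernel H lies in the product of [Gal M] and U, and the extension is ct(gu) =
   c(g). *)
have [m hm] := tower_lift T E3.
pose H : set (aut S) := [set s | Gal K s /\ tw m s = 0].
have HK s : H s -> Gal K s by case.
have MH g : Gal M g -> H g by move=> gM; split; [exact: MK | exact: (twG T)].
have HM s t : H s -> H t -> H (s * t)%g.
  by move=> [sK s0] [tK t0]; split; [exact: GalM | rewrite twM // s0 t0 addr0].
have HV s : H s -> H (s^-1)%g.
  by move=> [sK s0]; split; [exact: GalV | rewrite twV // s0 oppr0].
have HJ h s : H h -> Gal K s -> H (h ^ s)%g.
  move=> [hK h0] sK; have sK' := GalV sK; split; first by apply: GalM => //; exact: GalM.
  by rewrite /conjg !twM ?twV ?h0 ?add0r ?addNr //; exact: GalM.
have decomp v : H v -> exists g, Gal M g /\ U (g^-1 * v)%g.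
  move=> [vK v0]; have [g gM ge] := hm v vK v0; exists g; split=> //.
  have gK := MK _ gM; apply: UE3; first by apply: GalM => //; exact: GalV.
  by move=> x xe; rewrite autM -ge ?autVK.
pose gp v := xget 1%g [set g | Gal M g /\ U (g^-1 * v)%g].
have gpP v : H v -> Gal M (gp v) /\ U ((gp v)^-1 * v)%g.
  by move=> /decomp[g hg]; rewrite /gp; case: xgetP => [t _ //|/(_ g)[]].
pose ct v := c (gp v).
have ctE g u : Gal M g -> U u -> H (g * u)%g -> ct (g * u)%g = c g.
  move=> gM uU /gpP[]; rewrite -/(ct _) /ct; set g' := gp _ => g'M u'U.
  have E : (g^-1 * g' = u * (g'^-1 * (g * u))^-1)%g by rewrite !invMg !invgK !mulgA mulgV mul1g.
  have dM : Gal M (g^-1 * g')%g by apply: GalM => //; exact: GalV.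
  rewrite -(mulKVg g g') cR //; apply: Uc => //.
  by rewrite E; apply: (UM _ _ uU); exact: UV.
have ctv v : H v -> exists g u, [/\ Gal M g, U u, v = (g * u)%g & ct v = c g].
  move=> Hv; have [gM uU] := gpP v Hv; exists (gp v), ((gp v)^-1 * v)%g.
  by split=> //; rewrite mulKVg.
have ctG g : Gal M g -> ct g = c g.
  by move=> gM; rewrite -{1}[g]mulg1 ctE // mulg1; exact: MH.
have ctU u : U u -> H u -> ct u = 0.
  by move=> uU Hu; rewrite -[u]mul1g ctE ?mul1g.
have ctM v v' : H v -> H v' -> ct (v * v')%g = ct v + act v (ct v').
  move=> Hv Hv'; have Hvv := HM _ _ Hv Hv'.
  have [g [u [gM uU vE ->]]] := ctv v Hv; have [g' [u' [g'M u'U v'E ->]]] := ctv v' Hv'.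
  have [gK uK] := (MK _ gM, UK _ uU).
  have u'' := MJ g' (u^-1)%g g'M (GalV uK).
  have E : (v * v' = (g * g' ^ (u^-1)) * (u * u'))%g.
    by rewrite vE v'E /conjg invgK !mulgA mulgKV.
  rewrite E ctE; [|exact: GalM|exact: UM|by rewrite -E].
  rewrite cM // vE actM // (Uv u g' uU g'M); congr (_ + act g _).
  (* Moving u past g' changes g' by an element of both U and [Gal M], which c does not see. *)
  have E' : (g' ^ u^-1 = g' * (u ^ g' * u^-1))%g by rewrite /conjg invgK !mulgA mulgV mul1g.
  have wU : U (u ^ g' * u^-1)%g by apply: UM; [exact: UJ (MK _ g'M) | exact: UV].
  have wM : Gal M (u ^ g' * u^-1)%g.
    by rewrite -(mulKg g' (u ^ g' * u^-1)%g) -E'; apply: GalM => //; exact: GalV.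
  by rewrite E' cR //; exact: Uc.
have ctT v : H v -> Tor (ct v) by move=> /ctv[g [u [gM _ _ ->]]]; exact: cT.
pose rep x : aut S := xget 1%g [set s | Gal K s /\ tw m s = x].
have repP s : Gal K s -> Gal K (rep (tw m s)) /\ tw m (rep (tw m s)) = tw m s.
  by move=> sK; rewrite /rep; case: xgetP => [t _ //|/(_ s)[]].
have repH s : Gal K s -> H ((rep (tw m s))^-1 * s)%g.
  move=> sK; have [rK rs] := repP s sK.
  by split; [apply: GalM => //; exact: GalV | rewrite twM ?twV ?rs ?addNr //; exact: GalV].
(* [f] prolongs [ct] to a cochain on [Gal K] such that f(sv) = f(s) + s ct(v) for v in H. *)
pose f s := act (rep (tw m s)) (ct ((rep (tw m s))^-1 * s)%g).
have fT s : Gal K s -> Tor (f s).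
  by move=> sK; apply: Tor_act; [case: (repP s sK) | exact/ctT/repH].
have fR s v : Gal K s -> H v -> f (s * v)%g = f s + act s (ct v).
  move=> sK Hv; have [vK v0] := Hv; have [rK rs] := repP s sK; have sH := repH s sK.
  have sHK := HK _ sH.
  rewrite /f twM // v0 addr0 mulgA ctM // actD //.
  by rewrite -actM ?mulKVg.
have [ts [tsl tsK tsP]] :=
  @tower_transversal _ _ _ _ T m (Gal K) (fun _ => id) (@Gal1 _ _) (@GalM _ _) (@GalV _ _).
(* As a function of x this is constant on the cosets xH, so the sum [C0] over representatives is
   well defined; it is the usual corestriction. *)
pose h s x := f (s * x)%g - act s (f x).
have hinv s x v : Gal K s -> Gal K x -> Gal K v -> tw m v = 0 -> h s (x * v)%g = h s x.
  move=> sK xK vK v0; have Hv : H v by [].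
  have sxK := GalM sK xK; rewrite /h mulgA (fR _ _ sxK Hv) (fR _ _ xK Hv).
  by rewrite actD // actM // opprD addrACA subrr addr0.
pose C0 s := \sum_(t <- ts) h s t.
have C0M s s' : Gal K s -> Gal K s' -> C0 (s * s')%g = C0 s + act s (C0 s').
  move=> sK s'K; rewrite /C0 -(tsP V (h s) (fun x v => hinv s x v sK) s' s'K) act_sum // -big_split.
  apply: eq_big_seq => t /tsK tK; rewrite /h /= actB // actM // mulgA.
  by rewrite addrA subrK.
have C0T s : Gal K s -> Tor (C0 s).
  move=> sK; apply: Tor_sum => // t /tsK tK.
  by apply: TorB; [apply: fT; exact: GalM | apply: Tor_act => //; exact: fT].
(* Writing gt as t times the conjugate of g by t, each summand becomes t acting on c of that
   conjugate, that is c(g) up to the coboundary of some P_t; Q is the sum of the P_t - f(t). *)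
have [Q [QT QP]] : exists Q, Tor Q /\ forall g, Gal M g -> C0 g = c g *+ size ts + (act g Q - Q).
  have cinv' t : exists P, t \in ts -> Tor P /\
      forall g, Gal M g -> act t (c (g ^ t)%g) = c g + (act g P - P).
    have [/tsK/cinv[P PT hP]|_] := boolP (t \in ts); last by exists 0.
    by exists P.
  have [P PP] := choice cinv'.
  exists (\sum_(t <- ts) (P t - f t)); split.
    by apply: Tor_sum => // t tt; have [PT _] := PP t tt; apply: TorB => //; exact/fT/tsK.
  move=> g gM; have gK := MK _ gM.
  have -> : c g *+ size ts = \sum_(t <- ts) c g.
    by rewrite big_const_seq count_predT iter_addr_0.
  rewrite act_sum // -sumrB -big_split /=; apply: eq_big_seq => t tt.
  have [PT hP] := PP t tt; have tK := tsK t tt.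
  have gt := MJ g t gM tK.
  have -> : h g t = f t + act t (c (g ^ t)%g) - act g (f t).
    by rewrite /h (conjgC g t) fR ?ctG //; exact: MH.
  rewrite hP // actB //; move: (c g) (act g (P t)) (P t) (f t) (act g (f t)) => a b d x y.
  by rewrite opprB !addrA [x + a]addrC [a + x + _]addrAC [LHS]addrAC [a + _ + x - y]addrAC.
have [n hn] : exists n, {in vs, forall v, Tor v -> v *+ (r ^ n) = 0}.
  have [|n hn] := @pow_seq [seq v <- vs | `[< Tor v >]].
    by move=> v; rewrite mem_filter => /andP[/asboolP].
  by exists n => v vvs Tv; apply: hn; rewrite mem_filter vvs andbT; apply/asboolP.
have [w wE] : exists w, (w * size ts = 1 %[mod r ^ n])%N.
  have cop : coprime (size ts) (r ^ n).
    by have [k ->] := p_natP tsl; rewrite coprimeXl ?coprimeXr.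
  (* If r^n is 0, coprimality forces a single representative, and w = 1 works. *)
  have [E|r0] := posnP (r ^ n); first by exists 1%N; move: cop; rewrite E /coprime gcdn0 => /eqP ->.
  have s0 : (0 < size ts)%N by case/andP: tsl.
  case: (egcdnP (r ^ n) s0) => km kn E _; exists km.
  by rewrite E (eqP cop) modnMDl.
exists (fun s => C0 s *+ w); split.
- by move=> s t sK tK; rewrite C0M // mulrnDl actMn.
- by move=> s sK; apply/TorMn/C0T.
- have [e2 _ e2P] := tw_open T m; have [e3 e3P] := smooth_seq [seq f t | t <- ts].
  exists (E3 ++ e2 ++ e3) => s sK se; rewrite /C0 big_seq big1 ?mul0rn // => t tt.
  have tK := tsK t tt.
  have sU : U s by apply: UE3 => // x xe; apply: se; rewrite !mem_cat xe.
  have sH : H s.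
    by split=> //; apply: e2P => // x xe; apply: se; rewrite !mem_cat xe orbT.
  have HsT := HJ s t sH tK; have UsT := UJ s t sU tK.
  rewrite /h (conjgC s t) (fR t _ tK HsT) (ctU _ UsT HsT) act0 // addr0.
  rewrite (e3P s (f t) sK) ?subrr ?map_f // => x xe.
  by apply: se; rewrite !mem_cat xe !orbT.
exists (Q *+ w); first exact: TorMn.
move=> g gM; have gK := MK _ gM; rewrite QP // mulrnDl mulrnBl -actMn //; congr (_ + _).
have cg := hn _ (vsP g gM) (cT g gM).
have red a : c g *+ a = c g *+ (a %% r ^ n).
  by rewrite {1}(divn_eq a (r ^ n)) mulrnDr mulnC mulrnA cg mul0rn add0r.
by rewrite -mulrnA mulnC red wE -red.
Qed.

End TowerCohomology.

(** * Valuation rings and rank one *)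

Section ValuationRing.
Variables (T : fieldType) (O : set T).

(** A valuation ring of the whole ambient field. In contrast to [place] the trivial ring is allowed,
    so preimages under embeddings are again of this kind. *)
Definition vring : Prop := subring O /\ forall x, O x \/ O x^-1.
Hypothesis hO : vring.

Let OP x : (x \in O) <-> O x. Proof. by rewrite in_setE. Qed.

Lemma vO1 : O 1. Proof. by case: hO => -[/OP]. Qed.
Lemma vOB x y : O x -> O y -> O (x - y).
Proof. by case: hO => -[_ h _] _ /OP ? /OP ?; apply/OP; exact: h. Qed.
Lemma vOM x y : O x -> O y -> O (x * y).
Proof. by case: hO => -[_ _ h] _ /OP ? /OP ?; apply/OP; exact: h. Qed.
Lemma vO0 : O 0. Proof. by rewrite -(subrr 1); apply: vOB; exact: vO1. Qed.
Lemma vON x : O x -> O (- x). Proof. by move=> Ox; rewrite -sub0r; apply: vOB => //; exact: vO0. Qed.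
Lemma vOD x y : O x -> O y -> O (x + y).
Proof. by move=> Ox Oy; rewrite -[y]opprK; apply: vOB => //; exact: vON. Qed.
Lemma vOX x n : O x -> O (x ^+ n).
Proof. by move=> Ox; elim: n => [|n IH]; rewrite ?expr0 ?exprS; [exact: vO1 | exact: vOM]. Qed.
Lemma vO_sum (I : Type) (r : seq I) (P : pred I) (F : I -> T) :
  (forall i, P i -> O (F i)) -> O (\sum_(i <- r | P i) F i).
Proof. by move=> OF; elim/big_ind: _ => //; [exact: vO0 | exact: vOD]. Qed.
Lemma vO_nat n : O n%:R.
Proof. by elim: n => [|n IH]; [exact: vO0 | rewrite -natr1; apply: vOD => //; exact: vO1]. Qed.
Lemma vO_total x : O x \/ O x^-1. Proof. by case: hO. Qed.

(** The maximal ideal. *)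
Definition vm x : Prop := x = 0 \/ ~ O x^-1.

Lemma vm_O x : vm x -> O x.
Proof. by move=> [->|nx]; [exact: vO0 | case: (vO_total x)]. Qed.

Lemma vm_mul x y : O x -> vm y -> vm (x * y).
Proof.
move=> Ox [->|ny]; first by left; rewrite mulr0.
have [->|x0] := eqVneq x 0; first by left; rewrite mul0r.
by right => xy; apply: ny; have := vOM Ox xy; rewrite invfM mulVKf.
Qed.

Lemma vm_add x y : vm x -> vm y -> vm (x + y).
Proof.
wlog xy : x y / O (x / y).
  move=> W mx my; case: (vO_total (x / y)) => [h|h]; first exact: W.
  by rewrite addrC; apply: W => //; rewrite invf_div in h.
move=> mx my; have [y0|y0] := eqVneq y 0; first by rewrite y0 addr0.
rewrite (_ : x + y = (x / y + 1) * y); last by field.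
by apply: vm_mul => //; apply: vOD => //; exact: vO1.
Qed.

Lemma vm_opp x : vm x -> vm (- x).
Proof. by move=> mx; rewrite -mulN1r; apply: vm_mul => //; exact/vON/vO1. Qed.

Lemma vm1 : ~ vm 1.
Proof. by case=> [/eqP|]; rewrite ?oner_eq0 // invr1; apply; exact: vO1. Qed.

Lemma not_vm x : ~ vm x -> x != 0 /\ O x^-1.
Proof.
move=> nm; split; first by apply/eqP => x0; apply: nm; left.
by apply: contrapT => h; apply: nm; right.
Qed.

Lemma unit_not_vm x : x != 0 -> O x^-1 -> ~ vm x.
Proof. by move=> /eqP x0 xV []. Qed.

Lemma unit1 m : vm m -> 1 + m != 0 /\ O (1 + m)^-1.
Proof.
move=> mm; apply: not_vm => h; apply: vm1.
by rewrite -(addrK m 1); apply: vm_add => //; exact: vm_opp.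
Qed.

Lemma vm_X x n : vm (x ^+ n) -> vm x.
Proof.
move=> mx; apply: contrapT => /not_vm[x0 xV]; move: mx; apply: unit_not_vm.
  exact: expf_neq0.
by rewrite -exprVn; exact: vOX.
Qed.

Lemma exp_vm x n : vm x -> vm (x ^+ n.+1).
Proof. by move=> mx; rewrite exprSr; apply: vm_mul => //; exact/vOX/vm_O. Qed.

Lemma vm_sum (I : Type) (r : seq I) (P : pred I) (F : I -> T) :
  (forall i, P i -> vm (F i)) -> vm (\sum_(i <- r | P i) F i).
Proof. by move=> OF; elim/big_ind: _ => //; [by left | exact: vm_add]. Qed.

(** The ultrametric principle: in a vanishing sum the largest absolute value is attained at least
    twice. *)
Lemma two_terms n (t : 'I_n -> T) : \sum_i t i = 0 -> (exists i, t i != 0) ->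
  exists i j, [/\ i != j, t i != 0, t j != 0 & O (t i / t j) /\ O (t j / t i)].
Proof.
move=> s0 [i0 ti0].
have [i [ti imax]] : exists i, t i != 0 /\ forall j, O (t j / t i).
  suff H (s : seq 'I_n) : exists i, t i != 0 /\ {in s, forall j, O (t j / t i)}.
    have [i [ti hi]] := H (enum 'I_n); exists i; split=> // j; apply: hi.
    by rewrite mem_enum.
  elim: s => [|j s [i [ti hi]]]; first by exists i0.
  have [h|h] := vO_total (t j / t i).
    by exists i; split=> // x; rewrite inE => /orP[/eqP ->|/hi].
  have [tj|tj] := eqVneq (t j) 0.
    by exists i; split=> // x; rewrite inE => /orP[/eqP ->|/hi //]; rewrite tj mul0r; exact: vO0.
  exists j; split=> // x; rewrite inE => /orP[/eqP ->|/hi xi].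
    by rewrite mulfV //; exact: vO1.
  by have := vOM xi h; rewrite invf_div mulrA divfK.
apply: contrapT => H; have : vm 1; last exact: vm1.
have : \sum_j t j / t i = 0 by rewrite -mulr_suml s0 mul0r.
rewrite (bigD1 i) //= mulfV // => /eqP; rewrite addr_eq0 => /eqP ->.
apply/vm_opp/vm_sum => j ji; have [->|tj] := eqVneq (t j) 0; first by left; rewrite mul0r.
right => h; apply: H; exists j, i; split=> //; split=> //.
by move: h; rewrite invf_div.
Qed.

(** If x is not integral then 1/x is, and division of the equation by its lead coefficient and a
    power of x writes x as a combination of the normalised coefficients with integral factors. *)
Lemma root_bound (q : {poly T}) x b : q != 0 -> root q x -> O b ->
  (forall i, O (b * (q`_i / lead_coef q))) -> O (b * x).
Proof.
move=> q0 qx Ob bq; have [Ox|Ox] := vO_total x; first exact: vOM.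
have [->|x0] := eqVneq x 0; first by rewrite mulr0; exact: vO0.
have l0 : lead_coef q != 0 by rewrite lead_coef_eq0.
have : (1 < size q)%N.
  rewrite ltnNge; apply: contraL qx => /size1_polyC E.
  by rewrite E rootC; apply: contraNneq q0 => c0; rewrite E c0.
case E : (size q) => [|[|n]] // _; move: qx; rewrite /root horner_coef E big_ord_recr /=.
have -> : q`_n.+1 = lead_coef q by rewrite lead_coefE E.
rewrite addrC addr_eq0 => /eqP qE.
have -> : x = - \sum_(i < n.+1) (q`_i / lead_coef q) * x^-1 ^+ (n - i).
  apply: (mulIf (expf_neq0 n x0)); apply: (mulfI l0); rewrite -exprS qE mulNr mulrN; congr (- _).
  rewrite mulr_suml mulr_sumr; apply: eq_bigr => i _.
  have -> : x ^+ n = x ^+ (n - i) * x ^+ i by rewrite -exprD subnK // -ltnS.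
  have z0 : x ^+ (n - i) != 0 by rewrite expf_neq0.
  by rewrite exprVn; move: (x ^+ (n - i)) (x ^+ i) (q`_i) z0 => z w c z0; field; rewrite z0 l0.
rewrite mulrN mulr_sumr; apply: vON; apply: vO_sum => i _.
by rewrite mulrA; apply: vOM => //; exact: vOX.
Qed.

Section Over.
Variable A : set T.
Hypothesis hA : subfield A.

Lemma common_denominator (s : seq T) : {in s, forall c, A c} ->
  exists b, [/\ A b, b != 0, O b & {in s, forall c, O (b * c)}].
Proof.
elim: s => [|c s IH] sA; first by exists 1; split; [exact: (sf1 hA) | exact: oner_neq0 | exact: vO1 | ].
have [|b [Ab b0 Ob bs]] := IH; first by move=> x xs; apply: sA; rewrite inE xs orbT.
have Ac := sA c (mem_head _ _).
have [h|h] := vO_total (b * c).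
  by exists b; split=> // x; rewrite inE => /orP[/eqP ->|/bs].
have [c0|c0] := eqVneq c 0.
  by exists b; split=> // x; rewrite inE => /orP[/eqP ->|/bs //]; rewrite c0 mulr0; exact: vO0.
exists c^-1; split; [exact: (sfV hA) | by rewrite invr_eq0 | | ].
  by have := vOM Ob h; rewrite invfM mulrA mulfV // mul1r.
move=> x; rewrite inE => /orP[/eqP ->|/bs bx]; first by rewrite mulVf //; exact: vO1.
by have := vOM bx h; rewrite (_ : _ * _ = c^-1 * x) //; field; rewrite b0 c0.
Qed.

Lemma alg_bound x : algebraic_over A x -> exists b, [/\ A b, b != 0, O b & O (b * x)].
Proof.
move=> [q [qA q0 qx]]; have qA' := (polyOver_set _ (sf0 hA)).1 qA.
have [|b [Ab b0 Ob bq]] := @common_denominator [seq c / lead_coef q | c <- q].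
  move=> _ /mapP[c cq ->]; apply: (sf_div hA); last by rewrite lead_coefE; exact: qA'.
  by move/allP/(_ _ cq): qA; rewrite in_setE.
exists b; split=> //; apply: root_bound qx _ _ => // i.
have [lt|ge] := ltnP i (size q); first by apply/bq/map_f/mem_nth.
by rewrite nth_default // mul0r mulr0; exact: vO0.
Qed.

Lemma alg_trivial x : A `<=` O -> algebraic_over A x -> O x.
Proof.
move=> AO [q [/(polyOver_set _ (sf0 hA)) qA q0 qx]]; rewrite -[x]mul1r.
apply: root_bound q0 qx vO1 _ => i; rewrite mul1r; apply: AO.
by apply: (sf_div hA) => //; rewrite lead_coefE.
Qed.

(** [O] has rank one on the subset [A], and [pi] is a pseudo-uniformizer. *)
Definition rank1 (B : set T) (pi : T) : Prop :=
  [/\ B pi, pi != 0, vm pi,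
      (forall a, B a -> a != 0 -> exists n, O (pi ^+ n / a)) &
      (forall a, B a -> vm a -> exists n, O (a ^+ n / pi))].

(** Cofinality comes from a denominator in A for 1/a. For y in the maximal ideal, two terms of equal
    value in an equation of y give y^(j-i) = a u with a in A and u a unit, so a high power of y is
    as small as a power of a. *)
Lemma rank1_alg (L : set T) pi : A `<=` L -> (forall x, L x -> L x^-1) ->
  (forall x, L x -> algebraic_over A x) -> rank1 A pi -> rank1 L pi.
Proof.
move=> AL LV Lalg [Api pi0 mpi cof arch]; split=> //; first exact: AL.
  move=> a La a0; have [b [Ab b0 Ob ba]] := alg_bound (Lalg _ (LV _ La)).
  have [n hn] := cof b Ab b0; exists n.
  by have := vOM hn ba; rewrite mulrA divfK.
move=> y Ly my; have [y0|y0] := eqVneq y 0.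
  by exists 1%N; rewrite y0 expr1 mul0r; exact: vO0.
have [q [/(polyOver_set _ (sf0 hA)) qA q0 qy]] := Lalg y Ly.
have [||i [j [ij ti tj [tij tji]]]] := @two_terms (size q) (fun i => q`_i * y ^+ i).
- by move/eqP: qy; rewrite horner_coef.
- have lt : ((size q).-1 < size q)%N by rewrite prednK // size_poly_gt0.
  by exists (Ordinal lt); rewrite /= mulf_neq0 ?expf_neq0 // -lead_coefE lead_coef_eq0.
wlog lt : i j ij ti tj tij tji / (i < j)%N.
  move=> W; case: (ltngtP i j) => h; [exact: W h | apply: (W j i) => // | ].
    by rewrite eq_sym.
  by move/eqP: ij; case; exact: val_inj.
move: ti tj; rewrite !mulf_eq0 !expf_eq0 (negPf y0) !andbF !orbF => ti tj.
pose a := q`_i / q`_j; pose u := q`_j * y ^+ j / (q`_i * y ^+ i).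
have yj : y ^+ j = y ^+ (j - i) * y ^+ i by rewrite -exprD subnK // ltnW.
have [d0 i0] : y ^+ (j - i) != 0 /\ y ^+ i != 0 by rewrite !expf_neq0.
have yE : y ^+ (j - i) = a * u.
  rewrite /a /u yj; move: (y ^+ (j - i)) (y ^+ i) (q`_i) (q`_j) d0 i0 ti tj => ? ? ? ? *.
  by field; apply/and3P.
have aE : a = y ^+ (j - i) * (q`_i * y ^+ i / (q`_j * y ^+ j)).
  rewrite /a yj; move: (y ^+ (j - i)) (y ^+ i) (q`_i) (q`_j) d0 i0 ti tj => ? ? ? ? *.
  by field; apply/and3P.
have ma : vm a.
  rewrite aE mulrC; apply: vm_mul => //.
  by move: lt; rewrite -subn_gt0; case: (j - i)%N => // m _; exact: exp_vm.
have [n hn] := arch a (sf_div hA (qA i) (qA j)) ma.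
exists ((j - i) * n)%N; rewrite exprM yE exprMn mulrAC.
by apply: vOM => //; apply: vOX.
Qed.

End Over.
End ValuationRing.

(** * Valuations of the function field have rank one *)

Section FunctionFieldPlaces.
Variables (F : fieldType) (O : set F).
Hypothesis hO : vring O.

(** In characteristic p the inverse of a nonzero natural number is again a natural number, hence
    integral for every valuation. This is how primes other than p act as units below. *)
Lemma nat_inv (R : fieldType) (p n : nat) : p \in [pchar R] -> n%:R != 0 :> R ->
  exists m, (n%:R)^-1 = m%:R :> R.
Proof.
move=> pR n0; have p_pr := pcharf_prime pR.
have cop : coprime n p.
  by rewrite coprime_sym prime_coprime // (dvdn_pcharf pR).
have n_gt0 : (0 < n)%N by rewrite lt0n; apply: contraNneq n0 => ->.
case: (egcdnP p n_gt0) => a b E _; exists a.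
apply: (mulIf n0); rewrite mulVf // -natrM E (eqP cop) natrD natrM (pcharf0 pR).
by rewrite mulr0 add0r.
Qed.

Lemma constants_integral p x : p \in [pchar F] -> algebraic_over (@prime_subfield F) x -> O x.
Proof.
move=> pF; apply: alg_trivial => //; last by move=> _ [n _ <-]; exact: vO_nat.
split; first by rewrite in_setE; exists 1%N.
  move=> x' y /set_mem[a _ <-] /set_mem[b _ <-]; rewrite in_setE.
  exists (a + b * p.-1)%N => //; rewrite natrD natrM.
  have := pcharf0 pF; rewrite -{1}(prednK (prime_gt0 (pcharf_prime pF))) -natr1.
  by move/eqP; rewrite addr_eq0 => /eqP ->; rewrite mulrN1.
move=> x' y /set_mem[a _ <-] /set_mem[b _ <-]; rewrite in_setE.
have [->|b0] := eqVneq (b%:R : F) 0; first by exists 0%N; rewrite ?invr0 ?mulr0.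
by have [m ->] := nat_inv pF b0; exists (a * m)%N; rewrite ?natrM.
Qed.

(** Constants are integral, being algebraic over F_p. On the rational subfield k(tau) the valuation
    is the discrete one attached to a polynomial of least degree in the maximal ideal, and rank one
    then passes to the algebraic extension F. *)
Lemma function_field_rank1 p k : @function_field F p k -> (exists x, ~ O x) ->
  exists pi, rank1 O setT pi.
Proof.
move=> [pF hk kalg _ [_ [t _ alg]]] [x0 nx0].
have kO : k `<=` O by move=> x /kalg; exact: constants_integral pF.
(* One of t and 1/t is integral, and both generate the same field over k. *)
have [tau [Otau talg]] : exists tau, O tau /\ forall x, algebraic_over (adjoin k [set tau]) x.
  case: (vO_total hO t) => h; first by exists t.
  exists t^-1; split=> // x; apply: algebraic_over_sub (alg x).
  apply: adjoin_min; [exact: adjoin_subfield | exact: sub_adjoin_l |].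
  move=> x' /= ->; have := sfV (adjoin_subfield k [set t^-1]) (@sub_adjoin_r _ k [set _] _ erefl).
  by rewrite invrK.
have [U [v vk]] := subfield_type hk.
pose ev (g : {poly U}) := (map_poly v g).[tau].
have evM g h : ev (g * h) = ev g * ev h by rewrite /ev rmorphM hornerM.
have evB g h : ev (g - h) = ev g - ev h by rewrite /ev rmorphB hornerD hornerN.
have evD g h : ev (g + h) = ev g + ev h by rewrite /ev rmorphD hornerD.
have evC c : ev c%:P = v c by rewrite /ev map_polyC hornerC.
have ev1 : ev 1 = 1 by rewrite /ev rmorph1 hornerC.
have ev0 : ev 0 = 0 by rewrite /ev rmorph0 horner0.
have evO g : O (ev g).
  rewrite /ev horner_coef; apply: vO_sum => // i _; apply: vOM => //; last exact: vOX.
  by rewrite coef_map; apply: kO; rewrite -vk; eexists.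
pose A := adjoin k [set tau].
have hA : subfield A by exact: adjoin_subfield.
have Afrac a : A a -> exists g h, ev h != 0 /\ a = ev g / ev h.
  case/(_ [set a | exists g h, ev h != 0 /\ a = ev g / ev h]).
  - split.
    + rewrite in_setE; exists 1, 1; rewrite ev1 oner_neq0.
      by rewrite divr1.
    + move=> x y /set_mem[g [h [h0 ->]]] /set_mem[g' [h' [h0' ->]]]; rewrite in_setE.
      exists (g * h' - g' * h), (h * h'); rewrite evB !evM mulf_neq0 //; split=> //.
      by field; rewrite h0 h0'.
    + move=> x y /set_mem[g [h [h0 ->]]] /set_mem[g' [h' [h0' ->]]]; rewrite in_setE /=.
      have [E|g0'] := eqVneq (ev g') 0.
        exists 0, 1; rewrite E !mul0r invr0 mulr0 ev0 ev1 oner_neq0.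
        by rewrite mul0r.
      exists (g * h'), (h * g'); rewrite !evM mulf_neq0 //; split=> //.
      by field; rewrite h0 h0' g0'.
  - move=> c; rewrite -vk => -[u _ <-]; exists u%:P, 1.
    by rewrite evC ev1 oner_neq0 divr1.
  - move=> x' /= ->; exists 'X, 1; rewrite ev1 oner_neq0 divr1.
    by rewrite /ev map_polyX hornerX.
  by move=> g [h gh]; exists g, h.
(* If no polynomial value were a nonzero element of the maximal ideal, all of k(tau) and hence all
   of F would be integral. *)
have [_ [g [g0 mg <-]] ming] : exists2 n, exists g, [/\ ev g != 0, vm O (ev g) & size g = n] &
    forall m, (exists g, [/\ ev g != 0, vm O (ev g) & size g = m]) -> (n <= m)%N.
  apply: ex_min_nat; apply: contrapT => H; apply: nx0.
  apply: (alg_trivial hO hA _ (talg x0)) => a /Afrac[g [h [h0 ->]]].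
  apply: vOM => //; apply: contrapT => nh; apply: H; exists (size h), h; split=> //.
  by right.
pose pi := ev g.
(* Euclidean division by g: a nonzero remainder has unit value by minimality of the degree, and then
   h has unit value too; otherwise a factor g is split off. *)
have dvr n (h : {poly U}) : (size h < n)%N -> ev h != 0 ->
    exists m u, [/\ ev h = pi ^+ m * u, u != 0, O u & O u^-1].
  elim: n h => // n IH h; rewrite ltnS => hn h0.
  have g00 : g != 0 by apply: contraNneq g0 => ->; rewrite ev0.
  have hE : ev h = ev (h %/ g) * pi + ev (h %% g) by rewrite -evM -evD -divp_eq.
  have [r0|r0] := eqVneq (ev (h %% g)) 0.
    have w0 : ev (h %/ g) != 0 by apply: contraNneq h0 => w0; rewrite hE w0 r0 mul0r addr0.
    have [|m [u [E u0 Ou OuV]]] := IH (h %/ g) _ w0.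
      apply: leq_trans hn; rewrite size_divp // ltn_subrL.
      have h00 : h != 0 by apply: contraNneq h0 => ->; rewrite ev0.
      rewrite size_poly_gt0 h00 andbT; case sg : (size g) => [|[|m]] //.
        by move/eqP: sg; rewrite size_poly_eq0 (negPf g00).
      have E : g = (g`_0)%:P by apply: size1_polyC; rewrite sg.
      exfalso; move: mg; apply: (unit_not_vm g0).
      by rewrite E evC -fmorphV; apply: kO; rewrite -vk; eexists.
    exists m.+1, u; split=> //; rewrite hE E r0 addr0 exprSr; ring.
  have [r1 r2] : ev (h %% g) != 0 /\ O (ev (h %% g))^-1.
    apply: not_vm => mr; have := ltn_modp h g; rewrite g00 ltnNge ming //.
    by exists (h %% g).
  exists 0%N, (ev h); rewrite expr0 mul1r; split=> //.
  have -> : ev h = ev (h %% g) * (1 + (ev (h %/ g) / ev (h %% g)) * pi).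
    by rewrite hE; field.
  rewrite invfM; apply: vOM => //; apply: (unit1 hO _).2; apply: vm_mul => //.
  exact: vOM.
have dvr' h : ev h != 0 -> exists m u, [/\ ev h = pi ^+ m * u, u != 0, O u & O u^-1].
  by apply: (dvr (size h).+1).
have rA : rank1 O A pi.
  split=> //.
  - suff evA q : A (ev q) by exact: evA.
    rewrite /ev horner_coef; apply: (sf_sum hA) => i _; apply: (sfM hA); last first.
      by apply: (sfX hA); exact: (@sub_adjoin_r _ k [set _] _ erefl).
    by rewrite coef_map; apply: sub_adjoin_l; rewrite -vk; eexists.
  - move=> a /Afrac[g1 [h1 [h0 ->]]] a0.
    have g10 : ev g1 != 0 by apply: contraNneq a0 => ->; rewrite mul0r.
    have [m [u [-> u0 Ou OuV]]] := dvr' _ g10; exists m.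
    have -> : pi ^+ m / (pi ^+ m * u / ev h1) = ev h1 * u^-1.
      by field; rewrite u0 h0 expf_neq0.
    exact: vOM.
  - move=> a /Afrac[g1 [h1 [h0 ->]]] ma.
    have [E|g10] := eqVneq (ev g1) 0.
      by exists 1%N; rewrite E !mul0r; exact: vO0.
    have [m [u [gE u0 Ou OuV]]] := dvr' _ g10; have [n [w [hE w0 Ow OwV]]] := dvr' _ h0.
    exists 1%N; have [lt|ge] := ltnP n m.
      have -> : (ev g1 / ev h1) ^+ 1 / pi = pi ^+ (m - n.+1) * (u * w^-1).
        rewrite expr1 gE hE -{1}(subnK lt) exprD exprSr.
        move: (pi ^+ n) (expf_neq0 n g0 : pi ^+ n != 0) => z z0.
        by field; rewrite ?w0 ?z0 ?g0.
      by apply: (vOM hO); [apply: (vOX hO); exact: evO | exact: (vOM hO)].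
    have nz : ev g1 / ev h1 != 0 by rewrite mulf_neq0 ?invr_eq0.
    exfalso; move: ma; apply: (unit_not_vm nz).
    have -> : (ev g1 / ev h1)^-1 = pi ^+ (n - m) * (w * u^-1).
      rewrite invf_div gE hE -{1}(subnK ge) exprD.
      move: (pi ^+ m) (expf_neq0 m g0 : pi ^+ m != 0) => z z0.
      by field; rewrite ?u0 ?z0.
    by apply: (vOM hO); [apply: (vOX hO); exact: evO | exact: (vOM hO)].
by exists pi; apply: rank1_alg rA.
Qed.

End FunctionFieldPlaces.

(** * Chevalley's extension theorem for valuations *)

Section Subring.
Variables (T : fieldType) (A : set T).
Hypothesis hA : subring A.
Let AP x : (x \in A) <-> A x. Proof. by rewrite in_setE. Qed.
Lemma sr1 : A 1. Proof. by case: hA => /AP. Qed.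
Lemma srB x y : A x -> A y -> A (x - y).
Proof. by case: hA => _ h _ /AP ? /AP ?; apply/AP; exact: h. Qed.
Lemma srM x y : A x -> A y -> A (x * y).
Proof. by case: hA => _ _ h /AP ? /AP ?; apply/AP; exact: h. Qed.
Lemma sr0 : A 0. Proof. by rewrite -(subrr 1); apply: srB; exact: sr1. Qed.
Lemma srN x : A x -> A (- x). Proof. by move=> Ax; rewrite -sub0r; apply: srB => //; exact: sr0. Qed.
Lemma srD x y : A x -> A y -> A (x + y).
Proof. by move=> Ax Ay; rewrite -[y]opprK; apply: srB => //; exact: srN. Qed.
Lemma srX x n : A x -> A (x ^+ n).
Proof. by move=> Ax; elim: n => [|n IH]; rewrite ?expr0 ?exprS; [exact: sr1 | exact: srM]. Qed.
End Subring.

Lemma mk_subring (T : fieldType) (A : set T) : A 1 ->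
  (forall x y, A x -> A y -> A (x - y)) -> (forall x y, A x -> A y -> A (x * y)) -> subring A.
Proof.
move=> h1 hB hM; split; first by rewrite in_setE.
  by move=> x y /set_mem Ax /set_mem Ay; rewrite in_setE; exact: hB.
by move=> x y /set_mem Ax /set_mem Ay; rewrite in_setE; exact: hM.
Qed.

(** Chevalley's extension theorem: a subring maximal among those that meet [K] in
    [OK] is a valuation ring. *)
Section Chevalley.
Variables (T : fieldType) (K OK : set T).
Hypothesis hK : subfield K.
Hypothesis OK_K : OK `<=` K.
Hypothesis hOK : subring OK.
Hypothesis OK_total : forall x, K x -> OK x \/ OK x^-1.

Definition kmax m : Prop := K m /\ (m = 0 \/ ~ OK m^-1).
(** The ideal of A generated by the maximal ideal of OK. A single product is enough, since of two
    elements of K one divides the other in OK. *)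
Definition imax (A : set T) : set T := [set x | exists m a, [/\ kmax m, A a & x = m * a]].
Definition overring (A : set T) : Prop := [/\ subring A, OK `<=` A & A `&` K `<=` OK].

Lemma imaxM A a x : subring A -> A a -> imax A x -> imax A (a * x).
Proof. by move=> hA Aa [m [b [hm Ab ->]]]; exists m, (a * b); split; [|exact: srM|rewrite mulrCA]. Qed.

Lemma imaxD A x y : subring A -> OK `<=` A -> imax A x -> imax A y -> imax A (x + y).
Proof.
move=> hA OKA; have aux m m' a a' : kmax m -> kmax m' -> A a -> A a' -> OK (m / m') ->
    imax A (m * a + m' * a').
  move=> hm hm' Aa Aa' mm; have [m0|m0] := eqVneq m' 0.
    by exists m, a; rewrite m0 mul0r addr0.
  exists m', (m / m' * a + a'); split=> //; last by field.
  by apply: (srD hA) => //; apply: (srM hA) => //; exact: OKA.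
move=> [m [a [hm Aa ->]]] [m' [a' [hm' Aa' ->]]].
have [h|h] := OK_total (sf_div hK hm.1 hm'.1); first exact: aux.
by rewrite addrC; apply: aux; rewrite // -invf_div.
Qed.

Lemma imaxN A x : subring A -> imax A x -> imax A (- x).
Proof. by move=> hA hx; rewrite -mulN1r; apply: imaxM => //; apply: (srN hA); exact: sr1. Qed.

Lemma imax_sub A x : OK `<=` A -> subring A -> imax A x -> A x.
Proof.
move=> OKA hA [m [a [[Km hm] Aa ->]]]; apply: (srM hA) => //; apply: OKA.
by case: hm => [->|nm]; [exact: sr0 | case: (OK_total Km)].
Qed.

Lemma overringP A : subring A -> OK `<=` A -> overring A <-> ~ imax A 1.
Proof.
move=> hA OKA; split.
  move=> [_ _ AK] [m [a [[Km hm] Aa E]]].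
  have m0 : m != 0 by apply: contra_eqN E => /eqP ->; rewrite mul0r oner_neq0.
  have aE : a = m^-1 by apply: (mulfI m0); rewrite -E mulfV.
  case: hm => [/eqP|]; rewrite ?(negPf m0) // -aE; apply; apply: AK; split=> //.
  by rewrite aE; exact: sfV.
move=> n1; split=> // y [Ay Ky]; apply: contrapT => nOy; apply: n1.
have y0 : y != 0 by apply: contra_notN nOy => /eqP ->; exact: sr0.
exists y^-1, y; rewrite mulVf //; split=> //; split; first exact: sfV.
by right; rewrite invrK.
Qed.

Section Maximal.
Variable A : set T.
Hypothesis hA : overring A.
Hypothesis maxA : forall B, overring B -> A `<=` B -> B = A.
Let sA : subring A. Proof. by case: hA. Qed.
Let OKA : OK `<=` A. Proof. by case: hA. Qed.
Let nA1 : ~ imax A 1. Proof. by apply/overringP. Qed.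

(** Inverting 1 - a enlarges A without making the ideal trivial, because powers of 1 - a are 1
    modulo the ideal; by maximality nothing was added. *)
Lemma imax_unit a : imax A a -> A (1 - a)^-1.
Proof.
move=> ma; set u := 1 - a.
have u0 : u != 0.
  by apply: contra_notN nA1; rewrite subr_eq0 => /eqP ->.
have un n : imax A (1 - u ^+ n).
  elim: n => [|n IH].
    rewrite expr0 subrr; exists 0, 1; rewrite mul0r; split=> //; last exact: sr1.
    by split; [exact: (sf0 hK) | left].
  rewrite exprS (_ : 1 - _ = (1 - u ^+ n) + a * u ^+ n); last by rewrite /u; ring.
  apply: imaxD => //; rewrite mulrC; apply: imaxM => //; apply: (srX sA).
  by apply: (srB sA); [exact: sr1 | exact: imax_sub].
pose B : set T := [set x | exists n b, A b /\ x = b / u ^+ n].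
have AB : A `<=` B by move=> b Ab; exists 0%N, b; rewrite expr0 divr1.
have Au : A u by apply: (srB sA); [exact: sr1 | exact: imax_sub].
have hB : subring B.
  apply: mk_subring; first by apply: AB; exact: sr1.
    move=> _ _ [n [b [Ab ->]]] [m [c [Ac ->]]]; exists (n + m)%N, (b * u ^+ m - c * u ^+ n).
    split; first by apply: (srB sA); apply: (srM sA) => //; exact: srX.
    by rewrite exprD; field; rewrite !expf_neq0.
  move=> _ _ [n [b [Ab ->]]] [m [c [Ac ->]]]; exists (n + m)%N, (b * c).
  split; first exact: (srM sA).
  by rewrite exprD; field; rewrite !expf_neq0.
have <- : B = A; last by exists 1%N, 1; rewrite expr1 div1r; split=> //; exact: sr1.
apply: maxA => //.
apply/overringP => //; first exact: subset_trans OKA AB.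
move=> [m [_ [hm [n [b [Ab ->]]] E]]]; apply: nA1.
have uE : u ^+ n = m * b by rewrite -[LHS]mul1r {1}E -mulrA divfK ?expf_neq0.
have -> : 1 = (1 - u ^+ n) + m * b by rewrite -uE subrK.
by apply: imaxD => //; exists m, b.
Qed.

(** A relation 1 = p(x) with coefficients in the ideal is the obstruction to adjoining x to A. *)
Let reach x (p : {poly T}) := (forall i, imax A p`_i) /\ p.[x] = 1.

Lemma reach_ex x : ~ A x -> exists p, reach x p.
Proof.
move=> nAx; pose B : set T := [set y | exists p : {poly T}, (forall i, A p`_i) /\ y = p.[x]].
have AB : A `<=` B.
  move=> b Ab; exists b%:P; rewrite hornerC; split=> // i; rewrite coefC.
  by case: eqP => // _; exact: sr0.
have hB : subring B.
  apply: mk_subring; first by apply: AB; exact: sr1.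
    move=> _ _ [p [Ap ->]] [q [Aq ->]]; exists (p - q); rewrite hornerD hornerN; split=> // i.
    by rewrite coefB; exact: srB.
  move=> _ _ [p [Ap ->]] [q [Aq ->]]; exists (p * q); rewrite hornerM; split=> // i.
  rewrite coefM; elim/big_ind: _ => [|? ?|j _]; [exact: sr0 | exact: srD | exact: srM].
have Bx : B x.
  exists 'X; rewrite hornerX; split=> // i; rewrite coefX.
  by case: eqP => _; [exact: sr1 | exact: sr0].
have : imax B 1.
  apply: contrapT => n1; apply: nAx; have <- // : B = A; apply: maxA => //.
  by apply/overringP => //; exact: subset_trans AB.
move=> [m [_ [hm [p [Ap ->]] E]]]; exists (m *: p); split; last by rewrite hornerZ.
by move=> i; rewrite coefZ; exists m, p`_i.
Qed.

(** The relation q for 1/x, in which 1 - q(0) can be inverted, expresses the top power of x by lower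
    ones. Substitution into p shortens p. *)
Lemma reach_step x p q : reach x p -> reach x^-1 q -> (size q <= size p)%N ->
  exists p', reach x p' /\ (size p' < size p)%N.
Proof.
move=> [pA p1] [qA q1] qp.
have x0 : x != 0.
  apply/eqP => x0; apply: nA1; rewrite -p1 x0 horner_coef0; exact: pA.
have sp : (1 < size p)%N.
  rewrite ltnNge; apply/negP => /size1_polyC E; apply: nA1.
  by rewrite -p1 E hornerC; exact: pA.
case Ep : (size p) sp qp => [|[|n]] // _ qp.
pose c := p`_n.+1; pose w := (1 - q`_0)^-1.
have Aw : A w by exact: imax_unit.
have w0 : 1 - q`_0 != 0 by apply: contra_notN nA1; rewrite subr_eq0 => /eqP ->.
pose s := \sum_(j < n.+1) (c * q`_j.+1 * w) *: 'X^(n - j).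
exists (p - c *: 'X^(n.+1) + s); split; last first.
  rewrite ltnS (leq_trans (size_polyD _ _)) // geq_max; apply/andP; split.
    apply/leq_sizeP => i; rewrite leq_eqVlt => /orP[/eqP <-|lt].
      by rewrite coefB coefZ coefXn eqxx mulr1 subrr.
    by rewrite coefB coefZ coefXn gtn_eqF // mulr0 subr0 nth_default // Ep.
  apply: (leq_trans (size_sum _ _ _)); apply/bigmax_leqP => j _.
  by rewrite (leq_trans (size_scale_leq _ _)) // size_polyXn ltnS leq_subr.
have cA : imax A c by exact: pA.
split.
  move=> i; rewrite coefD; apply: imaxD => //.
    rewrite coefB; apply: imaxD => //; apply: imaxN => //.
    rewrite coefZ mulrC; apply: imaxM => //; rewrite coefXn; case: eqP => _; [exact: sr1 | exact: sr0].
  rewrite coef_sum; elim/big_ind: _ => [||j _].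
  - exists 0, 1; rewrite mul0r; split=> //; last exact: sr1.
    by split; [exact: (sf0 hK) | left].
  - by move=> *; exact: imaxD.
  rewrite coefZ -!mulrA mulrC; apply: imaxM => //; rewrite !mulrA; apply: (srM sA).
    by apply: (srM sA) => //; apply: imax_sub => //; exact: qA.
  by rewrite coefXn; case: eqP => _; [exact: sr1 | exact: sr0].
rewrite !hornerD hornerN p1 hornerZ hornerXn.
suff -> : s.[x] = c * x ^+ n.+1 by rewrite subrK.
have qE : \sum_(j < n.+1) q`_j.+1 * x^-1 ^+ j.+1 = 1 - q`_0.
  rewrite -q1 (horner_coef_wide _ qp) [in RHS]big_ord_recl expr0 mulr1 addrC addKr.
  by apply: eq_bigr.
rewrite /s horner_sum; under eq_bigr do rewrite hornerZ hornerXn.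
transitivity (c * w * x ^+ n.+1 * \sum_(j < n.+1) q`_j.+1 * x^-1 ^+ j.+1).
  rewrite mulr_sumr; apply: eq_bigr => j _.
  have -> : x ^+ n.+1 = x ^+ (n - j) * x ^+ j.+1 by rewrite -exprD -subSS subnK // ltnS -ltnS.
  by rewrite exprVn; field; rewrite expf_neq0.
by rewrite qE /w; field; rewrite w0.
Qed.

(** If neither x nor 1/x lies in A, both admit relations; of two relations of minimal length the
    longer one can be shortened. *)
Lemma maximal_vring : vring A.
Proof.
split=> // x; apply: contrapT => /not_orP[nx nx'].
have min y : ~ A y -> exists p, reach y p /\ forall q, reach y q -> (size p <= size q)%N.
  move=> /reach_ex[p hp]; have [_ [p0 h0 <-] m0] := @ex_min_nat
    (fun n => exists2 p, reach y p & size p = n) (ex_intro _ _ (ex_intro2 _ _ p hp erefl)).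
  by exists p0; split=> // q hq; apply: m0; exists q.
have [p [hp minp]] := min x nx; have [q [hq minq]] := min x^-1 nx'.
have [le|lt] := leqP (size q) (size p).
  by have [p' [/minp h]] := reach_step hp hq le; rewrite ltnNge h.
rewrite -[x]invrK in hp; have [q' [/minq h]] := reach_step hq hp (ltnW lt).
by rewrite ltnNge h.
Qed.
End Maximal.

Lemma chevalley : exists O, vring O /\ forall x, K x -> (O x <-> OK x).
Proof.
have [||A [hA _ maxA]] := @Zorn_above _ overring OK.
- by split=> // x [].
- move=> C CP [X0 CX0] Ctot.
  have two u v : (\bigcup_(X in C) X) u -> (\bigcup_(X in C) X) v ->
      exists X, [/\ C X, X u & X v].
    move=> [X CX Xu] [Y CY Yv]; have [XY|YX] := Ctot _ _ CX CY.
      by exists Y; split=> //; exact: XY.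
    by exists X; split=> //; exact: YX.
  split.
  + apply: mk_subring.
    * by exists X0 => //; case: (CP _ CX0) => h _ _; exact: sr1.
    * move=> u v /two h /h[X [CX Xu Xv]]; exists X => //.
      by case: (CP _ CX) => hX _ _; exact: srB.
    * move=> u v /two h /h[X [CX Xu Xv]]; exists X => //.
      by case: (CP _ CX) => hX _ _; exact: srM.
  + by move=> x OKx; exists X0 => //; case: (CP _ CX0) => _ h _; exact: h.
  + by move=> x [[X CX Xx] Kx]; case: (CP _ CX) => _ _; apply.
exists A; split; first exact: maximal_vring.
by move=> x Kx; case: hA => _ OKA AK; split; [move=> Ax; exact: AK | exact: OKA].
Qed.

End Chevalley.

(** * Balls and finite-dimensional spaces over a complete field *)

Section Balls.
Variables (T : fieldType) (O : set T) (pi : T).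
Hypothesis hO : vring O.
Hypothesis r1 : rank1 O setT pi.

Definition ball (n : nat) : set T := [set x | O (x / pi ^+ n)].

Lemma pi_neq0 : pi != 0. Proof. by case: r1. Qed.
Lemma piX_neq0 n : pi ^+ n != 0. Proof. by rewrite expf_neq0 // pi_neq0. Qed.
Lemma pi_O : O pi. Proof. by apply: vm_O => //; case: r1. Qed.
Lemma piX_O n : O (pi ^+ n). Proof. by apply: vOX => //; exact: pi_O. Qed.

Lemma ballE n x : ball n x <-> O (x / pi ^+ n). Proof. by []. Qed.
Lemma ball_O0 x : ball 0 x <-> O x. Proof. by rewrite /ball /= expr0 divr1. Qed.
Lemma ball0 n : ball n 0. Proof. by rewrite /ball /= mul0r; exact: vO0. Qed.
Lemma ballB n x y : ball n x -> ball n y -> ball n (x - y).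
Proof. by rewrite /ball /= mulrBl; exact: vOB. Qed.
Lemma ballD n x y : ball n x -> ball n y -> ball n (x + y).
Proof. by rewrite /ball /= mulrDl; exact: vOD. Qed.
Lemma ballN n x : ball n x -> ball n (- x).
Proof. by rewrite /ball /= mulNr; exact: vON. Qed.
Lemma ballM m n x y : ball m x -> ball n y -> ball (m + n) (x * y).
Proof. by rewrite /ball /= exprD invfM mulrACA; exact: vOM. Qed.
Lemma ballMl n a x : O a -> ball n x -> ball n (a * x).
Proof. by move=> /ball_O0 Oa; exact: ballM Oa. Qed.
Lemma ballMr n a x : O a -> ball n x -> ball n (x * a).
Proof. by rewrite mulrC; exact: ballMl. Qed.
Lemma ball_pi n : ball n (pi ^+ n).
Proof. by rewrite /ball /= mulfV ?piX_neq0 //; exact: vO1. Qed.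
Lemma ball_le m n x : (m <= n)%N -> ball n x -> ball m x.
Proof.
move=> mn; rewrite /ball /= => h.
have -> : x / pi ^+ m = pi ^+ (n - m) * (x / pi ^+ n).
  rewrite -(subnK mn) exprD addnK; have := piX_neq0 m; have := piX_neq0 (n - m).
  by move: (pi ^+ m) (pi ^+ (n - m)) => a b a0 b0; field; rewrite a0 b0.
by apply: vOM => //; exact: piX_O.
Qed.
Lemma ball_O n x : ball n x -> O x.
Proof. by move=> h; apply/ball_O0; apply: ball_le h. Qed.
Lemma ball_sum n (I : Type) (r : seq I) (P : pred I) (F : I -> T) :
  (forall i, P i -> ball n (F i)) -> ball n (\sum_(i <- r | P i) F i).
Proof. by move=> h; elim/big_ind: _ => //; [exact: ball0 | exact: ballD]. Qed.
Lemma ball_shift m n x : ball (m + n) (pi ^+ m * x) <-> ball n x.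
Proof.
rewrite /ball /= exprD invfM mulrACA mulfV ?piX_neq0 // mul1r; split=> //.
Qed.
Lemma ball_div m n x : ball (m + n) x <-> ball n (x / pi ^+ m).
Proof. by rewrite -(ball_shift m n) mulrC divfK ?piX_neq0. Qed.
Lemma ball_subr n x y : ball n (x - y) <-> ball n (y - x).
Proof. by split=> h; rewrite -opprB; exact: ballN. Qed.
Lemma ball_tri n x y z : ball n (x - y) -> ball n (y - z) -> ball n (x - z).
Proof. by move=> h h'; have := ballD h h'; rewrite addrA subrK. Qed.

Lemma bounded x : exists n, O (pi ^+ n * x).
Proof.
have [->|x0] := eqVneq x 0; first by exists 0%N; rewrite mulr0; exact: vO0.
have xV0 : x^-1 != 0 by rewrite invr_eq0.
case: r1 => _ _ _ cof _; have [n] := cof x^-1 I xV0; rewrite invrK; by exists n.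
Qed.
Lemma bounded_seq (s : seq T) : exists n, {in s, forall x, O (pi ^+ n * x)}.
Proof.
elim: s => [|x s [n hn]]; first by exists 0%N.
have [m hm] := bounded x; exists (m + n)%N => y; rewrite inE exprD => /orP[/eqP ->|/hn h].
  by rewrite mulrAC mulrC; apply: vOM => //; exact: piX_O.
by rewrite -mulrA; apply: vOM => //; exact: piX_O.
Qed.
Lemma ball_vm n x : ball n.+1 x -> vm O x.
Proof.
move=> h; rewrite -(divfK (piX_neq0 n.+1) x); apply: vm_mul => //.
by apply: exp_vm => //; case: r1.
Qed.
Lemma separated x : (forall n, ball n x) -> x = 0.
Proof.
move=> h; apply/eqP; apply: contraT => x0.
case: r1 => _ _ mpi cof _; have [n hn] := cof x I x0.
have := ball_vm (h n.+1); exfalso.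
have : vm O 1; last exact: vm1.
have := h n.+1; rewrite /ball /= exprS => h1.
have -> : 1 = (pi ^+ n / x) * (x / (pi * pi ^+ n)) * pi.
  by have := piX_neq0 n; move: (pi ^+ n) => a a0; field; rewrite a0 x0 pi_neq0.
by apply: vm_mul => //; exact: vOM.
Qed.
Lemma small_elt x : x != 0 -> exists n, forall y, ball n y -> O (y / x).
Proof.
move=> x0; case: r1 => _ _ _ cof _; have [n hn] := cof x I x0.
exists n => y hy; have := vOM hO hn hy; rewrite mulrC mulrA divfK ?piX_neq0 //.
Qed.

(** Completeness of the subset [K], tested on geometrically convergent sequences. *)
Definition gcomplete (K : set T) : Prop :=
  forall u : nat -> T, (forall k, K (u k)) -> (forall k, ball k (u k.+1 - u k)) ->
  exists2 x, K x & forall k, ball k (x - u k).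

Section FiniteDim.
Variable K : set T.
Hypothesis hK : subfield K.
Hypothesis Kpi : K pi.
Hypothesis Kc : gcomplete K.

Fixpoint kspan (e : seq T) (x : T) : Prop :=
  if e is y :: e' then exists2 a, K a & kspan e' (x - a * y) else x = 0.

Fixpoint ospan (e : seq T) (x : T) : Prop :=
  if e is y :: e' then exists2 a, K a /\ O a & ospan e' (x - a * y) else x = 0.

Lemma kspan0 e : kspan e 0.
Proof. by elim: e => //= y e IH; exists 0; [exact: (sf0 hK) | rewrite mul0r subr0]. Qed.
Lemma kspanB e x y : kspan e x -> kspan e y -> kspan e (x - y).
Proof.
elim: e x y => [|z e IH] x y /= => [-> ->|[a Ka ha] [b Kb hb]]; first by rewrite subrr.
exists (a - b); first exact: (sfB hK).
by have := IH _ _ ha hb; congr (kspan e _); ring.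
Qed.
Lemma kspanZ e a x : K a -> kspan e x -> kspan e (a * x).
Proof.
move=> Ka; elim: e x => [|z e IH] x /= => [->|[b Kb hb]]; first by rewrite mulr0.
exists (a * b); first exact: (sfM hK).
by have := IH _ hb; congr (kspan e _); ring.
Qed.
Lemma kspanN e x : kspan e x -> kspan e (- x).
Proof. by move=> h; rewrite -sub0r; apply: kspanB => //; exact: kspan0. Qed.
Lemma kspanD e x y : kspan e x -> kspan e y -> kspan e (x + y).
Proof. by move=> hx hy; rewrite -[y]opprK; apply: kspanB => //; exact: kspanN. Qed.
Lemma kspan_cons e y x : kspan e x -> kspan (y :: e) x.
Proof. by move=> h; exists 0; [exact: (sf0 hK) | rewrite mul0r subr0]. Qed.
Lemma kspan_mem e x : x \in e -> kspan e x.
Proof.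
elim: e => //= y e IH; rewrite inE => /orP[/eqP ->|/IH h].
  by exists 1; [exact: (sf1 hK) | rewrite mul1r subrr; exact: kspan0].
exact: kspan_cons.
Qed.
Lemma kspan_sum e n (a f : 'I_n -> T) : (forall i, K (a i)) -> (forall i, f i \in e) ->
  kspan e (\sum_i a i * f i).
Proof.
move=> Ka fe; elim/big_ind: _ => [|x y hx hy|i _]; first exact: kspan0.
  exact: kspanD.
by apply: kspanZ => //; exact: kspan_mem.
Qed.

(** Integral coefficients of the increments sum to convergent series of coefficients in K. The
    constant M absorbs the sizes of the generators, which need not be integral. *)
Lemma span_limit e (v : nat -> T) : kspan e (v 0%N) ->
  (forall n, ospan e ((v n.+1 - v n) / pi ^+ n)) ->
  exists w M, kspan e w /\ forall n, ball n (pi ^+ M * (w - v n)).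
Proof.
elim: e v => [|y e IH] v /=.
  move=> v0 vn; exists 0, 0%N; split=> // n; rewrite expr0 mul1r.
  suff -> : v n = 0 by rewrite subrr; exact: ball0.
  elim: n => // n vn0; have /eqP := vn n; rewrite vn0 subr0 mulf_eq0 invr_eq0.
  by rewrite (negPf (piX_neq0 n)) orbF => /eqP.
move=> [a0 Ka0 h0] vn.
have [d dP] : exists d : nat -> T, forall n, [/\ K (d n), O (d n) &
    ospan e ((v n.+1 - v n) / pi ^+ n - d n * y)].
  have [|d dP] := @choice nat T (fun n d => [/\ K d, O d & ospan e ((v n.+1 - v n) / pi ^+ n - d * y)]).
    by move=> n; have [a [Ka Oa] h] := vn n; exists a.
  by exists d.
pose a := fix a n := if n is m.+1 then a m + pi ^+ m * d m else a0.
have Ka n : K (a n).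
  elim: n => //= n IHn; have [Kd _ _] := dP n.
  by apply: (sfD hK) => //; apply: (sfM hK) => //; exact: (sfX hK).
have [|A KA hA] := Kc Ka.
  move=> n /=; rewrite addrC addKr -{1}[n]addn0; apply/ball_shift/ball_O0.
  by have [] := dP n.
have [||w [M [hw hM]]] := IH (fun n => v n - a n * y).
- by [].
- move=> n /=; have [_ _ h] := dP n; congr (ospan e _): h.
  by have := piX_neq0 n; move: (pi ^+ n) => z z0; field.
have [My hMy] := bounded y.
exists (w + A * y), (M + My)%N; split.
  exists A => //; by rewrite addrK.
move=> n; have -> : pi ^+ (M + My) * (w + A * y - v n) =
    pi ^+ My * (pi ^+ M * (w - (v n - a n * y))) + pi ^+ M * ((pi ^+ My * y) * (A - a n)).
  by rewrite exprD; ring.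
apply: ballD; first by apply: ballMl => //; exact: piX_O.
by apply: ballMl; [exact: piX_O | apply: ballMl].
Qed.

Lemma span_closed_of e N : (forall x, kspan e x -> ball N x -> ospan e x) ->
  forall x, (forall n, exists2 v, kspan e v & ball n (x - v)) -> kspan e x.
Proof.
move=> hN x hx.
have [v vP] : exists v : nat -> T, forall n, kspan e (v n) /\ ball (n + N) (x - v n).
  have [|v vP] := @choice nat T (fun n v => kspan e v /\ ball (n + N) (x - v)).
    by move=> n; have [v ? ?] := hx (n + N)%N; exists v.
  by exists v.
have [||w [M [hw hM]]] := @span_limit e v.
- by have [] := vP 0%N.
- move=> n; have [s1 b1] := vP n; have [s2 b2] := vP n.+1; apply: hN.
    by rewrite mulrC; apply: kspanZ; [exact/(sfV hK)/(sfX hK) | exact: kspanB].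
  apply/ball_div; rewrite (_ : _ - _ = (x - v n) - (x - v n.+1)); last by ring.
  by apply: ballB => //; apply: ball_le b2; rewrite leq_add2r.
suff -> : x = w by [].
apply/eqP; rewrite -subr_eq0; apply/eqP/separated => n.
apply/(ball_shift M).
rewrite (_ : x - w = (x - v (M + n)%N) - (w - v (M + n)%N)); last by ring.
rewrite mulrBr; apply: ballB; last exact: hM.
apply: ballMl; first exact: piX_O.
by have [_ h] := vP (M + n)%N; apply: ball_le h; rewrite leq_addr.
Qed.

(** On a finite span, small vectors have integral coordinates. By induction the span of the
    remaining generators is closed, so a new generator outside it stays at positive distance from
    it, which bounds its coefficient. *)
Lemma span_bounded e : exists N, forall x, kspan e x -> ball N x -> ospan e x.
Proof.
elim: e => [|y e [N hN]] /=; first by exists 0%N.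
have [ye|nye] := pselect (kspan e y).
  exists N => x [a Ka h] bx; exists 0; first by split; [exact: (sf0 hK) | exact: vO0].
  rewrite mul0r subr0; apply: hN => //.
  by rewrite -(subrK (a * y) x); apply: kspanD => //; exact: kspanZ.
have [n0 hn0] : exists n0, forall v, kspan e v -> ~ ball n0 (y - v).
  apply: contrapT => H; apply: nye; apply: (span_closed_of hN) => n.
  apply: contrapT => H'; apply: H; exists n => v ev bv; apply: H'; by exists v.
have [M hM] := bounded y.
exists ((N + M) + n0)%N => x [a Ka h] bx.
have Oa : O (a / pi ^+ (N + M)).
  have [//|Oi] := vO_total hO (a / pi ^+ (N + M)).
  have [a00|a00] := eqVneq a 0; first by rewrite a00 mul0r; exact: vO0.
  exfalso; apply: (hn0 (- (a^-1 * (x - a * y)))).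
    by apply: kspanN; apply: kspanZ => //; exact: (sfV hK).
  have -> : y - - (a^-1 * (x - a * y)) = (a / pi ^+ (N + M))^-1 * (x / pi ^+ (N + M)).
    have := piX_neq0 (N + M); move: (pi ^+ (N + M)) => z z0.
    by field; rewrite a00 z0.
  by apply: ballMl => //; apply/ball_div.
exists a; first by split=> //; apply: (@ball_O (N + M)).
apply: hN => //; apply: ballB; first by apply: ball_le bx; rewrite -addnA leq_addr.
have -> : a * y = (a / pi ^+ (N + M)) * (pi ^+ N * (pi ^+ M * y)).
  rewrite [pi ^+ N * _]mulrA -exprD; have := piX_neq0 (N + M); move: (pi ^+ (N + M)) => z z0.
  by field.
apply: ballMl => //; rewrite -[X in ball X]addn0; apply/ball_shift/ball_O0.
exact: hM.
Qed.

Lemma span_closed e x :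
  (forall n, exists2 v, kspan e v & ball n (x - v)) -> kspan e x.
Proof. by have [N hN] := span_bounded e; exact: span_closed_of hN x. Qed.

End FiniteDim.
End Balls.

(** A complete field of rank one has at most one extension of its valuation ring to
    an algebraic extension, since both define the same topology on finite subspaces. *)
Lemma vring_unique (T : fieldType) (K O1 O2 : set T) pi : subfield K -> K pi ->
  vring O1 -> vring O2 -> rank1 O1 setT pi -> rank1 O2 setT pi ->
  (forall x, K x -> O1 x <-> O2 x) -> gcomplete O2 pi K ->
  (forall x, algebraic_over K x) -> O1 `<=` O2.
Proof.
move=> hK Kpi h1 h2 r1 r2 K12 Kc Kalg x O1x; apply: contrapT => nO2x.
have x0 : x != 0 by apply: contra_notN nO2x => /eqP ->; exact: vO0.
pose y := x^-1; have my : vm O2 y by right; rewrite invrK.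
have [|n [e eP]] := @adjoin_finite _ K hK [:: y].
  by move=> z _; exact: Kalg.
pose es := [seq e i | i <- enum 'I_n].
have yspan k : kspan K es (y ^+ k).
  have [|a Ka ->] := eP (y ^+ k).
    apply: (sfX (adjoin_subfield _ _)); apply: sub_adjoin_r; exact: mem_head.
  by apply: kspan_sum => // i; apply: map_f; rewrite mem_enum.
have [N hN] := span_bounded h2 r2 hK Kpi Kc es.
have [M hM] := bounded_seq h1 r1 es.
have [_ _ _ _ arch] := r2; have [n0 hn0] := arch y I my.
have bn k : ball O2 pi k (y ^+ (n0 * k)).
  by rewrite /ball /= exprM -expr_div_n; exact: vOX.
(* A high power of y is so small for O2 that even its quotient by pi^(M+1) has integral coordinates
   over K, on which both rings agree. So that power of y lies in pi O1, although 1/y is in O1. *)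
have osp : ospan O2 K es (y ^+ (n0 * (M.+1 + N)) / pi ^+ M.+1).
  apply: hN; first by rewrite mulrC; apply: kspanZ => //; exact/(sfV hK)/(sfX hK).
  by apply/(ball_div r2); exact: bn.
have conv s z : {subset s <= es} -> ospan O2 K s z -> O1 (pi ^+ M * z).
  elim: s z => [|w s IH] z sub /=; first by move=> ->; rewrite mulr0; exact: vO0.
  move=> [a [Ka Oa] h]; rewrite -(subrK (a * w) z) mulrDr; apply: vOD => //.
    by apply: IH => // u us; apply: sub; rewrite inE us orbT.
  by rewrite mulrCA; apply: vOM => //; [apply/K12 | apply: hM; apply: sub; rewrite mem_head].
have := conv es _ (fun _ => id) osp => Oz.
have : vm O1 (y ^+ (n0 * (M.+1 + N))).
  have -> : y ^+ (n0 * (M.+1 + N)) = pi ^+ M * (y ^+ (n0 * (M.+1 + N)) / pi ^+ M.+1) * pi.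
    rewrite [pi ^+ M.+1]exprSr; have := piX_neq0 r1 M; move: (pi ^+ M) => z z0.
    by field; rewrite z0 (pi_neq0 r1).
  by apply: vm_mul => //; case: r1.
move/(vm_X h1) => [/eqP|]; first by rewrite invr_eq0 (negPf x0).
by rewrite invrK.
Qed.

(** * Completion of a field by Cauchy sequences *)

Section Completion.
Variables (T : fieldType) (O : set T) (pi : T).
Hypothesis hO : vring O.
Hypothesis r1 : rank1 O setT pi.
Local Notation Ball := (ball O pi).
Implicit Types u v w : nat -> T.

Definition null u := forall k, exists N, forall n, (N <= n)%N -> Ball k (u n).
Definition cauchy u := forall k, exists N, forall m n, (N <= m)%N -> (N <= n)%N -> Ball k (u m - u n).
Definition ceqv u v := null (fun n => u n - v n).

Lemma nullB u v : null u -> null v -> null (fun n => u n - v n).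
Proof.
move=> nu nv k; have [N hN] := nu k; have [M hM] := nv k.
by exists (maxn N M) => n; rewrite geq_max => /andP[/hN ? /hM ?]; exact: ballB.
Qed.
Lemma null_eq u v : u =1 v -> null u -> null v.
Proof. by move=> uv nu k; have [N hN] := nu k; exists N => n /hN; rewrite uv. Qed.
Lemma null0 : null (fun _ => 0). Proof. by move=> k; exists 0%N => n _; exact: ball0. Qed.
Lemma ceqv_refl u : ceqv u u.
Proof. by apply: null_eq null0 => n; rewrite subrr. Qed.
Lemma ceqv_sym u v : ceqv u v -> ceqv v u.
Proof. by move=> h; apply: null_eq (nullB null0 h) => n; rewrite sub0r opprB. Qed.
Lemma ceqv_trans u v w : ceqv u v -> ceqv v w -> ceqv u w.
Proof.
move=> h /ceqv_sym h'; apply: null_eq (nullB h h') => n.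
by rewrite opprB addrA subrK.
Qed.

Lemma cauchy_cst c : cauchy (fun _ => c).
Proof. by move=> k; exists 0%N => m n _ _; rewrite subrr; exact: ball0. Qed.
Lemma cauchyB u v : cauchy u -> cauchy v -> cauchy (fun n => u n - v n).
Proof.
move=> cu cv k; have [N hN] := cu k; have [M hM] := cv k; exists (maxn N M) => m n.
rewrite !geq_max => /andP[Nm Mm] /andP[Nn Mn].
have -> : u m - v m - (u n - v n) = (u m - u n) - (v m - v n) by ring.
by apply: (ballB hO); auto.
Qed.
Lemma cauchy_bounded u : cauchy u -> exists k N, forall n, (N <= n)%N -> O (pi ^+ k * u n).
Proof.
move=> cu; have [N hN] := cu 0%N; have [k hk] := bounded hO r1 (u N).
exists k, N => n Nn; rewrite -(subrK (u N) (u n)) mulrDr; apply: vOD => //.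
by apply: vOM => //; [exact: piX_O | exact/(ball_O0 O pi)/hN].
Qed.
Lemma null_mul u v : cauchy u -> null v -> null (fun n => u n * v n).
Proof.
move=> /cauchy_bounded[k [N hN]] nv j; have [M hM] := nv (k + j)%N.
exists (maxn N M) => n; rewrite geq_max => /andP[/hN h /hM]; rewrite addnC => h'.
have -> : u n * v n = (pi ^+ k * u n) * (v n / pi ^+ k).
  by have := piX_neq0 r1 k; move: (pi ^+ k) => z z0; field.
by apply: (ballMl hO) => //; apply/(ball_div r1); rewrite addnC.
Qed.
Lemma cauchyM u v : cauchy u -> cauchy v -> cauchy (fun n => u n * v n).
Proof.
move=> cu cv j; have [k1 [N1 h1]] := cauchy_bounded cu; have [k2 [N2 h2]] := cauchy_bounded cv.
have [M1 g1] := cu (k2 + j)%N; have [M2 g2] := cv (k1 + j)%N.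
exists (maxn (maxn N1 N2) (maxn M1 M2)) => m n; rewrite !geq_max.
move=> /andP[/andP[a1 a2] /andP[a3 a4]] /andP[/andP[b1 b2] /andP[b3 b4]].
have -> : u m * v m - u n * v n = (pi ^+ k1 * u m) * ((v m - v n) / pi ^+ k1)
   + (pi ^+ k2 * v n) * ((u m - u n) / pi ^+ k2).
  have := piX_neq0 r1 k1; have := piX_neq0 r1 k2.
  by move: (pi ^+ k1) (pi ^+ k2) => y z y0 z0; field; rewrite y0 z0.
apply: (ballD hO) => //.
  by apply: (ballMl hO); auto; apply/(ball_div r1); auto.
by apply: (ballMl hO); auto; apply/(ball_div r1); auto.
Qed.
Lemma cauchy_nonnull u : cauchy u -> ~ null u ->
  exists k N, forall n, (N <= n)%N -> ~ Ball k (u n).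
Proof.
move=> cu nu; apply: contrapT => H; apply: nu => k; have [N hN] := cu k.
have [n Nn bn] : exists2 n, (N <= n)%N & Ball k (u n).
  apply: contrapT => H'; apply: H; exists k, N => n Nn bn; apply: H'; by exists n.
exists N => m Nm; rewrite -(subrK (u n) (u m)); apply: (ballD hO) => //; exact: hN.
Qed.
Lemma nball_inv k x : ~ Ball k x -> x != 0 /\ O (pi ^+ k / x).
Proof.
move=> nb; split; first by apply: contra_notN nb => /eqP ->; exact: ball0.
by case: (vO_total hO (x / pi ^+ k)) => [//|]; rewrite invf_div.
Qed.
Lemma cauchyV u : cauchy u -> ~ null u -> cauchy (fun n => (u n)^-1).
Proof.
move=> cu nu; have [k [N hN]] := cauchy_nonnull cu nu.
move=> j; have [M hM] := cu ((k + k) + j)%N; exists (maxn N M) => m n.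
rewrite !geq_max => /andP[/hN/nball_inv[um hm] Mm] /andP[/hN/nball_inv[un hn] Mn].
have -> : (u m)^-1 - (u n)^-1 = ((pi ^+ k / u m) * (pi ^+ k / u n)) * ((u n - u m) / pi ^+ (k + k)).
  rewrite exprD; have := piX_neq0 r1 k; move: (pi ^+ k) => z z0.
  by field; rewrite z0 um un.
by apply: (ballMl hO); [exact: vOM | apply/(ball_div r1)/hM].
Qed.
Lemma null_cauchy u v : cauchy u -> ceqv u v -> cauchy v.
Proof.
move=> cu uv k; have [N hN] := cu k; have [M hM] := uv k; exists (maxn N M) => m n.
rewrite !geq_max => /andP[Nm Mm] /andP[Nn Mn].
have -> : v m - v n = (u m - u n) - ((u m - v m) - (u n - v n)) by ring.
by apply: (ballB hO); auto; apply: (ballB hO); auto.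
Qed.

(** A chosen representative of each class modulo null sequences. The completion then consists of the
    canonical Cauchy sequences, and no quotient type has to be formed. *)
Definition canon u : nat -> T := xget (fun _ => 0) [set v | ceqv u v].
Lemma canonP u : ceqv u (canon u).
Proof. by rewrite /canon; case: xgetP => [v _ //|/(_ u)[]]; exact: ceqv_refl. Qed.
Lemma canon_eq u v : ceqv u v -> canon u = canon v.
Proof.
move=> uv; rewrite /canon; congr (xget _ _); apply/seteqP; split=> w /=.
  exact/ceqv_trans/ceqv_sym.
exact: ceqv_trans.
Qed.

Record cpl := Cpl { cval : nat -> T; cvalP : cauchy cval /\ canon cval = cval }.

Fact mkcpl_subproof u : cauchy u -> cauchy (canon u) /\ canon (canon u) = canon u.
Proof.
by move=> cu; split; [exact: null_cauchy (canonP u) | apply: canon_eq; exact/ceqv_sym/canonP].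
Qed.
Definition mkcpl u (cu : cauchy u) : cpl := Cpl (mkcpl_subproof cu).

Lemma cval_mk u (cu : cauchy u) : ceqv (cval (mkcpl cu)) u.
Proof. exact/ceqv_sym/canonP. Qed.
Lemma cval_cauchy (x : cpl) : cauchy (cval x). Proof. by case: (cvalP x). Qed.
Lemma cpl_eq (x y : cpl) : ceqv (cval x) (cval y) -> x = y.
Proof.
case: x y => [u hu] [v hv] /= uv.
have E : u = v by rewrite -hu.2 -hv.2; exact: canon_eq.
by move: hv; rewrite -E => hv; congr Cpl; exact: Prop_irrelevance.
Qed.

HB.instance Definition _ := gen_eqMixin cpl.
HB.instance Definition _ := gen_choiceMixin cpl.

Definition cplc c : cpl := mkcpl (cauchy_cst c).
Definition cplB (x y : cpl) := mkcpl (cauchyB (cval_cauchy x) (cval_cauchy y)).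
Definition cplN (x : cpl) := cplB (cplc 0) x.
Definition cplD (x y : cpl) := cplB x (cplN y).
Definition cplM (x y : cpl) := mkcpl (cauchyM (cval_cauchy x) (cval_cauchy y)).

Lemma cvalB x y : ceqv (cval (cplB x y)) (fun n => cval x n - cval y n).
Proof. exact: cval_mk. Qed.
Lemma ceqvB u u' v v' : ceqv u u' -> ceqv v v' -> ceqv (fun n => u n - v n) (fun n => u' n - v' n).
Proof. by move=> h h'; apply: null_eq (nullB h h') => n; ring. Qed.
Lemma ceqvM u u' v v' : cauchy u -> cauchy v' -> ceqv u u' -> ceqv v v' ->
  ceqv (fun n => u n * v n) (fun n => u' n * v' n).
Proof.
move=> cu cv' h h'; have h1 := null_mul cu h'; have h2 := null_mul cv' (nullB null0 h).
by apply: null_eq (nullB h1 h2) => n; ring.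
Qed.
Lemma cvalN x : ceqv (cval (cplN x)) (fun n => - cval x n).
Proof.
apply: ceqv_trans (cvalB _ _) _.
apply: null_eq (ceqvB (cval_mk (cauchy_cst 0)) (ceqv_refl (cval x))) => n; ring.
Qed.
Lemma cvalD x y : ceqv (cval (cplD x y)) (fun n => cval x n + cval y n).
Proof.
apply: ceqv_trans (cvalB _ _) _.
apply: null_eq (ceqvB (ceqv_refl (cval x)) (cvalN y)) => n; ring.
Qed.
Lemma cvalM x y : ceqv (cval (cplM x y)) (fun n => cval x n * cval y n).
Proof. exact: cval_mk. Qed.
Lemma ceqvD u u' v v' : ceqv u u' -> ceqv v v' -> ceqv (fun n => u n + v n) (fun n => u' n + v' n).
Proof.
move=> h h'; apply: null_eq (nullB h (nullB null0 h')) => n; ring.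
Qed.

Fact cplDA : associative cplD.
Proof.
move=> x y z; apply: cpl_eq; apply: ceqv_trans (cvalD _ _) _.
apply: ceqv_trans (ceqvD (ceqv_refl _) (cvalD _ _)) _; apply: ceqv_sym.
apply: ceqv_trans (cvalD _ _) _; apply: ceqv_trans (ceqvD (cvalD _ _) (ceqv_refl _)) _.
by apply: null_eq null0 => n; ring.
Qed.
Fact cplDC : commutative cplD.
Proof.
move=> x y; apply: cpl_eq; apply: ceqv_trans (cvalD _ _) _.
apply: ceqv_sym; apply: ceqv_trans (cvalD _ _) _.
by apply: null_eq null0 => n; ring.
Qed.
Fact cpl0D : left_id (cplc 0) cplD.
Proof.
move=> x; apply: cpl_eq; apply: ceqv_trans (cvalD _ _) _.
apply: ceqv_trans (ceqvD (cval_mk _) (ceqv_refl _)) _.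
by apply: null_eq null0 => n; ring.
Qed.
Fact cplND : left_inverse (cplc 0) cplN cplD.
Proof.
move=> x; apply: cpl_eq; apply: ceqv_trans (cvalD _ _) _.
apply: ceqv_trans (ceqvD (cvalN _) (ceqv_refl _)) _; apply: ceqv_sym.
by apply: ceqv_trans (cval_mk _) _; apply: null_eq null0 => n; ring.
Qed.
HB.instance Definition _ := GRing.isZmodule.Build cpl cplDA cplDC cpl0D cplND.

Fact cplMA : associative cplM.
Proof.
move=> x y z; apply: cpl_eq; apply: ceqv_trans (cvalM _ _) _.
have [cx cy cz] := And3 (cval_cauchy x) (cval_cauchy y) (cval_cauchy z).
apply: ceqv_trans (ceqvM cx (cauchyM cy cz) (ceqv_refl _) (cvalM _ _)) _; apply: ceqv_sym.
apply: ceqv_trans (cvalM _ _) _.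
apply: ceqv_trans (ceqvM (cval_cauchy _) cz (cvalM _ _) (ceqv_refl _)) _.
by apply: null_eq null0 => n; ring.
Qed.
Fact cplMC : commutative cplM.
Proof.
move=> x y; apply: cpl_eq; apply: ceqv_trans (cvalM _ _) _.
apply: ceqv_sym; apply: ceqv_trans (cvalM _ _) _.
by apply: null_eq null0 => n; ring.
Qed.
Fact cpl1M : left_id (cplc 1) cplM.
Proof.
move=> x; apply: cpl_eq; apply: ceqv_trans (cvalM _ _) _.
apply: ceqv_trans (ceqvM (cval_cauchy _) (cval_cauchy x) (cval_mk _) (ceqv_refl _)) _.
by apply: null_eq null0 => n; ring.
Qed.
Fact cplMDl : left_distributive cplM cplD.
Proof.
move=> x y z; apply: cpl_eq; apply: ceqv_trans (cvalM _ _) _.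
apply: ceqv_trans (ceqvM (cval_cauchy _) (cval_cauchy z) (cvalD _ _) (ceqv_refl _)) _.
apply: ceqv_sym; apply: ceqv_trans (cvalD _ _) _.
apply: ceqv_trans (ceqvD (cvalM _ _) (cvalM _ _)) _.
by apply: null_eq null0 => n; ring.
Qed.
Fact cpl1_neq0 : cplc 1 != 0.
Proof.
apply/eqP => E; have : ceqv (fun _ => 1) (fun _ => 0).
  apply: ceqv_trans (ceqv_sym (cval_mk (cauchy_cst 1))) _.
  by rewrite -/(cplc 1) E; exact: cval_mk.
move=> h; have [N hN] := h 1%N; have := ball_vm hO r1 (hN N (leqnn N)).
by rewrite subr0; exact: vm1.
Qed.
HB.instance Definition _ := GRing.Zmodule_isComNzRing.Build cpl
  cplMA cplMC cpl1M cplMDl cpl1_neq0.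

Lemma cpl_invertible (x : cpl) : x != 0 -> exists y, y * x = 1.
Proof.
move=> x0; have nx : ~ null (cval x).
  move=> nx; move/eqP: x0; apply; apply: cpl_eq; apply: ceqv_sym.
  apply: ceqv_trans (cval_mk _) _; apply: null_eq (nullB null0 nx) => n; ring.
have cx := cval_cauchy x; exists (mkcpl (cauchyV cx nx)); apply: cpl_eq.
apply: ceqv_trans (cvalM _ _) _.
apply: ceqv_trans (ceqvM (cval_cauchy _) cx (cval_mk _) (ceqv_refl _)) _.
apply: ceqv_sym; apply: ceqv_trans (cval_mk _) _.
have [k [N hN]] := cauchy_nonnull cx nx => j; exists N => n /hN/nball_inv[xn _].
by rewrite mulVf // subrr; exact: ball0.
Qed.

Definition cplV (x : cpl) : cpl := if x == 0 then 0 else xget 0 [set y | y * x = 1].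
Fact cplVM (x : cpl) : x != 0 -> cplV x * x = 1.
Proof.
move=> x0; rewrite /cplV (negPf x0); case: xgetP => [y _ //|].
by have [y yx] := cpl_invertible x0 => /(_ y).
Qed.
Fact cplV0 : cplV 0 = 0. Proof. by rewrite /cplV eqxx. Qed.
HB.instance Definition _ := GRing.ComNzRing_isField.Build cpl cplVM cplV0.

Lemma cval_sub (x y : cpl) : ceqv (cval (x - y)) (fun n => cval x n - cval y n).
Proof.
apply: ceqv_trans (cvalD _ _) _.
apply: null_eq (ceqvD (ceqv_refl (cval x)) (cvalN y)) => n; ring.
Qed.

Fact cplc_zmod : zmod_morphism cplc.
Proof.
move=> c d; apply: cpl_eq; apply: ceqv_trans (cval_mk _) _; apply: ceqv_sym.
apply: ceqv_trans (cval_sub _ _) _.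
exact: ceqvB (cval_mk _) (cval_mk _).
Qed.
Fact cplc_monoid : monoid_morphism cplc.
Proof.
split=> // c d; apply: cpl_eq; apply: ceqv_trans (cval_mk _) _; apply: ceqv_sym.
apply: ceqv_trans (cvalM _ _) _.
exact: ceqvM (cval_cauchy _) (cauchy_cst d) (cval_mk _) (cval_mk _).
Qed.
HB.instance Definition _ := GRing.isZmodMorphism.Build T cpl cplc cplc_zmod.
HB.instance Definition _ := GRing.isMonoidMorphism.Build T cpl cplc cplc_monoid.

Definition cplO : set cpl := [set x | exists N, forall n, (N <= n)%N -> O (cval x n)].

Lemma ev_congr u v : ceqv u v -> (exists N, forall n, (N <= n)%N -> O (u n)) ->
  exists N, forall n, (N <= n)%N -> O (v n).
Proof.
move=> uv [N hN]; have [M hM] := uv 0%N; exists (maxn N M) => n.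
rewrite geq_max => /andP[Nn Mn]; rewrite (_ : v n = u n - (u n - v n)); last by ring.
by apply: vOB; auto; exact/(ball_O0 O pi)/hM.
Qed.
Lemma cplOP x u : ceqv (cval x) u -> cplO x <-> exists N, forall n, (N <= n)%N -> O (u n).
Proof. by move=> h; split; apply: ev_congr => //; exact: ceqv_sym. Qed.

Lemma cplO_cst c : O c <-> cplO (cplc c).
Proof.
split=> [Oc|/(cplOP (cval_mk _))[N hN]]; last exact: hN (leqnn N).
by apply/(cplOP (cval_mk _)); exists 0%N.
Qed.

Lemma cplO_vring : vring cplO.
Proof.
split.
  apply: mk_subring; first by apply/cplO_cst; exact: vO1.
    move=> x y [N hN] [M hM]; apply/(cplOP (cval_sub x y)); exists (maxn N M) => n.
    by rewrite geq_max => /andP[/hN ? /hM ?]; exact: vOB.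
  move=> x y [N hN] [M hM]; apply/(cplOP (cvalM x y)); exists (maxn N M) => n.
  by rewrite geq_max => /andP[/hN ? /hM ?]; exact: vOM.
move=> x; have cx := cval_cauchy x; have [N hN] := cx 0%N.
have [ON|nON] := pselect (O (cval x N)).
  left; exists N => n Nn; rewrite -(subrK (cval x N) (cval x n)); apply: vOD => //.
  exact/(ball_O0 O pi)/hN.
have nO n : (N <= n)%N -> ~ O (cval x n).
  move=> Nn On; apply: nON; rewrite -(subrK (cval x n) (cval x N)); apply: vOD => //.
  exact/(ball_O0 O pi)/hN.
have nx : ~ null (cval x).
  move=> nx; have [M hM] := nx 0%N; apply: (nO (maxn N M)); first exact: leq_maxl.
  exact/(ball_O0 O pi)/hM/leq_maxr.
have xE : x^-1 = mkcpl (cauchyV cx nx).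
  have x0 : x != 0.
    apply/eqP => x0; apply: nx; rewrite x0.
    by apply: null_eq (cval_mk (cauchy_cst 0)) => n; rewrite subr0.
  apply: (mulIf x0); rewrite mulVf //; apply: cpl_eq.
  apply: ceqv_trans (cval_mk _) _; apply: ceqv_sym; apply: ceqv_trans (cvalM _ _) _.
  apply: ceqv_trans (ceqvM (cval_cauchy _) cx (cval_mk _) (ceqv_refl _)) _.
  move=> j; exists N => n /nO nn; rewrite mulVf ?subrr; first exact: ball0.
  by apply: contra_notN nn => /eqP ->; exact: vO0.
right; rewrite xE; apply/(cplOP (cval_mk _)); exists N => n /nO nn.
by case: (vO_total hO (cval x n)).
Qed.


Lemma cballP x k : ball cplO (cplc pi) k x <-> exists N, forall n, (N <= n)%N -> Ball k (cval x n).
Proof.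
rewrite /ball /= -rmorphXn -fmorphV; apply: cplOP.
apply: ceqv_trans (cvalM _ _) _.
exact: ceqvM (cval_cauchy _) (cauchy_cst _) (ceqv_refl _) (cval_mk _).
Qed.

Lemma cpl_dense x k : exists c, ball cplO (cplc pi) k (x - cplc c).
Proof.
have [N hN] := cval_cauchy x k; exists (cval x N); apply/cballP.
have E : ceqv (fun n => cval x n - cval x N) (cval (x - cplc (cval x N))).
  apply: ceqv_sym; apply: ceqv_trans (cval_sub _ _) _.
  exact: ceqvB (ceqv_refl _) (cval_mk _).
have [M hM] := E k; exists (maxn N M) => n; rewrite geq_max => /andP[Nn Mn].
rewrite (_ : cval _ n = (cval x n - cval x N) - ((cval x n - cval x N) - cval (x - cplc (cval x N)) n)); last by ring.
by apply: (ballB hO); [exact: hN | exact: hM].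
Qed.

Lemma cpl_rank1 : rank1 cplO setT (cplc pi).
Proof.
have hC := cplO_vring; have pi0 : cplc pi != 0 by rewrite fmorph_eq0; exact: pi_neq0 r1.
have mpi : vm cplO (cplc pi).
  right; rewrite -fmorphV => /cplO_cst h; case: r1 => _ p0 [E|//] _ _.
  by rewrite E eqxx in p0.
split=> //.
  move=> x _ x0; have nx : ~ null (cval x).
    move=> nx; move/eqP: x0; apply; apply: cpl_eq; apply: ceqv_sym.
    apply: ceqv_trans (cval_mk _) _; apply: null_eq (nullB null0 nx) => n; ring.
  have [k [N hN]] := cauchy_nonnull (cval_cauchy x) nx; exists k.
  have [//|h] := vO_total hC (cplc pi ^+ k / x); rewrite invf_div in h.
  have [M hM] := (cballP x k).1 h; exfalso; apply: (hN (maxn N M)); first exact: leq_maxl.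
  exact/hM/leq_maxr.
move=> x _ mx; have [c hc] := cpl_dense x 1.
have mc : vm O c.
  have mc' : vm cplO (cplc c).
    rewrite (_ : cplc c = x - (x - cplc c)); last by ring.
    apply: (vm_add hC) => //; apply: (vm_opp hC).
    rewrite -(divfK pi0 (x - cplc c)); by apply: (vm_mul hC).
  case: mc' => [/eqP|nc]; first by rewrite fmorph_eq0 => /eqP; left.
  by right => h; apply: nc; rewrite -fmorphV; exact/cplO_cst.
case: r1 => _ _ _ _ arch; have [n hn] := arch c I mc; exists n.
rewrite -(subrK (cplc c ^+ n) (x ^+ n)) mulrDl; apply: (vOD hC); last first.
  by rewrite -rmorphXn -fmorph_div; exact/cplO_cst.
rewrite subrXX mulrAC; apply: (vOM hC).
  by move: hc; rewrite /ball /= expr1.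
apply: (vO_sum hC) => i _; apply: (vOM hC); apply: (vOX hC); first exact: vm_O.
by apply/cplO_cst; exact: vm_O.
Qed.

Lemma cpl_gcomplete : gcomplete cplO (cplc pi) setT.
Proof.
have hC := cplO_vring; have rC := cpl_rank1.
move=> u _ hu; have [y hy] := choice (fun k => cpl_dense (u k) k).
have dy k : Ball k (y k.+1 - y k).
  apply/cplO_cst; rewrite fmorph_div rmorphXn rmorphB.
  rewrite -/(ball cplO (cplc pi) k _).
  rewrite (_ : cplc (y k.+1) - _ = (u k.+1 - u k) - (u k.+1 - cplc (y k.+1)) + (u k - cplc (y k))); last by ring.
  apply: (ballD hC) => //; apply: (ballB hC) => //.
  exact: ball_le (leqnSn k) (hy k.+1).
have dy' k m : (k <= m)%N -> Ball k (y m - y k).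
  elim: m => [|m IH]; first by rewrite leqn0 => /eqP ->; rewrite subrr; exact: ball0.
  rewrite leq_eqVlt => /orP[/eqP ->|]; first by rewrite subrr; exact: ball0.
  rewrite ltnS => km; apply: (ball_tri hO) (IH km).
  exact: ball_le km (dy m).
have cy : cauchy y.
  move=> k; exists k => m n km kn; apply: (ball_tri hO) (dy' k m km) _.
  by apply/(ball_subr pi hO); exact: dy'.
exists (mkcpl cy) => // k.
rewrite (_ : mkcpl cy - u k = (mkcpl cy - cplc (y k)) - (u k - cplc (y k))); last by ring.
apply: (ballB hC) => //; apply/cballP.
have E : ceqv (fun n => y n - y k) (cval (mkcpl cy - cplc (y k))).
  apply: ceqv_sym; apply: ceqv_trans (cval_sub _ _) _.
  exact: ceqvB (cval_mk _) (cval_mk _).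
have [M hM] := E k; exists (maxn k M) => n; rewrite geq_max => /andP[kn Mn].
rewrite (_ : cval _ n = (y n - y k) - ((y n - y k) - cval (mkcpl cy - cplc (y k)) n)); last by ring.
by apply: (ballB hO); [exact: dy' | exact: hM].
Qed.

(** The interface through which the completion is used from here on. *)
Lemma completion_exists : exists (C : fieldType) (j : {rmorphism T -> C}) (OC : set C),
  [/\ vring OC, forall x, O x <-> OC (j x), rank1 OC setT (j pi),
      gcomplete OC (j pi) setT & forall x k, exists c, ball OC (j pi) k (x - j c)].
Proof.
exists cpl, (cplc : {rmorphism T -> cpl}), cplO; split.
- exact: cplO_vring.
- exact: cplO_cst.
- exact: cpl_rank1.
- exact: cpl_gcomplete.
- exact: cpl_dense.
Qed.

End Completion.

(** * Hensel's lemma and approximate roots *)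

Section Hensel.
Variables (T : fieldType) (O : set T) (pi : T).
Hypothesis hO : vring O.
Hypothesis r1 : rank1 O setT pi.
Local Notation Ball := (ball O pi).

Lemma poly_O (p : {poly T}) x : (forall i, O p`_i) -> O x -> O p.[x].
Proof.
move=> pO Ox; rewrite horner_coef; apply: (vO_sum hO) => i _.
by apply: (vOM hO) => //; exact: vOX.
Qed.

Lemma deriv_O (p : {poly T}) : (forall i, O p`_i) -> forall i, O p^`()`_i.
Proof.
by move=> pO i; rewrite coef_deriv -mulr_natl; apply: (vOM hO) => //; exact: vO_nat.
Qed.

Lemma taylor (p : {poly T}) x h : (forall i, O p`_i) -> O x -> O h ->
  exists2 s, O s & p.[x + h] = p.[x] + p^`().[x] * h + h ^+ 2 * s.
Proof.
move=> + Ox Oh; elim/poly_ind: p => [_|p c IH pO].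
  by exists 0; [exact: vO0 | rewrite deriv0 !horner0 !mul0r !mulr0 !addr0].
have pO' i : O p`_i by have := pO i.+1; rewrite coefD coefMX coefC /= addr0.
have [s Os E] := IH pO'; exists (s * (x + h) + p^`().[x]).
  apply: (vOD hO); first by apply: (vOM hO) => //; exact: vOD.
  by apply: poly_O => //; exact: deriv_O.
rewrite derivD derivC addr0 derivM derivX !(hornerD, hornerM, hornerX, hornerC) E; ring.
Qed.

Lemma taylor1 (p : {poly T}) x h n : (forall i, O p`_i) -> O x -> Ball n h ->
  Ball n (p.[x + h] - p.[x]).
Proof.
move=> pO Ox bh; have Oh := ball_O hO r1 bh.
have [s Os ->] := taylor pO Ox Oh.
rewrite (_ : _ - _ = (p^`().[x] + h * s) * h); last by ring.
apply: (ballMl hO) => //; apply: (vOD hO); last exact: vOM.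
by apply: poly_O => //; exact: deriv_O.
Qed.

Variable L : set T.
Hypothesis hL : subfield L.
Hypothesis Lc : gcomplete O pi L.

Lemma poly_L (p : {poly T}) x : (forall i, L p`_i) -> L x -> L p.[x].
Proof.
move=> pL Lx; rewrite horner_coef; apply: (sf_sum hL) => i _.
by apply: (sfM hL) => //; exact: sfX.
Qed.

(** Newton's iteration from a. The number d bounds the valuation of q'(a), and the value at a is
    small compared with the square of q'(a). *)
Lemma hensel (q : {poly T}) a d : (forall i, L q`_i) -> (forall i, O q`_i) -> L a -> O a ->
  q^`().[a] != 0 -> O (pi ^+ d / q^`().[a]) -> Ball (d.*2.+1) q.[a] ->
  exists b, [/\ L b, q.[b] = 0 & Ball d.+1 (b - a)].
Proof.
move=> qL qO La Oa qa0 qad qab.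
have q'L i : L q^`()`_i by rewrite coef_deriv -mulr_natl; apply: (sfM hL) => //; exact: sf_nat.
pose st x := x - q.[x] / q^`().[x].
(* Along the iteration the bound on the derivative is kept, while the value gains one level per
   step. *)
pose P k x := [/\ L x, O x, q^`().[x] != 0 /\ O (pi ^+ d / q^`().[x]) & Ball (d.*2.+1 + k) q.[x]].
have stepb k x : P k x -> Ball (d.+1 + k) (q.[x] / q^`().[x]).
  move=> [_ _ [x0 xd] bx].
  have -> : q.[x] / q^`().[x] = (pi ^+ d / q^`().[x]) * (q.[x] / pi ^+ d).
    by have := piX_neq0 r1 d; move: (pi ^+ d) => z z0; field; rewrite x0 z0.
  apply: (ballMl hO) => //; apply: (ball_div r1 d (d.+1 + k) _).1.
  by have -> : (d + (d.+1 + k) = d.*2.+1 + k)%N by rewrite -addnn; lia.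
have stepP k x : P k x -> P k.+1 (st x).
  move=> Px; have bh := stepb k x Px; have [Lx Ox [x0 xd] bx] := Px.
  set h := q.[x] / q^`().[x] in bh.
  have Oh : O h := ball_O hO r1 bh.
  have Lh : L h by apply: (sf_div hL); exact: poly_L.
  have ONh := vON hO Oh.
  have [s Os E] := taylor qO Ox ONh.
  have [s' Os' E'] := taylor (deriv_O qO) Ox ONh.
  pose w := q^`()^`().[x] + - h * s'.
  have Ow : O w.
    by apply: (vOD hO); [apply: poly_O => //; do 2!apply: deriv_O | exact: vOM].
  have E'' : q^`().[x - h] = q^`().[x] * (1 + - (h / q^`().[x] * w)).
    by rewrite E' /w; field.
  have mh : vm O (- (h / q^`().[x] * w)).
    apply: (vm_opp hO); rewrite mulrC; apply: (vm_mul hO) => //; apply: (@ball_vm _ _ _ hO r1 k).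
    have -> : h / q^`().[x] = (pi ^+ d / q^`().[x]) * (h / pi ^+ d).
      by have := piX_neq0 r1 d; move: (pi ^+ d) => z z0; field; rewrite x0 z0.
    apply: (ballMl hO) => //; apply: (ball_div r1 d k.+1 _).1.
    by have -> : (d + k.+1 = d.+1 + k)%N by lia.
  have [u0 Ou] := unit1 hO mh.
  split; [exact: sfB | exact: vOB | |]; rewrite /st -/h.
    rewrite E'' mulf_neq0 //; split=> //; rewrite invfM mulrA; exact: vOM.
  rewrite E (_ : _ + _ = h * (h * s)); last by rewrite /h; field.
  apply: (@ball_le _ _ _ hO r1 _ ((d.+1 + k) + (d.+1 + k))); first lia.
  by apply: (ballM hO) => //; apply: (ballMr hO).
pose u := fix u k := if k is k'.+1 then st (u k') else a.
have uP k : P k (u k).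
  elim: k => [|k IH] /=; last exact: stepP.
  by split=> //; rewrite addn0.
have ud k : Ball (d.+1 + k) (u k.+1 - u k).
  by rewrite /= /st addrAC subrr sub0r; apply: (ballN hO); exact: stepb.
have [||b Lb hb] := Lc (u := u).
- by move=> k; case: (uP k).
- by move=> k; apply: (ball_le hO r1) (ud k); rewrite leq_addl.
exists b; split=> //.
  apply: (separated hO r1) => k; have [_ Ou _ bu] := uP k.
  rewrite -(subrK q.[u k] q.[b]); apply: (ballD hO); last first.
    by apply: (ball_le hO r1) bu; rewrite leq_addl.
  by have := taylor1 qO Ou (hb k); rewrite (addrC (u k)) subrK.
have ua k : Ball d.+1 (u k - a).
  elim: k => [|k IH]; first by rewrite subrr; exact: ball0.
  by apply: (ball_tri hO) IH; apply: (ball_le hO r1) (ud k); rewrite leq_addr.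
exact: (ball_tri hO (hb d.+1) (ua d.+1)).
Qed.

(** In a separably closed field, a monic integral polynomial has approximate roots:
    an inseparable minimal factor [g] satisfies [g' = 0], and [g + eps X] is separable. *)
Lemma approx_root (h : {poly T}) m : separably_closed T -> h \is monic -> (1 < size h)%N ->
  (forall i, O h`_i) -> exists2 a, O a & Ball m h.[a].
Proof.
move=> sc hm sh hO'.
(* Integrality of a is automatic: a is a root of the monic integral polynomial h - h(a). *)
suff [a ba] : exists a, Ball m h.[a].
  exists a => //; have hb := ball_O hO r1 ba.
  pose h1 := h - (h.[a])%:P.
  have sC : (size (- (h.[a])%:P) < size h)%N by rewrite size_polyN (leq_ltn_trans (size_polyC_leq1 _)).
  have lh1 : lead_coef h1 = 1 by rewrite lead_coefDl // (eqP hm).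
  rewrite -[a]mul1r; apply: (@root_bound _ _ hO h1) => //.
  - by rewrite -lead_coef_eq0 lh1 oner_neq0.
  - by rewrite /root !hornerE subrr.
  - exact: vO1.
  - move=> i; rewrite lh1 divr1 mul1r coefB coefC; case: ifP => _; last by rewrite subr0.
    exact: vOB.
have h0 : h != 0 by rewrite -size_poly_gt0 ltnW.
have [_ [g [gh g1 <-]] ming] := @ex_min_nat (fun n => exists g, [/\ g %| h, (1 < size g)%N & size g = n])
  (ex_intro _ _ (ex_intro _ h (And3 (dvdpp h) sh erefl))).
have g0 : g != 0 by rewrite -size_poly_gt0 ltnW.
have /dvdpP[w hE] := gh.
have [gs|gns] := boolP (separable_poly g).
  have [a /eqP ga] := sc g gs g1; exists a.
  by rewrite hE hornerM ga mulr0; exact: ball0.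
(* Otherwise the gcd of g and its derivative would be a shorter nonconstant divisor of h. *)
have g'0 : g^`() = 0.
  apply/eqP; apply: contraNT gns => g'0; rewrite unlock /coprimep eqn_leq.
  rewrite size_poly_gt0 gcdp_eq0 (negPf g0) andbT leqNgt; apply/negP => s1.
  have dg : gcdp g g^`() %| g := dvdp_gcdl _ _.
  have := ming _ (ex_intro _ _ (And3 (dvdp_trans dg gh) s1 erefl)).
  apply/negP; rewrite -ltnNge; apply: leq_ltn_trans (lt_size_deriv g0).
  exact: dvdp_leq (dvdp_gcdr _ _).
have g2 : (2 < size g)%N.
  rewrite ltn_neqAle g1 andbT; apply/eqP => g2; have := congr1 (fun p : {poly T} => p`_0) g'0.
  rewrite coef_deriv coef0 mulr1n => /eqP E; move: E; apply/negP.
  have -> : g`_1 = lead_coef g by rewrite lead_coefE -g2.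
  by rewrite lead_coef_eq0.
have [k hk] := bounded_seq hO r1 [seq c / lead_coef g | c <- g].
have [N hN] : exists N, forall a, O (pi ^+ k * a) -> O (pi ^+ N * w.[a]).
  elim/poly_ind: {hE gh} w => [|p c [N hN]]; first by exists 0%N => a _; rewrite horner0 mulr0; exact: vO0.
  have [M hM] := bounded hO r1 c; exists (k + N + M)%N => a Oa.
  have -> : pi ^+ (k + N + M) * (p * 'X + c%:P).[a] =
     pi ^+ M * ((pi ^+ N * p.[a]) * (pi ^+ k * a)) + pi ^+ (k + N) * (pi ^+ M * c).
    by rewrite !exprD hornerD hornerMX hornerC; ring.
  apply: (vOD hO); apply: (vOM hO) => //; try exact: piX_O.
  by apply: (vOM hO) => //; exact: hN.
have [M hM] := bounded hO r1 (lead_coef g).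
(* The exponent leaves m after M is spent on the lead coefficient of g, k on the root a and N on the
   cofactor w at a. The factor [lead_coef g] keeps the normalised coefficients of g + eps X within
   the bound pi^-k. *)
pose eps := lead_coef g * pi ^+ (M + m + (k + N)).
have lg0 : lead_coef g != 0 by rewrite lead_coef_eq0.
have eps0 : eps != 0 by rewrite mulf_neq0 // (piX_neq0 r1).
pose f := g + eps *: 'X.
have sX : (size (eps *: 'X) < size g)%N by rewrite size_scale // size_polyX.
have sf : size f = size g by rewrite size_polyDl.
have fs : separable_poly f.
  rewrite unlock /= /f derivD g'0 derivZ derivX add0r coprimepZr //.
  exact: coprimep1.
have [|a fa] := sc f fs; first by rewrite sf.
exists a; have : O (pi ^+ k * a).
  apply: (@root_bound _ _ hO f) => //; first by rewrite -size_poly_gt0 sf ltnW.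
    exact: piX_O.
  move=> i; rewrite lead_coefDl // coefD mulrDl mulrDr; apply: (vOD hO).
    have [lt|ge] := ltnP i (size g); first by apply/hk/map_f/mem_nth.
    by rewrite nth_default // mul0r mulr0; exact: vO0.
  rewrite coefZ coefX /eps.
  have -> : lead_coef g * pi ^+ (M + m + (k + N)) * (i == 1%N)%:R / lead_coef g =
     pi ^+ (M + m + (k + N)) * (i == 1%N)%:R by field.
  by apply: (vOM hO); [exact: piX_O | apply: (vOM hO); [exact: piX_O | exact: vO_nat]].
move=> Oa; have Ow := hN a Oa.
have ga : g.[a] = - (eps * a).
  by move: fa; rewrite /root /f !hornerE addr_eq0 => /eqP.
rewrite hE hornerM ga.
have -> : w.[a] * - (eps * a) = - (pi ^+ m * ((pi ^+ M * lead_coef g) * ((pi ^+ k * a) * (pi ^+ N * w.[a])))).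
  by rewrite /eps !exprD; ring.
apply: (ballN hO); apply: (ballMr hO); last exact: ball_pi.
by apply: (vOM hO) => //; exact: vOM.
Qed.

End Hensel.

(** * Closures in the completion and continuous extension of automorphisms *)

Section Closure.
Variables (S C : fieldType) (O : set S) (OC : set C) (pi : S) (j : {rmorphism S -> C}).
Hypothesis hO : vring O.
Hypothesis r1 : rank1 O setT pi.
Hypothesis hC : vring OC.
Hypothesis rC : rank1 OC setT (j pi).
Hypothesis Oj : forall x, O x <-> OC (j x).
Hypothesis Cc : gcomplete OC (j pi) setT.
Hypothesis Cd : forall x k, exists c, ball OC (j pi) k (x - j c).
Local Notation Ball := (ball OC (j pi)).

Lemma ball_j n x : ball O pi n x <-> Ball n (j x).
Proof. by rewrite /ball /= -rmorphXn -fmorph_div; exact: Oj. Qed.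

(** Closure of the image of [A]. *)
Definition cl (A : set S) : set C := [set x | forall n, exists2 y, A y & Ball n (x - j y)].

Lemma cl_mono A B : A `<=` B -> cl A `<=` cl B.
Proof. by move=> AB x hx n; have [y Ay h] := hx n; exists y => //; exact: AB. Qed.

Lemma cl_sub (A : set S) y : A y -> cl A (j y).
Proof. by move=> Ay n; exists y => //; rewrite subrr; exact: ball0. Qed.

Lemma cl_setT x : cl setT x.
Proof. by move=> n; have [c hc] := Cd x n; exists c. Qed.

Lemma cl_gcomplete A : gcomplete OC (j pi) (cl A).
Proof.
move=> u uA hu; have [//|x _ hx] := Cc (u := u) _ hu.
exists x => // n; have [y Ay h] := uA n n; exists y => //.
exact: (ball_tri hC (hx n) h).
Qed.

Lemma cl_closed A x : (forall n, exists2 y, cl A y & Ball n (x - y)) -> cl A x.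
Proof.
move=> h n; have [y hy b] := h n; have [z Az b'] := hy n; exists z => //.
exact: (ball_tri hC b b').
Qed.

Lemma cl_subfield A : subfield A -> subfield (cl A).
Proof.
move=> hA; split; first by rewrite in_setE -(rmorph1 j); apply: cl_sub; exact: sf1.
  move=> x y /set_mem hx /set_mem hy; rewrite in_setE => n.
  have [x' Ax bx] := hx n; have [y' Ay b_y] := hy n; exists (x' - y'); first exact: sfB.
  have -> : x - y - j (x' - y') = (x - j x') - (y - j y').
    by rewrite (rmorphB j); move: (j x') (j y') => a b; ring.
  exact: ballB.
move=> x y /set_mem hx /set_mem hy; rewrite in_setE.
have clM z w : cl A z -> cl A w -> cl A (z * w).
  move=> hz hw n; have [k hk] := bounded_seq hC rC [:: z; w].
  have [z' Az bz] := hz (k + n)%N; have [w' Aw bw] := hw (k + n)%N.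
  exists (z' * w'); first exact: sfM.
  have -> : z * w - j (z' * w') = (j pi ^+ k * w) * ((z - j z') / j pi ^+ k)
     + (j pi ^+ k * j z') * ((w - j w') / j pi ^+ k).
    rewrite (rmorphM j); have := piX_neq0 rC k; move: (j pi ^+ k) (j z') (j w') => a b c a0; by field.
  apply: (ballD hC); apply: (ballMl hC); try exact: (ball_div rC k n _).1.
    by apply: hk; rewrite !inE eqxx orbT.
  rewrite -(subrK z (j z')) mulrDr; apply: (vOD hC); last by apply: hk; rewrite inE eqxx.
  apply: (vOM hC); first exact: (piX_O hC rC).
  by apply: (ball_O hC rC); apply/(ball_subr _ hC); exact: bz.
apply: clM => // n; have [->|y0] := eqVneq y 0.
  by exists 0; [exact: sf0 | rewrite rmorph0 invr0 subrr; exact: ball0].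
have yV0 : y^-1 != 0 by rewrite invr_eq0.
have [_ _ _ cof _] := rC; have [k] := cof y I y0 => hk.
(* Inversion loses twice the size k of 1/y; the extra level makes y'/y a unit. *)
have [y' Ay b_y] := hy ((k + k) + n).+1.
exists y'^-1; first exact: sfV.
have hk' : OC (j pi ^+ k / j y').
  have -> : j y' = y * (1 + - ((j pi ^+ k / y) * ((y - j y') / j pi ^+ k))).
    have := piX_neq0 rC k; move: (j pi ^+ k) (j y') => a b a0; field; by rewrite a0 y0.
  rewrite invfM mulrA; apply: (vOM hC) => //; apply: (unit1 hC _).2.
  apply: (vm_opp hC); apply: (vm_mul hC) => //; apply: (@ball_vm _ _ _ hC rC (k + n)).
  by apply: (ball_div rC k _ _).1; apply: (ball_le hC rC) b_y; lia.
have jy0 : j y' != 0.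
  apply/eqP => jy0; rewrite jy0 subr0 in b_y.
  have : vm OC 1; last exact: vm1.
  have -> : 1 = (j pi ^+ k / y) * (y / j pi ^+ k).
    by have := piX_neq0 rC k; move: (j pi ^+ k) => a a0; field; rewrite a0 y0.
  apply: (vm_mul hC) => //; apply: (@ball_vm _ _ _ hC rC (k + n)).
  by apply: (ball_div rC k _ _).1; apply: (ball_le hC rC) b_y; lia.
rewrite fmorphV.
have -> : y^-1 - (j y')^-1 = ((j pi ^+ k / y) * (j pi ^+ k / j y')) * - ((y - j y') / j pi ^+ (k + k)).
  rewrite exprD; have := piX_neq0 rC k; move: (j pi ^+ k) (j y') jy0 => a b b0 a0.
  by field; rewrite a0 y0 b0.
apply: (ballMl hC); first exact: vOM.
apply: (ballN hC); apply: (ball_div rC (k + k) n _).1; exact: (ball_le hC rC) (leqnSn _) b_y.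
Qed.

(** Extension of an isometric automorphism by continuity. *)
Definition extends (s : aut S) x z := forall k y, Ball k (x - j y) -> Ball k (z - j (s y)).

Definition isometric (s : aut S) := s pi = pi /\ forall x, O x <-> O (s x).

Lemma isometric_ball s k x : isometric s -> ball O pi k x <-> ball O pi k (s x).
Proof.
move=> [sp sO]; rewrite /ball /= sO -[s (_ / _)]/((s : {rmorphism S -> S}) _) fmorph_div rmorphXn /=.
by rewrite sp.
Qed.

Lemma isometricV s : isometric s -> isometric (s^-1)%g.
Proof.
move=> [sp sO]; split; first by rewrite -{1}sp autVK.
by move=> x; rewrite [O (_ x)]sO autKV.
Qed.

Lemma extends_exists s x : isometric s -> exists z, extends s x z.
Proof.
move=> hs; have [y hy] := choice (Cd x).
have yd k m : (k <= m)%N -> ball O pi k (y m - y k).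
  move=> km; apply/ball_j; rewrite rmorphB.
  apply: (ball_tri hC) (hy k); apply/(ball_subr _ hC); exact: (ball_le hC rC) km (hy m).
have [|k|z _ hz] := Cc (u := fun k => j (s (y k))).
- by [].
- rewrite -rmorphB; apply/ball_j; rewrite -[s _ - s _](rmorphB (s : {rmorphism S -> S})).
  by apply: (isometric_ball k _ hs).1; exact: yd.
exists z => k c hc; apply: (ball_tri hC (hz k)); rewrite -rmorphB; apply/ball_j.
rewrite -[s _ - s _](rmorphB (s : {rmorphism S -> S})); apply: (isometric_ball k _ hs).1.
apply/ball_j; rewrite rmorphB; apply: (ball_tri hC) hc.
by apply/(ball_subr _ hC); exact: hy.
Qed.

Lemma extends_unique s x z z' : extends s x z -> extends s x z' -> z = z'.
Proof.
move=> h h'; apply/eqP; rewrite -subr_eq0; apply/eqP/(separated hC rC) => k.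
have [c hc] := Cd x k; apply: (ball_tri hC (h k c hc)).
by apply/(ball_subr _ hC); exact: h'.
Qed.

Lemma extends_j s x : isometric s -> extends s (j x) (j (s x)).
Proof.
move=> hs k y; rewrite -(rmorphB j) => /ball_j h; rewrite -(rmorphB j) -(rmorphB (s : {rmorphism S -> S})).
by apply/ball_j; apply: (isometric_ball k _ hs).1.
Qed.

Lemma extends_of s x z : isometric s ->
  (forall k, exists y, Ball k (x - j y) /\ Ball k (z - j (s y))) -> extends s x z.
Proof.
move=> hs h k y b; have [c [b1 b2]] := h k; apply: (ball_tri hC b2).
apply: (@extends_j s c hs k y); apply: (ball_tri hC) b.
exact/(ball_subr _ hC).
Qed.

Lemma extendsB s x y z w : isometric s -> extends s x z -> extends s y w ->
  extends s (x - y) (z - w).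
Proof.
move=> hs h h'; apply: extends_of => // k; have [c hc] := Cd x k; have [d hd] := Cd y k.
exists (c - d); rewrite (rmorphB j) (rmorphB (s : {rmorphism S -> S})) (rmorphB j); split.
  have -> : x - y - (j c - j d) = (x - j c) - (y - j d) by move: (j c) (j d) => a b; ring.
  exact: ballB.
have -> : z - w - (j (s c) - j (s d)) = (z - j (s c)) - (w - j (s d)).
  by move: (j (s c)) (j (s d)) => a b; ring.
by apply: (ballB hC); [exact: h | exact: h'].
Qed.

Lemma extendsM s x y z w : isometric s -> extends s x z -> extends s y w ->
  extends s (x * y) (z * w).
Proof.
move=> hs h h'; apply: extends_of => // k.
have [m hm] := bounded_seq hC rC [:: x; y; z; w].
have [c hc] := Cd x (m + k)%N; have [d hd] := Cd y (m + k)%N.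
have prod u v c' d' : OC (j pi ^+ m * u) -> OC (j pi ^+ m * v) -> Ball (m + k) (u - c') ->
    Ball (m + k) (v - d') -> Ball k (u * v - c' * d').
  move=> bu bv bc bd.
  have -> : u * v - c' * d' = (j pi ^+ m * v) * ((u - c') / j pi ^+ m)
     + (j pi ^+ m * c') * ((v - d') / j pi ^+ m).
    have := piX_neq0 rC m; move: (j pi ^+ m) => a a0; by field.
  apply: (ballD hC); apply: (ballMl hC) => //; try exact: (ball_div rC m k _).1.
  rewrite -(subrK u c') mulrDr; apply: (vOD hC) => //.
  apply: (vOM hC); first exact: (piX_O hC rC).
  by apply: (ball_O hC rC); apply/(ball_subr _ hC); exact: bc.
exists (c * d); rewrite (rmorphM j) (rmorphM (s : {rmorphism S -> S})) (rmorphM j); split; apply: prod;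
  by first [exact: hc | exact: hd | exact: h | exact: h' | apply: hm; rewrite !inE eqxx ?orbT].
Qed.

Lemma extendsV s x z : isometric s -> extends s x z -> extends (s^-1)%g z x.
Proof.
move=> hs h; apply: extends_of; first exact: isometricV.
move=> k; have [c hc] := Cd x k; exists (s c); split; first exact: h.
by rewrite autVK.
Qed.

(** By density, an isometry of S has exactly one continuous extension; it preserves every ball and
    fixes the closure of whatever s fixes pointwise. *)
Lemma aut_extension s : isometric s -> exists t : aut C, [/\
  forall x, t (j x) = j (s x), forall x k, Ball k (t x) <-> Ball k x &
  forall A x, (forall y, A y -> s y = y) -> cl A x -> t x = x].
Proof.
move=> hs; have [f hf] := choice (fun x => extends_exists x hs).
have fB : zmod_morphism f.
  by move=> x y; apply: extends_unique (hf _) _; exact: extendsB.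
have fM : monoid_morphism f.
  split; last by move=> x y; apply: extends_unique (hf _) _; exact: extendsM.
  apply: extends_unique (hf _) _; have := extends_j (x := 1) hs.
  by rewrite -[s 1]/((s : {rmorphism S -> S}) 1) !rmorph1.
have fb : bijective f.
  have hs' := isometricV hs; have [g hg] := choice (fun x => extends_exists x hs').
  exists g => x.
    exact: extends_unique (hg _) (extendsV hs (hf _)).
  have := extendsV hs' (hg x); rewrite invgK; exact: extends_unique (hf _).
have z0 (t : aut S) : t 0 = 0 by exact: (rmorph0 (t : {rmorphism S -> S})).
have eball t x z k : extends t x z -> Ball k x -> Ball k z.
  by move=> e bx; have := e k 0; rewrite z0 rmorph0 !subr0; apply.
exists (Aut (And3 fB fM fb)); split=> /=.
- by move=> x; exact: extends_unique (hf _) (extends_j (x := x) hs).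
- by move=> x k; split; apply: eball; [exact: extendsV hs (hf x) | exact: hf].
move=> A x sA hx; apply: extends_unique (hf _) _; apply: extends_of => // k.
by have [y Ay b] := hx k; exists y; rewrite sA.
Qed.

End Closure.

(** * A separable closure of the closure of M inside C *)

Section SepClosure.
Variables (S C : fieldType) (O : set S) (OC : set C) (pi : S) (j : {rmorphism S -> C}).
Hypothesis hO : vring O.
Hypothesis r1 : rank1 O setT pi.
Hypothesis hC : vring OC.
Hypothesis rC : rank1 OC setT (j pi).
Hypothesis Oj : forall x, O x <-> OC (j x).
Hypothesis Cc : gcomplete OC (j pi) setT.
Hypothesis Cd : forall x k, exists c, ball OC (j pi) k (x - j c).
Local Notation Ball := (ball OC (j pi)).
Local Notation cl := (cl OC pi j).
Variable M : set S.
Hypothesis hM : separable_closure M.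
Hypothesis Mpi : M pi.

Let sM : subfield M. Proof. by case: hM. Qed.
Definition adj (e : seq S) : set S := adjoin M [set` e].

Lemma poly_bounded (w : {poly C}) k : exists N, forall a,
  OC (j pi ^+ k * a) -> OC (j pi ^+ N * w.[a]).
Proof.
elim/poly_ind: w => [|p c [N hN]]; first by exists 0%N => a _; rewrite horner0 mulr0; exact: vO0.
have [m hm] := bounded hC rC c; exists (k + N + m)%N => a Oa.
have -> : j pi ^+ (k + N + m) * (p * 'X + c%:P).[a] =
   j pi ^+ m * ((j pi ^+ N * p.[a]) * (j pi ^+ k * a)) + j pi ^+ (k + N) * (j pi ^+ m * c).
  rewrite !exprD hornerD hornerMX hornerC.
  by move: (j pi ^+ k) (j pi ^+ N) (j pi ^+ m) => x y z; ring.
apply: (vOD hC); apply: (vOM hC) => //; try exact: (piX_O hC rC).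
by apply: (vOM hC) => //; exact: hN.
Qed.

Lemma cl_adj_subfield e : subfield (cl (adj e)).
Proof. by apply: (cl_subfield hC rC); exact: adjoin_subfield. Qed.

(** The union of the closures of the finite extensions M(e). The whole field C may contain limits
    that are not algebraic over the closure of M. *)
Definition sepcl : set C := [set x | exists e, cl (adj e) x].

Lemma adj_mono (e e' : seq S) : {subset e <= e'} -> adj e `<=` adj e'.
Proof. by move=> ee; apply: adjoin_mono => // x; exact: ee. Qed.

Lemma sepcl_seq (s : seq C) : {in s, forall x, sepcl x} -> exists e, {in s, forall x, cl (adj e) x}.
Proof.
elim: s => [|x s IH] h; first by exists [::].
have [|e he] := IH; first by move=> y ys; apply: h; rewrite inE ys orbT.
have [e' he'] := h x (mem_head _ _); exists (e' ++ e) => y; rewrite inE => /orP[/eqP ->|ys].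
  by apply: cl_mono he'; apply: adj_mono => z; rewrite mem_cat => ->.
by apply: cl_mono (he _ ys); apply: adj_mono => z; rewrite mem_cat orbC => ->.
Qed.

Lemma sepcl_subfield : subfield sepcl.
Proof.
split; first by rewrite in_setE; exists [::]; apply: sf1; exact: cl_adj_subfield.
- move=> x y /set_mem hx /set_mem hy; rewrite in_setE.
  have [e he] := @sepcl_seq [:: x; y] ltac:(by move=> z; rewrite !inE => /orP[] /eqP ->).
  by exists e; apply: (sfB (cl_adj_subfield e)); apply: he; rewrite !inE eqxx ?orbT.
- move=> x y /set_mem hx /set_mem hy; rewrite in_setE.
  have [e he] := @sepcl_seq [:: x; y] ltac:(by move=> z; rewrite !inE => /orP[] /eqP ->).
  by exists e; apply: (sf_div (cl_adj_subfield e)); apply: he; rewrite !inE eqxx ?orbT.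
Qed.

Lemma sepcl_j x : sepcl (j x).
Proof.
exists [:: x]; apply: (cl_sub _ _ hC); apply: sub_adjoin_r; exact: mem_head.
Qed.

Lemma clM_sepcl : cl M `<=` sepcl.
Proof. by move=> x hx; exists [::]; apply: cl_mono hx; exact: sub_adjoin_l. Qed.

(** M(e) is spanned over M by finitely many separable elements, and their span over the complete
    field [cl M] is closed, so it contains the closure of M(e). *)
Lemma sepcl_separable x : sepcl x -> separable_over (cl M) x.
Proof.
move=> [e he]; have sK := cl_subfield hC rC sM.
have [|n [b hb]] := @adjoin_finite _ M sM e.
  by move=> y _; apply: separable_algebraic; case: hM.
pose bs := [seq j (b i) | i <- enum 'I_n].
have hbs k : cl M (j pi ^+ k) by apply: (sfX sK); apply: (cl_sub _ _ hC).
have : kspan (cl M) bs x.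
  apply: (span_closed hC rC sK (hbs 1%N)); first exact: (cl_gcomplete hC Cc).
  move=> m; have [y ey By] := he m; exists (j y) => //.
  have [a aM ->] := hb _ ey; rewrite rmorph_sum.
  under eq_bigr do rewrite rmorphM.
  apply: (kspan_sum sK); first by move=> i; exact: (cl_sub _ _ hC).
  by move=> i; rewrite /bs; apply/mapP; exists i => //; rewrite mem_enum.
have jsep y : separable_over (cl M) (j y).
  have [q [qM qs qy]] := let: And3 _ _ h := hM in h y.
  exists (map_poly j q); split; last by rewrite /root horner_map (eqP qy) rmorph0.
    apply/polyOver_set; first exact: (sf0 sK).
    move=> i; rewrite coef_map; apply: (cl_sub _ _ hC).
    by apply/polyOver_set: i; first exact: (sf0 sM).
  by rewrite separable_map.
have sS := separable_subfield sK.
have : {in bs, forall y, separable_over (cl M) y} by move=> _ /mapP[i _ ->].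
elim: bs x {he} => [|y s IH] x hs /=; first by move=> ->; exact: (sf0 sS).
move=> [a Ka h]; rewrite -(subrK (a * y) x); apply: (sfD sS).
  by apply: IH h => z zs; apply: hs; rewrite inE zs orbT.
apply: (sfM sS); first exact: (separable_base sK).
by apply: hs; exact: mem_head.
Qed.

(** A Krasner-type argument: after scaling to a monic integral polynomial, the coefficients are
    approximated by elements of M(e), the approximating polynomial has an approximate root a in S,
    and Hensel's lemma in the closure of M(a, e) corrects a to a true root. *)
Lemma sepcl_closed (q : {poly C}) : (forall i, sepcl q`_i) -> separable_poly q ->
  (1 < size q)%N -> exists2 x, sepcl x & root q x.
Proof.
move=> qc qs q1; have q0 := separable_poly_neq0 qs.
have [e he] := @sepcl_seq q ltac:(by move=> x /(nthP 0)[i _ <-]).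
have sL := cl_adj_subfield e; set L := cl (adj e) in sL he.
have qL i : L q`_i.
  have [lt|ge] := ltnP i (size q); first exact/he/mem_nth.
  by rewrite nth_default //; exact: (sf0 sL).
set c := lead_coef q; have c0 : c != 0 by rewrite lead_coef_eq0.
have [k hk] := bounded_seq hC rC [seq x / c | x <- q].
have qb i : OC (j pi ^+ k * (q`_i / c)).
  have [lt|ge] := ltnP i (size q); first by apply: hk; apply: map_f; exact: mem_nth.
  by rewrite nth_default // mul0r mulr0; exact: vO0.
set n := (size q).-1; have nE : size q = n.+1 by rewrite prednK // ltnW.
have cE : q`_n = c by [].
set z := j pi ^+ k; have z0 : z != 0 := piX_neq0 rC k.
have Lz : L z by apply: (sfX sL); apply: (cl_sub _ _ hC); exact: sub_adjoin_l.
(* The monic polynomial with q(a/z) = (c/z^n) q2(a); the power z of pi clears the denominators of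
   the coefficients. *)
pose q2 := \poly_(i < n.+1) (z ^+ (n - i) * (q`_i / c)).
have q2n : q2`_n = 1 by rewrite coef_poly ltnSn subnn expr0 mul1r cE divff.
have q2L i : L q2`_i.
  rewrite coef_poly; case: ifP => _; last exact: (sf0 sL).
  by apply: (sfM sL); [exact: (sfX sL) | apply: (sf_div sL); exact: qL].
have q2O i : OC q2`_i.
  rewrite coef_poly; case: ifP => [lt|_]; last exact: vO0.
  have [->|ni] := eqVneq i n; first by rewrite subnn expr0 mul1r cE divff //; exact: vO1.
  have in1 : (i < n)%N by rewrite ltn_neqAle ni -ltnS.
  rewrite -(subnSK in1).
  by rewrite exprSr -mulrA; apply: (vOM hC) => //; apply: (vOX hC); exact: (piX_O hC rC).
have q2s : size q2 = n.+1 by apply: size_poly_eq; rewrite subnn expr0 mul1r cE divff ?oner_neq0.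
have ev a : q.[a / z] = c / z ^+ n * q2.[a].
  rewrite horner_coef nE (horner_coef_wide _ (eq_leq q2s)) big_distrr /=; apply: eq_bigr => i _.
  rewrite coef_poly ltn_ord expr_div_n; have -> : z ^+ n = z ^+ (n - i) * z ^+ i.
    by rewrite -exprD subnK // -ltnS ltn_ord.
  have := expf_neq0 i z0; have := expf_neq0 (n - i) z0.
  move: (z ^+ i) (z ^+ (n - i)) (a ^+ i) => u v w u0 v0; field.
  by rewrite c0 u0 v0.
have ev' a : q^`().[a / z] = c / z ^+ n * (z * q2^`().[a]).
  have -> : q2 = (z ^+ n / c) *: (q \Po (z^-1 *: 'X)).
    apply/polyP => i; rewrite coefZ coef_poly comp_polyE coef_sum.
    rewrite nE; under eq_bigr do rewrite coefZ exprZn coefZ coefXn.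
    have [lt|ge] := ltnP i n.+1; last first.
      rewrite big1 ?mulr0 // => m _; rewrite (_ : (i == m) = false) ?mulr0 //.
      by apply/negP => /eqP im; move: (ltn_ord m); rewrite -im ltnNge ge.
    rewrite (bigD1 (Ordinal lt)) //= eqxx mulr1 big1 => [|m mi]; last first.
      by rewrite (_ : (i == m) = false) ?mulr0 //; apply: contraNF mi => /eqP im; apply/eqP/val_inj.
    rewrite addr0 exprVn; have -> : z ^+ n = z ^+ (n - i) * z ^+ i by rewrite -exprD subnK.
    have := expf_neq0 i z0; move: (z ^+ i) (z ^+ (n - i)) => u v u0; field.
    by rewrite c0 u0.
  rewrite derivZ deriv_comp derivZ derivX hornerZ hornerM horner_comp !hornerE /=.
  rewrite [z^-1 * a]mulrC; have := expf_neq0 n z0; move: (z ^+ n) q^`().[a / z] => u w u0.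
  by rewrite /= mulr1; field; rewrite c0 u0 z0.
have /Bezout_eq1_coprimepP[[u v] /= uv] : coprimep q q^`() by move: qs; rewrite unlock.
(* From a Bezout relation for q and q': pi^d is an integral combination of q2(a) and q2'(a), so at
   an approximate root the derivative has valuation at most d. *)
have [d hd] : exists d, forall a, OC a -> exists U V,
    [/\ OC U, OC V & j pi ^+ d = U * q2.[a] + V * q2^`().[a]].
  have [N1 h1] := poly_bounded ((c / z ^+ n) *: u) k.
  have [N2 h2] := poly_bounded ((c / z ^+ n * z) *: v) k.
  exists (N1 + N2)%N => a Oa.
  have Oaz : OC (j pi ^+ k * (a / z)) by rewrite mulrC divfK.
  exists (j pi ^+ N2 * (j pi ^+ N1 * ((c / z ^+ n) *: u).[a / z])).
  exists (j pi ^+ N1 * (j pi ^+ N2 * ((c / z ^+ n * z) *: v).[a / z])); split.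
  - by apply: (vOM hC); [exact: (piX_O hC rC) | exact: h1].
  - by apply: (vOM hC); [exact: (piX_O hC rC) | exact: h2].
  have := congr1 (fun p : {poly C} => p.[a / z]) uv.
  rewrite hornerD !hornerM !hornerZ hornerC ev ev' exprD.
  move: (j pi ^+ N1) (j pi ^+ N2) (c / z ^+ n) q2.[a] q2^`().[a] u.[_] v.[_] => m1 m2 b x y u1 v1 E.
  by rewrite -[m1 * m2]mulr1 -E; ring.
(* Precision 2d + 1 is what Hensel's lemma needs. Coefficients above n are taken to be 0 so that the
   approximation has the right degree. *)
have near i : exists x, [/\ adj e x, Ball d.*2.+1 (q2`_i - j x) & (n < i)%N -> x = 0].
  have [lt|ge] := ltnP n i.
    exists 0; split=> //; first by apply: sf0; exact: adjoin_subfield.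
    by rewrite nth_default ?q2s // rmorph0 subrr; exact: ball0.
  by have [y ay By] := q2L i d.*2.+1; exists y.
have [h0 hh] := choice near.
pose h := 'X^n + \poly_(i < n) h0 i.
have hs : size h = n.+1.
  by rewrite size_polyDl size_polyXn // ltnS; exact: size_poly.
have hm : h \is monic.
  by rewrite monicE lead_coefDl ?lead_coefXn // size_polyXn ltnS; exact: size_poly.
have hc i : Ball d.*2.+1 (q2`_i - j h`_i).
  rewrite coefD coefXn coef_poly; have [lt|gt|->] := ltngtP i n.
  - by rewrite add0r; have [] := hh i.
  - by rewrite addr0 rmorph0 nth_default ?q2s // subrr; exact: ball0.
  - by rewrite addr0 q2n rmorph1 subrr; exact: ball0.
have hO' i : O h`_i.
  apply/Oj; rewrite -(subrK q2`_i (j h`_i)); apply: (vOD hC) => //.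
  by apply: (ball_O hC rC (n := d.*2.+1)); apply/(ball_subr _ hC).
have [a Oa ha] := approx_root hO r1 d.*2.+1 (let: And3 _ h _ := hM in h) hm
   (ltac:(by rewrite hs -nE) : (1 < size h)%N) hO'.
have OCa : OC (j a) by apply/Oj.
have qa : Ball d.*2.+1 q2.[j a].
  rewrite -(subrK (j h.[a]) q2.[j a]); apply: (ballD hC); last exact: (ball_j pi Oj _ _).1.
  rewrite -horner_map -hornerN -hornerD horner_coef.
  apply: (ball_sum hC) => i _; apply: (ballMr hC); first exact: vOX.
  by rewrite coefB coef_map; exact: hc.
have [U [V [OU OV UV]]] := hd _ OCa.
have mU : vm OC (- (U * (q2.[j a] / j pi ^+ d))).
  apply: (vm_opp hC); apply: (vm_mul hC) => //; apply: (@ball_vm _ _ _ hC rC d).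
  by apply: (ball_div rC d d.+1 _).1; have -> : (d + d.+1 = d.*2.+1)%N by rewrite -addnn addnS.
have [w0 Ow] := unit1 hC mU.
have pd0 : j pi ^+ d != 0 := piX_neq0 rC d.
have Vq : V * q2^`().[j a] = j pi ^+ d * (1 - U * (q2.[j a] / j pi ^+ d)).
  by rewrite mulrBr mulr1 {1}UV; move: (j pi ^+ d) pd0 => y y0; field.
have q'0 : q2^`().[j a] != 0.
  apply/eqP => E; move: Vq; rewrite E mulr0 => /esym/eqP.
  by rewrite mulf_eq0 (negPf pd0) (negPf w0).
have dq : OC (j pi ^+ d / q2^`().[j a]).
  have -> : j pi ^+ d / q2^`().[j a] = V / (1 - U * (q2.[j a] / j pi ^+ d)).
    by apply/eqP; rewrite eqr_div // Vq.
  exact: (vOM hC).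
have [b [Lb qb0 _]] := hensel hC rC (cl_adj_subfield (a :: e))
  (@cl_gcomplete _ _ _ _ _ hC Cc _) (q := q2) (a := j a) (d := d)
  ltac:(by move=> i; apply: cl_mono (q2L i); apply: adj_mono => y; rewrite inE orbC => ->)
  q2O ltac:(by apply: (cl_sub _ _ hC); apply: sub_adjoin_r; exact: mem_head) OCa q'0 dq qa.
exists (b / z); last by rewrite /root ev qb0 mulr0.
apply: (sf_div sepcl_subfield); first by exists (a :: e).
by exists e.
Qed.

End SepClosure.

(** An arbitrary Cauchy sequence is thinned to a geometrically convergent one, whose limit is then
    the limit of the whole sequence. *)
Lemma subseq_vcomplete (U C : fieldType) (v : {rmorphism U -> C}) (OC : set C) (pi : C) (K : set U) :
  vring OC -> rank1 OC setT pi -> (exists2 p, K p & v p = pi) -> subfield K ->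
  gcomplete OC pi (v @` K) -> vcomplete K [set x | K x /\ OC (v x)].
Proof.
move=> hC rC [p Kp vp] sK Kc u uK cu.
have pn0 n : p ^+ n != 0 by rewrite -(fmorph_eq0 v) rmorphXn vp; exact: (piX_neq0 rC).
have [N hN] := choice (fun n => cu (p ^+ n) (sfX sK n Kp) (pn0 n)).
(* The maximum of the first moduli, so that the chosen indices do not decrease. *)
pose I n := \max_(i < n.+1) N i.
have NI n : (N n <= I n)%N by exact: (leq_bigmax (@ord_max n)).
have II n : (I n <= I n.+1)%N by rewrite /I [X in (_ <= X)%N]big_ord_recr /= leq_maxl.
have [|k|_ [x Kx <-] hx] := Kc (fun n => v (u (I n))).
- by move=> k; exists (u (I k)).
- have [_] := hN k _ _ (leq_trans (NI k) (II k)) (NI k).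
  by rewrite fmorph_div rmorphXn vp rmorphB.
exists x => // a Ka a0.
have va0 : v a != 0 by rewrite fmorph_eq0.
have [n hn] := small_elt hC rC va0; exists (N n) => m hm; split.
  by apply: (sf_div sK) => //; exact: (sfB sK).
rewrite fmorph_div; apply: hn; rewrite rmorphB.
apply: (ball_tri hC (y := v (u (I n)))); last exact/(ball_subr _ hC)/hx.
have [_] := hN n _ _ hm (NI n).
by rewrite fmorph_div rmorphXn vp rmorphB.
Qed.

Lemma vcomplete_gcomplete (S : fieldType) (O OK K : set S) (pi : S) :
  vring O -> rank1 O setT pi -> K pi -> subfield K -> OK `<=` K -> (forall x, K x -> (O x <-> OK x)) ->
  vcomplete K OK -> gcomplete O pi K.
Proof.
move=> hO r1 Kpi sK OKK KO Kc u uK hu.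
have ud k m : (k <= m)%N -> ball O pi k (u m - u k).
  elim: m => [|m IH]; first by rewrite leqn0 => /eqP ->; rewrite subrr; exact: ball0.
  rewrite leq_eqVlt => /orP[/eqP ->|]; first by rewrite subrr; exact: ball0.
  rewrite ltnS => km; apply: (ball_tri hO _ (IH km)); exact: (ball_le hO r1) km (hu m).
have [||x Kx hx] := Kc u.
- by [].
- move=> a Ka a0; have [n hn] := small_elt hO r1 a0; exists n => m m' hm hm'.
  apply/KO; first by apply: (sf_div sK) => //; exact: (sfB sK).
  apply: hn; apply: (ball_tri hO (y := u n)); first exact: ud.
  by apply/(ball_subr _ hO); exact: ud.
exists x => // k; have [N hN] := hx (pi ^+ k) (sfX sK k Kpi) (piX_neq0 r1 k).
have := hN (maxn N k) (leq_maxl _ _) => /KO h.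
apply: (ball_tri hO (y := u (maxn N k))); last by apply: ud; exact: leq_maxr.
apply/(ball_subr _ hO); apply: h.
by apply: (sf_div sK); [exact: (sfB sK) | exact: (sfX sK)].
Qed.

(** * The closure of M as a completion of the global field *)

Section CompletionTower.
Variables (S C : fieldType) (O : set S) (OC : set C) (pi : S) (j : {rmorphism S -> C}).
Hypothesis hO : vring O.
Hypothesis r1 : rank1 O setT pi.
Hypothesis hC : vring OC.
Hypothesis rC : rank1 OC setT (j pi).
Hypothesis Oj : forall x, O x <-> OC (j x).
Hypothesis Cc : gcomplete OC (j pi) setT.
Hypothesis Cd : forall x k, exists c, ball OC (j pi) k (x - j c).
Local Notation cl := (cl OC pi j).
Variable M : set S.
Hypothesis hM : separable_closure M.
Hypothesis Mpi : M pi.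
Variables (Fs : fieldType) (i : {rmorphism Fs -> S}) (cF : set Fs).
Hypothesis iM : forall x, cF x -> M (i x).
Hypothesis Md : forall x n, M x -> exists2 y, cF y & ball O pi n (x - i y).

(** Since [cF] is dense in M, the closure of M with its separable closure [sepcl] is a completion of
    [cF] to which the Selmer condition can be applied. The last clause restricts to U the continuous
    extension of an automorphism over M. *)
Lemma completion_sepcl : exists (U : fieldType) (v : {rmorphism U -> C}) (i' : {rmorphism Fs -> U}),
  [/\ forall x, v (i' x) = j (i x),
      range v = sepcl OC pi j M,
      completion cF [set x | cF x /\ O (i x)] i'
        [set x | cl M (v x)] [set x | cl M (v x) /\ OC (v x)]
    & forall (s : aut S) (t : aut C), Gal M s -> (forall x, t (j x) = j (s x)) ->
       (forall x k, ball OC (j pi) k (t x) <-> ball OC (j pi) k x) ->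
       exists s' : aut U, forall x, v (s' x) = t (v x)].
Proof.
have sM : subfield M by case: hM.
have sK := cl_subfield hC rC sM.
have [U [v vU]] := subfield_type (sepcl_subfield hC rC M).
have vin x : sepcl OC pi j M x -> exists y, v y = x by rewrite -vU => -[y _ <-]; exists y.
have vsep y : sepcl OC pi j M (v y) by rewrite -vU; exists y.
have [i0 hi0] := choice (fun x => vin _ (sepcl_j pi j hC M (i x))).
have vI : injective v := fmorph_inj v.
have [i' hi'] : exists i' : {rmorphism Fs -> U}, i' =1 i0.
  apply: mk_rmorph; first by move=> x y; apply: vI; rewrite rmorphB !hi0 !rmorphB.
  split; first by apply: vI; rewrite hi0 !rmorph1.
  by move=> x y; apply: vI; rewrite rmorphM !hi0 !rmorphM.
have vi' x : v (i' x) = j (i x) by rewrite hi' hi0.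
have vK x : cl M x -> exists2 y, cl M (v y) & v y = x.
  by move=> hx; have [y yE] := vin x (clM_sepcl hx); exists y; rewrite ?yE.
pose K' := [set x | cl M (v x)].
have sK' : subfield K'.
  split; first by rewrite in_setE /K' /= rmorph1; exact: (sf1 sK).
    by move=> x y /set_mem hx /set_mem hy; rewrite in_setE /K' /= rmorphB; exact: (sfB sK).
  by move=> x y /set_mem hx /set_mem hy; rewrite in_setE /K' /= fmorph_div; exact: (sf_div sK).
exists U, v, i'; split=> //; last first.
  move=> s t sMs tj tb.
  (* An extension t1 of s1 maps the closure of M(e) into that of M(s1(e)). *)
  have tsep (s1 : aut S) (t1 : aut C) x : Gal M s1 -> (forall x, t1 (j x) = j (s1 x)) ->
      (forall x k, ball OC (j pi) k (t1 x) <-> ball OC (j pi) k x) ->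
      sepcl OC pi j M x -> sepcl OC pi j M (t1 x).
    move=> s1M t1j t1b [e he]; exists (map s1 e) => n; have [y ye By] := he n.
    exists (s1 y); last first.
      rewrite -t1j -(rmorphB (t1 : {rmorphism C -> C})); exact/t1b.
    apply: (ye [set z | adj M (map s1 e) (s1 z)]).
    - have := adjoin_subfield M [set` map s1 e]; rewrite -/(adj M _) => sA.
      split; first by rewrite in_setE /= rmorph1; exact: (sf1 sA).
        by move=> z w /set_mem hz /set_mem hw; rewrite in_setE /= rmorphB; exact: (sfB sA).
      by move=> z w /set_mem hz /set_mem hw; rewrite in_setE /= fmorph_div; exact: (sf_div sA).
    - by move=> z Mz /=; rewrite s1M //; exact: sub_adjoin_l.
    - by move=> z ze /=; apply: sub_adjoin_r; exact: map_f.
  have tV (s1 : aut S) (t1 : aut C) : (forall x, t1 (j x) = j (s1 x)) ->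
      (forall x, (t1^-1)%g (j x) = j ((s1^-1)%g x)).
    by move=> h x; rewrite -{1}(autKV s1 x) -h autVK.
  have [f hf] := choice (fun x => vin _ (tsep s t (v x) sMs tj tb (vsep x))).
  have tb' x k : ball OC (j pi) k ((t^-1)%g x) <-> ball OC (j pi) k x.
    by rewrite -[X in _ <-> ball _ _ _ X](autKV t x); split=> /tb.
  have [g hg] := choice (fun x => vin _ (tsep _ _ (v x) (GalV sMs) (tV _ _ tj) tb' (vsep x))).
  have fB : zmod_morphism f.
    by move=> x y; apply: vI; rewrite rmorphB !hf !rmorphB.
  have fM : monoid_morphism f.
    split; first by apply: vI; rewrite hf !rmorph1.
    by move=> x y; apply: vI; rewrite rmorphM !hf !rmorphM.
  have fb : bijective f.
    by exists g => x; apply: vI; rewrite ?hg ?hf ?hg ?autVK ?autKV.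
  by exists (Aut (And3 fB fM fb)).
split.
- split=> //.
    move=> q qs q1; have [|||x xs rx] := sepcl_closed hO r1 hC rC Oj Cc hM Mpi (q := map_poly v q).
    + by move=> n; rewrite coef_map; exact: vsep.
    + by rewrite separable_map.
    + by rewrite size_map_poly.
    have [y yE] := vin x xs; exists y; move: rx; rewrite -yE /root horner_map.
    by rewrite fmorph_eq0.
  move=> x; have [q [qK qs qx]] := sepcl_separable hC rC Cc hM Mpi (vsep x).
  have [|q' qE] := @lift_poly _ _ v q.
    apply/polyOver_set; first by exists 0; rewrite ?rmorph0.
    move=> n; have qn : cl M q`_n by apply/polyOver_set: n; first exact: (sf0 sK).
    by have [y _ <-] := vK _ qn; exists y.
  exists q'; split.
  + apply/polyOver_set; first exact: (sf0 sK').
    move=> n; rewrite /K' /= -coef_map -qE.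
    by apply/polyOver_set: n; first exact: (sf0 sK).
  + by move: qs; rewrite qE separable_map.
  + by move: qx; rewrite qE /root horner_map fmorph_eq0.
- have [p Kp vp] := vK (j pi) (cl_sub pi j hC Mpi).
  split; last first.
    apply: (subseq_vcomplete hC rC _ sK'); first by exists p.
    have -> : v @` [set x | cl M (v x)] = cl M.
      by apply/seteqP; split=> [_ [y hy <-] //|y /vK [x hx <-]]; exists x.
    exact: (@cl_gcomplete _ _ _ _ _ hC Cc).
  split=> //.
  + by move=> x [].
  + apply: mk_subring => /=; rewrite ?rmorph1.
    * by split; [exact: (sf1 sK) | exact: vO1].
    * by move=> x y [h1 h2] [h3 h4]; rewrite rmorphB; split; [exact: (sfB sK) | exact: vOB].
    * by move=> x y [h1 h2] [h3 h4]; rewrite rmorphM; split; [exact: (sfM sK) | exact: vOM].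
  + move=> x hx; have [h|h] := vO_total hC (v x); [left | right] => //.
    by rewrite /= fmorphV; split=> //; exact: (sfV sK).
  + exists p^-1; first by rewrite /= fmorphV vp; apply: (sfV sK); exact: (cl_sub pi j hC).
    case=> _; rewrite fmorphV vp => h; have [_ p0 mp _ _] := rC.
    case: mp => [/eqP|//]; exact/negP.
- by move=> x cx; rewrite /= vi'; apply: (cl_sub pi j hC); exact: iM.
- move=> x cx; rewrite /= vi'; split=> [[_ h]|[_ h]]; split=> //; try exact/Oj.
  by apply: (cl_sub pi j hC); exact: iM.
- move=> x a /= hx ha a0; have va0 : v a != 0 by rewrite fmorph_eq0.
  have [n hn] := small_elt hC rC va0; have [y My By] := hx n; have [z cz Bz] := Md n My.
  exists z => //; rewrite fmorph_div rmorphB vi'; split.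
    by apply: (sf_div sK) => //; apply: (sfB sK) => //; apply: (cl_sub pi j hC); exact: iM.
  apply: hn; apply: (ball_tri hC By); rewrite -rmorphB; exact/(ball_j pi Oj).
Qed.

End CompletionTower.

(** * The formal group at the origin *)

(** Addition near infinity, in the coordinates z = x/y, w = 1/y: the line w = lz + n
    through two points meets the curve in a third point (z3, w3). *)
Section ZWAdd.
Variables (K : fieldType) (W : weierstrass K).
Local Notation a1 := (a1 W).
Local Notation a2 := (a2 W).
Local Notation a3 := (a3 W).
Local Notation a4 := (a4 W).
Local Notation a6 := (a6 W).

(** In these coordinates the curve is w + a1 zw + a3 w^2 = z^3 + a2 z^2 w + a4 z w^2 + a6 w^3.
    Subtracting the equations of two points gives (w1 - w2) A = (z1 - z2) B, so B/A is the slope of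
    the chord, and of the tangent when the points coincide. *)
Definition chordA (z1 w1 z2 w2 : K) : K :=
  1 + (a1 * z2 + a3 * (w1 + w2) - a2 * z2 ^+ 2 - a4 * z2 * (w1 + w2)
    - a6 * (w1 ^+ 2 + w1 * w2 + w2 ^+ 2)).
Definition chordB (z1 w1 z2 w2 : K) : K :=
  z1 ^+ 2 + z1 * z2 + z2 ^+ 2 + a2 * (z1 + z2) * w1 + a4 * w1 ^+ 2 - a1 * w1.
(** [cubicA], [cubicB] and [cubicC] are the coefficients of z^3, z^2 and z after substituting w = lz
    + n in the equation. *)
Definition cubicA (l : K) : K := 1 + (a2 * l + a4 * l ^+ 2 + a6 * l ^+ 3).
Definition cubicB (l n : K) : K :=
  n * (a2 + 2 * a4 * l + 3 * a6 * l ^+ 2) - a1 * l - a3 * l ^+ 2.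
Definition cubicC (l n : K) : K :=
  n * (a4 * n + 3 * a6 * l * n - a1 - 2 * a3 * l) - l.

(** The affine line y = mx + c is w = -(m/c) z + 1/c. Its third point gives (z3, w3), and the sum is
    the opposite of that point. *)
Lemma zw_add (x1 y1 x2 y2 : K) : let z1 := x1 / y1 in let w1 := y1^-1 in
  let z2 := x2 / y2 in let w2 := y2^-1 in
  let l := chordB z1 w1 z2 w2 / chordA z1 w1 z2 w2 in
  on_curve W (Some (x1, y1)) -> on_curve W (Some (x2, y2)) -> y1 != 0 -> y2 != 0 ->
  chordA z1 w1 z2 w2 != 0 -> cubicA l != 0 ->
  ~~ ((x1 == x2) && (y1 + y2 + a1 * x2 + a3 == 0)) ->
  exists n z3 w3, [/\ [/\ w1 = l * z1 + n, w2 = l * z2 + n & w3 = l * z3 + n],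
     cubicA l * (z1 + z2 + z3) = - cubicB l n,
     cubicA l * (z1 * z2 + z1 * z3 + z2 * z3) = cubicC l n,
     w3 != 0 &
     ec_add W (Some (x1, y1)) (Some (x2, y2)) = Some (z3 / w3, - w3^-1 - a1 * (z3 / w3) - a3)].
Proof.
move=> z1 w1 z2 w2 l E1 E2 y10 y20 A0 cA0 nv; rewrite ec_addE (negPf nv); cbv zeta.
have [y2E [h2 h1 h0]] := slopeP E1 E2 nv.
set m := slope _ _ _ _ _ in y2E h2 h1 h0 *; set x3 := _ - x2 in h2 h1 h0 *.
set c := y1 - m * x1 in y2E h2 h1 h0.
have y1E : y1 = m * x1 + c by rewrite /c; ring.
have mt : x1 = x2 -> 2 * y1 + a1 * x1 + a3 != 0 ->
    m * (2 * y1 + a1 * x1 + a3) = 3 * x1 ^+ 2 + 2 * a2 * x1 + a4 - a1 * y1.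
  by move=> x12 t0; rewrite /m /slope -x12 eqxx divfK.
have cE : c = y1 - m * x1 by [].
have x3E : x3 = m ^+ 2 + a1 * m - a2 - x1 - x2 by [].
clearbody x3 c m.
have F x y : y != 0 -> on_curve W (Some (x, y)) ->
    y^-1 + a1 * (x / y) * y^-1 + a3 * y^-1 ^+ 2 = (x / y) ^+ 3 + a2 * (x / y) ^+ 2 * y^-1
      + a4 * (x / y) * y^-1 ^+ 2 + a6 * y^-1 ^+ 3.
  move=> y0 E; apply: (mulIf (expf_neq0 3 y0)).
  transitivity (y ^+ 2 + a1 * x * y + a3 * y); first by field.
  by rewrite E; field.
have AB : (w1 - w2) * chordA z1 w1 z2 w2 = (z1 - z2) * chordB z1 w1 z2 w2.
  apply/eqP; rewrite -subr_eq0; apply/eqP.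
  transitivity ((w1 + a1 * z1 * w1 + a3 * w1 ^+ 2 - (z1 ^+ 3 + a2 * z1 ^+ 2 * w1
      + a4 * z1 * w1 ^+ 2 + a6 * w1 ^+ 3)) - (w2 + a1 * z2 * w2 + a3 * w2 ^+ 2 - (z2 ^+ 3 + a2 * z2 ^+ 2 * w2
      + a4 * z2 * w2 ^+ 2 + a6 * w2 ^+ 3))).
    by rewrite /chordA /chordB; ring.
  by rewrite /z1 /w1 /z2 /w2 (F _ _ y10 E1) (F _ _ y20 E2); ring.
have mz1 : m * z1 + c * w1 = 1 by rewrite /z1 /w1 y1E; field; rewrite -y1E.
have mz2 : m * z2 + c * w2 = 1 by rewrite /z2 /w2 y2E; field; rewrite -y2E.
have w10 : w1 != 0 by rewrite invr_eq0.
(* This says l = -m/c. In the tangent case it follows from the formula for the slope and the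
   equation of the curve. *)
have main : m * chordA z1 w1 z2 w2 + c * chordB z1 w1 z2 w2 = 0.
  have [z12|z12] := eqVneq z1 z2; last first.
    apply: (mulfI (_ : z1 - z2 != 0)); first by rewrite subr_eq0.
    rewrite mulr0 mulrDr (mulrCA _ c) -AB.
    transitivity (chordA z1 w1 z2 w2 * ((m * z1 + c * w1) - (m * z2 + c * w2))); first by ring.
    by rewrite mz1 mz2 subrr mulr0.
  have w12 : w1 = w2.
    by apply/(mulIf A0); apply/eqP; rewrite -subr_eq0 -mulrBl AB z12 subrr mul0r.
  have y12 : y1 = y2 by apply: invr_inj.
  have x12 : x1 = x2.
    by move: z12; rewrite /z1 /z2 -y12 => /(mulIf _); apply; rewrite invr_eq0.
  have t0 : 2 * y1 + a1 * x1 + a3 != 0.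
    move: nv; rewrite -x12 -y12 eqxx /=; congr (_ != 0); ring.
  apply: (mulfI (expf_neq0 2 y10)).
  transitivity (- y1 * (m * (2 * y1 + a1 * x1 + a3) - (3 * x1 ^+ 2 + 2 * a2 * x1 + a4 - a1 * y1))
     + 3 * m * (y1 ^+ 2 + a1 * x1 * y1 + a3 * y1 - (x1 ^+ 3 + a2 * x1 ^+ 2 + a4 * x1 + a6))).
    rewrite /chordA /chordB -z12 -w12 /z1 /w1 cE; by field.
  by rewrite mt // E1 !subrr !mulr0 addr0.
have c0 : c != 0.
  apply/eqP => c0; move: main mz1; rewrite c0 !mul0r !addr0 => /eqP.
  by rewrite mulf_eq0 (negPf A0) orbF => /eqP ->; rewrite mul0r => /eqP; rewrite eq_sym oner_eq0.
have lE : l = - m / c.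
  apply: (mulIf A0); rewrite divfK //; apply: (mulfI c0).
  by rewrite mulrA mulrCA mulfV // mulr1 mulNr; apply/eqP; rewrite -addr_eq0 addrC main.
have a2E : a2 = m ^+ 2 + a1 * m - (x1 + x2 + x3) by rewrite -h2; ring.
have a4E : a4 = 2 * m * c + a1 * c + a3 * m + (x1 * x2 + x1 * x3 + x2 * x3).
  by move/eqP: h1; rewrite -subr_eq0 => /eqP h1; rewrite -[LHS]addr0 -h1; ring.
have a6E : a6 = c ^+ 2 + a3 * c - x1 * x2 * x3 by rewrite -h0; ring.
(* As [cubicA l] is nonzero, the third point of the line does not have y = 0, so it has (z,
   w)-coordinates. *)
have cAE : cubicA l * c ^+ 3 = y1 * y2 * (m * x3 + c).
  by rewrite y1E y2E /cubicA lE a2E a4E a6E; field.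
have y30 : m * x3 + c != 0.
  apply/eqP => y30; move/eqP: cAE; rewrite y30 mulr0 mulf_eq0 (negPf cA0) expf_eq0 /=.
  by rewrite (negPf c0).
have y1n : m * x1 + c != 0 by rewrite -y1E.
have y2n : m * x2 + c != 0 by rewrite -y2E.
exists c^-1, (x3 / (m * x3 + c)), (m * x3 + c)^-1; split.
- split; rewrite lE /w1 /z1 /w2 /z2 ?y1E ?y2E; field; rewrite ?c0 ?y1n ?y2n ?y30 //.
- rewrite /z1 /z2 y1E y2E /cubicA /cubicB lE a2E a4E a6E; field.
  by rewrite c0 y1n y2n y30.
- rewrite /z1 /z2 y1E y2E /cubicA /cubicC lE a2E a4E a6E; field.
  by rewrite c0 y1n y2n y30.
- by rewrite invr_eq0.
by rewrite invrK divfK // cE; congr (Some (_, _)); ring.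
Qed.
End ZWAdd.

Section NearInfinity.
Variables (T : fieldType) (O : set T) (pi : T).
Hypothesis hO : vring O.
Hypothesis r1 : rank1 O setT pi.
Local Notation Ball := (ball O pi).
Variable W : weierstrass T.
Hypothesis intW : integral O W.
Local Notation a1 := (a1 W).
Local Notation a2 := (a2 W).
Local Notation a3 := (a3 W).
Local Notation a4 := (a4 W).
Local Notation a6 := (a6 W).

Definition pz (P : point T) : T := if P is Some (x, y) then x / y else 0.
Definition pw (P : point T) : T := if P is Some (x, y) then y^-1 else 0.

(** For positive m, the m-th step of the filtration of the kernel of reduction; w is bounded
    explicitly because for m = 0 it is not controlled by z. *)
Definition near0 m (P : point T) : Prop :=
  [/\ on_curve W P, (if P is Some (x, y) then y != 0 else true), Ball m (pz P) & Ball m (pw P)].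

Let Oa1 : O a1. Proof. by case: intW. Qed.
Let Oa2 : O a2. Proof. by case: intW. Qed.
Let Oa3 : O a3. Proof. by case: intW. Qed.
Let Oa4 : O a4. Proof. by case: intW. Qed.
Let Oa6 : O a6. Proof. by case: intW. Qed.

Ltac oO := repeat first [assumption | exact: (vO0 hO) | exact: (vO1 hO) | exact: (vO_nat hO)
  | apply: (vON hO) | apply: (vOD hO) | apply: (vOX hO) | apply: (vOM hO)].

Lemma ball_unit m u : (0 < m)%N -> Ball m u -> 1 + u != 0 /\ O (1 + u)^-1.
Proof. by case: m => // m _ hu; apply: (unit1 hO); exact: (ball_vm hO r1 hu). Qed.

Lemma zw_curve x y : y != 0 -> on_curve W (Some (x, y)) -> let z := x / y in let w := y^-1 in
  w * (1 + (z * (a1 - a2 * z - a4 * w) + w * (a3 - a6 * w))) = z ^+ 3.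
Proof.
move=> y0 /= E; apply: (mulIf (expf_neq0 3 y0)).
transitivity (y ^+ 2 + a1 * x * y + a3 * y - a2 * x ^+ 2 - a4 * x - a6); first by field.
by rewrite E; field.
Qed.

(** On the curve, w is z^3 times a unit as soon as both are small. *)
Lemma near0_w m j P : (0 < m)%N -> near0 m P -> Ball j (pz P) -> Ball (j + (j + j)) (pw P).
Proof.
move=> m0 [oP yP bz bw] bj; case: P oP yP bz bw bj => [[x y]|] /= oP y0 bz bw bj; last exact: ball0.
have := zw_curve y0 oP; cbv zeta; move: (y^-1) (x / y) bz bw bj => w z bz bw bj.
have Oz := ball_O hO r1 bz; have Ow := ball_O hO r1 bw.
have := @ball_unit m (z * (a1 - a2 * z - a4 * w) + w * (a3 - a6 * w)) m0.
case=> [|u0 Ou E]; first by apply: (ballD hO); apply: (ballMr hO) => //; oO.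
rewrite -[w](mulfK u0) E; apply: (ballMr hO) => //.
by rewrite exprS expr2; apply: (ballM hO) => //; exact: (ballM hO).
Qed.

Lemma near0_le m j P : (0 < m)%N -> near0 m P -> Ball j (pz P) -> near0 j P.
Proof.
move=> m0 nP bj; have bw := near0_w m0 nP bj; have [? ? _ _] := nP; split=> //.
by apply: (ball_le hO r1) bw; rewrite leq_addr.
Qed.

Lemma near0_None m : near0 m None.
Proof. by split=> //; exact: ball0. Qed.

Lemma near0_opp m j P : (0 < m)%N -> near0 m P -> [/\ near0 m (ec_opp W P),
  Ball j (pz P) -> Ball (m + j) (pz (ec_opp W P) + pz P),
  Ball j (pz P) -> Ball j (pz (ec_opp W P))
  & Ball j (pw P) -> Ball j (pw (ec_opp W P))].
Proof.
move=> m0 nP; have [oP yP bz _] := nP; have bw := near0_w m0 nP bz.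
have oN := on_curve_opp oP.
case: P oP yP bz bw oN {nP} => [[x y]|] /= oP y0 bz bw oN; last first.
  by rewrite addr0; split=> // _; exact: ball0.
have [|D0 OD] := @ball_unit m (a1 * (x / y) + a3 * y^-1) m0.
  apply: (ballD hO); apply: (ballMl hO) => //.
  by apply: (ball_le hO r1) bw; rewrite leq_addr.
have yE : - y - a1 * x - a3 = - y * (1 + (a1 * (x / y) + a3 * y^-1)) by field.
have y'0 : - y - a1 * x - a3 != 0 by rewrite yE mulf_neq0 // oppr_eq0.
have zE : x / (- y - a1 * x - a3) = - (1 + (a1 * (x / y) + a3 * y^-1))^-1 * (x / y).
  by rewrite yE; move: (1 + _) D0 => D D0; field; rewrite ?oppr_eq0 ?D0 ?y0.
have wE : (- y - a1 * x - a3)^-1 = - (1 + (a1 * (x / y) + a3 * y^-1))^-1 * y^-1.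
  by rewrite yE; move: (1 + _) D0 => D D0; field; rewrite ?oppr_eq0 ?D0 ?y0.
have ON : O (- (1 + (a1 * (x / y) + a3 * y^-1))^-1) by exact: vON.
have bzz k : Ball k (x / y) -> Ball k (x / (- y - a1 * x - a3)) by rewrite zE; exact: ballMl.
have bww k : Ball k y^-1 -> Ball k (- y - a1 * x - a3)^-1 by rewrite wE; exact: ballMl.
split; [| |exact: bzz|exact: bww].
  split=> //; first exact: bzz.
  by apply: bww; apply: (ball_le hO r1) bw; rewrite leq_addr.
move=> bj; rewrite zE; move: (y^-1) (x / y) bz bw bj D0 OD {zE wE yE y'0 ON bzz bww} => w z bz bw bj D0 OD.
have -> : - (1 + (a1 * z + a3 * w))^-1 * z + z = (1 + (a1 * z + a3 * w))^-1 * (z * (a1 * z + a3 * w)).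
  by field.
apply: (ballMl hO) => //; rewrite mulrC; apply: (ballM hO) => //; apply: (ballD hO); apply: (ballMl hO) => //.
by apply: (ball_le hO r1) bw; rewrite leq_addr.
Qed.

(** To first order z is additive, with an error of level m + j when one point has level m and the
    other level j. The chord has slope of level 2m, so the coefficient of z^3 is a unit and Vieta's
    formulas control the third point. *)
Lemma near0_add m j P Q : (0 < m)%N -> near0 m P -> near0 m Q ->
  [/\ near0 m (ec_add W P Q), near0 j Q -> Ball (m + j) (pz (ec_add W P Q) - pz P - pz Q) &
      near0 j Q -> Ball j (pw (ec_add W P Q) - pw P)].
Proof.
move=> m0 nP nQ.
case: P nP => [[x1 y1]|] nP; last first.
  rewrite [ec_add _ _ _]/= -/(pz Q) (_ : pz None = 0) // (_ : pw None = 0) // !subr0 subrr.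
  by split=> //; [move=> _; exact: ball0 | case].
case: Q nQ => [[x2 y2]|] nQ; last first.
  rewrite [ec_add _ _ _]/= (_ : pz None = 0) // !subrr ?subr0.
  by split=> // _; exact: ball0.
have [/andP[/eqP x12 /eqP t0]|nv] := boolP ((x1 == x2) && (y1 + y2 + a1 * x2 + a3 == 0)).
  have QP : Some (x1, y1) = ec_opp W (Some (x2, y2)).
    by rewrite /= x12; congr (Some (_, _)); rewrite -[RHS]addr0 -t0; ring.
  have -> : ec_add W (Some (x1, y1)) (Some (x2, y2)) = None.
    by rewrite QP ec_addNP //; case: nQ.
  rewrite QP; have [_ h1 h2 h3] := near0_opp j m0 nQ; split; first exact: near0_None.
  - by case=> _ _ /h1 + _; rewrite sub0r -opprD => /(ballN hO).
  - by case=> _ _ _ /h3; rewrite sub0r => /(ballN hO).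
have [oP y10 bz1 _] := nP; have bw1 := near0_w m0 nP bz1.
have [oQ y20 bz2 _] := nQ; have bw2 := near0_w m0 nQ bz2.
have := zw_add oP oQ y10 y20 _ _ nv; have -> : x1 / y1 = pz (Some (x1, y1)) by [].
rewrite -/(pw (Some (x1, y1))) -/(pw (Some (x2, y2))) -/(pz (Some (x2, y2))).
rewrite -/(pz (Some (x1, y1))) in bz1 *; rewrite -/(pz (Some (x2, y2))) in bz2 *.
pose z1 := pz (Some (x1, y1)); pose w1 := pw (Some (x1, y1)).
pose z2 := pz (Some (x2, y2)); pose w2 := pw (Some (x2, y2)).
have jz2 : near0 j (Some (x2, y2)) -> Ball j z2 by case.
have w3j : near0 j (Some (x2, y2)) -> Ball (j + (j + j)) w2.
  by move=> nj; have [_ _ b _] := nj; exact: near0_w m0 nQ b.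
have jw2 : near0 j (Some (x2, y2)) -> Ball j w2 by case.
rewrite -/z1 -/w1 -/z2 -/w2 in bz1 bz2 bw1 bw2 *.
clearbody z1 w1 z2 w2; set S := ec_add _ _ _.
have Oz1 := ball_O hO r1 bz1; have Ow1 := ball_O hO r1 bw1.
have Oz2 := ball_O hO r1 bz2; have Ow2 := ball_O hO r1 bw2.
have m1w1 : Ball m w1 by apply: (ball_le hO r1) bw1; rewrite leq_addr.
have m1w2 : Ball m w2 by apply: (ball_le hO r1) bw2; rewrite leq_addr.
have m2w1 : Ball (m + m) w1 by apply: (ball_le hO r1) bw1; rewrite leq_add2l leq_addr.
have [|A0 OA] := @ball_unit m (a1 * z2 + a3 * (w1 + w2) - a2 * z2 ^+ 2 - a4 * z2 * (w1 + w2)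
    - a6 * (w1 ^+ 2 + w1 * w2 + w2 ^+ 2)) m0.
  have -> : a1 * z2 + a3 * (w1 + w2) - a2 * z2 ^+ 2 - a4 * z2 * (w1 + w2)
    - a6 * (w1 ^+ 2 + w1 * w2 + w2 ^+ 2) = z2 * (a1 - a2 * z2 - a4 * (w1 + w2))
    + (w1 * (a3 - a6 * (w1 + w2)) + w2 * (a3 - a6 * w2)) by ring.
  by apply: (ballD hO); [|apply: (ballD hO)]; apply: (ballMr hO) => //; oO.
rewrite -/(chordA W z1 w1 z2 w2) in A0 OA.
have bB : Ball (m + m) (chordB W z1 w1 z2 w2).
  have -> : chordB W z1 w1 z2 w2 = z1 * z1 + z1 * z2 + z2 * z2 + w1 * (a2 * (z1 + z2) + a4 * w1 - a1).
    by rewrite /chordB; ring.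
  apply: (ballD hO); last by apply: (ballMr hO) => //; oO.
  by do 2?apply: (ballD hO); exact: (ballM hO).
have bl : Ball (m + m) (chordB W z1 w1 z2 w2 / chordA W z1 w1 z2 w2) by exact: (ballMr hO).
move: (_ / _) bl => l bl; have Ol := ball_O hO r1 bl.
have m1l : Ball m l by apply: (ball_le hO r1) bl; rewrite leq_addr.
have [|c0 Oc] := @ball_unit m (a2 * l + a4 * l ^+ 2 + a6 * l ^+ 3) m0.
  have -> : a2 * l + a4 * l ^+ 2 + a6 * l ^+ 3 = l * (a2 + a4 * l + a6 * l ^+ 2) by ring.
  by apply: (ballMr hO) => //; oO.
rewrite -/(cubicA W l) in c0 Oc.
case/(_ A0 c0) => n [z3 [w3 [[E1 E2 E3] V1 V2 w30 SE]]].
have bn : Ball (m + m) n.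
  by rewrite -(addKr (l * z1) n) -E1 addrC; apply: (ballB hO) => //; apply: (ballMr hO).
have On := ball_O hO r1 bn.
have m1n : Ball m n by apply: (ball_le hO r1) bn; rewrite leq_addr.
have bs : Ball (m + m) (z1 + z2 + z3).
  rewrite -[_ + z3](mulKf c0) V1 /cubicB.
  apply: (ballMl hO) => //; apply: (ballN hO).
  have -> : n * (a2 + 2 * a4 * l + 3 * a6 * l ^+ 2) - a1 * l - a3 * l ^+ 2 =
     n * (a2 + 2 * a4 * l + 3 * a6 * l ^+ 2) + l * (- a1 - a3 * l) by ring.
  by apply: (ballD hO); apply: (ballMr hO) => //; oO.
have bz3 : Ball m z3.
  rewrite -(addKr (z1 + z2) z3) addrC; apply: (ballB hO); last exact: (ballD hO).
  by apply: (ball_le hO r1) bs; rewrite leq_addr.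
have Oz3 := ball_O hO r1 bz3.
have bw3 : Ball (m + m) w3.
  by rewrite E3; apply: (ballD hO) => //; apply: (ballMr hO).
have Ow3 := ball_O hO r1 bw3.
have m1w3 : Ball m w3 by apply: (ball_le hO r1) bw3; rewrite leq_addr.
have [|D0 OD] := @ball_unit m (a1 * z3 + a3 * w3) m0.
  by apply: (ballD hO); apply: (ballMl hO).
have yE : - w3^-1 - a1 * (z3 / w3) - a3 = - (1 + (a1 * z3 + a3 * w3)) / w3 by field.
have y0 : - w3^-1 - a1 * (z3 / w3) - a3 != 0.
  by rewrite yE mulf_neq0 ?oppr_eq0 ?invr_eq0.
have zS : pz S = - (z3 / (1 + (a1 * z3 + a3 * w3))).
  rewrite SE /pz yE; move: (1 + _) D0 => D D0; field; by rewrite ?oppr_eq0 ?w30 ?D0.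
have wS : pw S = - (w3 / (1 + (a1 * z3 + a3 * w3))).
  rewrite SE /pw yE; move: (1 + _) D0 => D D0; field; by rewrite ?oppr_eq0 ?w30 ?D0.
have oS : on_curve W S by exact: on_curve_add.
split.
- split=> //; first by rewrite SE.
    by rewrite zS; apply: (ballN hO); apply: (ballMr hO).
  by rewrite wS; apply: (ballN hO); apply: (ballMr hO).
all: move=> nj; have {jz2}bj := jz2 nj; have {jw2}bwj := jw2 nj.
  have wjn : Ball (m + j) n.
    rewrite -(addKr (l * z2) n) -E2 addrC; apply: (ballB hO); last by apply: (ballM hO).
    (* w2 has level both 3m and 3j, and one of them is at least m + j. *)
    have [jm|mj] := leqP j m; first by apply: (ball_le hO r1) bw2; lia.
    by apply: (ball_le hO r1) (w3j nj); lia.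
  (* The numerator of the error. Vieta's formulas remove the leading terms of [cubicA W l * X],
     leaving multiples of n and of z2 times a small factor. *)
  pose X := z1 + z3 + (a1 + a3 * l) * (z1 * z3) + a3 * n * z1 + z2 * (1 + (a1 * z3 + a3 * w3)).
  have -> : pz S - z1 - z2 = - (X / (1 + (a1 * z3 + a3 * w3))).
    by rewrite zS /X E3; rewrite E3 in D0; field.
  apply: (ballN hO); apply: (ballMr hO) => //; rewrite -[X](mulKf c0); apply: (ballMl hO) => //.
  have -> : cubicA W l * X = n * ((a1 + a3 * l) * (a4 * n + 3 * a6 * l * n - a1 - 2 * a3 * l)
        - (a2 + 2 * a4 * l + 3 * a6 * l ^+ 2) + a3 * z1 * cubicA W l)
      - ((a1 + a3 * l) * (z1 + z3) - (a1 * z3 + a3 * w3)) * (z2 * cubicA W l).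
    rewrite -[X in _ = X]addr0 -[X in _ = _ + X](subrr (cubicA W l * (z1 + z2 + z3))) {2}V1
       -[X in _ = X]addr0 -[X in _ = _ + X](mulr0 (a1 + a3 * l))
       -[X in _ = _ + _ * X](subrr (cubicC W l n)) -{1}V2 /cubicB /cubicC /X; ring.
  have OcA : O (cubicA W l) by rewrite /cubicA; oO.
  apply: (ballB hO); first by apply: (ballMr hO) => //; oO.
  apply: (ballM hO); last by apply: (ballMr hO).
  apply: (ballB hO); first by apply: (ballMl hO); [oO | exact: (ballD hO)].
  by apply: (ballD hO); apply: (ballMl hO).
have nj' : Ball j n by rewrite -(addKr (l * z2) n) -E2 addrC; apply: (ballB hO) => //; apply: (ballMl hO).
have zd : Ball j (- (z3 / (1 + (a1 * z3 + a3 * w3))) - z1).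
  pose X := z1 + z3 + (a1 + a3 * l) * (z1 * z3) + a3 * n * z1.
  have -> : - (z3 / (1 + (a1 * z3 + a3 * w3))) - z1 = - (X / (1 + (a1 * z3 + a3 * w3))).
    by rewrite /X E3; rewrite E3 in D0; field.
  apply: (ballN hO); apply: (ballMr hO) => //; rewrite -[X](mulKf c0); apply: (ballMl hO) => //.
  have -> : cubicA W l * X = n * ((a1 + a3 * l) * (a4 * n + 3 * a6 * l * n - a1 - 2 * a3 * l)
        - (a2 + 2 * a4 * l + 3 * a6 * l ^+ 2) + a3 * z1 * cubicA W l)
      - z2 * (cubicA W l * (1 + (a1 + a3 * l) * (z1 + z3))).
    rewrite -[X in _ = X]addr0 -[X in _ = _ + X](subrr (cubicA W l * (z1 + z2 + z3))) {2}V1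
       -[X in _ = X]addr0 -[X in _ = _ + X](mulr0 (a1 + a3 * l))
       -[X in _ = _ + _ * X](subrr (cubicC W l n)) -{1}V2 /cubicB /cubicC /X; ring.
  have OcA : O (cubicA W l) by rewrite /cubicA; oO.
  by apply: (ballB hO); apply: (ballMr hO) => //; oO.
rewrite wS {1}E3 {1}E1.
have -> : - ((l * z3 + n) / (1 + (a1 * z3 + a3 * w3))) - (l * z1 + n) =
   l * (- (z3 / (1 + (a1 * z3 + a3 * w3))) - z1) - n / (1 + (a1 * z3 + a3 * w3)) - n by ring.
apply: (ballB hO) => //; apply: (ballB hO); first exact: (ballMl hO).
exact: (ballMr hO).
Qed.

End NearInfinity.

Section NearGroup.
Variables (T : fieldType) (O : set T) (pi : T).
Hypothesis hO : vring O.
Hypothesis r1 : rank1 O setT pi.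
Local Notation Ball := (ball O pi).
Variable W : weierstrass T.
Hypothesis intW : integral O W.
Hypothesis EW : elliptic W.
Local Notation E := (ecpt EW).
Implicit Types P Q R : E.
Local Notation a1 := (a1 W).
Local Notation a2 := (a2 W).
Local Notation a3 := (a3 W).
Local Notation a4 := (a4 W).
Local Notation a6 := (a6 W).

Definition nbh m P := near0 O pi W m (ptval P).
Definition ez P := pz (ptval P).

Lemma nbh0 m : nbh m 0. Proof. exact: near0_None. Qed.

Lemma nbh_le m j P : (0 < m)%N -> nbh m P -> Ball j (ez P) -> nbh j P.
Proof. exact: near0_le. Qed.

Lemma nbh_ball m P : nbh m P -> Ball m (ez P). Proof. by case. Qed.

Lemma nbh_weak j m P : (m <= j)%N -> nbh j P -> nbh m P.
Proof. by move=> mj [? ? b1 b2]; split=> //; [apply: (ball_le hO r1) b1 | apply: (ball_le hO r1) b2]. Qed.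

Lemma nbhN m P : (0 < m)%N -> nbh m P -> nbh m (- P).
Proof. by move=> m0 nP; have [] := near0_opp hO r1 intW m m0 nP. Qed.

Lemma nbhD m P Q : (0 < m)%N -> nbh m P -> nbh m Q -> nbh m (P + Q).
Proof. by move=> m0 nP nQ; have [] := near0_add hO r1 intW m m0 nP nQ. Qed.

Lemma nbhB m P Q : (0 < m)%N -> nbh m P -> nbh m Q -> nbh m (P - Q).
Proof. by move=> m0 nP nQ; apply: nbhD => //; exact: nbhN. Qed.

Lemma nbhMn m P n : (0 < m)%N -> nbh m P -> nbh m (P *+ n).
Proof.
by move=> m0 nP; elim: n => [|n IH]; [exact: nbh0 | rewrite mulrS; exact: nbhD].
Qed.

Lemma ezD m j P Q : (0 < m)%N -> nbh m P -> nbh m Q -> nbh j Q ->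
  Ball (m + j) (ez (P + Q) - ez P - ez Q).
Proof. by move=> m0 nP nQ; have [_ h _] := near0_add hO r1 intW j m0 nP nQ. Qed.

Lemma ezMn m P n : (0 < m)%N -> nbh m P -> Ball (m + m) (ez (P *+ n) - n%:R * ez P).
Proof.
move=> m0 nP; elim: n => [|n IH]; first by rewrite mulr0n mul0r subr0; exact: ball0.
rewrite mulrSr; have -> : ez (P *+ n + P) - n.+1%:R * ez P =
   (ez (P *+ n + P) - ez (P *+ n) - ez P) + (ez (P *+ n) - n%:R * ez P).
  by rewrite -addn1 natrD mulrDl mul1r; ring.
by apply: (ballD hO) => //; apply: ezD => //; exact: nbhMn.
Qed.

Lemma nbh_separated m P : (0 < m)%N -> nbh m P -> (forall j, Ball j (ez P)) -> P = 0.
Proof.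
move=> m0 nP zP; apply: ptval_inj; rewrite ptval0.
have : pw (ptval P) = 0.
  by apply: (separated hO r1) => j; have [] := nbh_le m0 nP (zP j).
have [_ + _ _] := nP; case: (ptval P) => [[x y]|] //= y0 /eqP.
by rewrite invr_eq0 (negPf y0).
Qed.

(** If rP = 0, then z(P) = -(z(rP) - r z(P)) / r has twice the level of P; iterating, P lies
    arbitrarily deep and is 0. *)
Lemma nbh_torsion_free m r P : (0 < m)%N -> r%:R != 0 :> T -> O (r%:R : T)^-1 ->
  nbh m P -> P *+ r = 0 -> P = 0.
Proof.
move=> m0 r0 Or nP rP; have step k : nbh (m + k) P -> Ball (m + k + (m + k)) (ez P).
  move=> nk; have mk0 : (0 < m + k)%N by rewrite addn_gt0 m0.
  have := ezMn r mk0 nk; rewrite rP /ez /= sub0r => /(ballN hO); rewrite opprK => h.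
  by rewrite -[X in Ball _ X](mulKf r0); exact: ballMl.
apply: (nbh_separated m0 nP); suff H k : nbh (m + k) P.
  by move=> j; apply: (ball_le hO r1) (nbh_ball (H j)); rewrite leq_addl.
elim: k => [|k IH]; first by rewrite addn0.
apply: (nbh_le m0 nP); apply: (ball_le hO r1) (step k IH); lia.
Qed.

(** Points near infinity with close z-coordinates have a small difference. *)
Lemma nbh_sub m j P Q : (0 < m)%N -> nbh m P -> nbh m Q -> Ball j (ez P - ez Q) -> nbh j (P - Q).
Proof.
move=> m0 nP nQ h; have nT := nbhB m0 nP nQ.
suff H k : Ball (minn j k) (ez (P - Q)).
  by apply: (nbh_le m0 nT); have := H j; rewrite minnn.
elim: k => [|k IH]; first by rewrite minn0; apply: (ball_le hO r1 (leq0n m)); exact: nbh_ball.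
have := ezD m0 nQ nT (nbh_le m0 nT IH); rewrite (addrC Q) subrK => b.
have -> : ez (P - Q) = (ez P - ez Q) - (ez P - ez Q - ez (P - Q)) by ring.
apply: (ballB hO); first by apply: (ball_le hO r1) h; rewrite geq_minl.
by apply: (ball_le hO r1) b; lia.
Qed.

Section Rational.
Variable L : set T.
Hypothesis hL : subfield L.
Hypothesis La : [/\ L a1, L a2, L a3, L a4 & L a6].

Lemma rational_add X Y : rational_points W L X -> rational_points W L Y ->
  rational_points W L (ec_add W X Y).
Proof.
have [La1 La2 La3 La4 La6] := La.
move=> [oX LX] [oY LY]; split; first exact: on_curve_add.
have L2 : L 2 by exact: sf_nat. have L3 : L 3 by exact: sf_nat.
case: X Y oX LX oY LY => [[x1 y1]|] [[x2 y2]|] //= _ [Lx1 Ly1] _ [Lx2 Ly2].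
case: ifP => // _; set m := if _ then _ else _; have Lm : L m.
  by rewrite /m; case: ifP => _; repeat first [assumption | apply: (sf_div hL) | apply: (sfN hL)
    | apply: (sfD hL) | apply: (sfX hL) | apply: (sfM hL)].
by split; repeat first [assumption | apply: (sfN hL) | apply: (sfD hL) | apply: (sfX hL) | apply: (sfM hL)].
Qed.

Lemma rational_opp X : rational_points W L X -> rational_points W L (ec_opp W X).
Proof.
have [La1 La2 La3 La4 La6] := La.
move=> [oX LX]; split; first exact: on_curve_opp.
case: X oX LX => [[x y]|] //= _ [Lx Ly].
by split; repeat first [assumption | apply: (sfN hL) | apply: (sfD hL) | apply: (sfM hL)].
Qed.

Lemma rational_muln X n : rational_points W L X -> rational_points W L (ec_muln W n X).
Proof. by move=> LX; elim: n => [|n IH]; [split | exact: rational_add]. Qed.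

Hypothesis Lpi : L pi.
Hypothesis Lc : gcomplete O pi L.

(** A neighbourhood of infinity in E(L) is complete: z and w converge in L and the equation passes
    to the limit. If w tends to 0, so does z, and the limit is the point at infinity. *)
Lemma gcomplete_nbh (R : nat -> E) m : (0 < m)%N -> (forall k, nbh m (R k)) ->
  (forall k, rational_points W L (ptval (R k))) ->
  (forall k, nbh k (R k.+1 - R k)) ->
  exists Q, [/\ nbh m Q, rational_points W L (ptval Q) & forall j, exists k, (j <= k)%N /\ nbh j (Q - R k)].
Proof.
move=> m0 nR rR dR.
have Lz k : L (pz (ptval (R k))) /\ L (pw (ptval (R k))).
  have [_] := rR k; case: (ptval (R k)) => [[x y]|] /=; last by split; exact: sf0.
  by move=> [Lx Ly]; split; [exact: sf_div | exact: sfV].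
have RE k : R k.+1 = R k + (R k.+1 - R k) by rewrite addrC subrK.
have [k|k|z Lzz hz] := Lc (u := fun k => ez (R k)); first by case: (Lz k).
  have nd : nbh m (R k.+1 - R k) by exact: nbhB.
  have b := ezD m0 (nR k) nd (dR k); rewrite -RE in b.
  rewrite -(subrK (ez (R k.+1 - R k)) (_ - _)); apply: (ballD hO); last exact: nbh_ball (dR k).
  by apply: (ball_le hO r1) b; rewrite leq_addl.
have [k|k|w Lw hw] := Lc (u := fun k => pw (ptval (R k))); first by case: (Lz k).
  have nd : nbh m (R k.+1 - R k) by exact: nbhB.
  have [_ _ h] := near0_add hO r1 intW k m0 (nR k) nd.
  by move: h; rewrite -ptvalD -RE; apply; exact: dR.
have bz : Ball m z.
  by rewrite -(subrK (ez (R m)) z); apply: (ballD hO) => //; exact: nbh_ball (nR m).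
have bw : Ball m w.
  by rewrite -(subrK (pw (ptval (R m))) w); apply: (ballD hO) => //; case: (nR m).
have F0 : w * (1 + (z * (a1 - a2 * z - a4 * w) + w * (a3 - a6 * w))) - z ^+ 3 = 0.
  apply: (separated hO r1) => k.
  have Fk : let z' := ez (R k) in let w' := pw (ptval (R k)) in
      w' * (1 + (z' * (a1 - a2 * z' - a4 * w') + w' * (a3 - a6 * w'))) - z' ^+ 3 = 0.
    rewrite /ez; have [oR + _ _] := nR k; case: (ptval (R k)) oR => [[x y]|] /= oR yR.
      by have := zw_curve yR oR; cbv zeta => ->; rewrite subrr.
    by rewrite mul0r sub0r expr0n oppr0.
  have [Oz Ow] : O z /\ O w by split; [exact: (ball_O hO r1 bz) | exact: (ball_O hO r1 bw)].
  have [Oz' Ow'] : O (ez (R k)) /\ O (pw (ptval (R k))).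
    by have [_ _ b1 b2] := nR k; split; [exact: (ball_O hO r1 b1) | exact: (ball_O hO r1 b2)].
  have [Oa1 Oa2 Oa3 Oa4 Oa6] := intW.
  move: Fk Oz' Ow' (hz k) (hw k); cbv zeta; move: (ez _) (pw _) => z' w' Fk Oz' Ow' hz' hw'.
  rewrite -[X in Ball k X]subr0 -Fk.
  rewrite (_ : _ - _ = (w - w') * chordA W z w z' w' - (z - z') * chordB W z w z' w'); last first.
    by rewrite /chordA /chordB; ring.
  by apply: (ballB hO); apply: (ballMr hO) => //; rewrite /chordA /chordB;
    repeat first [assumption | exact: (vO1 hO) | apply: (vON hO) | apply: (vOD hO) | apply: (vOX hO) | apply: (vOM hO)].
have [Q [zQ wQ LQ yQ]] : exists Q : E, [/\ ez Q = z, pw (ptval Q) = w, rational_points W L (ptval Q) &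
    (if ptval Q is Some (x, y) then y != 0 else true)].
  have [w0|w0] := eqVneq w 0.
    exists 0; split=> //; rewrite /ez ?ptval0 //=.
    move: F0; rewrite w0 mul0r sub0r => /eqP; rewrite oppr_eq0 expf_eq0 /= => /eqP -> //.
  have oQ : on_curve W (Some (z / w, w^-1)).
    rewrite /=; apply: (mulIf (expf_neq0 3 w0)); apply/eqP; rewrite -subr_eq0 -F0; apply/eqP; field => //.
  have [Q QE] := ptvalK EW oQ; exists Q; rewrite /ez QE /= invrK divfK ?invr_eq0 //; split=> //.
  by split=> //; split; [exact: sf_div | exact: sfV].
have nQ : nbh m Q by split; rewrite ?zQ ?wQ //; [exact: ptvalP | rewrite -/(ez Q) zQ].
exists Q; split=> // j; exists j; split=> //.
by apply: (nbh_sub m0) => //; rewrite zQ; exact: hz.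
Qed.

(** Newton's iteration for division by r: if ur = vp + 1, the correction u(P - rR) turns the error D
    into -vpD, and multiplication by p deepens the level because p = 0 in the field. *)
Lemma nbh_divisible p r m P : p \in [pchar T] -> coprime r p -> (0 < r)%N -> (0 < m)%N ->
  nbh m P -> rational_points W L (ptval P) ->
  exists Q, [/\ nbh m Q, rational_points W L (ptval Q) & Q *+ r = P].
Proof.
move=> pT rp r0 m0 nP rP.
case: (egcdnP p r0) => u v; rewrite (eqP rp) => uv _.
pose R := fix R k := if k is k'.+1 then R k' + (P - R k' *+ r) *+ u else 0 : E.
have rR k : rational_points W L (ptval (R k)).
  elim: k => [|k IH] /=; first by split.
  apply: rational_add => //; rewrite ptvalMn; apply: rational_muln; apply: rational_add => //.
  by apply: rational_opp; rewrite ptvalMn; exact: rational_muln.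
(* z(pQ) equals p z(Q) = 0 up to level 2j, which is at least j + 1. *)
have pstep j Q : (0 < j)%N -> nbh j Q -> nbh j.+1 (Q *+ p).
  move=> j0 nQ; apply: (nbh_le j0); first exact: nbhMn.
  have := ezMn p j0 nQ; rewrite (pcharf0 pT) mul0r subr0; apply: (ball_le hO r1); lia.
have D k : nbh (m + k) (P - R k *+ r).
  elim: k => [|k IH] /=; first by rewrite mul0rn subr0 addn0.
  have -> : P - (R k + (P - R k *+ r) *+ u) *+ r = - (P - R k *+ r) *+ v *+ p.
    rewrite mulrnDl opprD addrA; move: (P - R k *+ r) => D.
    by rewrite -mulrnA uv mulrnDr mulr1n opprD addrCA subrr addr0 mulNrn mulNrn mulrnA.
  rewrite addnS; apply: pstep; first by rewrite addn_gt0 m0.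
  by apply: nbhMn; [|apply: nbhN]; rewrite ?addn_gt0 ?m0.
have nR k : nbh m (R k).
  elim: k => [|k IH] /=; first exact: nbh0.
  by apply: nbhD => //; apply: nbhMn => //; apply: nbh_weak (D k); rewrite leq_addr.
have dR k : nbh k (R k.+1 - R k).
  rewrite /= addrC addKr; apply: (nbh_weak (leq_addl m k)).
  by apply: nbhMn; rewrite ?addn_gt0 ?m0.
have [Q [nQ rQ hQ]] := gcomplete_nbh m0 nR rR dR; exists Q; split=> //.
apply/eqP; rewrite -subr_eq0; apply/eqP; apply: (@nbh_separated m) => //.
  by apply: nbhB => //; exact: nbhMn.
move=> j; apply: (ball_le hO r1 (leqnSn j)); have [k [jk nk]] := hQ j.+1; apply: nbh_ball.
rewrite -(subrK (R k *+ r) (Q *+ r)) -mulrnBl -addrA; apply: nbhD => //.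
  exact: nbhMn.
rewrite -opprB; apply: nbhN => //; apply: nbh_weak (D k); lia.
Qed.

End Rational.
End NearGroup.

(** * Differences of nearby points, and scaling *)

Section NearFinite.
Variables (T : fieldType) (O : set T) (pi : T).
Hypothesis hO : vring O.
Hypothesis r1 : rank1 O setT pi.
Local Notation Ball := (ball O pi).
Variable W : weierstrass T.
Hypothesis intW : integral O W.
Hypothesis EW : elliptic W.
Local Notation a1 := (a1 W).
Local Notation a2 := (a2 W).
Local Notation a3 := (a3 W).
Local Notation a4 := (a4 W).
Local Notation a6 := (a6 W).

Lemma ball_mul k n a t : O (pi ^+ k * a) -> Ball (k + n) t -> Ball n (a * t).
Proof.
move=> Oa bt; have -> : a * t = (pi ^+ k * a) * (t / pi ^+ k).
  by have := piX_neq0 r1 k; move: (pi ^+ k) => u u0; field.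
by apply: (ballMl hO) => //; exact: (ball_div r1 k n t).1.
Qed.

Lemma small_elt_ball x : x != 0 -> exists n, forall j t, Ball (n + j) t -> Ball j (t / x).
Proof.
move=> x0; have [n hn] := small_elt hO r1 x0; exists n => j t.
rewrite addnC => /(ball_div r1 j n t).1 /hn; rewrite /ball /=; congr O; rewrite mulrAC //.
Qed.

(** The inverse slope mu of the chord is small, and the coordinates of the sum are mu^-2 and -mu^-3
    up to units. *)
Lemma near_sum x y x0 y0 k m : (0 < m)%N -> on_curve W (Some (x, y)) -> on_curve W (Some (x0, y0)) ->
  x != x0 -> y != y0 -> O (pi ^+ k * x) -> O (pi ^+ k * y) -> O (pi ^+ k * x0) ->
  Ball (k + m) ((x - x0) / (y - y0)) -> near0 O pi W m (ec_add W (Some (x, y)) (Some (x0, y0))).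
Proof.
move=> m0 oP oQ nx ny kx ky kx0 bmu; have oS := on_curve_add oP oQ.
move: oS; rewrite ec_addE (negPf nx) /slope (negPf nx) andFb; cbv zeta.
have dx0 : x0 - x != 0 by rewrite subr_eq0 eq_sym.
have dy0 : y0 - y != 0 by rewrite subr_eq0 eq_sym.
have dy0' : y - y0 != 0 by rewrite subr_eq0.
set s := (y0 - y) / (x0 - x); set x3 := _ - x0; set y3 := _ - a3 => oS.
pose mu := (x - x0) / (y - y0).
have s0 : s != 0 by rewrite mulf_neq0 ?invr_eq0.
have sE : s = mu^-1 by rewrite /mu /s; field; rewrite dx0 dy0' subr_eq0 nx.
have mu0 : mu != 0 by rewrite -invr_eq0 -sE.
rewrite -/mu in bmu; clearbody mu; clearbody s; rewrite sE in s0 x3 y3 oS *; clear s sE s0.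
have bm : Ball m mu by apply: (ball_le hO r1) bmu; rewrite leq_addl.
have Omu := ball_O hO r1 bm.
have [Oa1 Oa2 Oa3 Oa4 Oa6] := intW.
pose e1 := a1 * mu - a2 * mu * mu - (x * mu) * mu - (x0 * mu) * mu.
have bx : Ball m (x * mu) by exact: ball_mul bmu.
have bx0 : Ball m (x0 * mu) by exact: ball_mul bmu.
have by0 : Ball m (y * mu) by exact: ball_mul bmu.
have be1 : Ball m e1.
  by rewrite /e1; do 3?[apply: (ballB hO)]; apply: (ballMl hO) => //; first [exact: (vOM hO) | exact: (ball_O hO r1 bx) | exact: (ball_O hO r1 bx0)].
pose e2 := e1 + a1 * mu * (1 + e1) + (y * mu) * mu * mu + a3 * mu * mu * mu - (x * mu) * mu.
have Oe1 := ball_O hO r1 be1.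
have be2 : Ball m e2.
  have Ox := ball_O hO r1 bx; have Oy := ball_O hO r1 by0.
  rewrite /e2; apply: (ballB hO); last exact: (ballMl hO).
  apply: (ballD hO); last by apply: (ballMl hO) => //; do 2?apply: (vOM hO).
  apply: (ballD hO); last by apply: (ballMl hO) => //; apply: (vOM hO).
  apply: (ballD hO) => //; apply: (ballMr hO); last exact: (ballMl hO).
  by apply: (vOD hO) => //; exact: vO1.
have [u0 Ou] := ball_unit hO r1 m0 be2.
have x3E : x3 = (1 + e1) / mu ^+ 2 by rewrite /x3 /e1; field.
have y3E : y3 = - (1 + e2) / mu ^+ 3 by rewrite /y3 x3E /e2; field.
have y30 : y3 != 0 by rewrite y3E mulf_neq0 ?oppr_eq0 // invr_eq0 expf_neq0.
have O1e1 : O (1 + e1) by apply: (vOD hO) => //; exact: vO1.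
split=> //=.
  have -> : x3 / y3 = - ((1 + e1) / (1 + e2)) * mu.
    by rewrite x3E y3E; move: (1 + e2) (1 + e1) u0 => u v u0; field; rewrite ?oppr_eq0 ?mu0 ?u0.
  by apply: (ballMl hO) => //; apply: (vON hO); exact: vOM.
have -> : y3^-1 = - (1 + e2)^-1 * mu ^+ 2 * mu.
  by rewrite y3E; move: (1 + e2) u0 => u u0; field; rewrite ?oppr_eq0 ?mu0 ?u0.
by apply: (ballMl hO) => //; apply: (vOM hO); [exact: vON | exact: vOX].
Qed.

(** Continuity of subtraction at the diagonal. The chord from P to the opposite of a nearby point is
    steep; its inverse slope is estimated directly if the derivative in y is nonzero at P, and
    through the identity [curve] otherwise. *)
Lemma near_sub x y m : (0 < m)%N -> on_curve W (Some (x, y)) -> exists k, forall x0 y0,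
  on_curve W (Some (x0, y0)) -> Ball k (x - x0) -> Ball k (y - y0) ->
  near0 O pi W m (ec_sub W (Some (x, y)) (Some (x0, y0))).
Proof.
move=> m0 oP.
have [k hk] := bounded_seq hO r1 [:: x; y].
have kx : O (pi ^+ k * x) by apply: hk; rewrite inE eqxx.
have ky : O (pi ^+ k * y) by apply: hk; rewrite !inE eqxx orbT.
have [Oa1 Oa2 Oa3 Oa4 Oa6] := intW.
have kx0 x0 j : Ball j (x - x0) -> O (pi ^+ k * x0).
  move=> b; rewrite -[x0](subKr x) mulrBr; apply: (vOB hO) => //.
  by apply: (vOM hO); [exact: piX_O hO r1 k | exact: (ball_O hO r1 b)].
have tE x0 y0 j : Ball j (x - x0) -> Ball j (y - y0) -> Ball j ((y - y0) + a1 * (x - x0)).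
  by move=> b1 b2; apply: (ballD hO) => //; exact: ballMl.
have curve x0 y0 : on_curve W (Some (x0, y0)) ->
   (y - (- y0 - a1 * x0 - a3)) * ((y - y0) + a1 * (x - x0)) =
   (x - x0) * (x ^+ 2 + x * x0 + x0 ^+ 2 + a2 * (x + x0) + a4 - a1 * (- y0 - a1 * x0 - a3)).
  move=> /= E0; apply/eqP; rewrite -subr_eq0; apply/eqP.
  transitivity ((y ^+ 2 + a1 * x * y + a3 * y - (x ^+ 3 + a2 * x ^+ 2 + a4 * x + a6))
     - (y0 ^+ 2 + a1 * x0 * y0 + a3 * y0 - (x0 ^+ 3 + a2 * x0 ^+ 2 + a4 * x0 + a6))); first by ring.
  by rewrite E0; move: oP => /= ->; rewrite !subrr.
have same x0 : ec_sub W (Some (x, x0)) (Some (x, x0)) = None.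
  by rewrite /ec_sub ec_addE eqxx /= (_ : _ + _ + _ + _ = 0) ?eqxx //; ring.
have [t0|t0] := eqVneq (2 * y + a1 * x + a3) 0; last first.
  have [n hn] := small_elt_ball t0; exists (n + (k + m))%N => x0 y0 oQ bx b_y.
  have yE : y - (- y0 - a1 * x0 - a3) = (2 * y + a1 * x + a3)
       * (1 - ((y - y0) + a1 * (x - x0)) / (2 * y + a1 * x + a3)) by field.
  have [|u0 Ou] := @ball_unit _ _ _ hO r1 m (- (((y - y0) + a1 * (x - x0)) / (2 * y + a1 * x + a3))) m0.
    by apply: (ballN hO); apply: (ball_le hO r1) (hn _ _ (tE _ _ _ bx b_y)); rewrite leq_addl.
  have yn : y - (- y0 - a1 * x0 - a3) != 0 by rewrite yE mulf_neq0.
  have [xx|xn] := eqVneq x x0.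
    have := curve _ _ oQ; rewrite -xx subrr mul0r mulr0 addr0 => /eqP.
    rewrite mulf_eq0 xx (negPf yn) orFb subr_eq0 => /eqP <-.
    by rewrite -xx same; exact: near0_None.
  apply: (@near_sum _ _ _ _ k m) => //; first exact: (on_curve_opp oQ).
  - by rewrite -subr_eq0.
  - exact: (kx0 _ _ bx).
  rewrite yE invfM mulrA; apply: (ballMr hO) => //; exact: hn.
(* Here P equals its opposite, so numerator and denominator of the inverse slope are both small; the
   nonzero derivative in x rewrites the quotient with a denominator [N'] close to [N]. *)
have s0 : 3 * x ^+ 2 + 2 * a2 * x + a4 - a1 * y != 0.
  by have := nonsingular EW oP; rewrite t0 eqxx.
have [n hn] := small_elt_ball s0; exists (k + (n + (k + m)))%N => x0 y0 oQ bx b_y.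
set N := 3 * x ^+ 2 + 2 * a2 * x + a4 - a1 * y in s0 hn.
set N' := x ^+ 2 + x * x0 + x0 ^+ 2 + a2 * (x + x0) + a4 - a1 * (- y0 - a1 * x0 - a3).
have bd : Ball (n + (k + m)) (N' - N).
  have -> : N' - N = - ((x0 + 2 * x) * (x - x0)) - a2 * (x - x0) - a1 * ((y - y0) + a1 * (x - x0))
      + a1 * (2 * y + a1 * x + a3) by rewrite /N /N'; ring.
  rewrite t0 mulr0 addr0.
  have w t : Ball (k + (n + (k + m))) t -> Ball (n + (k + m)) t by apply: (ball_le hO r1); rewrite leq_addl.
  apply: (ballB hO); last by apply: (ballMl hO) => //; apply: w; exact: tE.
  apply: (ballB hO); last by apply: (ballMl hO) => //; apply: w.
  apply: (ballN hO); apply: (ball_mul _ bx); rewrite mulrDr mulrCA; apply: (vOD hO); first exact: (kx0 _ _ bx).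
  by apply: (vOM hO) => //; exact: vO_nat.
have [|u0 Ou] := @ball_unit _ _ _ hO r1 m ((N' - N) / N) m0.
  by apply: (ball_le hO r1) (hn _ _ bd); rewrite leq_addl.
have N'E : N' = N * (1 + (N' - N) / N) by field.
have N'0 : N' != 0 by rewrite N'E mulf_neq0.
have E := curve _ _ oQ; rewrite -/N' in E.
have yy0 : y = y0 -> x = x0 -> near0 O pi W m (ec_sub W (Some (x, y)) (Some (x0, y0))).
  by move=> <- <-; rewrite same; exact: near0_None.
have [xx|xn] := eqVneq x x0.
  apply: yy0 => //; move/eqP: E; rewrite -xx subrr mul0r mulr0 addr0 mulf_eq0 => /orP[/eqP h|/eqP h].
    apply/eqP; rewrite -subr_eq0; apply/eqP.
    transitivity ((2 * y + a1 * x + a3) - (y - (- y0 - a1 * x - a3))); first by ring.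
    by rewrite t0 h subrr.
  by apply/eqP; rewrite -subr_eq0 h.
have yn : y - (- y0 - a1 * x0 - a3) != 0.
  apply/eqP => h; move/eqP: E; rewrite h mul0r eq_sym mulf_eq0 subr_eq0 (negPf xn) (negPf N'0) //.
apply: (@near_sum _ _ _ _ k m) => //; first exact: (on_curve_opp oQ).
- by rewrite -subr_eq0.
- exact: (kx0 _ _ bx).
have -> : (x - x0) / (y - (- y0 - a1 * x0 - a3)) = ((y - y0) + a1 * (x - x0)) / N'.
  by apply/eqP; rewrite eqr_div // -E mulrC.
rewrite N'E invfM mulrA; apply: (ballMr hO) => //; apply: hn.
by apply: tE; [apply: (ball_le hO r1) bx | apply: (ball_le hO r1) b_y]; rewrite leq_addl.
Qed.

End NearFinite.

Section Scaling.
Variables (T : fieldType) (u : T).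
Hypothesis u0 : u != 0.
Variable W : weierstrass T.

(** With u a power of pi, this change of variables makes the coefficients and any given point
    integral, as the estimates above require. *)
Definition wsc (W : weierstrass T) : weierstrass T :=
  Weierstrass (u * a1 W) (u ^+ 2 * a2 W) (u ^+ 3 * a3 W) (u ^+ 4 * a4 W) (u ^+ 6 * a6 W).
Definition psc (P : point T) : point T :=
  if P is Some (x, y) then Some (u ^+ 2 * x, u ^+ 3 * y) else None.

Lemma wsc_elliptic : elliptic W -> elliptic (wsc W).
Proof.
move=> EW; rewrite /elliptic (_ : disc (wsc W) = u ^+ 12 * disc W).
  by rewrite mulf_neq0 // expf_neq0.
by rewrite /disc /b2 /b4 /b6 /b8 /=; ring.
Qed.

Lemma psc_curve P : on_curve W P <-> on_curve (wsc W) (psc P).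
Proof.
case: P => [[x y]|] //=; split=> E; last apply: (mulfI (expf_neq0 6 u0)).
  transitivity (u ^+ 6 * (y ^+ 2 + a1 W * x * y + a3 W * y)); first by ring.
  by rewrite E; ring.
transitivity ((u ^+ 3 * y) ^+ 2 + u * a1 W * (u ^+ 2 * x) * (u ^+ 3 * y) + u ^+ 3 * a3 W * (u ^+ 3 * y)).
  by ring.
by rewrite E; ring.
Qed.

Lemma psc_inj : injective psc.
Proof.
move=> [[x y]|] [[x' y']|] //= [] /(mulfI (expf_neq0 2 u0)) -> /(mulfI (expf_neq0 3 u0)) -> //.
Qed.

Lemma psc_surj P : exists Q, P = psc Q.
Proof.
case: P => [[x y]|]; last by exists None.
by exists (Some (x / u ^+ 2, y / u ^+ 3)); congr (Some (_, _)); rewrite mulrC divfK ?expf_neq0.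
Qed.

Lemma psc_add P Q : psc (ec_add W P Q) = ec_add (wsc W) (psc P) (psc Q).
Proof.
case: P Q => [[x1 y1]|] [[x2 y2]|] //; rewrite [psc (Some (x1, y1))]/= [psc (Some (x2, y2))]/= !ec_addE.
rewrite (inj_eq (mulfI (expf_neq0 2 u0))).
have -> : (u ^+ 3 * y1 + u ^+ 3 * y2 + a1 (wsc W) * (u ^+ 2 * x2) + a3 (wsc W) == 0) =
    (y1 + y2 + a1 W * x2 + a3 W == 0).
  rewrite (_ : _ + _ = u ^+ 3 * (y1 + y2 + a1 W * x2 + a3 W)); last by rewrite /=; ring.
  by rewrite mulf_eq0 expf_eq0 (negPf u0).
case: ifP => // _; cbv zeta.
have -> : slope (wsc W) (u ^+ 2 * x1) (u ^+ 3 * y1) (u ^+ 2 * x2) (u ^+ 3 * y2) = u * slope W x1 y1 x2 y2.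
  rewrite /slope (inj_eq (mulfI (expf_neq0 2 u0))) /=; case: ifP => _.
    rewrite (_ : 2 * _ + _ + _ = u ^+ 3 * (2 * y1 + a1 W * x1 + a3 W)); last by ring.
    rewrite (_ : 3 * _ + _ + _ - _ = u ^+ 3 * (u * (3 * x1 ^+ 2 + 2 * a2 W * x1 + a4 W - a1 W * y1))); last by ring.
    by rewrite invfM mulrACA mulfV ?mul1r ?mulrA ?expf_neq0.
  rewrite -!mulrBr (_ : u ^+ 3 * (y2 - y1) = u ^+ 2 * (u * (y2 - y1))); last by ring.
  by rewrite invfM mulrACA mulfV ?mul1r ?mulrA ?expf_neq0.
by rewrite /=; congr (Some (_, _)); ring.
Qed.

Lemma psc_opp P : psc (ec_opp W P) = ec_opp (wsc W) (psc P).
Proof. by case: P => [[x y]|] //=; congr (Some (_, _)); ring. Qed.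

Lemma psc_muln n P : psc (ec_muln W n P) = ec_muln (wsc W) n (psc P).
Proof. by elim: n => [//|n IH]; rewrite /ec_muln /= -!/(ec_muln _ _ _) psc_add IH. Qed.

Lemma psc_rational L P : subfield L -> L u ->
  rational_points W L P <-> rational_points (wsc W) L (psc P).
Proof.
move=> hL Lu; case: P => [[x y]|]; last by [].
have e2 : u ^+ 2 != 0 by rewrite expf_neq0.
have e3 : u ^+ 3 != 0 by rewrite expf_neq0.
split=> -[oP [Lx Ly]]; split.
- exact: (psc_curve _).1 oP.
- by split; apply: (sfM hL) => //; exact: sfX.
- exact: (psc_curve (Some (x, y))).2 oP.
rewrite -[x](mulKf e2) -[y](mulKf e3) mulrC [_^-1 * (_ * y)]mulrC.
by split; apply: (sf_div hL) => //; exact: sfX.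
Qed.

End Scaling.

(** * Approximating points modulo multiples of r^N *)

Section Approximation.
Variables (T : fieldType) (O : set T) (pi : T).
Hypothesis hO : vring O.
Hypothesis r1 : rank1 O setT pi.
Local Notation Ball := (ball O pi).
Variables (p r : nat).
Hypothesis pT : p \in [pchar T].
Hypothesis rp : coprime r p.
Hypothesis r_gt0 : (0 < r)%N.

Definition pclose k (P Q : point T) : Prop :=
  match P, Q with
  | Some (x, y), Some (x', y') => Ball k (x - x') /\ Ball k (y - y')
  | None, None => True
  | _, _ => False
  end.

Lemma scale_integral (W : weierstrass T) (s : seq T) : exists c,
  integral O (wsc (pi ^+ c) W) /\ {in s, forall x, O (pi ^+ c * x)}.
Proof.
have [c hc] := bounded_seq hO r1 [:: a1 W, a2 W, a3 W, a4 W, a6 W & s].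
have up n x : (0 < n)%N -> O (pi ^+ c * x) -> O ((pi ^+ c) ^+ n * x).
  case: n => // n _ h; rewrite exprSr -mulrA; apply: (vOM hO) => //.
  by apply: (vOX hO); exact: (piX_O hO r1 c).
exists c; split; last by move=> x xs; apply: hc; rewrite !inE xs !orbT.
by split=> /=; rewrite -1?[pi ^+ c in X in O X]expr1; (try apply: up => //); apply: hc; rewrite !inE eqxx ?orbT.
Qed.

Lemma r_unit n : (r ^ n)%:R != 0 :> T /\ O ((r ^ n)%:R : T)^-1.
Proof.
have h : (r ^ n)%:R != 0 :> T.
  rewrite natrX expf_neq0 // -(dvdn_pcharf pT) -prime_coprime ?(pcharf_prime pT) //.
  by rewrite coprime_sym.
by split=> //; have [m ->] := nat_inv pT h; exact: vO_nat.
Qed.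

Lemma pi_scale c : pi ^+ c != 0. Proof. exact: (piX_neq0 r1 c). Qed.

Lemma pclose_scale c k P Q : pclose k P Q -> pclose k (psc (pi ^+ c) P) (psc (pi ^+ c) Q).
Proof.
case: P Q => [[x y]|] [[x' y']|] //= [h1 h2]; rewrite -!mulrBr.
by split; apply: (ballMl hO) => //; apply: (vOX hO); exact: (piX_O hO r1 c).
Qed.

Lemma near_sub_point (W : weierstrass T) m P : integral O W -> elliptic W -> (0 < m)%N -> on_curve W P ->
  exists k, forall Q, on_curve W Q -> pclose k P Q -> near0 O pi W m (ec_sub W P Q).
Proof.
move=> iW EW m0; case: P => [[x y]|] oP; last by exists 0%N => -[[x y]|] // _ _; exact: near0_None.
have [k hk] := near_sub hO r1 iW EW m0 oP; exists k => -[[x' y']|] //= oQ [b1 b2].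
exact: hk.
Qed.

(** The difference of two close points with the same r^N-multiple is a torsion point near infinity,
    hence 0. *)
Lemma torsion_isolated (W : weierstrass T) N P : elliptic W -> on_curve W P -> exists k, forall Q,
  on_curve W Q -> pclose k P Q -> ec_muln W (r ^ N) P = ec_muln W (r ^ N) Q -> P = Q.
Proof.
move=> EW oP; have [c [iW _]] := scale_integral W [::].
have c0 := pi_scale c; have EW' := wsc_elliptic c0 EW.
have oP' := (psc_curve c0 W P).1 oP.
have [k hk] := near_sub_point iW EW' (ltn0Sn 0) oP'; exists k => Q oQ PQ rE.
have oQ' := (psc_curve c0 W Q).1 oQ.
apply: (psc_inj c0); have nD := hk _ oQ' (pclose_scale c PQ).
have [P' PE] := ptvalK EW' oP'; have [Q' QE] := ptvalK EW' oQ'.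
rewrite -PE -QE in nD *; congr ptval; apply/eqP; rewrite -subr_eq0; apply/eqP.
have [rn0 rnO] := r_unit N.
apply: (nbh_torsion_free hO r1 iW (m := 1) _ rn0 rnO) => //.
rewrite mulrnBl; apply/eqP; rewrite subr_eq0; apply/eqP; apply: ptval_inj.
by rewrite !ptvalMn PE QE -!psc_muln // rE.
Qed.

Variable L : set T.
Hypothesis hL : subfield L.
Hypothesis Lpi : L pi.
Hypothesis Lc : gcomplete O pi L.
Variable A : set T.
Hypothesis AL : A `<=` L.
Hypothesis Ad : forall x n, L x -> exists2 a, A a & Ball n (x - a).

(** One coordinate lies in the dense set A and locally determines the other. An automorphism that
    fixes the first and moves the second only slightly then fixes the point, even if the second
    coordinate is a mere limit. *)
Definition isolated (W : weierstrass T) (P : point T) : Prop :=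
  if P is Some (x, y) then
    exists n, (A x /\ forall y', on_curve W (Some (x, y')) -> Ball n (y' - y) -> y' = y) \/
              (A y /\ forall x', on_curve W (Some (x', y)) -> Ball n (x' - x) -> x' = x)
  else True.

Let Lcoef (W : weierstrass T) := [/\ L (a1 W), L (a2 W), L (a3 W), L (a4 W) & L (a6 W)].

Ltac oO := repeat first [assumption | exact: (vO0 hO) | exact: (vO1 hO) | exact: (vO_nat hO)
  | apply: (vON hO) | apply: (vOD hO) | apply: (vOX hO) | apply: (vOM hO)].
Ltac oL := repeat first [assumption | exact: (sf0 hL) | exact: (sf1 hL) | exact: (sf_nat hL)
  | apply: (sfN hL) | apply: (sfD hL) | apply: (sfX hL) | apply: (sfM hL)].

Lemma unit_near s n x : s != 0 -> (forall j t, Ball (n + j) t -> Ball j (t / s)) -> Ball n.+1 x ->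
  s + x != 0 /\ forall d, (n <= d)%N -> O (pi ^+ d / (s + x)).
Proof.
move=> s0 hn bx; have [|u0 Ou] := @ball_unit _ _ _ hO r1 1 (x / s) isT.
  by apply: hn; rewrite addn1.
have E : s + x = s * (1 + x / s) by field.
split=> [|d nd]; first by rewrite E mulf_neq0.
rewrite E invfM mulrA; apply: (vOM hO) => //.
have := hn 0%N (pi ^+ d); rewrite addn0 => h; have /h := ball_le hO r1 nd (ball_pi hO r1 d).
by rewrite /ball /= expr0 divr1.
Qed.

(** x is replaced by a nearby x0 in A and y is recomputed by Hensel's lemma, which applies because
    the derivative in y is nonzero; the same derivative separates the new y from the other
    solution. *)
Lemma approx_y (W : weierstrass T) x y k : integral O W -> Lcoef W -> L x -> L y -> O x -> O y ->
  on_curve W (Some (x, y)) -> 2 * y + a1 W * x + a3 W != 0 ->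
  exists x0 y0, [/\ A x0, L y0, on_curve W (Some (x0, y0)), Ball k (x - x0) /\ Ball k (y - y0) &
    exists n, forall y', on_curve W (Some (x0, y')) -> Ball n (y' - y0) -> y' = y0].
Proof.
move=> iW LW Lx Ly Ox Oy oP s0; have [Oa1 Oa2 Oa3 Oa4 Oa6] := iW.
have [La1 La2 La3 La4 La6] := LW.
have [n hn] := small_elt_ball hO r1 s0; pose d := (n + k)%N.
have [x0 Ax0 bx0] := Ad (d.*2.+1) Lx; have Lx0 := AL Ax0.
have Oxx := ball_O hO r1 bx0.
have Ox0 : O x0 by rewrite -(subKr x x0); apply: (vOB hO).
pose q : {poly T} := 'X^2 + (a1 W * x0 + a3 W) *: 'X + (- (x0 ^+ 3 + a2 W * x0 ^+ 2 + a4 W * x0 + a6 W))%:P.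
have qv z : q.[z] = z ^+ 2 + (a1 W * x0 + a3 W) * z - (x0 ^+ 3 + a2 W * x0 ^+ 2 + a4 W * x0 + a6 W).
  by rewrite /q !(hornerD, hornerXn, hornerZ, hornerX, hornerC).
have q'v z : q^`().[z] = 2 * z + (a1 W * x0 + a3 W).
  rewrite /q !(derivD, derivXn, derivZ, derivX, derivC) !(hornerD, hornerMn, hornerXn, hornerZ, hornerC).
  by rewrite /= expr1 mulr1 addr0 mulr_natl.
have le k' m z : (k' <= m)%N -> Ball m z -> Ball k' z := ball_le hO r1 (x := z).
have bd z : Ball d.*2.+1 z -> Ball n.+1 z by apply: le; rewrite /d -addnn; lia.
have yE : 2 * y + (a1 W * x0 + a3 W) = (2 * y + a1 W * x + a3 W) + - (a1 W * (x - x0)) by ring.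
have [|||||||b [Lb qb bb]] := hensel hO r1 hL Lc (q := q) (a := y) (d := d).
- by move=> i; rewrite !(coefD, coefXn, coefZ, coefX, coefC); case: (i == 0%N); oL.
- by move=> i; rewrite !(coefD, coefXn, coefZ, coefX, coefC); case: (i == 0%N); oO.
- by [].
- by [].
- rewrite q'v yE.
  apply: (unit_near s0 hn _).1; apply: (ballN hO); apply: (ballMl hO) => //; exact: bd.
- rewrite q'v yE.
  apply: (unit_near s0 hn _).2; last by rewrite leq_addr.
  apply: (ballN hO); apply: (ballMl hO) => //; exact: bd.
- rewrite qv (_ : _ - _ = (x - x0) * (x ^+ 2 + x * x0 + x0 ^+ 2 + a2 W * (x + x0) + a4 W - a1 W * y)).
    by apply: (ballMr hO) => //; oO.
  apply/eqP; rewrite -subr_eq0; apply/eqP.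
  transitivity ((y ^+ 2 + a1 W * x * y + a3 W * y) - (x ^+ 3 + a2 W * x ^+ 2 + a4 W * x + a6 W)); first by ring.
  by move: oP => /= ->; rewrite subrr.
have ob : on_curve W (Some (x0, b)).
  by apply/eqP; rewrite -subr_eq0 -qb qv; apply/eqP; ring.
exists x0, b; split=> //.
  split; first by apply: le bx0; rewrite /d -addnn; lia.
  by apply/(ball_subr _ hO); apply: le bb; rewrite /d; lia.
have s1 : 2 * b + (a1 W * x0 + a3 W) != 0.
  have -> : 2 * b + (a1 W * x0 + a3 W) = (2 * y + a1 W * x + a3 W) + (2 * (b - y) - a1 W * (x - x0)) by ring.
  apply: (unit_near s0 hn _).1; apply: (ballB hO); apply: (ballMl hO) => //; first exact: vO_nat.
    by apply: le bb; rewrite /d; lia.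
  by apply: le bx0; rewrite /d -addnn; lia.
have [n1 hn1] := small_elt_ball hO r1 s1; exists n1.+1 => y' oy' by'.
have [nz _] := unit_near s1 hn1 by'.
have : (y' - b) * (2 * b + (a1 W * x0 + a3 W) + (y' - b)) == 0.
  apply/eqP; transitivity (q.[y'] - q.[b]); first by rewrite !qv; ring.
  rewrite qb subr0 qv; apply/eqP; rewrite subr_eq0; apply/eqP; rewrite -oy'; ring.
by rewrite mulf_eq0 (negPf nz) orbF subr_eq0 => /eqP.
Qed.

Lemma approx_x (W : weierstrass T) x y k : integral O W -> Lcoef W -> L x -> L y -> O x -> O y ->
  on_curve W (Some (x, y)) -> 3 * x ^+ 2 + 2 * a2 W * x + a4 W - a1 W * y != 0 ->
  exists x0 y0, [/\ A y0, L x0, on_curve W (Some (x0, y0)), Ball k (x - x0) /\ Ball k (y - y0) &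
    exists n, forall x', on_curve W (Some (x', y0)) -> Ball n (x' - x0) -> x' = x0].
Proof.
move=> iW LW Lx Ly Ox Oy oP s0; have [Oa1 Oa2 Oa3 Oa4 Oa6] := iW.
have [La1 La2 La3 La4 La6] := LW.
have [n hn] := small_elt_ball hO r1 s0; pose d := (n + k)%N.
have [y0 Ay0 by0] := Ad (d.*2.+1) Ly; have Ly0 := AL Ay0.
have Oyy := ball_O hO r1 by0.
have Oy0 : O y0 by rewrite -(subKr y y0); apply: (vOB hO).
pose q : {poly T} := 'X^3 + a2 W *: 'X^2 + (a4 W - a1 W * y0) *: 'X + (a6 W - y0 ^+ 2 - a3 W * y0)%:P.
have qv z : q.[z] = z ^+ 3 + a2 W * z ^+ 2 + (a4 W - a1 W * y0) * z + (a6 W - y0 ^+ 2 - a3 W * y0).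
  by rewrite /q !(hornerD, hornerXn, hornerZ, hornerX, hornerC).
have q'v z : q^`().[z] = 3 * z ^+ 2 + 2 * a2 W * z + (a4 W - a1 W * y0).
  rewrite /q !(derivD, derivXn, derivZ, derivX, derivC) !(hornerD, hornerMn, hornerXn, hornerZ, hornerC) /=.
  by rewrite /=; ring.
have le k' m z : (k' <= m)%N -> Ball m z -> Ball k' z := ball_le hO r1 (x := z).
have bd z : Ball d.*2.+1 z -> Ball n.+1 z by apply: le; rewrite /d -addnn; lia.
have [|||||||b [Lb qb bb]] := hensel hO r1 hL Lc (q := q) (a := x) (d := d).
- by move=> i; rewrite !(coefD, coefXn, coefZ, coefX, coefC); case: (i == 0%N); oL.
- by move=> i; rewrite !(coefD, coefXn, coefZ, coefX, coefC); case: (i == 0%N); oO.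
- by [].
- by [].
- rewrite q'v (_ : _ + _ = (3 * x ^+ 2 + 2 * a2 W * x + a4 W - a1 W * y) + a1 W * (y - y0)); last by ring.
  by apply: (unit_near s0 hn _).1; apply: (ballMl hO) => //; exact: bd.
- rewrite q'v (_ : _ + (_ - _) = (3 * x ^+ 2 + 2 * a2 W * x + a4 W - a1 W * y) + a1 W * (y - y0)); last by ring.
  apply: (unit_near s0 hn _).2; last by rewrite leq_addr.
  by apply: (ballMl hO) => //; exact: bd.
- rewrite qv (_ : _ + _ = (y - y0) * (y + y0 + a1 W * x + a3 W)).
    by apply: (ballMr hO) => //; oO.
  apply/eqP; rewrite -subr_eq0; apply/eqP.
  transitivity ((x ^+ 3 + a2 W * x ^+ 2 + a4 W * x + a6 W) - (y ^+ 2 + a1 W * x * y + a3 W * y)); first by ring.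
  by move: oP => /= ->; rewrite subrr.
have ob : on_curve W (Some (b, y0)).
  by apply/eqP; rewrite eq_sym -subr_eq0 -qb qv; apply/eqP; ring.
exists b, y0; split=> //.
  split; last by apply: le by0; rewrite /d -addnn; lia.
  by apply/(ball_subr _ hO); apply: le bb; rewrite /d; lia.
have Ob : O b.
  by rewrite -(subrK x b); apply: (vOD hO) => //; exact: (ball_O hO r1 bb).
have bbn : Ball n.+1 (b - x) by apply: le bb; rewrite /d; lia.
have s1 : 3 * b ^+ 2 + 2 * a2 W * b + (a4 W - a1 W * y0) != 0.
  rewrite (_ : _ + _ = (3 * x ^+ 2 + 2 * a2 W * x + a4 W - a1 W * y)
     + ((b - x) * (3 * (b + x) + 2 * a2 W) + a1 W * (y - y0))); last by ring.
  apply: (unit_near s0 hn _).1; apply: (ballD hO); last by apply: (ballMl hO) => //; exact: bd.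
  by apply: (ballMr hO) => //; oO.
have [n1 hn1] := small_elt_ball hO r1 s1; exists n1.+1 => x' ox' bx'.
have Ox' := ball_O hO r1 bx'.
have Ox1 : O x' by rewrite -(subrK b x'); apply: (vOD hO).
have [|nz _] := unit_near s1 hn1 (x := (x' - b) * (x' + 2 * b + a2 W)).
  by apply: (ballMr hO) => //; oO.
have : (x' - b) * (3 * b ^+ 2 + 2 * a2 W * b + (a4 W - a1 W * y0) + (x' - b) * (x' + 2 * b + a2 W)) == 0.
  apply/eqP; transitivity (q.[x'] - q.[b]); first by rewrite !qv; ring.
  rewrite qb subr0 qv; move: ox' => /= /eqP; rewrite eq_sym -subr_eq0 => /eqP <-; ring.
by rewrite mulf_eq0 (negPf nz) orbF subr_eq0 => /eqP.
Qed.

(** One partial derivative at P is nonzero, which provides a nearby isolated P0; P - P0 is then near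
    infinity, where division by r^N is possible over L. *)
Lemma approx_integral (W : weierstrass T) N x y : integral O W -> elliptic W -> Lcoef W ->
  L x -> L y -> O x -> O y -> on_curve W (Some (x, y)) ->
  exists P0 R, [/\ rational_points W L P0, rational_points W L R, isolated W P0 &
     Some (x, y) = ec_add W P0 (ec_muln W (r ^ N) R)].
Proof.
move=> iW EW LW Lx Ly Ox Oy oP.
have [k hk] := near_sub hO r1 iW EW (ltn0Sn 0) oP.
have [x0 [y0 [Lx0 Ly0 oQ [b1 b2] iso]]] : exists x0 y0, [/\ L x0, L y0, on_curve W (Some (x0, y0)),
    Ball k (x - x0) /\ Ball k (y - y0) & isolated W (Some (x0, y0))].
  have /orP[s0|s0] := nonsingular EW oP.
    have [x0 [y0 [Ax Ly0 oQ b [n hn]]]] := approx_y k iW LW Lx Ly Ox Oy oP s0.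
    by exists x0, y0; split=> //; [exact: AL | exists n; left].
  have [x0 [y0 [Ay Lx0 oQ b [n hn]]]] := approx_x k iW LW Lx Ly Ox Oy oP s0.
  by exists x0, y0; split=> //; [exact: AL | exists n; right].
have nD := hk _ _ oQ b1 b2.
have [P PE] := ptvalK EW oP; have [Q QE] := ptvalK EW oQ.
have rP : rational_points W L (ptval P) by rewrite PE.
have rQ : rational_points W L (ptval Q) by rewrite QE.
have rD : rational_points W L (ptval (P - Q)).
  by apply: (rational_add hL) => //; exact: (rational_opp hL).
have nD' : nbh O pi 1 (P - Q) by rewrite /nbh ptvalB PE QE.
have [||R [_ rR RE]] := nbh_divisible hO r1 iW hL LW Lc (r := r ^ N) pT _ _ (ltn0Sn 0) nD' rD.
- by rewrite coprimeXl.
- by rewrite expn_gt0 r_gt0.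
have r0 : rational_points W L (Some (x0, y0)) by rewrite -QE.
exists (Some (x0, y0)), (ptval R); split=> //.
by rewrite -ptvalMn RE -QE -ptvalD addrC subrK PE.
Qed.

Hypothesis Apow : forall n a, A a -> A (a / pi ^+ n).

(** Integrality is arranged by scaling with a power of pi; stability of A under division by powers
    of pi carries isolation back to the original curve. *)
Lemma approx_isolated (W : weierstrass T) N P : elliptic W -> Lcoef W -> rational_points W L P ->
  exists P0 R, [/\ rational_points W L P0, rational_points W L R, isolated W P0 &
     P = ec_add W P0 (ec_muln W (r ^ N) R)].
Proof.
move=> EW LW; case: P => [[x y]|] rP; last first.
  exists None, None; split=> //; elim: (r ^ N)%N => //= n; by rewrite /ec_muln.
have [oP [Lx Ly]] := rP; have [c [iW hc]] := scale_integral W [:: x; y].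
have c0 := pi_scale c; have Oc := piX_O hO r1 c; have Lpc : L (pi ^+ c) by exact: sfX.
have EW' := wsc_elliptic c0 EW.
have [La1 La2 La3 La4 La6] := LW.
have LW' : Lcoef (wsc (pi ^+ c) W) by split=> /=; apply: (sfM hL) => //; do ?apply: (sfX hL).
have [_ [Lx' Ly']] := (psc_rational c0 W (Some (x, y)) hL Lpc).1 rP.
have up n z : O (pi ^+ c * z) -> O ((pi ^+ c) ^+ n.+1 * z).
  by move=> h; rewrite exprSr -mulrA; apply: (vOM hO) => //; apply: (vOX hO).
have Ox : O ((pi ^+ c) ^+ 2 * x) by apply: up; apply: hc; rewrite inE eqxx.
have Oy : O ((pi ^+ c) ^+ 3 * y) by apply: up; apply: hc; rewrite !inE eqxx orbT.
have [P0' [R' [rP0 rR iso E]]] := approx_integral N iW EW' LW' Lx' Ly' Ox Oy ((psc_curve c0 W _).1 oP).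
have [P0 P0E] := psc_surj c0 P0'; have [R RE] := psc_surj c0 R'; subst P0' R'.
exists P0, R; split; try exact/(psc_rational c0 W _ hL Lpc).
  case: P0 iso {rP0 E} => [[x0 y0]|] //= [n [[Ax h]|[Ay h]]].
    exists n; left; split=> [|y' oy by'].
      have -> : x0 = ((pi ^+ c) ^+ 2 * x0) / pi ^+ (c * 2) by rewrite exprM [RHS]mulrC mulKf //; exact: expf_neq0.
      exact: Apow.
    apply: (mulfI (expf_neq0 3 c0)); apply: h; first exact: (psc_curve c0 W (Some (x0, y'))).1.
    by rewrite -mulrBr; apply: (ballMl hO) => //; exact: vOX.
  exists n; right; split=> [|x' ox bx'].
    have -> : y0 = ((pi ^+ c) ^+ 3 * y0) / pi ^+ (c * 3) by rewrite exprM [RHS]mulrC mulKf //; exact: expf_neq0.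
    exact: Apow.
  apply: (mulfI (expf_neq0 2 c0)); apply: h; first exact: (psc_curve c0 W (Some (x', y0))).1.
  by rewrite -mulrBr; apply: (ballMl hO) => //; exact: vOX.
by apply: (psc_inj c0); rewrite psc_add // psc_muln.
Qed.

End Approximation.

(** * Restriction of automorphisms, dense subsets, action on points *)

Lemma sep_root_lift (A S : fieldType) (i : {rmorphism A -> S}) (q : {poly A}) z :
  separably_closed A -> separable_poly q -> root (map_poly i q) z -> range i z.
Proof.
move=> sc; elim: {q}_.+1 {-2}q (ltnSn (size q)) => // n IH q; rewrite ltnS => qn qs qz.
have q0 := separable_poly_neq0 qs.
have q1 : (1 < size q)%N.
  rewrite ltnNge; apply/negP => /size1_polyC qC; move: qz q0.
  by rewrite qC map_polyC /= rootC fmorph_eq0 polyC_eq0 => /eqP ->; rewrite eqxx.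
have [a qa] := sc q qs q1; have /factor_theorem[h qE] := qa.
have h0 : h != 0 by apply: contraNneq q0 => h0; rewrite qE h0 mul0r.
move: qz; rewrite qE rmorphM /= rootM => /orP[hz|]; last first.
  by rewrite rmorphB /= map_polyX map_polyC /= root_XsubC => /eqP ->; exists a.
apply: (IH h) => //.
  by move: qn; rewrite qE size_Mmonic ?monicXsubC // size_XsubC addn2.
by apply: dvdp_separable qs; rewrite qE dvdp_mulr.
Qed.

(** Fs contains all roots of separable polynomials over L, so an automorphism fixing L maps the
    image of Fs onto itself; the choice made in [aut_restrict] therefore succeeds. *)
Lemma aut_restrictP (Fs S : fieldType) (i : {rmorphism Fs -> S}) (L : set Fs) (s : aut S) :
  separable_closure L -> (forall x, L x -> s (i x) = i x) ->
  forall x, i (aut_restrict i s x) = s (i x).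
Proof.
move=> hL sL; have [sLf sc ssep] := hL; have iI : injective i := fmorph_inj i.
have rng (t : aut S) x : (forall x, L x -> t (i x) = i x) -> exists y, i y = t (i x).
  move=> tL; have [q [qL qs qx]] := ssep x.
  have [|y _ <-] := @sep_root_lift _ _ i q (t (i x)) sc qs; last by exists y.
  have -> : map_poly i q = map_poly t (map_poly i q).
    apply/polyP => n; rewrite !coef_map /= tL //.
    by apply/polyOver_set: n; first exact: (sf0 sLf).
  by rewrite /root horner_map horner_map (eqP qx) !rmorph0.
have sVL x : L x -> (s^-1)%g (i x) = i x by move=> Lx; rewrite -{1}(sL x Lx) autVK.
have [f hf] := choice (fun x => rng s x sL).
have [g hg] := choice (fun x => rng (s^-1)%g x sVL).
have fB : zmod_morphism f by move=> x y; apply: iI; rewrite rmorphB !hf !rmorphB.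
have fM : monoid_morphism f.
  split; first by apply: iI; rewrite hf !rmorph1.
  by move=> x y; apply: iI; rewrite rmorphM !hf !rmorphM.
have fb : bijective f by exists g => x; apply: iI; rewrite ?hg ?hf ?hg ?autVK ?autKV.
rewrite /aut_restrict; case: xgetP => [t _ //|/(_ (Aut (And3 fB fM fb)))]; case.
by move=> x /=; rewrite hf.
Qed.

Lemma aut_restrict_unique (Fs S : fieldType) (i : {rmorphism Fs -> S}) (s : aut S) (t : aut Fs) :
  (forall x, i (t x) = s (i x)) -> aut_restrict i s = t.
Proof.
move=> ht; rewrite /aut_restrict; case: xgetP => [t' _ ht'|/(_ t)//].
by apply: aut_ext => x; apply: (fmorph_inj i); rewrite ht.
Qed.

Lemma rank1_congr (T : fieldType) (O1 O2 K : set T) pi : subfield K -> (forall x, K x -> O1 x <-> O2 x) ->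
  rank1 O1 K pi -> rank1 O2 K pi.
Proof.
move=> sK K12 [Kpi pi0 mpi cof arch].
have vm12 a : K a -> vm O2 a -> vm O1 a.
  by move=> Ka [->|h]; [left | right => h'; apply: h; apply/K12 => //; exact: (sfV sK)].
split=> //.
- by case: mpi => [->|h]; [left | right => h'; apply: h; apply/K12 => //; exact: (sfV sK)].
- move=> a Ka a0; have [n hn] := cof a Ka a0; exists n; apply/K12 => //.
  by apply: (sf_div sK) => //; exact: (sfX sK).
- move=> a Ka ma; have [n hn] := arch a Ka (vm12 a Ka ma); exists n; apply/K12 => //.
  by apply: (sf_div sK) => //; exact: (sfX sK).
Qed.

(** Every nonzero a in K is a unit times an element of B, obtained by approximating a up to a pi. *)
Lemma rank1_dense (T : fieldType) (O B K : set T) pi : vring O -> subfield K -> B `<=` K ->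
  (forall x a, K x -> K a -> a != 0 -> exists2 y, B y & O ((x - y) / a)) ->
  rank1 O B pi -> rank1 O K pi.
Proof.
move=> hO sK BK dn [Bpi pi0 mpi cof arch]; have Kpi := BK _ Bpi; split=> //.
- move=> a Ka a0; have [|y By Oy] := dn a (a * pi) Ka (sfM sK Ka Kpi); first by rewrite mulf_neq0.
  have [u0 Ou] := unit1 hO (vm_opp hO (vm_mul hO Oy mpi)).
  have yE : y = a * (1 - (a - y) / (a * pi) * pi) by field; rewrite a0 pi0.
  have y0 : y != 0 by rewrite yE mulf_neq0.
  have [n hn] := cof y By y0; exists n.
  have -> : pi ^+ n / a = pi ^+ n / y * (1 - (a - y) / (a * pi) * pi).
    by rewrite {1}yE; move: (1 - _) u0 => u u0; field; rewrite u0 a0.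
  apply: (vOM hO) => //; apply: (vOB hO); first exact: vO1.
  by apply: (vOM hO) => //; exact: vm_O.
- move=> a Ka ma; have [y By Oy] := dn a pi Ka Kpi pi0.
  have my : vm O y.
    rewrite -(subKr a y); apply: (vm_add hO) => //; apply: (vm_opp hO).
    by rewrite -(divfK pi0 (a - y)); apply: (vm_mul hO).
  have [n hn] := arch y By my; exists n.
  rewrite -(subrK (y ^+ n) (a ^+ n)) mulrDl; apply: (vOD hO) => //.
  rewrite subrXX mulrAC; apply: (vOM hO) => //; apply: (vO_sum hO) => k _.
  by apply: (vOM hO); apply: (vOX hO); exact: vm_O.
Qed.

(** A point of rational coordinates transported by an automorphism fixing the curve. *)
Section PointAction.
Variables (S : fieldType) (W : weierstrass S) (EW : elliptic W) (L : set S).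
Hypothesis LW : [/\ L (a1 W), L (a2 W), L (a3 W), L (a4 W) & L (a6 W)].
Local Notation E := (ecpt EW).

(** Total on all automorphisms so that it can serve as an action; the default P only occurs when s
    does not preserve the curve. *)
Definition pact (s : aut S) (P : E) : E := xget P [set P' | ptval P' = point_map s (ptval P)].

Lemma wmap_fix (s : aut S) : Gal L s -> wmap s W = W.
Proof. by case: W LW => ? ? ? ? ? [h1 h2 h3 h4 h6] sL; rewrite /wmap /= !sL. Qed.

Lemma pact_val s P : Gal L s -> ptval (pact s P) = point_map s (ptval P).
Proof.
move=> sL; have : on_curve W (point_map s (ptval P)).
  by rewrite -{1}(wmap_fix sL); apply: (point_map_curve (s : {rmorphism S -> S}) W (ptval P)).1; exact: ptvalP.
move/(ptvalK EW) => [P' P'E]; rewrite /pact; case: xgetP => [Q _ //|/(_ P')]; case.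
exact: P'E.
Qed.

Lemma point_map_fixD s P Q : Gal L s ->
  point_map s (ec_add W P Q) = ec_add W (point_map s P) (point_map s Q).
Proof. by move=> sL; rewrite (point_mapD (s : {rmorphism S -> S})) wmap_fix. Qed.

Lemma point_map_fixN s P : Gal L s -> point_map s (ec_opp W P) = ec_opp W (point_map s P).
Proof. by move=> sL; rewrite (point_mapN (s : {rmorphism S -> S})) wmap_fix. Qed.

Lemma pactB s P Q : Gal L s -> pact s (P - Q) = pact s P - pact s Q.
Proof.
move=> sL; apply: ptval_inj; rewrite pact_val // ptvalB /ec_sub point_map_fixD // point_map_fixN //.
transitivity (ec_sub W (ptval (pact s P)) (ptval (pact s Q))); last by [].
by rewrite !pact_val.
Qed.

Lemma pactM s t P : Gal L s -> Gal L t -> pact (s * t)%g P = pact s (pact t P).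
Proof.
move=> sL tL; apply: ptval_inj; rewrite !pact_val //; last exact: GalM.
by case: (ptval P) => [[x y]|] //=; rewrite !autM.
Qed.

Lemma pact1 P : pact 1%g P = P.
Proof.
by apply: ptval_inj; rewrite pact_val; [case: (ptval P) => [[x y]|] | exact: Gal1].
Qed.

Lemma pact_smooth P : exists e : seq S,
  forall s, Gal L s -> {in e, forall x, s x = x} -> pact s P = P.
Proof.
case PE: (ptval P) => [[x y]|]; last by exists [::] => s sL _; apply: ptval_inj; rewrite pact_val // PE.
exists [:: x; y] => s sL h; apply: ptval_inj; rewrite pact_val // PE /= !h // !inE eqxx ?orbT //.
Qed.

End PointAction.

(** * Elements of the completion fixed by an open subgroup *)

Section Fixed.
Variables (l : nat) (S : fieldType) (K M : set S) (TT : tower l K M).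
Variables (C : fieldType) (O : set S) (OC : set C) (pi : S) (j : {rmorphism S -> C}).
Hypothesis hO : vring O.
Hypothesis r1 : rank1 O setT pi.
Hypothesis hC : vring OC.
Hypothesis rC : rank1 OC setT (j pi).
Hypothesis Oj : forall x, O x <-> OC (j x).
Hypothesis Kpi : K pi.
Hypothesis Kc : gcomplete O pi K.
Variable p : nat.
Hypothesis pC : p \in [pchar C].
Hypothesis l_prime : prime l.
Hypothesis lp : l <> p.
Local Notation Ball := (ball OC (j pi)).

Lemma gcomplete_image : gcomplete OC (j pi) (j @` K).
Proof.
move=> u uK hu; have [k|v hv] := @choice nat S (fun k v => K v /\ j v = u k).
  by have [v Kv E] := uK k; exists v.
have [k|k|x Kx hx] := Kc (u := v); first by case: (hv k).
  by apply/(ball_j pi Oj); rewrite rmorphB; have [_ ->] := hv k; have [_ ->] := hv k.+1.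
exists (j x); first by exists x.
by move=> k; have [_ <-] := hv k; rewrite -rmorphB; apply/(ball_j pi Oj).
Qed.

(** An argument in the style of Ax. x is a limit of elements y of M(e'), and the average of the
    conjugates of y over a finite l-quotient of the group fixing e and e' is as close to x as y is,
    since l is a unit. The averages lie in the finite extension K(e, e'), which is closed because K
    is complete, so x lies in it. *)
Lemma fixed_algebraic (t : aut S -> aut C) x (e e' : seq S) :
  (forall s, Gal K s -> forall y, t s (j y) = j (s y)) ->
  (forall s, Gal K s -> forall y k, Ball k (t s y) <-> Ball k y) ->
  (forall n, exists2 y, adjoin M [set` e'] y & Ball n (x - j y)) ->
  (forall s, Gal K s -> {in e, forall z, s z = z} -> t s x = x) -> exists y, j y = x.
Proof.
move=> tj tb hx tx; have hK := tw_closure TT; have [sK _ Ksep] := hK.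
pose e3 := e ++ e'; pose G := [set s : aut S | Gal K s /\ {in e3, forall z, s z = z}].
pose L := adjoin K [set` e3]; have sL : subfield L := adjoin_subfield _ _.
have KL : K `<=` L by exact: sub_adjoin_l.
have hL : separable_closure L by exact: separable_closure_sub KL sL hK.
have LG s : Gal L s -> G s.
  move=> sLs; split; first exact: Gal_sub sLs.
  by move=> z ze; apply: sLs; exact: sub_adjoin_r.
have sjK : subfield (j @` K).
  split; first by rewrite in_setE; exists 1; [exact: (sf1 sK) | rewrite rmorph1].
    move=> _ _ /set_mem[a Ka <-] /set_mem[b Kb <-]; rewrite in_setE.
    by exists (a - b); [exact: (sfB sK) | rewrite rmorphB].
  move=> _ _ /set_mem[a Ka <-] /set_mem[b Kb <-]; rewrite in_setE.
  by exists (a / b); [exact: (sf_div sK) | rewrite fmorph_div].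
have [|n [b hb]] := @adjoin_finite _ K sK e3; first by move=> z _; exact: separable_algebraic.
pose bs := [seq j (b i) | i <- enum 'I_n].
suff : kspan (j @` K) bs x.
  have : {in bs, forall z, exists y, j y = z} by move=> _ /mapP[i _ ->]; exists (b i).
  elim: bs {hx tx} x => [|z s IH] x hs /=; first by move=> ->; exists 0; rewrite rmorph0.
  move=> [_ [a Ka <-] h]; have [|y yE] := IH _ _ h; first by move=> w ws; apply: hs; rewrite inE ws orbT.
  have [z' zE] := hs z (mem_head _ _).
  by exists (y + a * z'); rewrite rmorphD rmorphM yE zE subrK.
apply: (span_closed hC rC sjK _ gcomplete_image) => [|m]; first by exists pi.
have [y ye By] := hx m; have [m' hm'] := adjoin_fix TT ye.
have G1 : G 1%g by split; first exact: Gal1.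
have GM s u : G s -> G u -> G (s * u)%g.
  move=> [h1 h2] [h3 h4]; split; first exact: GalM.
  by move=> z ze; rewrite autM h4 ?h2.
have GV s : G s -> G (s^-1)%g.
  move=> [h1 h2]; split; first exact: GalV.
  by move=> z ze; rewrite -{1}(h2 z ze) autVK.
have [ts [tsl tsG tsP]] := @tower_transversal _ _ _ _ TT m' G (fun s => @proj1 _ _) G1 GM GV.
have k0 : (size ts)%:R != 0 :> C.
  rewrite -(dvdn_pcharf pC); apply/negP => pk.
  by move: (pnat_dvd pk tsl); rewrite pnatE ?(pcharf_prime pC) // inE => /eqP pl; apply: lp.
have [q qE] := nat_inv pC k0.
(* [q] is the inverse of the number of representatives in characteristic p, so z is an average. It
   is fixed by [Gal L] and thus lies in L. *)
pose z := q%:R * \sum_(s <- ts) s y.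
have Lz : L z.
  apply: contrapT => nz; have [s sLs] := galois_moves hL nz; apply; have Gs := LG _ sLs.
  rewrite /z rmorphM rmorph_nat; congr (_ * _); rewrite rmorph_sum.
  rewrite -(tsP S (fun s => s y) _ s Gs); first by apply: eq_bigr => u _; rewrite autM.
  move=> s' u _ [uK ue] tu; rewrite autM hm' //.
  by move=> w we; apply: ue; rewrite mem_cat we orbT.
exists (j z).
  have [a aK ->] := hb _ Lz; rewrite rmorph_sum; under eq_bigr do rewrite rmorphM.
  apply: (kspan_sum sjK) => i; first by exists (a i).
  by apply/mapP; exists i => //; rewrite mem_enum.
have -> : x - j z = q%:R * \sum_(s <- ts) (x - j (s y)).
  rewrite big_split /= sumrN mulrDr mulrN; congr (_ - _).
    by rewrite big_const_seq count_predT iter_addr_0 -[x *+ _]mulr_natl mulrA -qE mulVf // mul1r.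
  by rewrite /z rmorphM rmorph_nat rmorph_sum.
apply: (ballMl hC); first exact: vO_nat.
rewrite big_seq; apply: (ball_sum hC) => s /tsG[sGK se].
rewrite -tj // -{1}(tx s sGK); last by move=> w we; apply: se; rewrite mem_cat we.
by rewrite -(rmorphB (t s : {rmorphism C -> C})); apply/tb.
Qed.

End Fixed.

(** * Transport along embeddings, and the valuation on the separable closure of a local field *)

Lemma image_subfield (A B : fieldType) (f : {rmorphism A -> B}) (K : set A) :
  subfield K -> subfield (f @` K).
Proof.
move=> sK; split; first by rewrite in_setE; exists 1; [exact: (sf1 sK) | rewrite rmorph1].
  move=> _ _ /set_mem[a Ka <-] /set_mem[b Kb <-]; rewrite in_setE.
  by exists (a - b); [exact: (sfB sK) | rewrite rmorphB].
move=> _ _ /set_mem[a Ka <-] /set_mem[b Kb <-]; rewrite in_setE.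
by exists (a / b); [exact: (sf_div sK) | rewrite fmorph_div].
Qed.

Lemma preimage_subfield (A B : fieldType) (f : {rmorphism A -> B}) (K : set B) :
  subfield K -> subfield [set x | K (f x)].
Proof.
move=> sK; split; first by rewrite in_setE /= rmorph1; exact: (sf1 sK).
  by move=> x y /set_mem hx /set_mem hy; rewrite in_setE /= rmorphB; exact: (sfB sK).
by move=> x y /set_mem hx /set_mem hy; rewrite in_setE /= fmorph_div; exact: (sf_div sK).
Qed.

Lemma point_map_muln (A B : fieldType) (f : {rmorphism A -> B}) (W : weierstrass A) n P :
  point_map f (ec_muln W n P) = ec_muln (wmap f W) n (point_map f P).
Proof. by elim: n => [//|n IH]; rewrite /ec_muln /= -!/(ec_muln _ _ _) point_mapD IH. Qed.

Lemma point_map_comp (A B C : Type) (f : A -> B) (g : B -> C) P :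
  point_map g (point_map f P) = point_map (g \o f) P.
Proof. by case: P => [[]|]. Qed.

Lemma point_map_eq (A B : Type) (f g : A -> B) P : f =1 g -> point_map f P = point_map g P.
Proof. by case: P => [[x y]|] //= fg; rewrite !fg. Qed.

Lemma point_map_inj (A B : fieldType) (f : {rmorphism A -> B}) : injective (point_map f).
Proof. by move=> [[x y]|] [[x' y']|] //= [] /fmorph_inj -> /fmorph_inj ->. Qed.

Lemma algebraic_over_map (A B : fieldType) (f : {rmorphism A -> B}) (K : set A) (L : set B) x :
  subfield K -> L 0 -> (forall y, K y -> L (f y)) -> algebraic_over K x -> algebraic_over L (f x).
Proof.
move=> sK L0 KL [q [qK q0 qx]]; exists (map_poly f q); split.
- apply/polyOver_set => // n; rewrite coef_map; apply: KL.
  by apply/polyOver_set: n; first exact: (sf0 sK).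
- by rewrite map_poly_eq0.
- by rewrite /root horner_map (eqP qx) rmorph0.
Qed.

(** OK is extended to S by Chevalley's theorem. Rank one is followed from F to L, which is algebraic
    over it, to K, where L is dense, and to S, algebraic again; in particular a pseudo-uniformizer
    can be taken in F. *)
Lemma local_valuation p (F : fieldType) (k : set F) (Fs S : fieldType) (f : {rmorphism F -> Fs})
    (i : {rmorphism Fs -> S}) (L O : set Fs) (K OK : set S) :
  function_field p k -> range f `<=` L -> subfield L ->
  (forall x, L x -> algebraic_over (range f) x) -> place L O -> completion L O i K OK ->
  exists (OS : set S) (u : F), let pi := i (f u) in [/\ vring OS, (forall x, K x -> OS x <-> OK x),
    rank1 OS setT pi, gcomplete OS pi K & forall s, Gal K s -> isometric OS pi s].
Proof.
move=> HF fL sL Lalg [_ _ _ [y0 Ly0 nOy0]] [hS [[OKK sOK Ktot _] Kc] LK LO Ld].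
have [sK _ Ksep] := hS.
have [OS [hO OSK]] := chevalley sK sOK Ktot.
pose g : {rmorphism F -> S} := (i \o f : {rmorphism F -> S}).
have sg : subfield (range g) := range_subfield g.
pose OF := [set x : F | OS (g x)].
have hOF : vring OF.
  split; last by move=> x; have [h|h] := vO_total hO (g x); [left | right]; rewrite /OF /= ?fmorphV.
  apply: mk_subring => [|x y|x y]; rewrite /OF /=; first by rewrite !rmorph1; exact: vO1.
    by move=> hx hy; rewrite !rmorphB; exact: vOB.
  by move=> hx hy; rewrite !rmorphM; exact: vOM.
have galg y : L y -> algebraic_over (range g) (i y).
  move=> /Lalg; apply: algebraic_over_map (range_subfield f) (sf0 sg) _.
  by move=> _ [z _ <-]; exists z.
have ntF : exists x, ~ OF x.
  apply: contrapT => H; apply: nOy0; apply/LO => //; apply/OSK; first exact: LK.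
  apply: (alg_trivial hO sg _ (galg _ Ly0)) => _ [x _ <-].
  by apply: contrapT => nx; apply: H; exists x.
have [u [_ u0 mu cof arch]] := function_field_rank1 hOF HF ntF.
exists OS, u; move=> pi; have piE : pi = g u by [].
have vmg x : vm OF x <-> vm OS (g x).
  split=> -[h|h].
  - by left; rewrite h rmorph0.
  - by right; rewrite -fmorphV.
  - by left; apply/eqP; rewrite -(fmorph_eq0 g) h.
  - by right => h'; apply: h; rewrite -fmorphV.
have rg : rank1 OS (range g) pi.
  split; rewrite ?piE ?fmorph_eq0 //.
  - exact/vmg.
  - move=> _ [a _ <-]; rewrite fmorph_eq0 => a0; have [n hn] := cof a I a0; exists n.
    by rewrite -rmorphXn -fmorph_div.
  - move=> _ [a _ <-] /vmg ma; have [n hn] := arch a I ma; exists n.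
    by rewrite -rmorphXn -fmorph_div.
have rL : rank1 OS (i @` L) pi.
  apply: (rank1_alg hO sg) rg.
  - by move=> _ [x _ <-]; exists (f x) => //; apply: fL; exists x.
  - by move=> _ [x Lx <-]; exists x^-1; [exact: (sfV sL) | rewrite fmorphV].
  - by move=> _ [x Lx <-]; exact: galg.
have rK : rank1 OS K pi.
  apply: (rank1_dense hO sK) rL; first by move=> _ [x Lx <-]; exact: LK.
  move=> x a Kx Ka a0; have [y Ly h] := Ld x a Kx Ka a0; exists (i y); first by exists y.
  apply/OSK => //; apply: (sf_div sK) => //; apply: (sfB sK) => //; exact: LK.
have Kalg x : algebraic_over K x by exact: separable_algebraic.
have rT O2 : vring O2 -> (forall x, K x -> OS x <-> O2 x) -> rank1 O2 setT pi.
  by move=> h2 K2; apply: (rank1_alg h2 sK) (rank1_congr sK K2 rK).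
have rS := rT OS hO (fun _ _ => iff_refl _).
have Kpi : K pi by case: rK.
have gc : gcomplete OS pi K by exact: vcomplete_gcomplete hO rS Kpi sK OKK OSK Kc.
split=> //.
(* O and its preimage under s both extend the valuation ring of the complete field K, so they
   agree. *)
have half s : Gal K s -> forall x, OS x -> OS (s x).
  move=> sK'; have h2 : vring [set x | OS (s x)].
    split; last by move=> x; have [h|h] := vO_total hO (s x); [left | right]; rewrite /= ?fmorphV.
    apply: mk_subring => /=; first by rewrite rmorph1; exact: vO1.
      by move=> x y hx hy; rewrite rmorphB; exact: vOB.
    by move=> x y hx hy; rewrite rmorphM; exact: vOM.
  have K2 x : K x -> OS x <-> [set x | OS (s x)] x by move=> Kx; rewrite /= sK'.
  have r2 := rT _ h2 K2.
  have gc2 : gcomplete [set x | OS (s x)] pi K.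
    apply: (vcomplete_gcomplete h2 r2 Kpi sK OKK _ Kc) => x Kx; rewrite /= sK' //; exact: OSK.
  by move=> x Ox; exact: (vring_unique sK Kpi hO h2 rS r2 K2 gc2 Kalg Ox).
move=> s sK'; split; first exact: sK'.
move=> x; split; first exact: half.
by move=> h; rewrite -(autVK s x); apply: half => //; exact: GalV.
Qed.

(** * Descending a divided point from the completion to S *)

Section NearFixed.
Variables (l : nat) (S : fieldType) (K M : set S) (TT : tower l K M).
Variables (C : fieldType) (O : set S) (OC : set C) (pi : S) (j : {rmorphism S -> C}).
Hypothesis hO : vring O.
Hypothesis r1 : rank1 O setT pi.
Hypothesis hC : vring OC.
Hypothesis rC : rank1 OC setT (j pi).
Hypothesis Oj : forall x, O x <-> OC (j x).
Hypothesis Kpi : K pi.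
Hypothesis Kc : gcomplete O pi K.
Variables p r : nat.
Hypothesis pC : p \in [pchar C].
Hypothesis l_prime : prime l.
Hypothesis lp : l <> p.
Hypothesis rp : coprime r p.
Hypothesis r_gt0 : (0 < r)%N.
Local Notation Ball := (ball OC (j pi)).
Local Notation cl := (cl OC pi j).
Variable t : aut S -> aut C.
Hypothesis tj : forall s, Gal K s -> forall y, t s (j y) = j (s y).
Hypothesis tb : forall s, Gal K s -> forall y k, Ball k (t s y) <-> Ball k y.
Variable W : weierstrass S.
Hypothesis KW : [/\ K (a1 W), K (a2 W), K (a3 W), K (a4 W) & K (a6 W)].
Hypothesis EW : elliptic W.
Local Notation WC := (wmap j W).

Lemma jK_fix s : Gal K s -> Gal (j @` K) (t s).
Proof. by move=> sK _ [x Kx <-]; rewrite tj // sK. Qed.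

Lemma jK_coef : [/\ (j @` K) (a1 WC), (j @` K) (a2 WC), (j @` K) (a3 WC), (j @` K) (a4 WC) & (j @` K) (a6 WC)].
Proof.
have [h1 h2 h3 h4 h6] := KW.
by split; [exists (a1 W) | exists (a2 W) | exists (a3 W) | exists (a4 W) | exists (a6 W)].
Qed.

Lemma t_curve s P : Gal K s -> on_curve WC P -> on_curve WC (point_map (t s) P).
Proof.
move=> sK oP; rewrite -(wmap_fix jK_coef (jK_fix sK)).
exact: (point_map_curve (t s : {rmorphism C -> C}) _ _).1.
Qed.

Lemma t_close m n s x y : Gal K s -> tw TT m s = 0 ->
  (forall s, Gal K s -> tw TT m s = 0 -> s y = y) -> Ball n (x - j y) -> Ball n (t s x - x).
Proof.
move=> sK ts hy b; apply: (ball_tri hC (y := j y)); last exact/(ball_subr _ hC).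
rewrite -{1}(hy s sK ts) -tj // -(rmorphB (t s : {rmorphism C -> C})); exact/tb.
Qed.

(** A deep level fixes the coordinate in M and an element of M close to the other coordinate. That
    coordinate then moves little and, being isolated on the curve, does not move. *)
Lemma isolated_fixed (P0 : point C) : isolated OC (j pi) (j @` M) WC P0 ->
  rational_points WC (cl M) P0 ->
  exists m, forall s, Gal K s -> tw TT m s = 0 -> point_map (t s) P0 = P0.
Proof.
case: P0 => [[x y]|] /=; last by exists 0%N.
move=> [n iso] [oP [cx cy]].
have up m m' s : Gal K s -> tw TT (maxn m m') s = 0 -> tw TT m s = 0 /\ tw TT m' s = 0.
  by move=> sK h; split; [exact: tw_le (leq_maxl _ _) sK h | exact: tw_le (leq_maxr _ _) sK h].
case: iso => -[[a Ma E] h].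
  have [b Mb Bb] := cy n; have [m hm] := tw_fix TT Ma; have [m' hm'] := tw_fix TT Mb.
  exists (maxn m m') => s sK /(up _ _ _ sK)[ts ts'].
  have xE : t s x = x by rewrite -E tj // hm.
  have oP' := t_curve sK (P := Some (x, y)) oP; move: oP' => /=; rewrite -/(on_curve WC (Some (t s x, t s y))) xE => oP'.
  congr (Some (_, _)) => //; apply: h => //; exact: t_close sK ts' hm' Bb.
have [b Mb Bb] := cx n; have [m hm] := tw_fix TT Ma; have [m' hm'] := tw_fix TT Mb.
exists (maxn m m') => s sK /(up _ _ _ sK)[ts ts'].
have yE : t s y = y by rewrite -E tj // hm.
have oP' := t_curve sK (P := Some (x, y)) oP; move: oP' => /=; rewrite -/(on_curve WC (Some (t s x, t s y))) yE => oP'.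
congr (Some (_, _)) => //; apply: h => //; exact: t_close sK ts' hm' Bb.
Qed.

(** An automorphism of deep level fixing e' moves Q0 only slightly and fixes P0, so it sends Q0 to a
    nearby point with the same r^N-multiple; [torsion_isolated] applies. The level is traded for the
    finite list e1 by [tw_open]. *)
Lemma division_fixed N (P0 Q0 : point C) (e' : seq S) : on_curve WC Q0 -> ec_muln WC (r ^ N) Q0 = P0 ->
  (exists m, forall s, Gal K s -> tw TT m s = 0 -> point_map (t s) P0 = P0) ->
  (if Q0 is Some (x, y) then cl (adjoin M [set` e']) x /\ cl (adjoin M [set` e']) y else True) ->
  exists e : seq S, forall s, Gal K s -> {in e, forall z, s z = z} -> point_map (t s) Q0 = Q0.
Proof.
move=> oQ QP [m0 hm0] cQ; have EC : elliptic WC := elliptic_map j EW.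
have [k hk] := torsion_isolated hC rC pC rp N EC oQ.
have [m hm] : exists m, forall s, Gal K s -> tw TT m s = 0 -> {in e', forall z, s z = z} ->
    pclose OC (j pi) k Q0 (point_map (t s) Q0).
  move: cQ {oQ QP hk}; case: Q0 => [[x y]|] /=; last by exists 0%N.
  move=> [cx cy]; have [a aA Ba] := cx k; have [b bA Bb] := cy k.
  have [m hm] := adjoin_fix TT aA; have [m' hm'] := adjoin_fix TT bA.
  exists (maxn m m') => s sK ts se.
  have tsm : tw TT m s = 0 by exact: tw_le (leq_maxl _ _) sK ts.
  have tsm' : tw TT m' s = 0 by exact: tw_le (leq_maxr _ _) sK ts.
  split; apply/(ball_subr _ hC).
    apply: (ball_tri hC (y := j a)); last exact/(ball_subr _ hC).
    by rewrite -{1}(hm s sK tsm se) -tj // -(rmorphB (t s : {rmorphism C -> C})); exact/tb.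
  apply: (ball_tri hC (y := j b)); last exact/(ball_subr _ hC).
  by rewrite -{1}(hm' s sK tsm' se) -tj // -(rmorphB (t s : {rmorphism C -> C})); exact/tb.
have [e1 _ he1] := tw_open TT (maxn m m0).
exists (e1 ++ e') => s sK se.
have ts : tw TT (maxn m m0) s = 0 by apply: he1 => // z ze; apply: se; rewrite mem_cat ze.
have tsm : tw TT m s = 0 by exact: tw_le (leq_maxl _ _) sK ts.
have tsm0 : tw TT m0 s = 0 by exact: tw_le (leq_maxr _ _) sK ts.
apply/esym; apply: hk; first exact: t_curve.
  by apply: hm => // z ze; apply: se; rewrite mem_cat ze orbT.
rewrite QP -{1}(hm0 s sK tsm0) -QP (point_map_muln (t s : {rmorphism C -> C})).
by rewrite (wmap_fix jK_coef (jK_fix sK)).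
Qed.

Lemma division_descends N (P0 Q0 : point C) (e' : seq S) : on_curve WC Q0 -> ec_muln WC (r ^ N) Q0 = P0 ->
  (exists m, forall s, Gal K s -> tw TT m s = 0 -> point_map (t s) P0 = P0) ->
  (if Q0 is Some (x, y) then cl (adjoin M [set` e']) x /\ cl (adjoin M [set` e']) y else True) ->
  exists Q, point_map j Q = Q0.
Proof.
move=> oQ QP h cQ; have [e he] := division_fixed oQ QP h cQ.
case: Q0 {oQ QP} cQ he => [[x y]|]; last by exists None.
move=> [cx cy] he.
have fx := fixed_algebraic TT hC rC Oj Kpi Kc pC lp tj tb.
have [a <-] : exists a, j a = x.
  by apply: (fx x e e') => // s sK se; have [] := he s sK se.
have [b <-] : exists b, j b = y.
  by apply: (fx y e e') => // s sK se; have [] := he s sK se.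
by exists (Some (a, b)).
Qed.

End NearFixed.

Lemma pact_additive (S : fieldType) (W : weierstrass S) (EW : elliptic W) (L : set S) (s : aut S) :
  [/\ L (a1 W), L (a2 W), L (a3 W), L (a4 W) & L (a6 W)] -> Gal L s ->
  exists g : {additive ecpt EW -> ecpt EW}, g =1 pact s.
Proof.
move=> LW sL; have aB : zmod_morphism (@pact S W EW s) by move=> P Q; exact: (pactB LW P Q sL).
pose fA := GRing.isZmodMorphism.Build (ecpt EW) (ecpt EW) (@pact S W EW s) aB.
pose g : {additive ecpt EW -> ecpt EW} := HB.pack (@pact S W EW s) fA.
by exists g.
Qed.

Lemma uniform_exponent (V : zmodType) (r : nat) (vs : seq V) :
  exists N, {in vs, forall v, (exists n, v *+ (r ^ n) = 0) -> v *+ (r ^ N) = 0}.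
Proof.
elim: vs => [|v vs [N hN]]; first by exists 0%N.
have [[n hn]|nv] := pselect (exists n, v *+ (r ^ n) = 0); last first.
  by exists N => w; rewrite inE => /orP[/eqP -> //|/hN].
exists (n + N)%N => w; rewrite inE expnD => /orP[/eqP ->|/hN h] hw.
  by rewrite mulrnA hn mul0rn.
by rewrite mulnC mulrnA h // mul0rn.
Qed.

(** * Averaging a coboundary down the tower *)

Section Finish.
Variables (l r : nat) (S : fieldType) (K M : set S) (TT : tower l K M).
Hypothesis l_prime : prime l.
Hypothesis r_prime : prime r.
Hypothesis rl : r <> l.
Variables (W : weierstrass S) (EW : elliptic W).
Hypothesis KW : [/\ K (a1 W), K (a2 W), K (a3 W), K (a4 W) & K (a6 W)].
Local Notation E := (ecpt EW).
Local Notation act := (@pact S W EW).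

(** Values are moved from bare points to the Z-module [ecpt]; the default 0 is taken only off the
    curve. *)
Definition lift_cochain (c : cochain S) (s : aut S) : E := xget 0 [set P : E | ptval P = c s].

Lemma lift_cochainP c s : on_curve W (c s) -> ptval (lift_cochain c s) = c s.
Proof.
move=> /(ptvalK EW)[P PE]; rewrite /lift_cochain; case: xgetP => [Q _ //|/(_ P)]; by case.
Qed.

Lemma torsionP (P : E) : primary_torsion W r (ptval P) <-> exists n, P *+ (r ^ n) = 0.
Proof.
split=> [[_ [n h]]|[n h]].
  by exists n; apply: ptval_inj; rewrite ptvalMn h.
by split; [exact: ptvalP | exists n; rewrite -ptvalMn h].
Qed.

Lemma cocycle_lift c : cocycle W r K c -> [/\
  forall s, Gal K s -> ptval (lift_cochain c s) = c s,
  forall s, Gal K s -> exists n, lift_cochain c s *+ (r ^ n) = 0,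
  forall s t, Gal K s -> Gal K t -> lift_cochain c (s * t)%g = lift_cochain c s + act s (lift_cochain c t) &
  exists e : seq S, forall s, Gal K s -> {in e, forall x, s x = x} -> lift_cochain c s = 0].
Proof.
move=> [cT cM cC]; have v s : Gal K s -> ptval (lift_cochain c s) = c s.
  by move=> sK; apply: lift_cochainP; case: (cT s sK).
have M1 s t : Gal K s -> Gal K t -> lift_cochain c (s * t)%g = lift_cochain c s + act s (lift_cochain c t).
  move=> sK tK; apply: ptval_inj; rewrite v; last exact: GalM.
  transitivity (ec_add W (ptval (lift_cochain c s)) (ptval (act s (lift_cochain c t)))); last by [].
  by rewrite (pact_val KW) // !v // cM.
split=> // [s sK|].
  by apply/torsionP; rewrite v //; exact: cT.
have [e he] := cC 1%g (@Gal1 _ K); exists e => s sK se.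
have c1 : lift_cochain c 1%g = 0.
  have := M1 1%g 1%g (@Gal1 _ K) (@Gal1 _ K); rewrite mulg1 (pact1 KW) => /esym/eqP.
  by rewrite -subr_eq0 addrK => /eqP.
by apply: ptval_inj; rewrite v // he // -v ?c1 //; exact: Gal1.
Qed.

(** The difference of c and the coboundary of Q0 is a cocycle vanishing on [Gal M], so k times it is
    the coboundary of some B, with k a power of l. As c has values killed by r^N, multiplying by an
    inverse a of k modulo r^N shows that c is the coboundary of a(B + kQ0). The last clause, on
    torsion, is what injectivity of restriction needs. *)
Lemma descent_finish c Q0 : cocycle W r K c -> on_curve W Q0 ->
  (forall s, Gal M s -> c s = ec_sub W (point_map s Q0) Q0) ->
  exists N Q, [/\ on_curve W Q, rational_points W K (ec_muln W (r ^ N) Q),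
    forall s, Gal K s -> c s = ec_sub W (point_map s Q) Q &
    primary_torsion W r Q0 -> primary_torsion W r Q].
Proof.
move=> /cocycle_lift[cv cT cM [e he]] oQ cQ; have hK := tw_closure TT.
set ce := lift_cochain c in cv cT cM he.
have [q0 q0E] := ptvalK EW oQ.
have additive s : Gal K s -> exists g : {additive E -> E}, g =1 act s by exact: pact_additive KW.
have act0 s : Gal K s -> act s 0 = 0 by move=> /additive[g gE]; rewrite -gE raddf0.
pose b s : E := ce s - (act s q0 - q0).
have bM s t : Gal K s -> Gal K t -> b (s * t)%g = b s + act s (b t).
  move=> sK tK; rewrite /b cM // (pactM KW) // !(pactB KW) // !opprB [RHS]addrACA; congr (_ + _).
  by rewrite addrA subrK.
have bG g : Gal M g -> b g = 0.
  move=> gM; have gK := GalMK TT gM; apply/eqP; rewrite subr_eq0; apply/eqP; apply: ptval_inj.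
  rewrite cv // cQ //; transitivity (ec_sub W (ptval (act g q0)) (ptval q0)); last by [].
  by rewrite (pact_val KW) // q0E.
have [e' he'] := pact_smooth KW q0.
have [|k [ts [kl tsK bk]]] := tower_inflation TT (pactB KW (EW := EW)) bM bG.
  exists (e ++ e') => s sK se; rewrite /b he ?he' ?subrr ?subr0 // => z ze; apply: se; rewrite mem_cat ze ?orbT //.
set B := - \sum_(t <- ts) b t in bk.
have [vs vsP] : exists vs : seq E, forall s, Gal K s -> ce s \in vs.
  apply: (finite_values hK (e := e)) => // s t sK tK st.
  have uK : Gal K (s^-1 * t)%g by apply: GalM => //; exact: GalV.
  have u0 : ce (s^-1 * t)%g = 0 by apply: he => // x xe; rewrite autM -st ?autVK.
  by rewrite -[in RHS](mulKVg s t) cM // u0 act0 // addr0.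
(* A continuous cocycle takes finitely many values, so a single power of r kills all of them. *)
have [N hN] := uniform_exponent r vs.
have rN s : Gal K s -> ce s *+ (r ^ N) = 0 by move=> sK; apply: hN; [exact: vsP | exact: cT].
have k_gt0 : (0 < k)%N by case/andP: kl.
have kr : coprime k (r ^ N).
  rewrite coprimeXr // coprime_sym prime_coprime //; apply/negP => rk.
  by move: (pnat_dvd rk kl); rewrite pnatE // inE => /eqP.
case: (egcdnP (r ^ N) k_gt0) => a b'; rewrite (eqP kr) => akE _.
have ck s : Gal K s -> ce s *+ k *+ a = ce s.
  by move=> sK; rewrite -mulrnA mulnC akE mulrnDr mulr1n mulnC mulrnA rN // mul0rn add0r.
pose Q2 := (B + q0 *+ k) *+ a.
have cQ2 s : Gal K s -> act s Q2 - Q2 = ce s.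
  move=> sK; rewrite -[RHS]ck //; have [g gE] := additive s sK.
  rewrite /Q2 -gE raddfMn raddfD raddfMn !gE -mulrnBl; congr (_ *+ a).
  by rewrite opprD addrACA -mulrnBl -bk // -mulrnDl /b subrK.
(* The coboundary of Q2 is c, which r^N kills; so r^N Q2 is Galois-invariant, hence rational over
   K. *)
have rQ2 s : Gal K s -> act s (Q2 *+ (r ^ N)) = Q2 *+ (r ^ N).
  move=> sK; have [g gE] := additive s sK; apply/eqP; rewrite -subr_eq0 -gE raddfMn gE -mulrnBl.
  by rewrite cQ2 // rN.
exists N, (ptval Q2); split; first exact: ptvalP.
- rewrite -ptvalMn; split; first exact: ptvalP.
  case QE : (ptval (Q2 *+ (r ^ N))) => [[x y]|] //.
  have fix1 s : Gal K s -> s x = x /\ s y = y.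
    move=> sK; have := congr1 (@ptval _ _ EW) (rQ2 s sK); rewrite (pact_val KW) // QE /=.
    by case=> -> ->.
  split; apply: contrapT => nK; have [s sK] := galois_moves hK nK; apply; exact: (fix1 s sK).1 || exact: (fix1 s sK).2.
- move=> s sK; rewrite -cv // -cQ2 //.
  transitivity (ec_sub W (ptval (act s Q2)) (ptval Q2)); first by [].
  by rewrite (pact_val KW).
rewrite -q0E => /torsionP[n qn]; apply/torsionP; exists (N + n)%N.
have q0n : q0 *+ r ^ (N + n) = 0 by rewrite expnD mulnC mulrnA qn mul0rn.
have bn s : Gal K s -> b s *+ r ^ (N + n) = 0.
  move=> sK; have [g gE] := additive s sK.
  rewrite /b !mulrnBl -gE -raddfMn q0n raddf0 subrr subr0 expnD mulrnA rN // mul0rn //.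
rewrite /Q2 -mulrnA mulnC mulrnA mulrnDl -mulrnA [(k * _)%N]mulnC mulrnA q0n mul0rn addr0 /B mulNrn -sumrMnl.
by rewrite big_seq big1 ?oppr0 ?mul0rn // => t /tsK /bn.
Qed.

End Finish.

(** * The local condition descends along the tower *)

Definition kummer_local (Fs S : fieldType) (W : weierstrass Fs) (r : nat) (i : {rmorphism Fs -> S})
    (K : set S) (c : cochain Fs) : Prop :=
  exists N Q, [/\ on_curve (wmap i W) Q, rational_points (wmap i W) K (ec_muln (wmap i W) (r ^ N) Q) &
    forall s, Gal K s -> point_map i (c (aut_restrict i s)) = ec_sub (wmap i W) (point_map s Q) Q].

(** The valuation on S restricts to a place of [cF] above the given one, where the cocycle is a
    coboundary over the closure of M. Approximation and the fixed-point theorem return the point to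
    S, and [descent_finish] returns the relation to K. *)
Lemma local_descent (p l r : nat) (F : fieldType) (k : set F) (Fs S : fieldType)
    (f : {rmorphism F -> Fs}) (i : {rmorphism Fs -> S}) (L cF O : set Fs) (K OK : set S)
    (W : weierstrass Fs) (c : cochain Fs)
    (TT : tower l K (adjoin K (i @` cF))) :
  function_field p k -> separable_closure (range f) -> range f `<=` L -> subfield L ->
  L `<=` cF -> subfield cF -> [/\ L (a1 W), L (a2 W), L (a3 W), L (a4 W) & L (a6 W)] -> elliptic W ->
  prime l -> prime r -> l <> p -> r <> l -> r <> p ->
  place L O -> completion L O i K OK ->
  cocycle (wmap i W) r K (fun s => point_map i (c (aut_restrict i s))) ->
  (forall O', place cF O' -> forall (U : fieldType) (i' : {rmorphism Fs -> U}) K' OK',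
     completion cF O' i' K' OK' -> kummer_local W r i' K' c) ->
  kummer_local W r i K c.
Proof.
move=> HF HFs fL sL LcF sF LW EW l_prime r_prime lp rl rp pl cpl cK Hsel.
have hL : separable_closure L := separable_closure_sub fL sL HFs.
have Lalg x : L x -> algebraic_over (range f) x.
  by move=> _; apply: separable_algebraic; case: HFs.
have [OS [u]] := local_valuation HF fL sL Lalg pl cpl; set pi := i (f u) => -[hO OSK rS Kc iso].
have [hS [[OKK sOK Ktot _] _] LK LO Ld] := cpl; have [sK _ _] := hS.
have Lu : L (f u) by apply: fL; exists u.
have Kpi : K pi by exact: LK.
have [C [j [OC [hC Oj rC Cc Cd]]]] := completion_exists hO rS.
set M := adjoin K (i @` cF) in TT *; have sM : subfield M := adjoin_subfield _ _.
have KM : K `<=` M by exact: sub_adjoin_l.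
have hM := separable_closure_sub KM sM hS; have Mpi := KM _ Kpi.
have iM x : cF x -> M (i x) by move=> cx; apply: sub_adjoin_r; exists x.
have sA : subfield (i @` cF) := image_subfield i sF.
have clA := cl_subfield hC rC sA.
(* K is approximated by L, so the compositum M has no larger closure than [cF] and yields a
   completion of [cF]. *)
have MA : M `<=` [set x | cl OC pi j (i @` cF) (j x)].
  apply: adjoin_min; first exact: preimage_subfield.
    move=> x Kx n; have [y Ly h] := Ld x (pi ^+ n) Kx (sfX sK n Kpi) (piX_neq0 rS n).
    exists (i y); first by exists y => //; exact: LcF.
    rewrite -rmorphB; apply/(ball_j pi Oj); apply/OSK => //.
    by apply: (sf_div sK); [apply: (sfB sK) => //; exact: LK | exact: sfX].
  by move=> _ [x cx <-]; apply: (cl_sub pi j hC); exists x.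
have Md x n : M x -> exists2 y, cF y & ball OS pi n (x - i y).
  move=> Mx; have [_ [y cy <-] h] := MA x Mx n; exists y => //.
  by apply/(ball_j pi Oj); rewrite rmorphB.
have [U [v [i' [vi' vU cU ext]]]] := completion_sepcl hO rS hC rC Oj Cc hM Mpi iM Md.
have vI : injective v := fmorph_inj v.
have plc : place cF [set x | cF x /\ OS (i x)].
  split; first by move=> x [].
  - apply: mk_subring => [|x y|x y] /=; first by rewrite rmorph1; split; [exact: (sf1 sF) | exact: vO1].
      by move=> [h1 h2] [h3 h4]; rewrite rmorphB; split; [exact: (sfB sF) | exact: vOB].
    by move=> [h1 h2] [h3 h4]; rewrite rmorphM; split; [exact: (sfM sF) | exact: vOM].
  - move=> x cx; have [h|h] := vO_total hO (i x); [by left | right].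
    by split; [exact: (sfV sF) | rewrite fmorphV].
  - exists (f u)^-1; first by apply: (sfV sF); exact: LcF.
    case=> _; rewrite fmorphV => h; have [_ p0 mp _ _] := rS.
    by case: mp => [/eqP|//]; exact/negP.
(* The hypothesis over [cF] is used here, at the place cut out by the valuation of S. *)
have [N [Q' [oQ' rQ' hQ']]] := Hsel _ plc _ _ _ _ cU.
have [s|t ht] := @choice (aut S) (aut C) (fun s t => Gal K s -> [/\ forall x, t (j x) = j (s x),
    forall x k, ball OC (j pi) k (t x) <-> ball OC (j pi) k x &
    forall A x, (forall y, A y -> s y = y) -> cl OC pi j A x -> t x = x]).
  have [sK'|nK] := pselect (Gal K s); last by exists 1%g.
  by have [t [h1 h2 h3]] := aut_extension hC rC Oj Cc Cd (iso s sK'); exists t => _; split.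
have tj s : Gal K s -> forall y, t s (j y) = j (s y) by move=> /ht[].
have tb s : Gal K s -> forall y k, ball OC (j pi) k (t s y) <-> ball OC (j pi) k y by move=> /ht[].
set WS := wmap i W in cK *; have EWS : elliptic WS := elliptic_map i EW.
pose WC := wmap j WS; have EWC : elliptic WC := elliptic_map j EWS.
have KWS : [/\ K (a1 WS), K (a2 WS), K (a3 WS), K (a4 WS) & K (a6 WS)].
  by case: LW => ? ? ? ? ?; split; exact: LK.
have vW : wmap v (wmap i' W) = WC by rewrite /WC /WS /wmap /= !vi'.
have pF : p \in [pchar F] by case: HF.
have pC : p \in [pchar C] by exact: (rmorph_pchar j (rmorph_pchar i (rmorph_pchar f pF))).
have p_prime := pcharf_prime pC.
have rp' : coprime r p.
  by rewrite prime_coprime // dvdn_prime2 //; apply/eqP.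
have r_gt0 := prime_gt0 r_prime.
have sLc := cl_subfield hC rC sM.
have jM : j @` M `<=` cl OC pi j M by move=> _ [x Mx <-]; exact: (cl_sub pi j hC).
have LWC : [/\ cl OC pi j M (a1 WC), cl OC pi j M (a2 WC), cl OC pi j M (a3 WC), cl OC pi j M (a4 WC) & cl OC pi j M (a6 WC)].
  by case: KWS => ? ? ? ? ?; split; apply: jM; apply: imageP; exact: KM.
pose Q1 := point_map v Q'.
have oQ1 : on_curve WC Q1 by rewrite -vW; exact: (point_map_curve v _ _).1.
have rQ1 : rational_points WC (cl OC pi j M) (ec_muln WC (r ^ N) Q1).
  rewrite -vW -point_map_muln; case: rQ' => oP; case: (ec_muln _ _ Q') oP => [[x y]|] oP // rP.
  by split; [exact: (point_map_curve v _ (Some (x, y))).1 | exact: rP].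
have jMd x n : cl OC pi j M x -> exists2 a, (j @` M) a & ball OC (j pi) n (x - a).
  by move=> /(_ n)[y My h]; exists (j y); [exists y | ].
have jMp n a : (j @` M) a -> (j @` M) (a / j pi ^+ n).
  by move=> [y My <-]; exists (y / pi ^+ n); [by apply: (sf_div sM) => //; exact: (sfX sM) | rewrite fmorph_div rmorphXn].
(* r^N Q1 is split into an isolated point P0 and r^N times a point R over the closure of M. Removing
   R from Q1 leaves the coboundary over M unchanged, because automorphisms over M act trivially on
   R, and turns r^N Q1 into P0. *)
have [P0 [R [rP0 rR isoP E]]] := approx_isolated hC rC pC rp' r_gt0 sLc (jM _ (imageP j Mpi))
  (@cl_gcomplete _ _ _ _ _ hC Cc M) jM jMd jMp N EWC LWC rQ1.
have [q1 q1E] := ptvalK EWC oQ1.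
have [re reE] : exists P : ecpt EWC, ptval P = R by apply: ptvalK; case: rR.
have [p0 p0E] : exists P : ecpt EWC, ptval P = P0 by apply: ptvalK; case: rP0.
pose q0 := q1 - re.
have q0P : ec_muln WC (r ^ N) (ptval q0) = P0.
  rewrite -ptvalMn -p0E; congr ptval; apply/eqP; rewrite mulrnBl subr_eq; apply/eqP; apply: ptval_inj.
  transitivity (ec_add WC (ptval p0) (ptval (re *+ r ^ N))); last by [].
  by rewrite !ptvalMn q1E reE p0E.
have [e' he'] : exists e' : seq S, if ptval q0 is Some (x, y) then
    cl OC pi j (adjoin M [set` e']) x /\ cl OC pi j (adjoin M [set` e']) y else True.
  have sS : subfield (sepcl OC pi j M) := sepcl_subfield hC rC M.
  have rq : rational_points WC (sepcl OC pi j M) (ptval q0).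
    have cs := clM_sepcl (OC := OC) (pi := pi) (j := j) (M := M).
    have LWs : [/\ sepcl OC pi j M (a1 WC), sepcl OC pi j M (a2 WC), sepcl OC pi j M (a3 WC),
      sepcl OC pi j M (a4 WC) & sepcl OC pi j M (a6 WC)] by case: LWC => ? ? ? ? ?; split; exact: cs.
    apply: (rational_add sS LWs).
      rewrite q1E; split=> //; rewrite /Q1; case: (Q') => [[x y]|] //=.
      by rewrite -vU; split; [exists x | exists y].
    apply: (rational_opp sS LWs); rewrite reE; have [oR bR] := rR; split=> //.
    by move: bR; case: (R) => [[x y]|] //= [cx cy]; split; exact: cs.
  case: (ptval q0) rq => [[x y]|] [_] /=; last by exists [::].
  move=> [sx sy]; have [e he] := sepcl_seq (s := [:: x; y]) (M := M) (OC := OC) (pi := pi) (j := j)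
     ltac:(by move=> z; rewrite !inE => /orP[] /eqP ->).
  by exists e; split; apply: he; rewrite !inE eqxx ?orbT.
have P0fix := isolated_fixed TT hC tj tb KWS isoP rP0.
(* The corrected point has coordinates in the closure of some M(e') and is fixed by an open
   subgroup, so it comes from S. *)
have [Q0 Q0E] := division_descends hC rC Oj Kpi Kc pC lp rp' tj tb KWS EWS (ptvalP q0) q0P P0fix he'.
have oQ0 : on_curve WS Q0 by apply/(point_map_curve j); rewrite Q0E; exact: ptvalP.
have [|N' [Q [oQ rQ cQ _]]] := descent_finish TT r_prime rl EWS KWS cK oQ0; last first.
  by exists N', Q; split.
move=> s sMs; have sK' : Gal K s := GalMK TT sMs.
have [s' hs'] := ext s (t s) sMs (tj s sK') (tb s sK').
have s'K : Gal [set x | cl OC pi j M (v x)] s'.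
  by move=> x cx; apply: vI; rewrite hs'; have [_ _ h] := ht s sK'; exact: h cx.
(* Both automorphisms induce the same one on Fs, so c is evaluated at the same argument. *)
have resE : aut_restrict i' s' = aut_restrict i s.
  apply: aut_restrict_unique => x; apply: vI.
  rewrite vi' hs' vi' tj // (aut_restrictP hL) // => y Ly; apply: sK'; exact: LK.
apply: (point_map_inj (f := j)).
have := congr1 (point_map v) (hQ' s' s'K); rewrite resE.
rewrite /ec_sub (point_mapD v) (point_mapN v) (point_mapD j) (point_mapN j) vW -/WC !point_map_comp.
rewrite (point_map_eq (f := v \o i') (g := j \o i)) // => ->.
have -> : point_map (v \o s') Q' = point_map (t s) Q1.
  by rewrite /Q1 point_map_comp; apply: point_map_eq => x /=.
have -> : point_map (j \o s) Q0 = point_map (t s) (ptval q0).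
  by rewrite -Q0E point_map_comp; apply: point_map_eq => x /=; rewrite tj.
rewrite Q0E -/Q1.
have jW := jK_coef j KWS; have jF := jK_fix tj sK'.
have re_fix : pact (t s) re = re.
  apply: ptval_inj; rewrite (pact_val jW) // reE; case: rR => _; case: (R) => [[x y]|] //= [cx cy].
  by have [_ _ h] := ht s sK'; rewrite !(h M).
have : pact (t s) q1 - q1 = pact (t s) q0 - q0.
  by rewrite /q0 (pactB jW) // re_fix opprB addrA subrK.
move/(congr1 (@ptval _ _ EWC)) => H.
transitivity (ec_sub WC (ptval (pact (t s) q1)) (ptval q1)); first by rewrite (pact_val jW) // q1E.
transitivity (ec_sub WC (ptval (pact (t s) q0)) (ptval q0)); first exact: H.
by rewrite (pact_val jW).
Qed.

(** * Towers attached to the Z_l^d-extension, globally and locally *)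

Lemma padic0 l a m n : padic l a -> (m <= n)%N -> a n = 0%N -> a m = 0%N.
Proof.
move=> pa; elim: n => [|n IH]; first by rewrite leqn0 => /eqP ->.
rewrite leq_eqVlt => /orP[/eqP -> //|]; rewrite ltnS => mn an.
by apply: IH => //; rewrite pa an mod0n.
Qed.

(** The levels are the reductions of phi modulo powers of l. A tower does not ask for surjective
    levels, so phi can simply be restricted to the subgroup [Gal L]. *)
Lemma zld_tower (l d : nat) (S : fieldType) (K L M : set S) : prime l -> separable_closure K ->
  subfield L -> K `<=` L -> L `<=` M -> Zld_extension l d K M -> inhabited (tower l L M).
Proof.
move=> l_prime hK sL KL LM [[sM KM Mn] [phi [pp pM _ _ [c1 c2]]]].
have GLK s : Gal L s -> Gal K s by exact: Gal_sub.
have l1 m : (1 < l ^ m.+1)%N.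
  by rewrite (leq_ltn_trans (n := m.+1)) // ltn_expl // prime_gt1.
(* Exponents start at 1 because ['Z_n] is Z/n only for n > 1. *)
pose X m : finZmodType := 'rV['Z_(l ^ m.+1)]_d.
pose tw m (s : aut S) : X m := \row_i (phi s i m.+1)%:R.
have tw0 m s : Gal L s -> (tw m s = 0) <-> (forall i, phi s i m.+1 = 0%N).
  move=> sLs; split=> [/rowP h i|h]; last by apply/rowP => i; rewrite !mxE h.
  have /(congr1 val) := h i; rewrite !mxE /= Zp_nat /= Zp_cast // modn_small //.
  by rewrite (pp s (GLK s sLs) i) ltn_mod expn_gt0 prime_gt0.
constructor; apply: (@Tower l S L M X tw) => //.
- exact: separable_closure_sub KL sL hK.
- by move=> s x sLs Mx; apply: (Mn s (GLK s sLs)); exists x.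
- move=> m; rewrite card_mx card_ord Zp_cast // mul1n !pnatX; apply/orP; left.
  by apply/orP; left; rewrite pnatE // inE.
- move=> m s t sLs tL; apply/rowP => i; rewrite !mxE pM; [|exact: GLK..].
  by rewrite Zp_nat_mod // natrD.
- move=> m n s mn sLs /(tw0 _ _ sLs) h; apply/(tw0 _ _ sLs) => i.
  exact: padic0 (pp s (GLK s sLs) i) _ (h i).
- move=> m s sM'; have sLs : Gal L s by exact: Gal_sub sM'.
  apply/(tw0 _ _ sLs) => i; have [e eM he] := c1 m.+1.
  by apply: he; [exact: GLK | move=> x /eM Mx; exact: sM'].
- move=> x Mx; have [|n hn] := c2 [:: x]; first by move=> y; rewrite inE => /eqP ->.
  exists n => s sLs /(tw0 _ _ sLs) h; apply: (hn s (GLK s sLs)); last exact: mem_head.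
  by move=> i; apply: padic0 (pp s (GLK s sLs) i) (leqnSn n) (h i).
- move=> m; have [e eM he] := c1 m.+1; exists e => // s sLs se.
  by apply/(tw0 _ _ sLs) => i; apply: he => //; exact: GLK.
Qed.

Section LocalTower.
Variables (l : nat) (Fs S : fieldType) (i : {rmorphism Fs -> S}) (L cF : set Fs) (K : set S).
Variable TT : tower l L cF.
Hypothesis hK : separable_closure K.
Hypothesis LK : forall x, L x -> K (i x).
Local Notation M := (adjoin K (i @` cF)).
Local Notation rs := (aut_restrict i).

Lemma restrictE s x : Gal K s -> i (rs s x) = s (i x).
Proof.
move=> sK; apply: (aut_restrictP (tw_closure TT)) => y Ly; exact/sK/LK.
Qed.

Lemma restrict_Gal s : Gal K s -> Gal L (rs s).
Proof. by move=> sK x Lx; apply: (fmorph_inj i); rewrite restrictE // sK //; exact: LK. Qed.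

Lemma restrictM s t : Gal K s -> Gal K t -> rs (s * t)%g = (rs s * rs t)%g.
Proof.
by move=> sK tK; apply: aut_restrict_unique => x; rewrite !autM !restrictE.
Qed.

(** Restriction embeds the Galois group of the compositum over K in that of [cF] over L, so the
    levels are pulled back along [aut_restrict]. *)
Lemma local_tower : tower l K M.
Proof.
have sK : subfield K by case: hK.
have sM : subfield M := adjoin_subfield _ _.
apply: (@Tower l S K M (twX TT) (fun m s => tw TT m (rs s))) => //.
- exact: sub_adjoin_l.
- move=> s x sK' Mx; apply: (Mx [set z | M (s z)]).
  + exact: (preimage_subfield (s : {rmorphism S -> S}) sM).
  + by move=> z Kz /=; rewrite sK' //; exact: sub_adjoin_l.
  + move=> _ [z cz <-] /=; rewrite -restrictE //; apply: sub_adjoin_r; exists (rs s z) => //.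
    by apply: (tw_norm TT) => //; exact: restrict_Gal.
- exact: tw_pnat.
- by move=> m s t sK' tK; rewrite restrictM // (twM TT) //; exact: restrict_Gal.
- by move=> m n s mn sK' h; exact: (tw_le mn (restrict_Gal sK') h).
- move=> m s sM'; have sK' : Gal K s by apply: Gal_sub sM'; exact: sub_adjoin_l.
  apply: (twG TT) => x cx; apply: (fmorph_inj i); rewrite restrictE //.
  by apply: sM'; apply: sub_adjoin_r; exists x.
- move=> x Mx; apply: (Mx [set z | exists m, forall s, Gal K s -> tw TT m (rs s) = 0 -> s z = z]).
  + have up m n s : Gal K s -> tw TT (maxn m n) (rs s) = 0 -> tw TT m (rs s) = 0 /\ tw TT n (rs s) = 0.
      move=> /restrict_Gal sL h; split; first exact: (tw_le (leq_maxl _ _) sL h).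
      exact: (tw_le (leq_maxr _ _) sL h).
    split; first by rewrite in_setE; exists 0%N => s _ _; rewrite rmorph1.
      move=> y z /set_mem[m hm] /set_mem[n hn]; rewrite in_setE; exists (maxn m n) => s sK' h.
      by have [h1 h2] := up _ _ _ sK' h; rewrite rmorphB; congr (_ - _); [exact: hm | exact: hn].
    move=> y z /set_mem[m hm] /set_mem[n hn]; rewrite in_setE; exists (maxn m n) => s sK' h.
    by have [h1 h2] := up _ _ _ sK' h; rewrite fmorph_div; congr (_ / _); [exact: hm | exact: hn].
  + by move=> z Kz; exists 0%N => s sK' _; exact: sK'.
  + move=> _ [z cz <-]; have [m hm] := tw_fix TT cz; exists m => s sK' h.
    by rewrite -restrictE // hm //; exact: restrict_Gal.
- move=> m; have [e eM he] := tw_open TT m; exists (map i e).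
    by move=> _ /mapP[x xe ->]; apply: sub_adjoin_r; exists x => //; exact: eM.
  move=> s sK' se; apply: he; first exact: restrict_Gal.
  by move=> x xe; apply: (fmorph_inj i); rewrite restrictE //; apply: se; exact: map_f.
Qed.

End LocalTower.

(** * Completions of a subfield inside a given completion *)

Lemma separable_over_map (A B : fieldType) (f : {rmorphism A -> B}) (K : set A) (L : set B) x :
  subfield K -> L 0 -> (forall y, K y -> L (f y)) -> separable_over K x -> separable_over L (f x).
Proof.
move=> sK L0 KL [q [qK qs qx]]; exists (map_poly f q); split.
- apply/polyOver_set => // n; rewrite coef_map; apply: KL.
  by apply/polyOver_set: n; first exact: (sf0 sK).
- by rewrite separable_map.
- by rewrite /root horner_map (eqP qx) rmorph0.
Qed.

Section SubCompletion.
Variables (p : nat) (F : fieldType) (k : set F) (Fs U : fieldType) (f : {rmorphism F -> Fs}).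
Variables (i' : {rmorphism Fs -> U}) (L cF O' : set Fs) (K' OK' : set U).
Hypothesis HF : function_field p k.
Hypothesis HFs : separable_closure (range f).
Hypothesis fL : range f `<=` L.
Hypothesis sL : subfield L.
Hypothesis LcF : L `<=` cF.
Hypothesis sF : subfield cF.
Hypothesis plc : place cF O'.
Hypothesis cpl : completion cF O' i' K' OK'.

(** The closure of L in K' is a completion of L at the place below, and the elements of U separable
    over it form a separable closure, by transitivity of separability. *)
Lemma sub_completion : exists (S : fieldType) (w : {rmorphism S -> U}) (i : {rmorphism Fs -> S}) K OK,
  [/\ forall x, w (i x) = i' x, forall x, K x -> K' (w x),
      place L [set x | L x /\ O' x] & completion L [set x | L x /\ O' x] i K OK].
Proof.
have [OU [u]] := local_valuation HF (subset_trans fL LcF) sF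
  (fun x _ => separable_algebraic (let: And3 _ _ h := HFs in h x)) plc cpl.
set pi := i' (f u) => -[hO OUK rU Kc iso].
have [hU [[OKK sOK Ktot _] _] LK LO Ld] := cpl; have [sK' scU _] := hU.
have Lu : L (f u) by apply: fL; exists u.
have scl : subfield (cl OU (f u) i' L) := cl_subfield hO rU sL.
(* Limits of elements of L are taken inside K', which is complete, although U need not be. *)
pose Ks := [set x | K' x /\ cl OU (f u) i' L x].
have sKs : subfield Ks.
  split; first by rewrite in_setE; split; [exact: (sf1 sK') | exact: (sf1 scl)].
    move=> x y /set_mem[h1 h2] /set_mem[h3 h4]; rewrite in_setE.
    by split; [exact: (sfB sK') | exact: (sfB scl)].
  move=> x y /set_mem[h1 h2] /set_mem[h3 h4]; rewrite in_setE.
  by split; [exact: (sf_div sK') | exact: (sf_div scl)].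
have LKs x : L x -> Ks (i' x) by move=> Lx; split; [exact/LK/LcF | exact: (cl_sub (f u) i' hO)].
have Ksc : gcomplete OU pi Ks.
  move=> v vK hv; have [|x Kx hx] := Kc v _ hv; first by move=> n; case: (vK n).
  exists x => //; split=> // n; have [_ /(_ n)[y Ly h]] := vK n; exists y => //.
  exact: (ball_tri hO (hx n) h).
have sSs := separable_subfield sKs.
have [S [w wS]] := subfield_type sSs.
have wI : injective w := fmorph_inj w.
have win x : separable_over Ks x -> exists y, w y = x.
  by move=> hx; have : range w x by [rewrite wS]; case=> y _ <-; exists y.
have wsep y : separable_over Ks (w y).
  by have : range w (w y) by [exists y]; rewrite wS.
have i's x : separable_over Ks (i' x).
  apply: (separable_over_map (K := range f)); first exact: range_subfield.
  - exact: (sf0 sKs).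
  - by move=> y hy; apply: LKs; exact: fL.
  - by case: HFs.
have [i0 hi0] := choice (fun x => win _ (i's x)).
have [i hi] : exists i : {rmorphism Fs -> S}, i =1 i0.
  apply: mk_rmorph; first by move=> x y; apply: wI; rewrite rmorphB !hi0 !rmorphB.
  split; first by apply: wI; rewrite hi0 !rmorph1.
  by move=> x y; apply: wI; rewrite rmorphM !hi0 !rmorphM.
have wi x : w (i x) = i' x by rewrite hi hi0.
pose K := [set x | Ks (w x)].
have sK : subfield K := preimage_subfield w sKs.
have wK x : Ks x -> exists2 y, K y & w y = x.
  by move=> hx; have [y yE] := win x (separable_base sKs hx); exists y; rewrite // /K /= yE.
exists S, w, i, K, [set x | K x /\ OU (w x)]; split=> //.
- by move=> x [].
- have [_ sO' O'tot _] := plc; split; first by move=> x [].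
  + apply: mk_subring => [|x y [? ?] [? ?]|x y [? ?] [? ?]] /=.
    * by split; [exact: (sf1 sL) | exact: (sr1 sO')].
    * by split; [exact: (sfB sL) | exact: (srB sO')].
    * by split; [exact: (sfM sL) | exact: (srM sO')].
  + move=> x Lx; have [h|h] := O'tot x (LcF Lx); [by left | right].
    by split=> //; exact: (sfV sL).
  + exists (f u)^-1; first exact: (sfV sL).
    case=> _ /(LO _ (LcF (sfV sL Lu))) /OUK h; have [_ p0 mp _ _] := rU.
    have {}h : OU pi^-1 by rewrite -fmorphV; apply: h; exact/LK/LcF/(sfV sL).
    by case: mp => [/eqP|//]; exact/negP.
split.
- split=> //.
    move=> q qs q1; have [||z rz] := scU (map_poly w q); first by rewrite separable_map.
      by rewrite size_map_poly.
    have [y yE] : exists y, w y = z.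
      apply: win; apply: (separable_over_trans sKs).
      exists (map_poly w q); split=> //; last by rewrite separable_map.
      by apply/polyOver_set; [exact: (sf0 sSs) | move=> n; rewrite coef_map; exact: wsep].
    by exists y; move: rz; rewrite -yE /root horner_map fmorph_eq0.
  move=> x; have [q [qK qs qx]] := wsep x.
  have qKs n : Ks q`_n by apply/polyOver_set: n; first exact: (sf0 sKs).
  have [|q' qE] := @lift_poly _ _ w q.
    apply/polyOver_set; first by exists 0; rewrite ?rmorph0.
    by move=> n; have [y _ <-] := wK _ (qKs n); exists y.
  exists q'; split.
  + apply/polyOver_set; first exact: (sf0 sK).
    by move=> n; rewrite /K /= -coef_map -qE.
  + by move: qs; rewrite qE separable_map.
  + by move: qx; rewrite qE /root horner_map fmorph_eq0.
- have [pp Kp wp] := wK pi (LKs _ Lu); split; last first.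
    apply: (subseq_vcomplete hO rU _ sK); first by exists pp.
    have -> : w @` K = Ks by apply/seteqP; split=> [_ [y hy <-] //|y /wK [x hx <-]]; exists x.
    exact: Ksc.
  split.
  + by move=> x [].
  + apply: mk_subring => [|x y [? ?] [? ?]|x y [? ?] [? ?]] /=.
    * by rewrite rmorph1; split; [exact: (sf1 sK) | exact: vO1].
    * by rewrite rmorphB; split; [exact: (sfB sK) | exact: vOB].
    * by rewrite rmorphM; split; [exact: (sfM sK) | exact: vOM].
  + move=> x hx; have [h|h] := vO_total hO (w x); [by left | right].
    by split; [exact: (sfV sK) | rewrite fmorphV].
  + exists pp^-1; first exact: (sfV sK).
    case=> _; rewrite fmorphV wp => h; have [_ p0 mp _ _] := rU.
    by case: mp => [/eqP|//]; exact/negP.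
- by move=> x Lx; rewrite /K /= wi; exact: LKs.
- move=> x Lx; have cx := LcF Lx; have KLx := LK _ cx; rewrite /K /= wi; split.
    by move=> [_ /(LO _ cx) /(OUK _ KLx) h]; split=> //; exact: LKs.
  by move=> [_ /(OUK _ KLx) /(LO _ cx) h].
- move=> x a Kx Ka a0; have wa0 : w a != 0 by rewrite fmorph_eq0.
  have [n hn] := small_elt hO rU wa0; have [_ /(_ n)[y Ly h]] := Kx; exists y => //; split.
    by apply: (sf_div sK) => //; apply: (sfB sK) => //; rewrite /K /= wi; exact: LKs.
  by rewrite fmorph_div rmorphB wi; exact: hn.
Qed.

(** The point that works over the smaller completion works over the larger one: automorphisms over
    K' restrict to automorphisms over K with the same restriction to Fs. *)
Lemma kummer_local_sub (W : weierstrass Fs) r c :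
  (forall O, place L O -> forall (S : fieldType) (i : {rmorphism Fs -> S}) K OK,
     completion L O i K OK -> kummer_local W r i K c) -> kummer_local W r i' K' c.
Proof.
move=> H; have [S [w [i [K [OK [wi wK pl cp]]]]]] := sub_completion.
have [N [Q [oQ rQ hQ]]] := H _ pl _ _ _ _ cp.
have hK : separable_closure K by case: cp.
have hcF : separable_closure cF := separable_closure_sub (subset_trans fL LcF) sF HFs.
have LK' x : cF x -> K' (i' x) by case: cpl => _ _ h _ _; exact: h.
have wW : wmap w (wmap i W) = wmap i' W by rewrite /wmap /= !wi.
exists N, (point_map w Q); split.
- by rewrite -wW; exact: (point_map_curve w _ _).1.
- rewrite -wW -point_map_muln; case: rQ => oP; case: (ec_muln _ _ Q) oP => [[x y]|] oP //= [Kx Ky].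
  by split; [exact: (point_map_curve w _ (Some (x, y))).1 | split; exact: wK].
move=> s' s'K; have rE x : w (aut_restrict w s' x) = s' (w x).
  by apply: (aut_restrictP hK) => y Ky; exact/s'K/wK.
set s := aut_restrict w s' in rE.
have sK : Gal K s by move=> x Kx; apply: (fmorph_inj w); rewrite rE; exact/s'K/wK.
have resE : aut_restrict i s = aut_restrict i' s'.
  apply: aut_restrict_unique => x; apply: (fmorph_inj w); rewrite wi rE wi.
  by apply: (aut_restrictP hcF) => y cy; exact/s'K/LK'.
have := congr1 (point_map w) (hQ s sK); rewrite resE.
rewrite /ec_sub (point_mapD w) (point_mapN w) wW !point_map_comp.
rewrite (point_map_eq (f := w \o i) (g := i')) // => ->.
by congr (ec_add _ _ _); apply: point_map_eq => x /=; exact: rE.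
Qed.

End SubCompletion.

(** * Cohomology classes: sums, restriction, localisation *)

Lemma bigcup_same (A B : Type) (X : set A) (Phi : A -> set B) Z c :
  X c -> (forall c', X c' -> Phi c' = Z) -> \bigcup_(c' in X) Phi c' = Z.
Proof.
move=> Xc h; apply/seteqP; split=> [x [c' Xc']|x Zx]; first by rewrite h.
by exists c => //; rewrite h.
Qed.

Section Classes.
Variables (S : fieldType) (W : weierstrass S) (EW : elliptic W) (r : nat) (L : set S).
Hypothesis LW : [/\ L (a1 W), L (a2 W), L (a3 W), L (a4 W) & L (a6 W)].
Local Notation E := (ecpt EW).
Local Notation lc := (lift_cochain EW).
Local Notation act := (@pact S W EW).
Local Notation cocycle := (cocycle W r L).
Local Notation cclass := (cclass W r L).

Lemma lc_val c s : cocycle c -> Gal L s -> ptval (lc c s) = c s.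
Proof. by move=> /(cocycle_lift EW LW)[h _ _ _] /h. Qed.

Lemma lc_mk (C : aut S -> E) s : lc (fun s => ptval (C s)) s = C s.
Proof. by apply: ptval_inj; apply: lift_cochainP; exact: ptvalP. Qed.

Lemma pact0 s : Gal L s -> act s 0 = 0.
Proof. by move=> /(pact_additive EW LW)[g gE]; rewrite -gE raddf0. Qed.
Lemma pactD s P Q : Gal L s -> act s (P + Q) = act s P + act s Q.
Proof. by move=> /(pact_additive EW LW)[g gE]; rewrite -!gE raddfD. Qed.
Lemma pactMn s P n : Gal L s -> act s (P *+ n) = act s P *+ n.
Proof. by move=> /(pact_additive EW LW)[g gE]; rewrite -!gE raddfMn. Qed.

Lemma cocycle_mk (C : aut S -> E) :
  (forall s t, Gal L s -> Gal L t -> C (s * t)%g = C s + act s (C t)) ->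
  (forall s, Gal L s -> exists n, C s *+ (r ^ n) = 0) ->
  (exists e : seq S, forall s, Gal L s -> {in e, forall x, s x = x} -> C s = 0) ->
  cocycle (fun s => ptval (C s)).
Proof.
move=> CM CT [e he]; split.
- by move=> s sL; apply/torsionP; exact: CT.
- move=> s t sL tL; rewrite CM //.
  transitivity (ec_add W (ptval (C s)) (ptval (act s (C t)))); first by [].
  by rewrite (pact_val LW).
move=> s sL; exists e => t tL st; congr ptval.
have u0 : C (s^-1 * t)%g = 0.
  by apply: he => [|x xe]; [apply: GalM => //; exact: GalV | rewrite autM st ?autVK].
rewrite -(mulKVg s t) CM //; last by apply: GalM => //; exact: GalV.
by rewrite u0 pact0 // addr0.
Qed.

Lemma cocycle_ext c c' : (forall s, Gal L s -> c s = c' s) -> cocycle c -> cocycle c'.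
Proof.
move=> cc [h1 h2 h3]; split.
- by move=> s sL; rewrite -cc //; exact: h1.
- by move=> s t sL tL; rewrite -!cc ?h2 //; exact: GalM.
- move=> s sL; have [e he] := h3 s sL; exists e => t tL st; rewrite -!cc //; exact: he.
Qed.

Lemma cohP c c' : cocycle c -> cocycle c' -> (cohomologous W r L c c' <->
  exists P : E, (exists n, P *+ (r ^ n) = 0) /\
    forall s, Gal L s -> lc c' s = lc c s + (act s P - P)).
Proof.
move=> hc hc'; have key (P : E) s : Gal L s ->
    ptval (lc c s + (act s P - P)) = ec_add W (c s) (cobound W (ptval P) s).
  move=> sL; transitivity (ec_add W (ptval (lc c s)) (ec_sub W (ptval (act s P)) (ptval P))); first by [].
  by rewrite lc_val // (pact_val LW).
split=> [[P0 tP h]|[P [tP h]]].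
  have [P PE] := ptvalK EW (proj1 tP); rewrite -PE in tP h; exists P; split; first exact/torsionP.
  by move=> s sL; apply: ptval_inj; rewrite key // lc_val // h.
exists (ptval P); first exact/torsionP.
by move=> s sL; rewrite -(lc_val hc' sL) h // key.
Qed.

Lemma cclass_self c : cocycle c -> cclass c c.
Proof.
move=> hc; split=> //; apply/(cohP hc hc); exists 0; split; first by exists 0%N; rewrite mul0rn.
by move=> s sL; rewrite pact0 // subrr addr0.
Qed.

Lemma torD (P Q : E) : (exists n, P *+ (r ^ n) = 0) -> (exists n, Q *+ (r ^ n) = 0) ->
  exists n, (P + Q) *+ (r ^ n) = 0.
Proof.
move=> [n hn] [m hm]; exists (n + m)%N; rewrite mulrnDl expnD mulrnA hn mul0rn add0r.
by rewrite mulnC mulrnA hm mul0rn.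
Qed.
Lemma torN (P : E) : (exists n, P *+ (r ^ n) = 0) -> exists n, (- P) *+ (r ^ n) = 0.
Proof. by move=> [n hn]; exists n; rewrite mulNrn hn oppr0. Qed.

Lemma cclass_eq c c' : cocycle c -> cocycle c' -> cohomologous W r L c c' -> cclass c = cclass c'.
Proof.
move=> hc hc' /(cohP hc hc')[P [tP h]]; apply/seteqP; split=> c'' [hc''].
  move=> /(cohP hc hc'')[Q [tQ h']]; split=> //; apply/(cohP hc' hc''); exists (Q - P).
  split; first by apply: torD => //; exact: torN.
  move=> s sL; rewrite h' // h // (pactB LW) // -addrA; congr (_ + _).
  by rewrite opprB addrCA [X in _ = _ + X]addrA subrK addrA subrK.
move=> /(cohP hc' hc'')[Q [tQ h']]; split=> //; apply/(cohP hc hc''); exists (P + Q).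
split; first exact: torD.
by move=> s sL; rewrite h' // h // pactD // -addrA opprD addrACA.
Qed.

Lemma cocycle_sum c c' : cocycle c -> cocycle c' -> cocycle (fun s => ec_add W (c s) (c' s)).
Proof.
move=> hc hc'; apply: (@cocycle_ext (fun s => ptval (lc c s + lc c' s))).
  move=> s sL; transitivity (ec_add W (ptval (lc c s)) (ptval (lc c' s))); first by [].
  by rewrite !lc_val.
have [_ t1 m1 [e he]] := cocycle_lift EW LW hc; have [_ t2 m2 [e' he']] := cocycle_lift EW LW hc'.
apply: cocycle_mk => [s t sL tL|s sL|]; first by rewrite m1 // m2 // pactD // addrACA.
  by apply: torD; [exact: t1 | exact: t2].
exists (e ++ e') => s sL se; rewrite he ?he' ?addr0 // => x xe; apply: se; rewrite mem_cat xe ?orbT //.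
Qed.

Lemma lc_sum c c' s : cocycle c -> cocycle c' -> Gal L s ->
  lc (fun s => ec_add W (c s) (c' s)) s = lc c s + lc c' s.
Proof.
move=> hc hc' sL; apply: ptval_inj; rewrite (lc_val (cocycle_sum hc hc')) //.
transitivity (ec_add W (ptval (lc c s)) (ptval (lc c' s))); last by [].
by rewrite !lc_val.
Qed.

(** The operations on classes are unions over all representatives; here, as for restriction and
    localisation, [bigcup_same] collapses the union to the class of one chosen representative. *)
Lemma class_addE c c' : cocycle c -> cocycle c' ->
  class_add W r L (cclass c) (cclass c') = cclass (fun s => ec_add W (c s) (c' s)).
Proof.
move=> hc hc'; have main c1 c2 : cclass c c1 -> cclass c' c2 ->
    cclass (fun s => ec_add W (c1 s) (c2 s)) = cclass (fun s => ec_add W (c s) (c' s)).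
  move=> [h1 /(cohP hc h1)[P [tP hP]]] [h2 /(cohP hc' h2)[Q [tQ hQ]]].
  apply/esym/cclass_eq; try exact: cocycle_sum.
  apply/cohP; try exact: cocycle_sum.
  exists (P + Q); split; first exact: torD.
  by move=> s sL; rewrite !lc_sum // hP // hQ // pactD // opprD addrACA [X in _ + X]addrACA.
apply: (bigcup_same (c := c)) => [|c1 Xc1]; first exact: cclass_self.
by apply: (bigcup_same (c := c')) => [|c2 Xc2]; [exact: cclass_self | exact: main].
Qed.

End Classes.

Lemma cocycle_res (S : fieldType) (W : weierstrass S) r (L M : set S) c : L `<=` M ->
  cocycle W r L c -> cocycle W r M c.
Proof.
move=> LM [h1 h2 h3]; have ML s : Gal M s -> Gal L s by exact: Gal_sub.
split=> [s /ML|s t /ML sL /ML|s /ML sL]; [exact: h1 | exact: h2 |].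
by have [e he] := h3 s sL; exists e => t /ML; exact: he.
Qed.

Lemma resE (S : fieldType) (W : weierstrass S) (EW : elliptic W) r (L M : set S) c : L `<=` M ->
  [/\ L (a1 W), L (a2 W), L (a3 W), L (a4 W) & L (a6 W)] -> cocycle W r L c ->
  res W r M (cclass W r L c) = cclass W r M c.
Proof.
move=> LM LW hc; have MW : [/\ M (a1 W), M (a2 W), M (a3 W), M (a4 W) & M (a6 W)].
  by case: LW => ? ? ? ? ?; split; exact: LM.
apply: (bigcup_same (c := c)) => [|c' [hc' [P tP h]]]; first exact: (cclass_self EW LW).
apply/esym/(cclass_eq EW MW); try exact: cocycle_res LM _.
by exists P => // s sM; apply: h; exact: Gal_sub sM.
Qed.

Section Localisation.
Variables (Fs S : fieldType) (i : {rmorphism Fs -> S}) (L : set Fs) (K : set S) (r : nat).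
Hypothesis hL : separable_closure L.
Hypothesis LK : forall x, L x -> K (i x).
Variables (W : weierstrass Fs) (EW : elliptic W).
Hypothesis LW : [/\ L (a1 W), L (a2 W), L (a3 W), L (a4 W) & L (a6 W)].
Local Notation rs := (aut_restrict i).
Local Notation Wi := (wmap i W).

Lemma rsE s x : Gal K s -> i (rs s x) = s (i x).
Proof. by move=> sK; apply: (aut_restrictP hL) => y Ly; exact/sK/LK. Qed.
Lemma rs_Gal s : Gal K s -> Gal L (rs s).
Proof. by move=> sK x Lx; apply: (fmorph_inj i); rewrite rsE // sK //; exact: LK. Qed.
Lemma rs_point s P : Gal K s -> point_map i (point_map (rs s) P) = point_map s (point_map i P).
Proof. by move=> sK; rewrite !point_map_comp; apply: point_map_eq => x /=; exact: rsE. Qed.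

Lemma torsion_map P : primary_torsion W r P -> primary_torsion Wi r (point_map i P).
Proof.
move=> [oP [n h]]; split; first exact: (point_map_curve i W P).1.
by exists n; rewrite -point_map_muln h.
Qed.

Lemma loc_cocycle c : cocycle W r L c -> cocycle Wi r K (fun s => point_map i (c (rs s))).
Proof.
move=> [h1 h2 h3]; split.
- by move=> s sK; apply: torsion_map; apply: h1; exact: rs_Gal.
- move=> s t sK tK; have -> : rs (s * t)%g = (rs s * rs t)%g.
    by apply: aut_restrict_unique => x; rewrite !autM !rsE.
  by rewrite h2; [rewrite point_mapD rs_point | exact: rs_Gal..].
- move=> s sK; have [e he] := h3 _ (rs_Gal sK); exists (map i e) => t tK st.
  rewrite he //; first exact: rs_Gal.
  by move=> x xe; apply: (fmorph_inj i); rewrite !rsE //; apply: st; exact: map_f.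
Qed.

Let KWi : [/\ K (a1 Wi), K (a2 Wi), K (a3 Wi), K (a4 Wi) & K (a6 Wi)].
Proof. by case: LW => ? ? ? ? ?; split; exact: LK. Qed.
Let EWi : elliptic Wi := elliptic_map i EW.

Lemma localisationE c : cocycle W r L c -> localisation W r i K (cclass W r L c) =
  cclass Wi r K (fun s => point_map i (c (rs s))).
Proof.
move=> hc; apply: (bigcup_same (c := c)) => [|c' [hc' [P tP h]]]; first exact: (cclass_self EW LW).
apply/esym/(cclass_eq EWi KWi); try exact: loc_cocycle.
exists (point_map i P) => [|s sK]; first exact: torsion_map.
rewrite h; last exact: rs_Gal.
by rewrite point_mapD /cobound /ec_sub point_mapD point_mapN rs_point.
Qed.

(** Passage from classes to the cocycle itself: the torsion point T that makes c cohomologous to the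
    Kummer cocycle of Q is absorbed by replacing Q with Q + T and raising the exponent by that of
    T. *)
Lemma kummerP c : subfield K -> cocycle W r L c ->
  kummer_image Wi r K (localisation W r i K (cclass W r L c)) <-> kummer_local W r i K c.
Proof.
move=> sK hc; rewrite localisationE //; have hl := loc_cocycle hc; split; last first.
  move=> [N [Q [oQ rQ h]]]; exists N, (ec_muln Wi (r ^ N) Q), Q; split=> //.
  apply/seteqP; split=> c'' [hc'' [P tP e]]; split=> //; exists P => // s sKs; rewrite e //.
    by rewrite h.
  by rewrite h.
move=> [n [P [Q [rP oQ PE XE]]]].
have [_ [T tT hT]] : cclass Wi r K (cobound Wi Q) (fun s => point_map i (c (rs s))).
  by rewrite -XE; exact: (cclass_self EWi KWi).
have [q qE] := ptvalK EWi oQ; have [t tE] := ptvalK EWi (proj1 tT).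
have /torsionP[m tm] : primary_torsion Wi r (ptval t) by rewrite tE.
exists (n + m)%N, (ptval (q + t)); split; first exact: ptvalP.
  have E1 : (q + t) *+ r ^ (n + m) = q *+ r ^ n *+ r ^ m.
    by rewrite mulrnDl expnD mulrnA [X in _ + t *+ X]mulnC [t *+ _]mulrnA tm mul0rn addr0.
  rewrite -ptvalMn E1.
  by rewrite ptvalMn; apply: (rational_muln sK KWi); rewrite ptvalMn qE PE.
move=> s sKs; rewrite hT //.
have -> : ec_add Wi (cobound Wi Q s) (cobound Wi T s) = ptval ((pact s q - q) + (pact s t - t)).
  transitivity (ec_add Wi (ec_sub Wi (ptval (pact s q)) (ptval q)) (ec_sub Wi (ptval (pact s t)) (ptval t))); last by [].
  by rewrite !(pact_val KWi) // qE tE.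
have -> : (pact s q - q) + (pact s t - t) = pact s (q + t) - (q + t).
  by rewrite (pactD KWi) // opprD addrACA.
transitivity (ec_sub Wi (ptval (pact s (q + t))) (ptval (q + t))); first by [].
by rewrite (pact_val KWi).
Qed.

End Localisation.

(** * Restriction onto invariant classes along the tower *)

Section Descent.
Variables (l r : nat) (S : fieldType) (L M : set S) (TT : tower l L M).
Variables (W : weierstrass S) (EW : elliptic W).
Hypothesis LW : [/\ L (a1 W), L (a2 W), L (a3 W), L (a4 W) & L (a6 W)].
Hypothesis l_prime : prime l.
Hypothesis r_prime : prime r.
Hypothesis rl : r <> l.
Local Notation E := (ecpt EW).
Local Notation lc := (lift_cochain EW).
Local Notation act := (@pact S W EW).

Let LM : L `<=` M := tw_sub TT.
Let MW : [/\ M (a1 W), M (a2 W), M (a3 W), M (a4 W) & M (a6 W)].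
Proof. by case: LW => ? ? ? ? ?; split; exact: LM. Qed.

(** Over M the difference of the cocycles is the coboundary of a torsion point, and [descent_finish]
    replaces it by a torsion point whose coboundary is the difference over L. *)
Lemma res_injective c c' : cocycle W r L c -> cocycle W r L c' ->
  cclass W r M c = cclass W r M c' -> cclass W r L c = cclass W r L c'.
Proof.
move=> hc hc' E1; have mc := cocycle_res LM hc; have mc' := cocycle_res LM hc'.
have [_ /(cohP EW MW mc mc')[P [tP hP]]] : cclass W r M c c'.
  by rewrite E1; exact: (cclass_self EW MW).
pose D s : E := lc c' s - lc c s.
have [_ t1 m1 [e he]] := cocycle_lift EW LW hc; have [_ t2 m2 [e' he']] := cocycle_lift EW LW hc'.
have hD : cocycle W r L (fun s => ptval (D s)).
  apply: (cocycle_mk LW) => [s t sL tL|s sL|]; rewrite /D.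
  - by rewrite m1 // m2 // (pactB LW) // opprD addrACA.
  - by apply: torD; [exact: t2 | apply: torN; exact: t1].
  exists (e ++ e') => s sL se; rewrite he ?he' ?subr0 // => x xe; apply: se; rewrite mem_cat xe ?orbT //.
have [|N [Q [oQ _ hQ tQ]]] := descent_finish TT r_prime rl EW LW hD (ptvalP P).
  move=> s sM; rewrite /D hP // addrC addKr.
  transitivity (ec_sub W (ptval (act s P)) (ptval P)); first by [].
  by rewrite (pact_val MW).
apply: (cclass_eq EW LW) => //; apply/(cohP EW LW hc hc').
have [q qE] := ptvalK EW oQ; exists q; split; first by apply/torsionP; rewrite qE; apply: tQ; exact/torsionP.
move=> s sL; have : D s = act s q - q.
  apply: ptval_inj; rewrite hQ //; transitivity (ec_sub W (ptval (act s q)) (ptval q)); last by [].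
  by rewrite (pact_val LW) // qE.
by rewrite /D => <-; rewrite addrC subrK.
Qed.

Lemma conj_Gal g s : Gal L g -> Gal M s -> Gal M (s ^ g)%g.
Proof.
move=> gL sM x Mx; rewrite conjgE !autM sM ?autVK //; exact: (tw_norm TT).
Qed.

Lemma twisted_cocycle c g : Gal L g -> cocycle W r M c ->
  cocycle W r M (fun s => point_map g (c (s ^ g)%g)) /\
  forall s, Gal M s -> lc (fun s => point_map g (c (s ^ g)%g)) s = act g (lc c (s ^ g)%g).
Proof.
move=> gL hc; have [v t1 m1 [e he]] := cocycle_lift EW MW hc.
have sL s : Gal M s -> Gal L s by exact: (GalMK TT).
have vE s : Gal M s -> ptval (act g (lc c (s ^ g)%g)) = point_map g (c (s ^ g)%g).
  by move=> sM; rewrite (pact_val LW) // v //; exact: conj_Gal.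
have hg : cocycle W r M (fun s => point_map g (c (s ^ g)%g)).
  apply: (cocycle_ext vE); apply: (cocycle_mk MW) => [s t sM tM|s sM|].
  - rewrite conjMg m1; [|exact: conj_Gal..].
    rewrite (pactD LW) // -!(pactM LW) //; try exact: sL; last exact/sL/conj_Gal.
    by rewrite conjgE mulKVg.
  - have [n hn] := t1 _ (conj_Gal gL sM); exists n; rewrite -(pactMn LW) // hn (pact0 EW LW) //.
  exists (map g e) => s sM se; rewrite he ?(pact0 EW LW) //; first exact: conj_Gal.
  by move=> x xe; rewrite conjgE !autM se ?autVK //; exact: map_f.
split=> // s sM; apply: ptval_inj; rewrite (lc_val EW MW hg) // vE //.
Qed.

(** Conjugation by g changes a cocycle defined on all of [Gal L] by the coboundary of its value at
    g. *)
Lemma res_invariant c g : Gal L g -> cocycle W r L c ->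
  class_act W r M g (cclass W r M c) = cclass W r M c.
Proof.
move=> gL hc; have mc := cocycle_res LM hc; have [_ t1 m1 _] := cocycle_lift EW LW hc.
have sL s : Gal M s -> Gal L s by exact: (GalMK TT).
apply: (bigcup_same (c := c)) => [|c' [hc' /(cohP EW MW mc hc')[P [tP hP]]]].
  exact: (cclass_self EW MW).
have [hg gE] := twisted_cocycle gL hc'.
apply/esym/(cclass_eq EW MW) => //; apply/(cohP EW MW mc hg).
exists (lc c g + act g P); split.
  by apply: torD; [exact: t1 | case: tP => n hn; exists n; rewrite -(pactMn LW) // hn (pact0 EW LW)].
move=> s sM; have sgM := conj_Gal gL sM.
(* The cocycle rule applied to both sides of sg = g s^g. *)
have E1 : lc c s + act s (lc c g) = lc c g + act g (lc c (s ^ g)%g).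
  rewrite -m1 //; last exact: sL.
  by rewrite -m1 //; [rewrite conjgE mulKVg | exact: sL].
have E2 : act g (act (s ^ g)%g P) = act s (act g P).
  by rewrite -!(pactM LW) //; [rewrite conjgE mulKVg | exact: sL..].
have sLs := sL s sM.
rewrite gE // hP // [in LHS](pactD LW) // (pactB LW) // E2 [in RHS](pactD LW) // opprD.
rewrite [X in _ = _ + X]addrACA [RHS]addrA; congr (_ + _).
by rewrite addrA E1 addrAC subrr add0r.
Qed.

(** Invariance of the class supplies, for each g, the torsion point comparing c with its conjugate;
    this is the stability hypothesis of [tower_corestriction], and l is coprime to r. *)
Lemma res_surjective c : cocycle W r M c ->
  (forall g, Gal L g -> class_act W r M g (cclass W r M c) = cclass W r M c) ->
  exists2 C, cocycle W r L C & cclass W r M C = cclass W r M c.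
Proof.
move=> hc inv; have [v t1 m1 [e he]] := cocycle_lift EW MW hc.
have sL s : Gal M s -> Gal L s by exact: (GalMK TT).
have lr : coprime l r by rewrite prime_coprime // dvdn_prime2 //; apply/eqP => E; apply: rl.
pose Tor := [set P : E | exists n, P *+ (r ^ n) = 0].
have TB u w : Tor u -> Tor w -> Tor (u - w) by move=> tu tw; apply: torD => //; exact: torN.
have TA s u : Gal L s -> Tor u -> Tor (act s u).
  by move=> sK [n hn]; exists n; rewrite -(pactMn LW) // hn (pact0 EW LW).
have TP u : Tor u -> exists n, u *+ (r ^ n) = 0 by [].
have sm u : exists e : seq S, forall s, Gal L s -> {in e, forall x, s x = x} -> act s u = u.
  exact: (pact_smooth LW).
have cinv g : Gal L g -> exists2 P, Tor P &
    forall s, Gal M s -> act g (lc c (s ^ g)%g) = lc c s + (act s P - P).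
  move=> gL; have [hg gE] := twisted_cocycle gL hc.
  have [_ /(cohP EW MW hc hg)[P [tP hP]]] : cclass W r M c (fun s => point_map g (c (s ^ g)%g)).
    rewrite -(inv g gL); exists c; first exact: (cclass_self EW MW).
    exact: (cclass_self EW MW).
  by exists P => // s sM; rewrite -gE // hP.
have [C [CM CT CC [P tP hP]]] := tower_corestriction TT (fun s u v => @pactB _ _ EW _ LW s u v)
  (fun s t v => @pactM _ _ EW _ LW s t v) lr TB TA TP sm m1 t1 (ex_intro _ e he) cinv.
have hC := cocycle_mk LW CM CT CC.
exists (fun s => ptval (C s)) => //; apply/esym/(cclass_eq EW MW) => //.
  exact: cocycle_res LM hC.
apply/(cohP EW MW hc (cocycle_res LM hC)); exists P; split=> // s sM.
by rewrite lc_mk hP.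
Qed.

End Descent.

(** * The isomorphism of Selmer groups *)

Theorem theorem4p16 (p l r d : nat)
  (F : fieldType) (k : set F) (HF : function_field p k)
  (Fs : fieldType) (f : {rmorphism F -> Fs}) (HFs : separable_closure (range f))
  (E : weierstrass F) (HE : elliptic E) (Hj : ~ k (j_inv E))
  (Hred : forall O : set F, place setT O ->
     good_reduction O E \/ split_multiplicative_reduction O E)
  (l_prime : prime l) (l_neq_p : l <> p)
  (cF : set Fs) (HcF : Zld_extension l d (range f) cF)
  (Fn : nat -> set Fs)
  (Fn_finite : forall n, finite_extension (range f) (Fn n))
  (Fn_tower : forall n, Fn n `<=` Fn n.+1)
  (Fn_union : \bigcup_n Fn n = cF)
  (r_prime : prime r) (r_neq_l : r <> l) (r_neq_p : r <> p) :
  let W := wmap f E in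
  forall n : nat,
    group_isomorphism
      (Selmer W r (Fn n)) (class_add W r (Fn n))
      (Selmer_invariants W r (Fn n) cF) (class_add W r cF)
      (res W r cF).
Proof.
move=> W n; have [sL fL _] := Fn_finite n.
have LcF : Fn n `<=` cF by move=> x Lx; rewrite -Fn_union; exists n.
have sF : subfield cF by case: HcF => -[].
have fcF : range f `<=` cF by exact: subset_trans fL LcF.
have EW : elliptic W := elliptic_map f HE.
have LW : [/\ Fn n (a1 W), Fn n (a2 W), Fn n (a3 W), Fn n (a4 W) & Fn n (a6 W)].
  by split; apply: fL; eexists.
have MW : [/\ cF (a1 W), cF (a2 W), cF (a3 W), cF (a4 W) & cF (a6 W)].
  by case: LW => ? ? ? ? ?; split; exact: LcF.
have hL := separable_closure_sub fL sL HFs; have hcF := separable_closure_sub fcF sF HFs.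
have [TT] := zld_tower l_prime HFs sL fL LcF HcF.
(* Membership in the Selmer group becomes a condition on one cocycle, the same in every completion;
   this allows the cocycle to be kept fixed while L is exchanged for [cF]. *)
have selL c : cocycle W r (Fn n) c -> Selmer W r (Fn n) (cclass W r (Fn n) c) <->
    forall O, place (Fn n) O -> forall (S : fieldType) (i : {rmorphism Fs -> S}) K OK,
      completion (Fn n) O i K OK -> kummer_local W r i K c.
  move=> hc; split=> [[_ h] O pl S i K OK cp|h].
    have [[sK _ _] _ LK _ _] := cp; exact: ((kummerP hL LK EW LW sK hc).1 (h O pl S i K OK cp)).
  split=> [|O pl S i K OK cp]; first by exists c.
  have [[sK _ _] _ LK _ _] := cp; exact: ((kummerP hL LK EW LW sK hc).2 (h O pl S i K OK cp)).
have selM c : cocycle W r cF c -> Selmer W r cF (cclass W r cF c) <->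
    forall O, place cF O -> forall (S : fieldType) (i : {rmorphism Fs -> S}) K OK,
      completion cF O i K OK -> kummer_local W r i K c.
  move=> hc; split=> [[_ h] O pl S i K OK cp|h].
    have [[sK _ _] _ LK _ _] := cp; exact: ((kummerP hcF LK EW MW sK hc).1 (h O pl S i K OK cp)).
  split=> [|O pl S i K OK cp]; first by exists c.
  have [[sK _ _] _ LK _ _] := cp; exact: ((kummerP hcF LK EW MW sK hc).2 (h O pl S i K OK cp)).
have rE c := resE EW (c := c) LcF LW.
split; first split.
(* Restriction lands in the invariant Selmer classes: each completion of [cF] contains one of the
   layer. *)
- move=> X sel; have [[c hc XE] _] := sel; move: sel; rewrite -XE => sel; rewrite rE //; have mc := cocycle_res LcF hc; split.
    apply/selM => // O pl S i K OK cp.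
    exact: (kummer_local_sub HF HFs fL sL LcF sF pl cp ((selL c hc).1 sel)).
  by split=> [|g gL]; [exists c | exact: (res_invariant TT EW LW gL hc)].
- move=> _ _ /set_mem[[c hc <-] _] /set_mem[[c' hc' <-] _]; rewrite !rE //.
  exact: (res_injective TT EW LW r_prime r_neq_l hc hc').
(* An invariant class lifts to a cocycle C over the layer; its local conditions are deduced from
   those over [cF] by descent along the local tower. *)
- move=> X [sel [[c hc XE] inv]]; move: sel inv; rewrite -{X}XE => sel inv.
  have [C hC CE] := res_surjective TT EW LW l_prime r_prime r_neq_l hc inv.
  exists (cclass W r (Fn n) C); last by rewrite rE.
  have mC := cocycle_res LcF hC; rewrite -CE in sel.
  apply/selL => // O pl S i K OK cp.
  have [hS _ LK _ _] := cp.
  have lT := local_tower TT hS LK.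
  apply: (local_descent lT HF HFs fL sL LcF sF LW EW l_prime r_prime l_neq_p r_neq_l r_neq_p pl cp).
    exact: (loc_cocycle hL LK).
  by move=> O' pl' U i' K' OK' cp'; exact: ((selM C mC).1 sel O' pl' U i' K' OK' cp').
move=> _ _ /set_mem[[c hc <-] _] /set_mem[[c' hc' <-] _].
rewrite (class_addE EW LW hc hc') !rE //; last exact: (cocycle_sum EW LW).
by rewrite (class_addE EW MW) //; exact: (cocycle_res LcF).
Qed.
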